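(* Let $(M,\langle\cdot,\cdot\rangle)$ be a complete (connected) Riemannian manifold of dimension $m\ge 3$ supporting the Euclidean Sobolev inequality $$\|v\|_{L^{\frac{2m}{m-2}}}\le S\|\nabla v\|_{L^{2}}$$ for every $v\in C_{c}^{\infty}(M)$ and for some constant $S>0$. Assume also that $\mathrm{vol}(B_{R})=O(R^{m})$ as $R\to+\infty$. Let $0\le\psi\in Lip_{loc}(M)$ be a distributional solution of the differential inequality $$\psi\Delta\psi+a(x)\psi^{2}+A|\nabla\psi|^{2}\ge 0$$ on $M$, where $A\in\mathbb{R}$ and $0\le a\in C^{0}(M)\cap L^{m/2}(M)$ satisfies the uniform decay estimate $$\sup_{M\setminus B_{R}}a(x)=O\left(\frac{1}{R^{2}}\right)\quad\text{as }R\to+\infty.$$ Suppose that $\psi\in L^{2p}(M)$ for some $p>(1+A)/2$. For $H\in\mathbb{R}$ let $\mathcal{L}_{H}=-\Delta-Ha(x)$ and let $\lambda_{1}(\mathcal{L}_{H})$ be the bottom of its spectrum. Then: (i) If $\lambda_{1}(\mathcal{L}_{H})\ge 0$ for some $H>1+A>0$, then either $a\equiv 0$ or $\psi\equiv 0$. (ii) If $\lambda_{1}(\mathcal{L}_{H})\ge 0$ with $H=1+A>0$, then $\psi$ satisfies the differential inequality with the equality sign, i.e. $\psi\Delta\psi+a(x)\psi^{2}+A|\nabla\psi|^{2}=0$ in the distributional sense on $M$.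
   Context: Riemannian manifolds are connected. $B_R$ is the geodesic ball of radius $R$ centered at a fixed origin $o\in M$; $Lip_{loc}(M)$ (resp. $Lip_c(M)$) denotes locally Lipschitz (resp. compactly supported Lipschitz) functions. Distributional solution: $\psi$ satisfies the differential inequality if for every $0\le\eta\in Lip_c(M)$, $$\int_M a\,\eta\,\psi^{2}+\int_M A\,\eta\,|\nabla\psi|^{2}-\int_M\langle\nabla(\eta\psi),\nabla\psi\rangle\ \ge\ 0,$$ and the equality sign means that this expression vanishes for all such $\eta$. The condition $\lambda_1(\mathcal{L}_H)\ge 0$ means $\int_M|\nabla\phi|^{2}\ge\int_M Ha\,\phi^{2}$ for every $\phi\in C_c^\infty(M)$. *)

(* Defs.v *)
From HB Require Import structures.
From mathcomp Require Import all_boot all_order all_algebra.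
From mathcomp Require Import all_classical all_reals all_analysis.

Set Implicit Arguments.
Unset Strict Implicit.
Unset Printing Implicit Defensive.

Import Order.TTheory GRing.Theory Num.Theory.
Import numFieldNormedType.Exports.

Local Open Scope classical_set_scope.
Local Open Scope ring_scope.

(* Meant for U open: f has continuous partial derivatives up to order k on U. *)
Fixpoint Ck_on (R : realType) (m k : nat) (U : set 'rV[R]_m)
    (f : 'rV[R]_m -> R) : Prop :=
  (forall y, U y -> {for y, continuous f}) /\
  match k with
  | 0 => True
  | k'.+1 => forall j : 'I_m,
      (forall y, U y -> derivable f y (delta_mx 0 j)) /\
      Ck_on k' U (fun y => 'D_(delta_mx 0 j) f y)
  end.

Definition smooth_on (R : realType) (m : nat) (U : set 'rV[R]_m)
    (f : 'rV[R]_m -> R) : Prop := forall k, Ck_on k U f.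

(* chart_map c and chart_inv c are total functions, meaningful on chart_dom c
   and on its image respectively. *)
Record smooth_manifold (R : realType) (m : nat) := SmoothManifold {
  carrier :> ptopologicalType ;
  manifold_hausdorff : hausdorff_space carrier ;
  manifold_second_countable : @second_countable carrier ;
  manifold_connected : connected [set: carrier] ;
  chart : Type ;
  chart_dom : chart -> set carrier ;
  chart_map : chart -> carrier -> 'rV[R]_m ;
  chart_inv : chart -> 'rV[R]_m -> carrier ;
  chart_dom_open : forall c, open (chart_dom c) ;
  chart_cover : forall x, exists c, chart_dom c x ;
  chart_img_open : forall c, open (chart_map c @` chart_dom c) ;
  chart_mapK : forall c x, chart_dom c x -> chart_inv c (chart_map c x) = x ;
  chart_map_continuous : forall c x, chart_dom c x ->
    {for x, continuous (chart_map c)} ;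
  chart_inv_continuous : forall c x, chart_dom c x ->
    {for chart_map c x, continuous (chart_inv c)} ;
  chart_transition_smooth : forall (c d : chart) (j : 'I_m),
    smooth_on (chart_map c @` (chart_dom c `&` chart_dom d))
      (fun y => chart_map d (chart_inv c y) 0 j)
}.

(* gram c x is the Gram matrix (g_ij(x)) of the metric in the chart c.
   Tangent vectors are rows and the library Jacobian acts on rows from the
   right, whence the shape of the change-of-chart rule. *)
Record riemannian_metric (R : realType) (m : nat) (M : smooth_manifold R m) :=
  RiemannianMetric {
  gram : chart M -> M -> 'M[R]_m ;
  gram_smooth : forall (c : chart M) (i j : 'I_m),
    smooth_on (chart_map c @` chart_dom c)
      (fun y => gram c (chart_inv c y) i j) ;
  gram_sym : forall (c : chart M) (x : M), chart_dom c x ->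
    (gram c x)^T = gram c x ;
  gram_posdef : forall (c : chart M) (x : M), chart_dom c x ->
    forall v : 'rV[R]_m, v != 0 -> 0 < (v *m gram c x *m v^T) 0 0 ;
  gram_transition : forall (c d : chart M) (x : M),
    chart_dom c x -> chart_dom d x ->
    let J := jacobian (chart_map d \o chart_inv c) (chart_map c x) in
    gram c x = J *m gram d x *m J^T
}.

Section RiemannianGeometry.
Context (R : realType) (m : nat) (M : smooth_manifold R m).
Variable g : riemannian_metric M.

(* Tangent vectors at x are represented by their components in chart_at x. *)
Definition chart_at (x : M) : chart M := sval (cid (chart_cover x)).

Definition inner (x : M) (v w : 'rV[R]_m) : R :=
  (v *m gram g (chart_at x) x *m w^T) 0 0.

Definition velocity (gamma : R -> M) (t : R) : 'rV[R]_m :=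
  derive1 (chart_map (chart_at (gamma t)) \o gamma) t.

Definition curve_length (gamma : R -> M) : \bar R :=
  (\int[lebesgue_measure]_(t in `[0%R, 1%R])
    (Num.sqrt (inner (gamma t) (velocity gamma t) (velocity gamma t)))%:E)%E.

(* Meant for I open. *)
Definition C1_curve_on (I : set R) (gamma : R -> M) : Prop :=
  forall t, I t -> {for t, continuous gamma} /\
    forall c : chart M, chart_dom c (gamma t) ->
      derivable (chart_map c \o gamma) t 1 /\
      {for t, continuous (derive1 (chart_map c \o gamma))}.

(* On each closed piece the curve coincides with one that is C^1 on an open
   neighbourhood of the piece. *)
Definition piecewise_C1 (gamma : R -> M) : Prop :=
  {within `[0, 1], continuous gamma} /\
  exists s : seq R, itv_partition 0 1 s /\
    forall k, (k < size s)%N ->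
      let t0 := nth 0 (0 :: s) k in let t1 := nth 0 s k in
      exists (e : R) (delta : R -> M),
        [/\ 0 < e, C1_curve_on `]t0 - e, t1 + e[ delta &
            forall t, t0 <= t <= t1 -> gamma t = delta t].

Definition dist (x y : M) : \bar R :=
  ereal_inf [set curve_length gamma | gamma in
    [set gamma | [/\ piecewise_C1 gamma, gamma 0 = x & gamma 1 = y]]].

Definition geodesic_ball (o : M) (r : R) : set M :=
  [set x | (dist o x < r%:E)%E].

Definition complete_metric : Prop :=
  forall u : nat -> M,
    (forall e : R, 0 < e -> exists N, forall i j, (N <= i)%N -> (N <= j)%N ->
      (dist (u i) (u j) < e%:E)%E) ->
    exists x, forall e : R, 0 < e -> exists N, forall i, (N <= i)%N ->
      (dist (u i) x < e%:E)%E.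

Definition lip_loc (f : M -> R) : Prop :=
  forall x : M, exists (L : R) (U : set M), nbhs x U /\
    forall y z, U y -> U z -> (`|f y - f z|%:E <= L%:E * dist y z)%E.

Definition compactly_supported (f : M -> R) : Prop :=
  compact (closure [set x | f x != 0]).

Definition lip_c (f : M -> R) : Prop :=
  compactly_supported f /\
  exists L : R, forall y z, (`|f y - f z|%:E <= L%:E * dist y z)%E.

Definition smooth_c (f : M -> R) : Prop :=
  compactly_supported f /\
  forall c : chart M, smooth_on (chart_map c @` chart_dom c) (f \o chart_inv c).

(* Components g^{ij} d_i f of the gradient in chart_at x. It is set to 0 where
   f is not differentiable; for locally Lipschitz f this is a null set
   (Rademacher). *)
Definition grad (f : M -> R) (x : M) : 'rV[R]_m :=
  let c := chart_at x in
  let fc : 'rV[R]_m -> R := f \o chart_inv c in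
  if `[< differentiable fc (chart_map c x) >] then
    (\row_j 'D_(delta_mx 0 j) fc (chart_map c x)) *m invmx (gram g c x)
  else 0.

Definition inner_grad (f h : M -> R) (x : M) : R :=
  inner x (grad f x) (grad h x).

Definition norm_grad (f : M -> R) (x : M) : R := Num.sqrt (inner_grad f f x).

End RiemannianGeometry.

(* Iterated one-dimensional Lebesgue integrals: by Tonelli this is integration
   against the Lebesgue measure of R^m for f nonnegative and Borel, the only
   case where it is used. *)
Fixpoint lebesgue_integral_rV (R : realType) (m : nat) :
    ('rV[R]_m -> \bar R) -> \bar R :=
  match m with
  | 0 => fun f => f 0
  | m'.+1 => fun f => (\int[lebesgue_measure]_t
      lebesgue_integral_rV (fun y : 'rV[R]_m' => f (row_mx t%:M y)))%E
  end.

Definition borel (T : ptopologicalType) := g_sigma_algebraType (@open T).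

Section Analysis.
Context (R : realType) (m : nat) (M : smooth_manifold R m).
Variables (g : riemannian_metric M) (vol : {measure set (borel M) -> \bar R}).

(* Since M is covered by countably many charts, exactly one Borel measure
   satisfies this: dvol = sqrt(det g_ij) dy in every chart. *)
Definition riemannian_volume : Prop :=
  forall (c : chart M) (A : set (borel M)),
    measurable A -> A `<=` chart_dom c ->
    vol A = lebesgue_integral_rV (fun y : 'rV[R]_m =>
      (\1_(chart_map c @` A) y *
       Num.sqrt (\det (gram g c (chart_inv c y))))%:E).

Local Open Scope ereal_scope.

Definition sobolev_inequality (S : R) : Prop :=
  forall v : M -> R, smooth_c v ->
    'N[vol]_((2 * m%:R / (m%:R - 2))%R%:E) [(EFin \o v : borel M -> \bar R)]
    <= S%:E * 'N[vol]_2 [(EFin \o norm_grad g v : borel M -> \bar R)].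

Definition weak_form (a : M -> R) (A : R) (psi eta : M -> R) : \bar R :=
  \int[vol]_x (a x * eta x * psi x ^+ 2)%:E
  + \int[vol]_x (A * eta x * norm_grad g psi x ^+ 2)%:E
  - \int[vol]_x (inner_grad g (fun z => eta z * psi z)%R psi x)%:E.

(* psi Delta psi + a psi^2 + A |grad psi|^2 >= 0, resp. = 0, in the
   distributional sense. *)
Definition weak_ineq (a : M -> R) (A : R) (psi : M -> R) : Prop :=
  forall eta : M -> R, (forall x, 0 <= eta x)%R -> lip_c g eta ->
    0 <= weak_form a A psi eta.

Definition weak_eq (a : M -> R) (A : R) (psi : M -> R) : Prop :=
  forall eta : M -> R, (forall x, 0 <= eta x)%R -> lip_c g eta ->
    weak_form a A psi eta = 0.

(* lambda_1(- Delta - H a) >= 0, in variational form. *)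
Definition lambda1_ge0 (a : M -> R) (H : R) : Prop :=
  forall phi : M -> R, smooth_c phi ->
    \int[vol]_x (H * a x * phi x ^+ 2)%:E
    <= \int[vol]_x (norm_grad g phi x ^+ 2)%:E.

End Analysis.

(* Main.v *)
(* With s = 1 + A, test the inequality with eta = chi^2 G(psi), where chi is a
   cutoff and G(psi) behaves like psi^(2 tau - 2), regularized at the zero set
   of psi by powers of u = psi^s / (psi^s + e). For s / 2 < tau <= s and
   v = chi F(psi), with F(psi) close to psi^tau, one gets

     c1 int |grad v|^2 <= sigma int a v^2 + error,

   with c1 = 1 and sigma -> s when tau = s. Each F is bounded by a multiple of
   psi^p, and psi is in L^(2p), so the cutoff radius can be chosen, depending on
   e, to make the error tend to 0.
   Since a is in L^(m/2), its tail is absorbed by the Sobolev inequality, so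
   psi^tau is in L^(2m/(m-2)); iterating, psi^s is in L^(2m/(m-2)) and a psi^(2s)
   is integrable. For tau = s, lambda_1 >= 0 gives
   H int a v^2 <= int |grad v|^2 <= s int a v^2 + o(1). If H > s, then
   int a psi^(2s) = 0, hence int |grad v|^2 -> 0 and psi = 0 by Sobolev. If
   H = s, the weak form tends to 0 along eta; every truncation of a test
   function away from {psi = 0} is dominated by a multiple of eta, and grad psi
   vanishes almost everywhere on {psi = 0}.

   The approximation of Lipschitz test functions by smooth ones rests on
   Rademacher's theorem, the cutoffs on Hopf-Rinow; both are read off from the
   description of the distance by chains of short segments in charts. *)

Require Import Defs.
From HB Require Import structures.
From mathcomp Require Import all_boot all_order all_algebra.
From mathcomp Require Import all_classical all_reals all_analysis.
From mathcomp Require Import ring lra.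
From mathcomp Require Import measurable_realfun lebesgue_measure.
Set Implicit Arguments.
Unset Strict Implicit.
Unset Printing Implicit Defensive.
Import Order.TTheory GRing.Theory Num.Theory.
Import numFieldNormedType.Exports.
Local Open Scope classical_set_scope.
Local Open Scope ring_scope.

(** The coefficient of the gradient term available before the cutoff is 2 - s / tau. It is positive
    exactly for tau > s / 2, which is the origin of the bound p > (1 + A) / 2, and it equals 1 at
    tau = s. There the mixed term in grad chi and grad psi cancels as well, so the estimate is sharp
    enough to meet lambda_1 >= 0 even for H = s. As tau cannot exceed the current p, each use of
    Sobolev raises the exponent by the factor m / (m - 2), until s is reached. Since psi may vanish
    and 2 tau - 2 may be negative, psi^(2 tau - 2) is not an admissible factor. A high power of u
    makes it C^1 across 0 and lets psi^p dominate F near 0, at the price of a constant that blows up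
    as e tends to 0. Lebesgue measure on R^m enters as an iterated integral. Besides measurability,
    three facts about it suffice: bounds on cubes from above and from below, and vanishing for
    functions that are null on all lines of one direction. For this reason Rademacher's theorem adds
    one coordinate at a time, and smoothing uses lattice sums instead of convolution. *)

Lemma lipschitz_fun_continuous (R : realType) (V W : normedModType R)
  (f : V -> W) (C : R) :
  (forall x y, `|f x - f y| <= C * `|x - y|) -> continuous f.
Proof.
move=> fC x; apply/cvgrPdist_lt => e e0.
have C1 : 0 < `|C| + 1 by rewrite ltr_wpDl.
have /= : \forall y \near x, `|x - y| < e / (`|C| + 1).
  by apply: cvgr_dist_lt => //; rewrite divr_gt0.
apply: filterS => y; rewrite ltr_pdivlMr// => xy.
apply: le_lt_trans (fC _ _) (le_lt_trans _ xy).
by rewrite mulrC ler_wpM2l// (le_trans (ler_norm _))// lerDl.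
Qed.

(** * Rademacher's theorem *)

Section lipschitz_derivable.
Context {R : realType} (f : R -> R) (L : R).
Hypothesis fL : forall x y, `|f x - f y| <= L * `|x - y|.
Local Notation mu := (@lebesgue_measure R).

(** Adding [L * x] makes the function nondecreasing, hence the distribution function of a Stieltjes
    measure, without affecting derivability. *)
Definition tilt (x : R) : R := f x + L * x.

Let L_ge0 : 0 <= L.
Proof. by have := le_trans (normr_ge0 _) (fL 1 0); rewrite subr0 normr1 mulr1. Qed.

Let tilt_bnd x y : x <= y -> 0 <= tilt y - tilt x <= 2 * L * (y - x).
Proof.
move=> xy; have := fL y x; rewrite (ger0_norm (_ : 0 <= y - x)) ?subr_ge0//.
by rewrite /tilt ler_norml => /andP[? ?]; apply/andP; split; lra.
Qed.

Let tilt_nd : nondecreasing tilt.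
Proof. by move=> x y /tilt_bnd/andP[]; rewrite subr_ge0. Qed.

Let tilt_continuous : continuous tilt.
Proof.
apply: (@lipschitz_fun_continuous R R R _ (2 * L)) => x y.
wlog xy : x y / x <= y => [h|].
  by have [/h//|/ltW/h] := leP x y; rewrite distrC (distrC y).
have /andP[h1 h2] := tilt_bnd xy.
by rewrite distrC ger0_norm// distrC ger0_norm ?subr_ge0.
Qed.

HB.instance Definition _ := isCumulative.Build R _ R tilt tilt_nd
  (right_continuousW tilt_continuous).

(** Both sides are infima over the same covers by half-open intervals, and on an interval the
    Stieltjes length is at most [2 * L] times the length. The summand 1 keeps the constant positive
    when [L = 0], as the division requires. *)
Let stieltjes_le (A : set R) :
  (lebesgue_stieltjes_measure tilt A <= (2 * L + 1)%:E * mu A)%E.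
Proof.
have C0 : 0 < 2 * L + 1 by have := L_ge0; lra.
rewrite -lee_pdivrMl//; apply: le_ereal_inf_tmp => _ /= [F [mF AF] <-].
rewrite lee_pdivrMl// -nneseriesZl; last 1 first.
  by move=> k _; apply: wlength_ge0.
apply: (@le_trans _ _ (\sum_(0 <= k <oo) wlength tilt (F k))%E).
  by apply: ereal_inf_lbound; exists F.
apply: lee_nneseries => [k _ _|k _]; first exact: (wlength_ge0 tilt).
have /ocitvP[->|[[a b] /= ab ->]] := mF k; first by rewrite !wlength0 mule0.
have abw := ltW ab; rewrite !wlength_itv_bnd// -?EFinB -EFinM lee_fin.
have /andP[_] := tilt_bnd (ltW ab) => /le_trans; apply.
by rewrite /= ler_wpM2r ?subr_ge0 ?ltW// ltrDl.
Qed.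

(** The Stieltjes measure of [tilt] is absolutely continuous. Radon-Nikodym gives it a density, and
    the Lebesgue differentiation theorem differentiates the primitive of this density. Restricting
    to []-n, n]] keeps the measure finite. *)
Lemma lipschitz_ae_derivable : {ae mu, forall x, derivable f x 1}.
Proof.
suff H n : {ae mu, forall x, (- n%:R < x < n%:R) -> derivable f x 1}.
  have : {ae mu, forall x n, (- n%:R < x < n%:R) -> derivable f x 1}.
    by apply/ae_foralln => n; exact: H.
  apply: (@filterS _ (nbhs (almost_everywhere mu))) => x /(_ (Num.bound `|x : R|)); apply.
  by rewrite -ltr_norml; exact: archi_boundP.
pose tiltc : cumulative R R := tilt.
pose D : set (measurableTypeR R) := `](- n%:R), n%:R]%classic.
have mD : measurable D by exact: measurable_itv.
have Doo : (lebesgue_stieltjes_measure tiltc D < +oo)%E.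
  apply: le_lt_trans (stieltjes_le D) _; rewrite lebesgue_measure_itv/=.
  by case: ifP => _; rewrite ?mule0 ?ltry// -EFinB -EFinM ltry.
pose nu : {finite_measure set (measurableTypeR R) -> \bar R} := mfrestr mD Doo.
have numu : nu `<< mu.
  apply/null_content_dominatesP => A mA A0; apply/eqP; rewrite eq_le measure_ge0 andbT.
  have := stieltjes_le (A `&` D); rewrite -/(mrestr _ mD A) => /le_trans; apply.
  have A0' : mu A = 0%E by exact: A0.
  have -> : mu (A `&` D) = 0%E; last by rewrite mule0.
  apply/eqP; rewrite eq_le measure_ge0 andbT -A0'.
  by apply: le_measure; rewrite ?inE//; exact: measurableI.
have [h [h0 hfin hi hE]] := radon_nikodym_sigma_finite numu.
pose k := fine \o h.
have hk : h = EFin \o k by apply/funext => x /=; rewrite fineK.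
have mR : measurable [set: R] by [].
have ki : mu.-integrable setT (EFin \o k) by rewrite -hk.
have ka (y : R) : mu.-integrable [set` Interval (BRight (- n%:R)) (BRight y)] (EFin \o k).
  exact: integrableS ki.
have kl : locally_integrable setT k by exact: open_integrable_locally openT ki.
have := FTC1 ka kl.
apply: (@filterS _ (nbhs (almost_everywhere mu))) => x /=.
rewrite lte_fin => H /andP[nx xn].
have {H}[H _] := H nx.
pose F := fun x0 : R => (\int[mu]_(t in [set` Interval (BRight (- n%:R)) (BRight x0)]) k t)%R.
(* On half-open intervals the measure is the increment of [tilt], so the primitive of the density is
   [tilt] up to a constant. *)
have FE y : - n%:R < y -> y < n%:R -> F y = tilt y - tilt (- n%:R).
  move=> ny yn.
  have yD : `]- n%:R, y]%classic `<=` D.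
    by rewrite /D => z /=; rewrite !in_itv/= => /andP[-> zy]/=; exact/ltW/(le_lt_trans zy).
  have -> : F y = fine (nu `]- n%:R, y]%classic).
    by rewrite hE; [rewrite hk|exact: measurable_itv].
  rewrite /nu /= /mfrestr /mrestr setIidl//.
  have := @measurable_mu_extE _ _ _ (wlength tilt) `]- n%:R, y]%classic (is_ocitv _ _).
  rewrite /lebesgue_stieltjes_measure /measure_extension => ->.
  have := @wlength_itv_bnd R tilt (- n%:R) y false false (ltW ny).
  by move=> /(congr1 fine) /= <-.
have Ft : {near x, F =1 (fun y => tilt y - tilt (- n%:R))}.
  have : \forall y \near (x : R), `]- n%:R, n%:R[%classic y.
    apply: open_nbhs_nbhs; split; first exact: interval_open.
    by rewrite /= in_itv/= nx.
  by apply: filterS => y; rewrite /= in_itv/= => /andP[? ?]; exact: FE.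
have {}H := near_eq_derivable Ft H.
have -> : f = (fun y => tilt y - tilt (- n%:R)) + (fun y => tilt (- n%:R) - L * y).
  by apply/funext => y; rewrite /tilt !fctE; ring.
apply: derivableD; first exact: H.
apply: derivableB; first exact: derivable_cst.
by apply: derivableM; [exact: derivable_cst|exact: derivable_id].
Qed.
End lipschitz_derivable.

(** * Borel measurability on R^m and the iterated integral *)

Section rV_measurability.
Context {R : realType}.
Implicit Types m : nat.

Lemma rV_ball_coord m (x y : 'rV[R]_m) (r : R) : 0 < r ->
  ball x r y <-> forall j, `|x 0 j - y 0 j| < r.
Proof.
move=> r0; split.
  by move=> [_ xy] j; exact: xy.
move=> h; split=> // i j; rewrite (ord1 i); exact: h.
Qed.

(** An open set is the union of the countably many boxes with rational centre and radius [1 / n.+1]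
    that it contains, and the preimage of a box is a finite intersection of conditions on single
    coordinates. *)
Lemma measurable_to_rV d (T : measurableType d) m (F : T -> 'rV[R]_m) :
  (forall j, measurable_fun setT (fun t => F t 0 j)) ->
  measurable_fun setT (F : T -> borel 'rV[R]_m).
Proof.
move=> mF; apply: (@measurability _ _ _ (borel 'rV[R]_m) _ _ (@open 'rV[R]_m)) => //.
move=> _ [U oU <-]; rewrite setTI.
pose box (q : 'rV[rat]_m * nat) : set 'rV[R]_m :=
  @ball R 'rV[R]_m (map_mx ratr q.1) (q.2.+1%:R)^-1.
have -> : F @^-1` U = \bigcup_(q in [set q | box q `<=` U]) (F @^-1` box q).
  apply/seteqP; split=> [t /= Ut|t [q qU]]; last by move=> /qU.
  have /nbhs_ballP[e /= e0 eU] : nbhs (F t) U by exact: open_nbhs_nbhs.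
  have [n ne] : exists n : nat, (n.+1%:R)^-1 < e / 2 :> R.
    have e2 : 0 < e / 2 by rewrite divr_gt0.
    have [n _ /(_ n (leqnn n))/=] := near_infty_natSinv_lt (PosNum e2).
    by exists n.
  have n0 : 0 < (n.+1%:R)^-1 :> R by rewrite invr_gt0 ltr0n.
  have qj (j : 'I_m) : exists q : rat, `|ratr q - F t 0 j| < (n.+1%:R)^-1.
    have /rat_in_itvoo[q] : F t 0 j - (n.+1%:R)^-1 < F t 0 j + (n.+1%:R)^-1.
      by rewrite ltrBlDr -addrA ltrDl addr_gt0.
    by rewrite in_itv/= => /andP[q1 q2]; exists q; rewrite ltr_distl q1 q2.
  have [q qF] := choice qj.
  have Bt : box (\row_j q j, n) (F t).
    by apply/rV_ball_coord => // j; rewrite !mxE; exact: qF.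
  exists (\row_j q j, n) => //= z Bz; apply: eU.
  have := ball_triangle (ball_sym Bt) Bz; apply: le_ball => /=.
  by rewrite (splitr e); apply: lerD; exact: ltW.
rewrite bigcup_mkcond; apply: countable_bigcupT_measurable => [|q]; first exact: countableP.
case: ifPn => // _.
have -> : F @^-1` box q = \bigcap_(j in [set: 'I_m])
    ((fun t => F t 0 j) @^-1` ball (ratr (q.1 0 j) : R) (q.2.+1%:R)^-1).
  have n0 : 0 < (q.2.+1%:R)^-1 :> R by rewrite invr_gt0 ltr0n.
  apply/seteqP; split=> t.
    by move=> /(rV_ball_coord _ _ n0) h j _; have := h j; rewrite mxE.
  by move=> h; apply/(rV_ball_coord _ _ n0) => j; rewrite mxE; exact: h.
apply: fin_bigcap_measurable => [|j _]; first exact: finite_finset.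
by rewrite -[X in measurable X]setTI; apply: mF => //; exact: measurable_ball.
Qed.

Lemma measurable_continuous_rV m (f : 'rV[R]_m -> R) : continuous f ->
  measurable_fun setT (f : borel 'rV[R]_m -> R).
Proof.
move=> cf; apply: (measurability _ (RGenOpens.measurableE R)) => //.
move=> _ [_ [a [b ->]] <-]; rewrite setTI; apply: sub_sigma_algebra.
by move/continuousP : cf; apply; exact: interval_open.
Qed.

Lemma measurable_coord m (j : 'I_m) :
  measurable_fun setT ((fun y => y 0 j) : borel 'rV[R]_m -> R).
Proof. by apply: measurable_continuous_rV => y; exact: coord_continuous. Qed.

Lemma row_mx0E m (t : R) (y : 'rV[R]_m) : (row_mx t%:M y : 'rV[R]_m.+1) 0 0 = t.
Proof. by rewrite mxE; case: splitP => //= k _; rewrite (ord1 k) mxE eqxx. Qed.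

Lemma row_mxSE m (t : R) (y : 'rV[R]_m) (j : 'I_m) :
  (row_mx t%:M y : 'rV[R]_m.+1) 0 (lift 0 j) = y 0 j.
Proof. rewrite mxE; case: splitP => k /=; rewrite /bump/= add1n; first by case: k => -[].
by move=> [jk]; congr (y _ _); exact/val_inj. Qed.

Lemma measurable_row_mx d (T : measurableType d) m (t : T -> R)
    (y : T -> borel 'rV[R]_m) :
  measurable_fun setT t -> measurable_fun setT y ->
  measurable_fun setT
    ((fun x => row_mx (t x)%:M (y x)) : T -> borel 'rV[R]_m.+1).
Proof.
move=> mt my; apply: measurable_to_rV => j.
case: (unliftP 0 j) => [j' ->|->].
  under eq_fun do rewrite row_mxSE.
  exact: (measurableT_comp (measurable_coord j') my).
by under eq_fun do rewrite row_mx0E.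
Qed.

Local Notation rVint := (@lebesgue_integral_rV R _).

Lemma lebesgue_integral_rV_ge0 m (f : 'rV[R]_m -> \bar R) :
  (forall y, 0 <= f y)%E -> (0 <= rVint f)%E.
Proof.
elim: m f => [|m IH] f f0 /=; first exact: f0.
by apply: integral_ge0 => t _; apply: IH.
Qed.

(** The parameter space is arbitrary so that the induction can move the first coordinate into it;
    the outer integral is then covered by Tonelli's measurability statement. *)
Lemma measurable_lebesgue_integral_rV d (T : measurableType d) m
    (f : T -> 'rV[R]_m -> \bar R) :
  measurable_fun setT (fun x : T * borel 'rV[R]_m => f x.1 x.2) ->
  (forall x y, 0 <= f x y)%E ->
  measurable_fun setT (fun x => rVint (f x)).
Proof.
elim: m d T f => [|m IH] d T f mf f0 /=.
  rewrite (_ : f^~ 0 = (fun x : T * borel 'rV[R]_0 => f x.1 x.2) \o (fun x => (x, 0)))//.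
  by apply: measurableT_comp => //; exact: pair2_measurable.
pose F (z : T * R) := rVint (fun y : 'rV[R]_m => f z.1 (row_mx z.2%:M y)).
apply: (@measurable_fun_fubini_tonelli_F _ _ _ _ _ lebesgue_measure F) => [|z]; last first.
  exact: lebesgue_integral_rV_ge0.
apply: IH => // ; apply: (measurableT_comp mf (_ : measurable_fun setT
  (fun x : (T * R) * borel 'rV[R]_m => (x.1.1, row_mx x.1.2%:M x.2 : borel 'rV[R]_m.+1)))).
apply: measurable_fun_pair => /=; first exact: measurableT_comp measurable_fst measurable_fst.
apply: measurable_row_mx; last exact: measurable_snd.
exact: measurableT_comp measurable_snd measurable_fst.
Qed.

(** Tonelli's theorem in the single case where the integrals against [mu] vanish: [mu] is exchanged
    with one coordinate after the other. *)
Lemma lebesgue_integral_rV_swap0 d (T : measurableType d)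
    (mu : {sigma_finite_measure set T -> \bar R}) m (f : T -> 'rV[R]_m -> \bar R) :
  measurable_fun setT (fun x : T * borel 'rV[R]_m => f x.1 x.2) ->
  (forall x y, 0 <= f x y)%E ->
  (forall y, \int[mu]_x f x y = 0)%E -> (\int[mu]_x rVint (f x) = 0)%E.
Proof.
elim: m f => [|m IH] f mf f0 fI /=; first exact: fI.
pose F (z : T * R) := rVint (fun y : 'rV[R]_m => f z.1 (row_mx z.2%:M y)).
have mrow : measurable_fun setT
  (fun x : (T * R) * borel 'rV[R]_m => (x.1.1, row_mx x.1.2%:M x.2 : borel 'rV[R]_m.+1)).
  apply: measurable_fun_pair => /=; first exact: measurableT_comp measurable_fst measurable_fst.
  apply: measurable_row_mx; last exact: measurable_snd.
  exact: measurableT_comp measurable_snd measurable_fst.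
have mF : measurable_fun setT F.
  apply: (@measurable_lebesgue_integral_rV _ (T * R)%type m
    (fun z (y : 'rV[R]_m) => f z.1 (row_mx z.2%:M y))) => //.
  exact: (measurableT_comp mf mrow).
have F0 z : (0 <= F z)%E by exact: lebesgue_integral_rV_ge0.
have /= -> := @fubini_tonelli _ _ _ _ _ mu lebesgue_measure F mF F0.
apply: integral0_eq => t _; apply: (IH (fun x y => f x (row_mx t%:M y))) => //.
apply: (measurableT_comp mf (_ : measurable_fun setT
  (fun x : T * borel 'rV[R]_m => (x.1, row_mx t%:M x.2 : borel 'rV[R]_m.+1)))).
by apply: measurable_fun_pair => //=; apply: measurable_row_mx => //; exact: measurable_snd.
Qed.

Definition set_coord m (y : 'rV[R]_m) (j : 'I_m) (t : R) : 'rV[R]_m :=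
  y + (t - y 0 j) *: delta_mx 0 j.

Lemma set_coordE m (y : 'rV[R]_m) j t k :
  set_coord y j t 0 k = if k == j then t else y 0 k.
Proof.
by rewrite !mxE eqxx/=; have [->|_] := eqVneq k j; rewrite ?mulr1 ?mulr0 ?addr0//; ring.
Qed.

Lemma set_coord0_row_mx m s (y : 'rV[R]_m) t :
  set_coord (row_mx s%:M y : 'rV[R]_m.+1) 0 t = row_mx t%:M y.
Proof.
apply/rowP => k; rewrite set_coordE; case: (unliftP 0 k) => [k' ->|->].
  by rewrite !row_mxSE.
by rewrite !row_mx0E eqxx.
Qed.

Lemma set_coordS_row_mx m s (y : 'rV[R]_m) j t :
  set_coord (row_mx s%:M y : 'rV[R]_m.+1) (lift 0 j) t = row_mx s%:M (set_coord y j t).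
Proof.
apply/rowP => k; rewrite set_coordE; case: (unliftP 0 k) => [k' ->|->].
  by rewrite !row_mxSE set_coordE (inj_eq (@lift_inj _ 0)).
by rewrite !row_mx0E.
Qed.

(** The form of Fubini on which Rademacher's theorem rests. If [j] is not the first coordinate, the
    claim passes inside the outer integral; if it is, the outer integral has to be exchanged with
    all the others. *)
Lemma lebesgue_integral_rV_line_null m (j : 'I_m) (f : borel 'rV[R]_m -> \bar R) :
  measurable_fun setT f -> (forall y, 0 <= f y)%E ->
  (forall y, \int[lebesgue_measure]_t f (set_coord y j t) = 0)%E -> rVint f = 0%E.
Proof.
elim: m j f => [|m IH] j f mf f0 fI; first by have := ltn_ord j; rewrite ltn0.
have mrow : measurable_fun setT
  (fun x : R * borel 'rV[R]_m => row_mx x.1%:M x.2 : borel 'rV[R]_m.+1).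
  by apply: measurable_row_mx; [exact: measurable_fst|exact: measurable_snd].
case: (unliftP 0 j) => [j' jE|jE].
  apply: integral0_eq => t _; apply: (IH j' (fun y => f (row_mx t%:M y))) => //.
    apply: (measurableT_comp mf); apply: measurable_row_mx => //; exact: measurable_id.
  by move=> y; under eq_integral do rewrite -set_coordS_row_mx; rewrite -jE.
apply: (@lebesgue_integral_rV_swap0 _ _ lebesgue_measure m (fun t y => f (row_mx t%:M y))) => //.
  exact: (measurableT_comp mf mrow).
move=> y; under eq_integral do rewrite -(set_coord0_row_mx 0).
by rewrite -jE.
Qed.

Lemma integral_cst_itv_radius (q r k : R) : 0 <= r ->
  (\int[lebesgue_measure]_(t in `[(q - r)%R, (q + r)%R]) (cst k%:E) t = (k * (2 * r))%:E)%E.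
Proof.
move=> r0; rewrite integral_cst; last exact: measurable_itv.
rewrite EFinM; congr (_ * _)%E; apply: etrans (lebesgue_measure_itv _) _.
rewrite /= lte_fin; case: ifPn => [_|].
  by rewrite -EFinB; congr EFin; ring.
by rewrite -leNgt => h; congr EFin; lra.
Qed.

(** This bound yields the finite volume of compact sets; its counterpart from below yields the
    positive volume of open sets. *)
Lemma lebesgue_integral_rV_cube_le m (f : 'rV[R]_m -> \bar R) (q : 'rV[R]_m) (r C : R) :
  0 <= r -> 0 <= C ->
  measurable_fun setT (f : borel 'rV[R]_m -> \bar R) -> (forall y, 0 <= f y)%E ->
  (forall y : 'rV[R]_m, (forall j, `|y 0 j - q 0 j| <= r) -> (f y <= C%:E)%E) ->
  (forall y : 'rV[R]_m, ~ (forall j, `|y 0 j - q 0 j| <= r) -> f y = 0%E) ->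
  (rVint f <= (C * (2 * r) ^+ m)%:E)%E.
Proof.
move=> r0; elim: m f q C => [|m IH] f q C C0 mf f0 fC fz /=.
  by rewrite expr0 mulr1; apply: fC => -[].
pose q' : 'rV[R]_m := \row_j q 0 (lift 0 j).
have cubeE t (y : 'rV[R]_m) : (forall j, `|(row_mx t%:M y : 'rV[R]_m.+1) 0 j - q 0 j| <= r) <->
    `|t - q 0 0| <= r /\ forall j, `|y 0 j - q' 0 j| <= r.
  split=> [h|[h0 h] j].
    split; first by have := h 0; rewrite row_mx0E.
    by move=> j; have := h (lift 0 j); rewrite row_mxSE mxE.
  case: (unliftP 0 j) => [j' ->|->]; last by rewrite row_mx0E.
  by rewrite row_mxSE; have := h j'; rewrite mxE.
have mrow : measurable_fun setT
  (fun x : R * borel 'rV[R]_m => row_mx x.1%:M x.2 : borel 'rV[R]_m.+1).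
  by apply: measurable_row_mx; [exact: measurable_fst|exact: measurable_snd].
have mt t : measurable_fun setT ((fun y => f (row_mx t%:M y)) : borel 'rV[R]_m -> \bar R).
  apply: (measurableT_comp mf); apply: measurable_row_mx => //; exact: measurable_id.
pose I := `[q 0 0 - r, q 0 0 + r]%classic : set R.
have inI t : I t <-> `|t - q 0 0| <= r by rewrite /I /= in_itv/= ler_distl.
have -> : (\int[lebesgue_measure]_t rVint (fun y : 'rV[R]_m => f (row_mx t%:M y)) =
    \int[lebesgue_measure]_(t in I) rVint (fun y : 'rV[R]_m => f (row_mx t%:M y)))%E.
  rewrite [RHS]integral_mkcond; apply: eq_integral => t _; rewrite patchE.
  case: ifPn => // /negP tI.
  have : (0 <= rVint (fun y : 'rV[R]_m => f (row_mx t%:M y)) <= (0 * (2 * r) ^+ m)%:E)%E.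
    apply/andP; split; first exact: lebesgue_integral_rV_ge0.
    apply: (IH _ q') => // y h; rewrite fz// => /cubeE[h0 //].
    by move=> _; apply: tI; rewrite inE; apply/inI.
  by rewrite mul0r => H; apply/eqP; rewrite eq_le; case/andP : H => -> ->.
apply: (@le_trans _ _ (\int[lebesgue_measure]_(t in I) (cst (C * (2 * r) ^+ m)%:E) t)%E).
  apply: ge0_le_integral => //.
  - exact: measurable_itv.
  - by move=> t _; exact: lebesgue_integral_rV_ge0.
  - apply: measurable_funTS; apply: (@measurable_lebesgue_integral_rV _ (measurableTypeR R) m
      (fun (t : R) (y : 'rV[R]_m) => f (row_mx t%:M y))) => //.
    exact: (measurableT_comp mf mrow).
  - move=> t tI; apply: (IH _ q') => // y h.
      by apply: fC; apply/cubeE; split => //; apply/inI.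
    by rewrite fz// => /cubeE[].
by rewrite integral_cst_itv_radius// -mulrA -exprSr lexx.
Qed.

Lemma lebesgue_integral_rV_cube_ge m (f : 'rV[R]_m -> \bar R) (q : 'rV[R]_m) (r c : R) :
  0 < r -> 0 <= c ->
  measurable_fun setT (f : borel 'rV[R]_m -> \bar R) -> (forall y, 0 <= f y)%E ->
  (forall y : 'rV[R]_m, (forall j, `|y 0 j - q 0 j| <= r) -> (c%:E <= f y)%E) ->
  ((c * (2 * r) ^+ m)%:E <= rVint f)%E.
Proof.
move=> r0; elim: m f q c => [|m IH] f q c c0 mf f0 fc /=.
  by rewrite expr0 mulr1; apply: fc => -[].
pose q' : 'rV[R]_m := \row_j q 0 (lift 0 j).
have mrow : measurable_fun setT
  (fun x : R * borel 'rV[R]_m => row_mx x.1%:M x.2 : borel 'rV[R]_m.+1).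
  by apply: measurable_row_mx; [exact: measurable_fst|exact: measurable_snd].
have mI : @measurable_fun _ _ (measurableTypeR R) _ setT (fun t : R => rVint (fun y : 'rV[R]_m => f (row_mx t%:M y))).
  apply: (@measurable_lebesgue_integral_rV _ (measurableTypeR R) m
      (fun (t : R) (y : 'rV[R]_m) => f (row_mx t%:M y))) => //.
  exact: (measurableT_comp mf mrow).
pose I := `[q 0 0 - r, q 0 0 + r]%classic : set R.
apply: (@le_trans _ _ (\int[lebesgue_measure]_(t in I) (cst (c * (2 * r) ^+ m)%:E) t)%E).
  by rewrite (integral_cst_itv_radius _ _ (ltW r0)) -mulrA -exprSr lexx.
apply: (@le_trans _ _ (\int[lebesgue_measure]_(t in I) rVint (fun y : 'rV[R]_m => f (row_mx t%:M y)))%E).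
  apply: ge0_le_integral => //.
  - exact: measurable_itv.
  - by move=> t _; rewrite lee_fin mulr_ge0// exprn_ge0// mulr_ge0// ltW.
  - exact: measurable_funTS.
  - move=> t; rewrite /I /= in_itv/= -ler_distl => tI; apply: (IH _ q') => // [|y h].
      apply: (measurableT_comp mf); apply: measurable_row_mx => //; exact: measurable_id.
    apply: fc => j; case: (unliftP 0 j) => [j' ->|->]; last by rewrite row_mx0E.
    by rewrite row_mxSE; have := h j'; rewrite mxE.
apply: ge0_subset_integral => //; first exact: measurable_itv.
by move=> t _; exact: lebesgue_integral_rV_ge0.
Qed.

End rV_measurability.

(** * Linear approximation and almost everywhere differentiability on R^m *)

Section linear_approximation.
Context {R : realType}.

Lemma differentiable_approxP (V W : normedModType R) (f : V -> W) (x : V)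
    (df : {linear V -> W}) : continuous df ->
  (forall e, 0 < e -> \forall h \near 0, `|f (h + x) - f x - df h| <= e * `|h|) ->
  differentiable f x /\ 'd f x = df :> (V -> W).
Proof.
move=> cdf H.
have E : f \o shift x = cst (f x) + df +o_ 0 id.
  apply/eqaddoP => e e0; apply: filterS (H _ e0) => h /=.
  by rewrite !fctE /= opprD addrA.
have D := diff_unique cdf E; split=> //.
by apply/diff_locallyP; rewrite D.
Qed.

Lemma differentiable_approx (V W : normedModType R) (f : V -> W) (x : V) :
  differentiable f x ->
  forall e, 0 < e -> \forall h \near 0, `|f (h + x) - f x - 'd f x h| <= e * `|h|.
Proof.
move=> /diff_locally /eqaddoP H e e0; apply: filterS (H _ e0) => h /=.
by rewrite !fctE /= opprD addrA.
Qed.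

Lemma near0_norm_lt (V : normedModType R) (d : R) : 0 < d ->
  \forall h \near (0 : V), `|h| < d.
Proof.
by move=> d0; apply/nbhs_ballP; exists d => //= h; rewrite -ball_normE /= sub0r normrN.
Qed.

Lemma continuous_translation (V : normedModType R) (h : V) :
  continuous (fun y => y + h).
Proof.
apply: (@lipschitz_fun_continuous R _ _ _ 1) => x y.
by rewrite opprD addrACA subrr addr0 mul1r.
Qed.

Lemma rV_coord_le m (h : 'rV[R]_m) j : `|h 0 j| <= `|h|.
Proof.
rewrite [leRHS]mx_normrE.
exact: (le_bigmax_cond _ (fun ij : 'I_1 * 'I_m => `|h ij.1 ij.2|) (j := (0, j))).
Qed.

Lemma rV_norm_le m (h : 'rV[R]_m) r : 0 <= r -> (forall j, `|h 0 j| <= r) -> `|h| <= r.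
Proof.
move=> r0 H; rewrite [leLHS]mx_normrE; apply/bigmax_leP; split=> // -[i j] _ /=.
by rewrite (ord1 i).
Qed.

Lemma norm_delta_mx_le m (j : 'I_m) : `|delta_mx 0 j : 'rV[R]_m| <= 1.
Proof.
apply: rV_norm_le => // k; rewrite mxE eqxx.
by case: eqP => _; rewrite ?normr1 ?normr0.
Qed.

Definition dotrow m (L h : 'rV[R]_m) : R := \sum_j L 0 j * h 0 j.

Lemma dotrow_is_linear m (L : 'rV[R]_m) : linear (dotrow L : 'rV[R]_m -> R^o).
Proof.
move=> a u v; rewrite /dotrow /GRing.scale/= mulr_sumr -big_split/=.
by apply: eq_bigr => j _; rewrite !mxE; ring.
Qed.

HB.instance Definition _ m (L : 'rV[R]_m) :=
  GRing.isLinear.Build R 'rV[R]_m R^o _ (dotrow L) (dotrow_is_linear L).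

Lemma dotrow_le m (L h : 'rV[R]_m) (C : R) : (forall j, `|L 0 j| <= C) ->
  `|dotrow L h| <= m%:R * C * `|h|.
Proof.
move=> LC; rewrite /dotrow (le_trans (ler_norm_sum _ _ _))//.
rewrite (le_trans (y := \sum_(j < m) C * `|h|))//; last first.
  by rewrite sumr_const card_ord -(mulr_natl (C * `|h|)) mulrA.
by apply: ler_sum => j _; rewrite normrM ler_pM// rV_coord_le.
Qed.

Lemma dotrow_continuous m (L : 'rV[R]_m) : continuous (dotrow L : 'rV[R]_m -> R^o).
Proof.
apply: (@lipschitz_fun_continuous R _ _ _ (m%:R * `|L|)) => x y.
by rewrite -linearB; apply: dotrow_le => j; exact: rV_coord_le.
Qed.

Lemma dotrowB m (L L' h : 'rV[R]_m) : dotrow (L - L') h = dotrow L h - dotrow L' h.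
Proof. by rewrite /dotrow -sumrB; apply: eq_bigr => j _; rewrite !mxE mulrBl. Qed.

Lemma dotrowN m (L h : 'rV[R]_m) : dotrow L (- h) = - dotrow L h.
Proof. by rewrite /dotrow -sumrN; apply: eq_bigr => j _; rewrite mxE mulrN. Qed.

Lemma dotrow_delta m (L : 'rV[R]_m) j : dotrow L (delta_mx 0 j) = L 0 j.
Proof.
rewrite /dotrow (bigD1 j)//= mxE !eqxx mulr1 big1 ?addr0// => k kj.
by rewrite mxE eqxx (negbTE kj) mulr0.
Qed.

Lemma rV_delta_sum m (h : 'rV[R]_m) : h = \sum_j h 0 j *: delta_mx 0 j.
Proof.
apply/rowP => k; rewrite summxE (bigD1 k)//= !mxE !eqxx mulr1 big1 ?addr0// => j jk.
by rewrite !mxE eqxx eq_sym (negbTE jk) mulr0.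
Qed.

Lemma diff_dotrow m (f : 'rV[R]_m -> R) x h : differentiable f x ->
  'd f x h = dotrow (\row_j 'D_(delta_mx 0 j) f x) h.
Proof.
move=> df; rewrite {1}(rV_delta_sum h) linear_sum /dotrow.
by apply: eq_bigr => j _; rewrite linearZ/= mxE deriveE// mulrC.
Qed.

End linear_approximation.

Section almost_differentiable.
Context {R : realType}.
Implicit Types (m : nat).

(* [f] admits at [y], for the increments supported in [J], a linear
   approximation with error [1 / i.+1]; the parameters range over countable
   sets so that this is a Borel condition. *)
Definition approximable_on m (J : pred 'I_m) (f : 'rV[R]_m -> R) (i : nat)
    (q : 'rV[rat]_m) (n : nat) : set 'rV[R]_m :=
  [set y | forall h : 'rV[R]_m, (forall j, ~~ J j -> h 0 j = 0) ->
    `|h| < n.+1%:R^-1 ->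
    `|f (y + h) - f y - dotrow (map_mx ratr q) h| <= i.+1%:R^-1 * `|h|].

Definition approximable m (J : pred 'I_m) (f : 'rV[R]_m -> R) : set 'rV[R]_m :=
  [set y | forall i, exists q n, approximable_on J f i q n y].

Lemma natS_inv_lt (e : R) : 0 < e -> exists n : nat, n.+1%:R^-1 < e.
Proof.
move=> e0; have [n _ /(_ n (leqnn n))/=] := near_infty_natSinv_lt (PosNum e0).
by exists n.
Qed.

(** For fixed [q] and [n] the condition is an intersection, over the increments [h], of closed
    conditions on [y]. Only the quantifiers over [i], [q] and [n] remain, and these are
    countable. *)
Lemma closed_approximable_on m (J : pred 'I_m) (f : 'rV[R]_m -> R) i q n : continuous f ->
  closed (approximable_on J f i q n).
Proof.
move=> cf.
have -> : approximable_on J f i q n = \bigcap_(h in [set h : 'rV[R]_m |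
    (forall j, ~~ J j -> h 0 j = 0) /\ `|h| < n.+1%:R^-1])
    ((fun y => `|f (y + h) - f y - dotrow (map_mx ratr q) h|) @^-1`
      [set t : R | t <= i.+1%:R^-1 * `|h|]).
  apply/seteqP; split=> [y Hy h [/= h1 h2]|y Hy h h1 h2]; first exact: Hy.
  exact: (Hy h).
apply: closed_bigI => h _; apply: preimage_closed; last exact: closed_le.
have cfh : continuous (fun y : 'rV[R]_m => f (y + h)).
  move=> y; apply: (@continuous_comp _ _ _ (fun y : 'rV[R]_m => y + h) f); last exact: cf.
  exact: continuous_translation.
have c1 : continuous (fun y : 'rV[R]_m => (f (y + h) - f y : R)).
  by move=> y; apply: (@cvgB R R _ _ _ _ _ _ _ (cfh y) (cf y)).
have c2 : continuous (fun y : 'rV[R]_m => (f (y + h) - f y - dotrow (map_mx ratr q) h : R)).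
  by move=> y; apply: (@cvgB R R _ _ _ _ _ _ _ (c1 y)); exact: cvg_cst.
by move=> y _; exact: (cvg_norm (c2 y)).
Qed.

Lemma measurable_approximable m (J : pred 'I_m) (f : 'rV[R]_m -> R) : continuous f ->
  measurable (approximable J f : set (borel 'rV[R]_m)).
Proof.
move=> cf.
have -> : approximable J f = \bigcap_i \bigcup_q \bigcup_n approximable_on J f i q n.
  apply/seteqP; split=> [y Hy i _|y Hy i]; first by have [q [n H]] := Hy i; exists q => //; exists n.
  by have [q _ [n _ H]] := Hy i I; exists q, n.
apply: bigcap_measurable => [|i _]; first by exists 0%N.
apply: countable_bigcupT_measurable => [|q]; first exact: countableP.
apply: bigcup_measurable => n _.
rewrite -[X in measurable X]setCK; apply: measurableC; apply: sub_sigma_algebra.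
by apply: closed_openC; exact: closed_approximable_on.
Qed.

(** Half of the error is reserved for rounding: moving each entry of [q] to a rational within
    [e / (2 * (m + 1))] changes the linear form by at most [e / 2] times the norm of [h]. *)
Lemma approximableP m (J : pred 'I_m) (f : 'rV[R]_m -> R) y :
  (forall e, 0 < e -> exists q : 'rV[R]_m, exists2 d : R, 0 < d &
    forall h : 'rV[R]_m, (forall j, ~~ J j -> h 0 j = 0) -> `|h| < d ->
    `|f (y + h) - f y - dotrow q h| <= e * `|h|) -> approximable J f y.
Proof.
move=> H i.
have i0 : 0 < i.+1%:R^-1 :> R by rewrite invr_gt0 ltr0n.
have i2 : 0 < i.+1%:R^-1 / 2 :> R by rewrite divr_gt0.
have [q [d d0 qd]] := H _ i2.
have m0 : 0 < m%:R + 1 :> R by rewrite ltr_wpDl.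
pose k : R := i.+1%:R^-1 / 2 / (m%:R + 1).
have k0 : 0 < k by rewrite divr_gt0.
have qj (j : 'I_m) : exists a : rat, `|ratr a - q 0 j| < k.
  have /rat_in_itvoo[a] : q 0 j - k < q 0 j + k by rewrite ltrBlDr -addrA ltrDl addr_gt0.
  by rewrite in_itv/= => /andP[q1 q2]; exists a; rewrite ltr_distl q1 q2.
have [a aq] := choice qj.
have [n nd] := natS_inv_lt d0.
exists (\row_j a j), n => h hJ hn.
set q' := map_mx _ _.
have -> : f (y + h) - f y - dotrow q' h = (f (y + h) - f y - dotrow q h) - dotrow (q' - q) h.
  by rewrite dotrowB; ring.
apply: (le_trans (ler_normB _ _)); rewrite [i.+1%:R^-1]splitr mulrDl lerD//.
  by apply: qd => //; exact: lt_trans nd.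
apply: (le_trans (@dotrow_le _ _ _ _ k _)) => [j|].
  by rewrite !mxE ltW.
by rewrite ler_wpM2r// /k mulrCA ler_piMr ?(ltW i2)// ler_pdivrMr// mul1r lerDl.
Qed.

(** The slopes [p i] depend on the precision [e i], but the intervals of radius [e i] around their
    entries meet pairwise. The supremum of the left ends lies in all of them and gives the
    differential. *)
Lemma approximable_differentiable m (f : 'rV[R]_m -> R) y : approximable predT f y ->
  differentiable f y.
Proof.
move=> /choice[q /choice[n H]].
pose p i : 'rV[R]_m := map_mx ratr (q i).
pose e i : R := i.+1%:R^-1.
have e0 i : 0 < e i by rewrite invr_gt0 ltr0n.
have {}H i h : `|h| < e (n i) -> `|f (y + h) - f y - dotrow (p i) h| <= e i * `|h|.
  by move=> hn; apply: H.
(* Both approximations are tested on one increment along [e_j], short enough for each of them. *)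
have pp i l j : p i 0 j - e i <= p l 0 j + e l.
  pose s : R := Num.min (e (n i)) (e (n l)) / 2.
  have s0 : 0 < s by rewrite divr_gt0// lt_min !e0.
  pose h : 'rV[R]_m := s *: delta_mx 0 j.
  have hs : `|h| <= s.
    by rewrite normrZ gtr0_norm// ler_piMr ?(ltW s0)// norm_delta_mx_le.
  have sm : s < Num.min (e (n i)) (e (n l)).
    by rewrite /s ltr_pdivrMr// mulr_natr mulr2n ltrDl lt_min !e0.
  have [hi hl] : `|h| < e (n i) /\ `|h| < e (n l).
    by move: (le_lt_trans hs sm); rewrite lt_min => /andP.
  have := H i h hi; have := H l h hl.
  rewrite !linearZ/= !dotrow_delta /GRing.scale/= !ler_norml => /andP[_ h1] /andP[h4 _].
  have H1 : s * (p i 0 j - p l 0 j) <= s * (e i + e l).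
    have := ler_wpM2l (ltW (e0 i)) hs; have := ler_wpM2l (ltW (e0 l)) hs.
    by move: h1 h4; lra.
  by rewrite ler_pM2l// in H1; lra.
pose L : 'rV[R]_m := \row_j sup [set p i 0 j - e i | i in setT].
have Lp i j : `|(L - p i) 0 j| <= e i.
  have hs : has_sup [set p i 0 j - e i | i in setT].
    split; first by exists (p 0%N 0 j - e 0%N); exists 0%N.
    by exists (p i 0 j + e i) => _ [l _ <-]; exact: pp.
  have pE : p i 0 j = ratr (q i 0 j) by rewrite mxE.
  rewrite !mxE -pE ler_norml; apply/andP; split.
    rewrite lerBrDr addrC; apply: sup_upper_bound => //=.
    by exists i.
  rewrite lerBlDr addrC; apply: ge_sup => [|_ [l _ <-]]; last exact: pp.
  by case: hs.
suff : differentiable f y /\ 'd f y = dotrow L :> (_ -> R) by case.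
apply: differentiable_approxP => [|t t0]; first exact: dotrow_continuous.
have m0 : 0 < m%:R + 1 :> R by rewrite ltr_wpDl.
have [i it] := natS_inv_lt (divr_gt0 t0 m0).
have : \forall h \near (0 : 'rV[R]_m), `|h| < e (n i).
  exact: near0_norm_lt.
apply: filterS => h hn.
have -> : f (h + y) - f y - dotrow L h =
    (f (y + h) - f y - dotrow (p i) h) - dotrow (L - p i) h.
  by rewrite dotrowB [h + y]addrC; ring.
apply: (le_trans (ler_normB _ _)).
apply: (le_trans (lerD (H _ _ hn) (dotrow_le _ (Lp i)))).
rewrite -mulrDl ler_wpM2r//.
have := it; rewrite ltr_pdivlMr// -/(e i) => /ltW; lra.
Qed.

(** With the converse implication, the set of differentiability points of a continuous function
    becomes the Borel set [approximable predT f]. *)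
Lemma differentiable_approximable m (f : 'rV[R]_m -> R) y : differentiable f y ->
  approximable predT f y.
Proof.
move=> df; apply: approximableP => e e0.
have /nbhs_ballP[d /= d0 H] := differentiable_approx df e0.
exists (\row_j 'D_(delta_mx 0 j) f y), d => // h _ hd.
rewrite -(diff_dotrow _ df) [y + h]addrC; apply: H.
by rewrite -ball_normE /= sub0r normrN.
Qed.

Lemma approximable_line m (f : 'rV[R]_m -> R) y j t :
  derivable (fun t => f (set_coord y j t)) t 1 -> approximable (pred1 j) f (set_coord y j t).
Proof.
move=> df; apply: approximableP => e e0.
move: df => /derivable1_diffP df.
have /nbhs_ballP[d /= d0 H] := differentiable_approx df e0.
exists ('d (fun t => f (set_coord y j t)) t 1 *: delta_mx 0 j), d => // h hJ hd.
have hE : h = h 0 j *: delta_mx 0 j.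
  apply/rowP => k; rewrite !mxE eqxx/=; have [->|kj] := eqVneq k j; first by rewrite mulr1.
  by rewrite mulr0 hJ.
have hj : `|h 0 j| <= `|h| by exact: rV_coord_le.
have := H (h 0 j); rewrite -ball_normE/= sub0r normrN => /(_ (le_lt_trans hj hd)).
have -> : set_coord y j (h 0 j + t) = set_coord y j t + h.
  by rewrite /set_coord [in RHS]hE -[RHS]addrA -scalerDl; congr (_ + _ *: _); ring.
have -> : 'd (fun t0 : R => f (set_coord y j t0)) t (h 0 j) =
    dotrow ('d (fun t0 : R => f (set_coord y j t0)) t 1 *: delta_mx 0 j) h.
  rewrite [in RHS]hE linearZ/= dotrow_delta !mxE !eqxx mulr1 /GRing.scale/=.
  by rewrite -[in LHS](mulr1 (h 0 j)) -[h 0 j * 1]/(h 0 j *: (1 : R^o)) linearZ.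
by move=> /le_trans; apply; rewrite ler_wpM2l// ltW.
Qed.

(** The infimum of the empty set is 0 by default, so this function is 1-Lipschitz and nonnegative
    for every [E], empty or not. *)
Definition set_dist (V : normedModType R) (E : set V) (y : V) : R :=
  inf [set `|y - z| | z in E].

Lemma set_dist_lipschitz (V : normedModType R) (E : set V) x y :
  `|set_dist E x - set_dist E y| <= 1 * `|x - y|.
Proof.
rewrite mul1r; have [->|/set0P[z0 Ez0]] := eqVneq E set0.
  by rewrite /set_dist !image_set0 subrr normr0.
have hi a : has_inf [set `|a - z| | z in E].
  by split; [exists `|a - z0|; exists z0|exists 0 => _ [z _ <-]].
have H a b : set_dist E a - set_dist E b <= `|a - b|.
  rewrite lerBlDr -lerBlDl; apply: lb_le_inf => [|_ [z Ez <-]]; first by case: (hi b).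
  rewrite lerBlDl (le_trans (_ : _ <= `|a - z|))//.
    by apply: ge_inf; [case: (hi a)|exists z].
  exact: ler_distD.
by rewrite ler_norml H lerNl opprB distrC H.
Qed.

Lemma set_dist_ge0 (V : normedModType R) (E : set V) y : 0 <= set_dist E y.
Proof.
have [->|/set0P[z0 Ez0]] := eqVneq E set0; first by rewrite /set_dist image_set0 inf0.
by apply: lb_le_inf => [|_ [z _ <-]//]; exists `|y - z0|; exists z0.
Qed.

Lemma set_dist0 (V : normedModType R) (E : set V) y : E y -> set_dist E y = 0.
Proof.
move=> Ey; apply/eqP; rewrite eq_le set_dist_ge0 andbT.
by apply: ge_inf; [exists 0 => _ [z _ <-]|exists y => //; rewrite subrr normr0].
Qed.

Lemma set_dist_lt (V : normedModType R) (E : set V) y d : E !=set0 ->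
  set_dist E y < d -> exists2 z, E z & `|y - z| < d.
Proof.
move=> [z0 Ez0] yd; have [|_ [z Ez <-] zd] := inf_lt _ yd; last by exists z.
by exists `|y - z0|; exists z0.
Qed.

(* The induction step of Rademacher's theorem: at a point of [E], derivability
   of the distance to [E] along [e_j] forces [E] to contain points at distance
   [o(t)] of [y + t e_j], where the approximation valid on [E] can be used. *)
Lemma approximable_step m (J : pred 'I_m) j (f : 'rV[R]_m -> R) (L : R) y :
  (forall x z, `|f x - f z| <= L * `|x - z|) ->
  approximable J f y -> approximable (pred1 j) f y ->
  (forall i q n, approximable_on J f i q n y ->
     approximable (pred1 j) (set_dist (approximable_on J f i q n)) y) ->
  approximable [predU1 j & J] f y.
Proof.
move=> fL fJ fj fE; apply: approximableP => e e0.
have L0 : 0 <= `|L| by [].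
(* The four errors at the end add up to [6 * |L| + 2] times [et] times the norm of [h], which the
   factor [12 * (|L| + 1)] covers with room to spare. *)
have eta0 : 0 < e / (12 * (`|L| + 1)) by rewrite divr_gt0// mulr_gt0// ltr_wpDl.
have [i ieta] := natS_inv_lt eta0; set et : R := i.+1%:R^-1 in ieta.
have et0 : 0 < et by rewrite invr_gt0 ltr0n.
have [q [n yE]] := fJ i; set E := approximable_on J f i q n in yE.
have Ln : 12 * (`|L| + 1) * et <= e.
  by move: ieta; rewrite ltr_pdivlMr 1?mulrC ?mulr_gt0 ?ltr_wpDl// => /ltW.
have [q1 [n1 H1]] := fj i; have [q2 [n2 H2]] := fE _ _ _ yE i.
(* The entry [j] comes from the approximation along the line, the others from the approximation
   valid on [E]. *)
pose p : 'rV[R]_m := \row_k if k == j then ratr (q1 0 j) else ratr (q 0 k).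
pose d : R := Num.min n.+1%:R^-1 (Num.min n1.+1%:R^-1 n2.+1%:R^-1).
have d0 : 0 < d by rewrite !lt_min !invr_gt0 !ltr0n.
exists p, d => // h hJ hd.
move: hd; rewrite !lt_min => /andP[hn /andP[hn1 hn2]].
set t := h 0 j; pose te : 'rV[R]_m := t *: delta_mx 0 j; pose h' := h - te.
have tePn k : ~~ (k == j) -> te 0 k = 0 by rewrite !mxE eqxx /= => /negbTE->; rewrite mulr0.
have h'J k : ~~ J k -> h' 0 k = 0.
  move=> Jk; rewrite !mxE eqxx/=; have [->|kj] := eqVneq k j; first by rewrite mulr1 subrr.
  by rewrite mulr0 subr0 hJ// negb_or kj.
have teh : `|te| <= `|h|.
  by rewrite normrZ (le_trans (ler_piMr _ (norm_delta_mx_le j)))// rV_coord_le.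
have h'h : `|h'| <= `|h|.
  apply: rV_norm_le => // k; rewrite !mxE eqxx/=.
  have [->|kj] := eqVneq k j; first by rewrite mulr1 subrr normr0.
  by rewrite mulr0 subr0 rV_coord_le.
have {}H1 := H1 te tePn (le_lt_trans teh hn1).
(* The distance is 0 at [y] and nonnegative. Its approximations at [te] and [- te] have opposite
   linear parts, so adding them bounds the sum of the two distances, hence each of them. *)
have dE : set_dist E (y + te) <= 2 * et * `|te|.
  have tmP k : ~~ (k == j) -> (- te) 0 k = 0 by move=> kj; rewrite mxE tePn ?oppr0.
  have := H2 te tePn (le_lt_trans teh hn2).
  have := H2 (- te) tmP; rewrite normrN => /(_ (le_lt_trans teh hn2)).
  have dy0 : set_dist E y = 0 by exact: set_dist0.
  rewrite -/E -/et dy0 dotrowN; set X := dotrow _ _; set D1 := set_dist E (y - te).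
  set D2 := set_dist E (y + te); rewrite 2!subr0 2!ler_norml.
  move=> /andP[_ h2] /andP[_ h4]; have D0 := set_dist_ge0 E (y - te).
  by clear -D0 h2 h4; lra.
have [z Ez yz] : exists2 z, E z & `|y + te - z| <= 3 * et * `|h|.
  have [h0|hn0] := eqVneq h 0.
    exists y => //; rewrite /te /t h0 mxE scale0r addr0 subrr !normr0 mulr0//.
  have hp : 0 < `|h| by rewrite normr_gt0.
  have [|z Ez /ltW yz] := @set_dist_lt _ E (y + te) (3 * et * `|h|) (ex_intro _ y yE).
    apply: (le_lt_trans dE); apply: (@le_lt_trans _ _ (2 * et * `|h|)).
      by rewrite ler_wpM2l// mulr_ge0// ltW.
    by rewrite ltr_pM2r// ltr_pM2r//; lra.
  by exists z.
have {}Ez := Ez h' h'J (le_lt_trans h'h hn).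
have f1 := fL (y + h) (z + h'); have f2 := fL z (y + te).
have yhz : y + h - (z + h') = y + te - z.
  by apply/rowP => k; rewrite !mxE; ring.
rewrite yhz in f1; rewrite distrC in f2; rewrite distrC in f2.
rewrite distrC [`|z - _|]distrC in f2.
(* The path goes from [y + h] to [z + h'], then to [z], then to [y + te], then to [y]. The first and
   third moves have length o(h) and cost the Lipschitz constant; the second stays in the directions
   [J] and starts at a point of [E]. *)
have -> : f (y + h) - f y - dotrow p h =
   (f (y + h) - f (z + h')) + (f (z + h') - f z - dotrow (map_mx ratr q) h')
   + (f z - f (y + te)) + (f (y + te) - f y - dotrow (map_mx ratr q1) te).
  suff -> : dotrow p h = dotrow (map_mx ratr q) h' + dotrow (map_mx ratr q1) te by ring.
  rewrite /dotrow -big_split/=; apply: eq_bigr => k _; rewrite !mxE eqxx/=.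
  by have [->|kj] := eqVneq k j; rewrite /t ?mulr1 ?mulr0 ?subr0 ?subrr; ring.
have Ly : L * `|y + te - z| <= `|L| * (3 * et * `|h|).
  by rewrite (le_trans (ler_wpM2r _ (ler_norm L)))// ler_wpM2l.
apply: (le_trans (ler_normD _ _)); apply: (@le_trans _ _
  (`|L| * (3 * et * `|h|) + et * `|h| + `|L| * (3 * et * `|h|) + et * `|h|)).
  apply: lerD; last by rewrite (le_trans H1)// ler_wpM2l// ltW.
  apply: (le_trans (ler_normD _ _)); apply: lerD; last first.
    by rewrite distrC (le_trans _ Ly)//.
  apply: (le_trans (ler_normD _ _)); apply: lerD; first exact: le_trans f1 Ly.
  by rewrite (le_trans Ez)// ler_wpM2l// ltW.
have := ler_wpM2r (normr_ge0 h) Ln.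
have : 0 <= `|L| * et * `|h| by rewrite !mulr_ge0// ltW.
have : 0 <= et * `|h| by rewrite mulr_ge0// ltW.
move=> A B C; apply: le_trans C; rewrite -subr_ge0.
by rewrite (_ : _ - _ = 6 * (`|L| * et * `|h|) + 10 * (et * `|h|)); [rewrite addr_ge0// mulr_ge0|ring].
Qed.

(* Null sets of the iterated integral, defined so as to be stable under
   intersection with Borel sets and multiplication by a density. *)
Definition rV_null1 m (N : set 'rV[R]_m) :=
  measurable (N : set (borel 'rV[R]_m)) /\
  forall f : borel 'rV[R]_m -> \bar R, measurable_fun setT f ->
    (forall y, (0 <= f y)%E) -> (forall y, ~ N y -> f y = 0%E) ->
    lebesgue_integral_rV f = 0%E.

(** Asking only for a countable Borel cover admits arbitrary subsets and makes countable unions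
    immediate, without sigma-additivity of the iterated integral. *)
Definition rV_null m (N : set 'rV[R]_m) :=
  exists2 F : nat -> set 'rV[R]_m, (forall k, rV_null1 (F k)) & N `<=` \bigcup_k F k.

Lemma rV_nullS m (N N' : set 'rV[R]_m) : N' `<=` N -> rV_null N -> rV_null N'.
Proof. by move=> NN' [F F0 NF]; exists F => //; exact: subset_trans NF. Qed.

Lemma rV_null1_null m (N : set 'rV[R]_m) : rV_null1 N -> rV_null N.
Proof. by move=> N0; exists (fun=> N) => // y Ny; exists 0%N. Qed.

Lemma rV_null1_set0 m : rV_null1 (set0 : set 'rV[R]_m).
Proof.
split=> [|f mf f0 fz]; first exact: measurable0.
apply/eqP; rewrite eq_le lebesgue_integral_rV_ge0// andbT.
rewrite (_ : f = cst 0%E); last by apply/funext => y; rewrite fz.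
have := @lebesgue_integral_rV_cube_le R m (cst 0%E) 0 0 0 (lexx _) (lexx _).
by rewrite mul0r; apply => //; exact: measurable_cst.
Qed.

Lemma rV_null_bigcup m (I : countType) (N : I -> set 'rV[R]_m) :
  (forall i, rV_null (N i)) -> rV_null (\bigcup_i N i).
Proof.
move=> H.
have H' i : exists F : nat -> set 'rV[R]_m, (forall k, rV_null1 (F k)) /\ N i `<=` \bigcup_k F k.
  by have [F ? ?] := H i; exists F.
have [F HF] := choice H'.
have n0 := rV_null1_set0 m.
exists (fun k => match @unpickle (I * nat)%type k with Some p => F p.1 p.2 | None => set0 end).
  by move=> k; case: unpickle => [[i l]|]//=; have [H1 _] := HF i.
move=> y [i _ /(HF i).2[k _ yk]]; exists (pickle (i, k)) => //.
by rewrite pickleK.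
Qed.

Lemma rV_nullU m (N N' : set 'rV[R]_m) : rV_null N -> rV_null N' -> rV_null (N `|` N').
Proof.
move=> h h'; apply: (@rV_nullS _ (\bigcup_b (if b then N else N'))).
  by move=> y [Ny|Ny]; [exists true|exists false].
by apply: rV_null_bigcup => -[].
Qed.

(** On each line of direction [e_j] the one-dimensional theorem applies, and the exceptional set is
    Borel, so that the iterated integral can be taken along these lines. *)
Lemma rV_null_not_approximable_line m (f : 'rV[R]_m -> R) (L : R) j :
  (forall x z, `|f x - f z| <= L * `|x - z|) -> rV_null (~` approximable (pred1 j) f).
Proof.
move=> fL; apply: rV_null1_null.
have mA : measurable (approximable (pred1 j) f : set (borel 'rV[R]_m)).
  by apply: measurable_approximable; exact: lipschitz_fun_continuous fL.
split; first exact: measurableC.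
move=> h mh h0 hz; apply: (@lebesgue_integral_rV_line_null _ _ j) => // y.
have ae : {ae lebesgue_measure, forall t : R, derivable (fun t => f (set_coord y j t)) t 1}.
  apply: (@lipschitz_ae_derivable _ _ `|L|) => s t.
  apply: (le_trans (fL _ _)); rewrite /set_coord opprD addrACA subrr add0r -scalerBl.
  rewrite normrZ opprB addrA subrK (le_trans (ler_wpM2r _ (ler_norm L)))// ?mulr_ge0//.
  by rewrite ler_wpM2l// ler_piMr// norm_delta_mx_le.
have ms : measurable_fun setT (fun t : R => set_coord y j t : borel 'rV[R]_m).
  apply: measurable_to_rV => k; under eq_fun do rewrite set_coordE.
  by case: (k == j); [exact: measurable_id|exact: measurable_cst].
rewrite (ae_eq_integral (cst 0%E))//; first by rewrite integral0.
- exact: (measurableT_comp mh ms).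
- apply: (@filterS _ (nbhs (almost_everywhere lebesgue_measure)) _ _ _ _ ae) => t dt _.
  by apply: hz => /=; apply; exact: approximable_line.
Qed.

(** Induction on the number [k] of coordinates in which increments are allowed. Passing to [k.+1]
    discards the exceptional set for [k], the points not approximable along the new line, and those
    where one of the distance functions is not approximable along it; there are countably many such
    functions because [E] has countable parameters. *)
Lemma lipschitz_differentiable m (f : 'rV[R]_m -> R) (L : R) :
  (forall x z, `|f x - f z| <= L * `|x - z|) ->
  rV_null [set y | ~ differentiable f y].
Proof.
move=> fL.
suff H k : (k <= m)%N -> rV_null (~` approximable [pred j : 'I_m | j < k]%N f).
  apply: rV_nullS (H m (leqnn m)) => y; apply: contra_not => fy.
  apply: approximable_differentiable => i; have [q [n qn]] := fy i; exists q, n => h _; apply: qn.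
  by move=> j; rewrite /= ltn_ord.
elim: k => [_|k IH km].
  apply: (@rV_nullS _ set0); last first.
    exact/rV_null1_null/rV_null1_set0.
  move=> y; apply; apply: approximableP => e e0; exists 0, 1 => // h h0 _.
  have -> : h = 0 by apply/rowP => j; rewrite h0 ?mxE.
  by rewrite addr0 subrr linear0 subrr !normr0 mulr0.
pose j := Ordinal km.
pose E i q n := approximable_on [pred j : 'I_m | j < k]%N f i q n.
apply: (@rV_nullS _ ((~` approximable [pred j : 'I_m | j < k]%N f `|` ~` approximable (pred1 j) f) `|`
   \bigcup_(p : nat * 'rV[rat]_m * nat) ~` approximable (pred1 j) (set_dist (E p.1.1 p.1.2 p.2)))).
  move=> y; apply: contra_notP => /not_orP[/not_orP[/contrapT h1 /contrapT h2] h3].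
  have H : approximable [predU1 j & [pred j : 'I_m | j < k]%N] f y.
    apply: (approximable_step fL) => // i q n _; apply: contrapT => h; apply: h3.
    by exists (i, q, n).
  move=> i; have [q [n qn]] := H i; exists q, n => h hJ; apply: qn => l.
  by rewrite /= negb_or => /andP[lj lk]; apply: hJ; rewrite /= ltnS leq_eqVlt negb_or lk andbT.
apply: rV_nullU; last first.
  by apply: rV_null_bigcup => p; apply: rV_null_not_approximable_line; exact: set_dist_lipschitz.
apply: rV_nullU; first exact/IH/ltnW.
exact: rV_null_not_approximable_line fL.
Qed.

End almost_differentiable.

(** * Smooth functions on R^m and approximation by them *)

Section Ck_closure.
Context {R : realType}.

Lemma is_derive_line (V : normedModType R) (f : V -> R) (z v : V) (s : R) :
  derivable f (z + s *: v) v ->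
  is_derive s 1 (fun s => f (z + s *: v)) ('D_v f (z + s *: v)).
Proof.
move=> df.
have E : (fun h : R => h^-1 *: (((fun s => f (z + s *: v)) \o shift s) (h *: 1) - f (z + s *: v))) =
    (fun h => h^-1 *: ((f \o shift (z + s *: v)) (h *: v) - f (z + s *: v))).
  apply/funext => h /=; congr (_ *: (f _ - _)).
  by rewrite -[h *: 1]/(h * 1) mulr1 scalerDl addrCA.
by split; [rewrite /derivable E|rewrite /derive E].
Qed.

Section pointwise.
Context {m : nat}.
Implicit Types (U V : set 'rV[R]_m) (f g : 'rV[R]_m -> R).

Lemma Ck_onP k U f : Ck_on k U f <-> forall y, U y -> Ck_on k [set y] f.
Proof.
elim: k f => [|k IH] f /=.
  split=> [[fc _] y Uy|H]; first by split=> // _ ->; exact: fc.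
  by split=> // y Uy; have [H' _] := H y Uy; exact: H'.
split=> [[fc H] y Uy|H].
  split=> [_ ->|j]; first exact: fc.
  have [fd /IH Hj] := H j; split=> [_ ->|]; first exact: fd.
  exact: Hj.
split=> [y Uy|j]; first by have [H' _] := H y Uy; exact: H'.
split=> [y Uy|]; first by have [_ /(_ j)[H' _]] := H y Uy; exact: H'.
by apply/IH => y Uy; have [_ /(_ j)[_ ?]] := H y Uy.
Qed.

Lemma Ck_on_sub k U V f : V `<=` U -> Ck_on k U f -> Ck_on k V f.
Proof. by move=> VU /Ck_onP H; apply/Ck_onP => y /VU; exact: H. Qed.

Lemma Ck_onW k U f : Ck_on k.+1 U f -> Ck_on k U f.
Proof.
elim: k f => [|k IH] f [fc H] /=; first by [].
split=> // j; have [fd Hj] := H j; split=> //; exact: IH.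
Qed.

Lemma Ck_on_continuous k U f y : Ck_on k U f -> U y -> {for y, continuous f}.
Proof. by case: k => [|k] [fc _]; exact: fc. Qed.

Lemma Ck_on_derivable k U f y j : Ck_on k.+1 U f -> U y -> derivable f y (delta_mx 0 j).
Proof. by move=> [_ /(_ j)[fd _]]; exact: fd. Qed.

Lemma Ck_on_derive k U f j : Ck_on k.+1 U f ->
  Ck_on k U (fun y => 'D_(delta_mx 0 j) f y).
Proof. by move=> [_ /(_ j)[]]. Qed.

Lemma Ck_on_ext k U f g : open U -> (forall y, U y -> f y = g y) ->
  Ck_on k U f -> Ck_on k U g.
Proof.
move=> oU; elim: k f g => [|k IH] f g fg [fc H];
  have Un y : U y -> {near y, f =1 g} by
    (move=> Uy; apply: filterS (open_nbhs_nbhs (conj oU Uy)) => z; exact: fg).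
  split=> // y Uy; rewrite /prop_for /continuous_at -fg//; apply: cvg_trans (fc y Uy).
  exact: (@near_eq_cvg _ _ (nbhs y) _ _ _ (Un y Uy)).
have gc y : U y -> {for y, continuous g}.
  move=> Uy; rewrite /prop_for /continuous_at -fg//; apply: cvg_trans (fc y Uy).
  exact: (@near_eq_cvg _ _ (nbhs y) _ _ _ (Un y Uy)).
split=> // j.
have [fd Hj] := H j; split=> [y Uy|]; first exact: near_eq_derivable (Un y Uy) (fd y Uy).
by apply: IH Hj => y Uy; apply: near_eq_derive; exact: Un.
Qed.

Lemma Ck_on_cst k U (c : R) : Ck_on k U (cst c).
Proof.
elim: k c => [|k IH] c /=.
  by split=> // y _; exact: cst_continuous.
split=> [y _|j]; first exact: cst_continuous.
split=> [y _|]; first exact: derivable_cst.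
rewrite (_ : (fun y => _) = cst 0); first exact: IH.
by apply/funext => y; rewrite derive_cst.
Qed.

Lemma derive_coord (y v : 'rV[R]_m) i :
  derivable (fun z : 'rV[R]_m => z 0 i) y v /\ 'D_v (fun z : 'rV[R]_m => z 0 i) y = v 0 i.
Proof.
have E : (fun h : R => h^-1 *: (((fun z : 'rV[R]_m => z 0 i) \o shift y) (h *: v) - y 0 i)) @ 0^'
    --> v 0 i.
  apply: cvg_trans (@cvg_cst _ (v 0 i) _ (0 : R)^' _).
  apply: near_eq_cvg; near=> h; rewrite /= !mxE addrK /GRing.scale/= mulKf//.
  by near: h; exact: nbhs_dnbhs_neq.
by split; [apply/cvg_ex; exists (v 0 i)|exact: cvg_lim].
Unshelve. all: by end_near. Qed.

Lemma Ck_on_coord k U i : Ck_on k U (fun y : 'rV[R]_m => y 0 i).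
Proof.
case: k => [|k] /=; first by split=> // y _; exact: coord_continuous.
split=> [y _|j]; first exact: coord_continuous.
split=> [y _|]; first by have [] := derive_coord y (delta_mx 0 j) i.
suff -> : 'D_(delta_mx 0 j) (fun y : 'rV[R]_m => y 0 i) = cst ((delta_mx 0 j : 'rV[R]_m) 0 i) by exact: Ck_on_cst.
by apply/funext => y; have [] := derive_coord y (delta_mx 0 j) i.
Qed.

Lemma Ck_on_add k U f g : open U -> Ck_on k U f -> Ck_on k U g ->
  Ck_on k U (fun y => f y + g y).
Proof.
move=> oU; elim: k f g => [|k IH] f g Hf Hg.
  by split=> // y Uy; apply: (@cvgD R R _ _ _ _ _ _ _ (Hf.1 y Uy) (Hg.1 y Uy)).
split=> [y Uy|j].
  by apply: (@cvgD R R _ _ _ _ _ _ _ (Hf.1 y Uy) (Hg.1 y Uy)).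
split=> [y Uy|].
  suff : derivable (f + g) y (delta_mx 0 j) by [].
  by apply: derivableD; [exact: Ck_on_derivable Hf Uy|exact: Ck_on_derivable Hg Uy].
apply: Ck_on_ext (IH _ _ (Ck_on_derive j Hf) (Ck_on_derive j Hg)) => // y Uy.
by rewrite -(deriveD (Ck_on_derivable Hf Uy) (Ck_on_derivable Hg Uy)).
Qed.

Lemma Ck_on_mul k U f g : open U -> Ck_on k U f -> Ck_on k U g ->
  Ck_on k U (fun y => f y * g y).
Proof.
move=> oU; elim: k f g => [|k IH] f g Hf Hg.
  by split=> // y Uy; apply: (@cvgM R _ _ _ _ _ _ _ (Hf.1 y Uy) (Hg.1 y Uy)).
split=> [y Uy|j].
  by apply: (@cvgM R _ _ _ _ _ _ _ (Hf.1 y Uy) (Hg.1 y Uy)).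
split=> [y Uy|].
  suff : derivable (f * g) y (delta_mx 0 j) by [].
  by apply: derivableM; [exact: Ck_on_derivable Hf Uy|exact: Ck_on_derivable Hg Uy].
have H1 := IH _ _ (Ck_onW Hf) (Ck_on_derive j Hg).
have H2 := IH _ _ (Ck_onW Hg) (Ck_on_derive j Hf).
apply: Ck_on_ext (Ck_on_add oU H1 H2) => // y Uy.
by rewrite -[LHS](deriveM (Ck_on_derivable Hf Uy) (Ck_on_derivable Hg Uy)).
Qed.

Lemma Ck_on_opp k U f : open U -> Ck_on k U f -> Ck_on k U (fun y => - f y).
Proof.
move=> oU Hf; apply: Ck_on_ext (Ck_on_mul oU (Ck_on_cst k U (-1)) Hf) => // y _.
by rewrite mulN1r.
Qed.

Lemma Ck_on_sum k U (I : Type) (r : seq I) (F : I -> 'rV[R]_m -> R) : open U ->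
  (forall i, Ck_on k U (F i)) -> Ck_on k U (fun y => \sum_(i <- r) F i y).
Proof.
move=> oU HF; elim: r => [|i r IH].
  by apply: Ck_on_ext (Ck_on_cst k U 0) => // y _; rewrite big_nil.
by apply: Ck_on_ext (Ck_on_add oU (HF i) IH) => // y _; rewrite big_cons.
Qed.

Lemma Ck_on_prod k U (I : Type) (r : seq I) (F : I -> 'rV[R]_m -> R) : open U ->
  (forall i, Ck_on k U (F i)) -> Ck_on k U (fun y => \prod_(i <- r) F i y).
Proof.
move=> oU HF; elim: r => [|i r IH].
  by apply: Ck_on_ext (Ck_on_cst k U 1) => // y _; rewrite big_nil.
by apply: Ck_on_ext (Ck_on_mul oU (HF i) IH) => // y _; rewrite big_cons.
Qed.

Lemma C1_increment f (z : 'rV[R]_m) (j : 'I_m) (t c e : R) :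
  (forall s, `|s| <= `|t| -> derivable f (z + s *: delta_mx 0 j) (delta_mx 0 j)) ->
  (forall s, `|s| <= `|t| -> `|'D_(delta_mx 0 j) f (z + s *: delta_mx 0 j) - c| <= e) ->
  `|f (z + t *: delta_mx 0 j) - f z - c * t| <= e * `|t|.
Proof.
move=> fd fe; pose g s := f (z + s *: delta_mx 0 j).
pose dg s := 'D_(delta_mx 0 j) f (z + s *: delta_mx 0 j).
have gd s : `|s| <= `|t| -> is_derive (s : R) (1 : R) g (dg s) by move=> /fd; exact: is_derive_line.
have gc s : `|s| <= `|t| -> {for s, continuous g}.
  by move=> /gd [sd _]; apply: differentiable_continuous; apply/derivable1_diffP.
have -> : f z = g 0 by rewrite /g scale0r addr0.
rewrite -/(g t).
suff [s st ->] : exists2 s, `|s| <= `|t| & g t - g 0 = dg s * t.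
  by rewrite -mulrBl normrM ler_wpM2r// fe.
have [->|t0] := eqVneq t 0; first by exists 0; rewrite // subrr mulr0.
have gw a b : (forall s, a <= s <= b -> `|s| <= `|t|) -> {within `[a, b], continuous g}.
  move=> ab; apply: continuous_in_subspaceT => s; rewrite inE/= in_itv/= => /ab; exact: gc.
case: (ltrgtP t 0) t0 => // t0 _.
  have st s : t <= s <= 0 -> `|s| <= `|t| by move=> /andP[? ?]; rewrite !ler0_norm ?lerN2//; lra.
  have [|s] := @MVT R g dg t 0 t0 _ (gw _ _ st).
    by move=> s; rewrite in_itv/= => /andP[? ?]; apply: gd; apply: st; lra.
  rewrite in_itv/= => /andP[? ?] E; exists s; first by apply: st; lra.
  by rewrite -opprB E; ring.
have st s : 0 <= s <= t -> `|s| <= `|t| by move=> /andP[? ?]; rewrite !ger0_norm//; lra.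
have [|s] := @MVT R g dg 0 t t0 _ (gw _ _ st).
  by move=> s; rewrite in_itv/= => /andP[? ?]; apply: gd; apply: st; lra.
rewrite in_itv/= => /andP[? ?] E; exists s; first by apply: st; lra.
by rewrite E subr0.
Qed.

(** The increment is made one coordinate at a time. On a small cube each partial derivative stays
    within [e / (m + 1)] of its value at [y], so the mean value theorem bounds the cost of each of
    the [m] moves. *)
Lemma C1_differentiable U f y : open U -> Ck_on 1 U f -> U y -> differentiable f y.
Proof.
move=> oU Hf Uy; pose p : 'rV[R]_m := \row_j 'D_(delta_mx 0 j) f y.
suff : differentiable f y /\ 'd f y = dotrow p :> (_ -> R) by case.
apply: differentiable_approxP => [|e e0]; first exact: dotrow_continuous.
have m0 : 0 < m%:R + 1 :> R by rewrite ltr_wpDl.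
pose e' := e / (m%:R + 1); have e'0 : 0 < e' by rewrite divr_gt0.
have /nbhs_ballP[d0 /= d00 dU] : nbhs y U by exact: open_nbhs_nbhs.
have /choice[d Hd] (j : 'I_m) : exists d : R, 0 < d /\
    forall z, `|z - y| < d -> `|'D_(delta_mx 0 j) f z - 'D_(delta_mx 0 j) f y| <= e'.
  have [_ /(_ j)[_ [Dc _]]] := Hf.
  have /cvgrPdist_le/(_ _ e'0)/nbhs_ballP[d /= d1 H] := Dc y Uy.
  exists d; split=> // z zy; rewrite distrC; apply: H.
  by rewrite -ball_normE /= distrC.
have fdU z : U z -> forall j, derivable f z (delta_mx 0 j).
  by move=> Uz j; exact: Ck_on_derivable Hf Uz.
pose dm := \big[Num.min/d0]_j d j.
have dm0 : 0 < dm by apply/bigmin_gtP; split=> // j _; case: (Hd j).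
apply: filterS (near0_norm_lt _ dm0) => h hd.
suff H k : (k <= m)%N -> forall h : 'rV[R]_m, (forall j : 'I_m, (k <= j)%N -> h 0 j = 0) ->
    `|h| < dm -> `|f (h + y) - f y - dotrow p h| <= k%:R * e' * `|h|.
  apply: (le_trans (H m (leqnn _) h _ hd)) => [j|]; first by rewrite leqNgt ltn_ord.
  by rewrite ler_wpM2r// /e' mulrCA ler_piMr ?(ltW e0)// ler_pdivrMr// mul1r lerDl.
elim: k => [_ {hd}h h0 _|k IH km {hd}h h0 hd].
  have -> : h = 0 by apply/rowP => j; rewrite h0 ?mxE.
  by rewrite add0r subrr linear0 subrr !normr0 mulr0.
pose j := Ordinal km; set t := h 0 j; pose h' := h - t *: delta_mx 0 j.
have h'0 (i : 'I_m) : (k <= i)%N -> h' 0 i = 0.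
  move=> ki; rewrite !mxE eqxx/=; have [->|ij] := eqVneq i j; first by rewrite mulr1 subrr.
  rewrite mulr0 subr0 h0// ltn_neqAle ki andbT eq_sym.
  by apply: contra ij => /eqP ik; apply/eqP/val_inj.
have h'h : `|h'| <= `|h|.
  apply: rV_norm_le => // i; rewrite !mxE eqxx/=.
  have [->|ij] := eqVneq i j; first by rewrite mulr1 subrr normr0.
  by rewrite mulr0 subr0 rV_coord_le.
have hsh s : `|s| <= `|t| -> `|h' + s *: delta_mx 0 j| <= `|h|.
  move=> st; apply: rV_norm_le => // i; rewrite !mxE eqxx/=.
  have [->|ij] := eqVneq i j; last by rewrite !mulr0 subr0 addr0 rV_coord_le.
  by rewrite !mulr1 subrr add0r (le_trans st)// rV_coord_le.
have I1 : `|f (h' + y + t *: delta_mx 0 j) - f (h' + y) - p 0 j * t| <= e' * `|t|.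
  have cl s : `|s| <= `|t| -> `|h' + y + s *: delta_mx 0 j - y| < dm.
    by move=> /hsh st; rewrite addrAC addrK (le_lt_trans st).
  apply: C1_increment => s /cl st.
    apply: fdU; apply: dU; rewrite -ball_normE /= distrC.
    by apply: (lt_le_trans st); exact: bigmin_le_id.
  rewrite mxE; apply: (Hd j).2; apply: (lt_le_trans st); exact: bigmin_le.
have I2 := IH (ltnW km) h' h'0 (le_lt_trans h'h hd).
have hE : h = h' + t *: delta_mx 0 j by rewrite subrK.
have -> : f (h + y) - f y - dotrow p h = (f (h' + y + t *: delta_mx 0 j) - f (h' + y) - p 0 j * t)
    + (f (h' + y) - f y - dotrow p h').
  rewrite {1 2}hE linearD linearZ/= dotrow_delta [h' + _ + y]addrAC /GRing.scale/=; ring.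
apply: (le_trans (ler_normD _ _)); apply: (le_trans (lerD I1 I2)).
rewrite -natr1 [_ + 1]addrC !mulrDl mul1r; apply: lerD; apply: ler_wpM2l => //; first exact: ltW.
  exact: rV_coord_le.
by rewrite mulr_ge0// ltW.
Qed.

End pointwise.

Lemma differentiable_rV m n (T : 'rV[R]_m -> 'rV[R]_n) y :
  (forall i, differentiable (fun z => T z 0 i) y) -> differentiable T y.
Proof.
move=> dT.
have -> : T = (fun z => \sum_i (fun z => T z 0 i *: delta_mx 0 i : 'rV[R]_n) z).
  by apply/funext => z; exact: rV_delta_sum.
rewrite -fct_sumE; apply: differentiable_sum => i; exact: differentiableZl.
Qed.

Lemma derive_comp_rV m n (h : 'rV[R]_n -> R) (T : 'rV[R]_m -> 'rV[R]_n) y v :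
  differentiable h (T y) -> (forall i, differentiable (fun z => T z 0 i) y) ->
  differentiable (h \o T) y /\
  'D_v (h \o T) y = \sum_i 'D_(delta_mx 0 i) h (T y) * 'D_v (fun z => T z 0 i) y.
Proof.
move=> dh dT; have dT' := differentiable_rV dT.
have dhT : differentiable (h \o T) y by exact: differentiable_comp.
split=> //; rewrite deriveE// diff_comp//= diff_dotrow// /dotrow.
apply: eq_bigr => i _; rewrite mxE; congr (_ * _).
have -> : (fun z => T z 0 i) = (fun u : 'rV[R]_n => u 0 i) \o T by [].
have dc : differentiable (fun u : 'rV[R]_n => u 0 i) (T y) by exact: differentiable_coord.
rewrite deriveE; last exact: differentiable_comp.
have -> : 'd ((fun u : 'rV[R]_n => u 0 i) \o T) y v =
    'd (fun u : 'rV[R]_n => u 0 i) (T y) ('d T y v) by rewrite diff_comp.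
rewrite -(@deriveE _ _ _ (fun u : 'rV[R]_n => u 0 i))//.
by have [_ ->] := derive_coord (T y) ('d T y v) i.
Qed.

Lemma continuous_rV (V : topologicalType) n (T : V -> 'rV[R]_n) y :
  (forall i, {for y, continuous (fun z => T z 0 i)}) -> {for y, continuous T}.
Proof.
move=> Tc; apply/cvgrPdist_le => e e0.
have : \forall z \near y, forall i, `|T y 0 i - T z 0 i| <= e.
  by apply: filter_forall => i; have /cvgrPdist_le := Tc i; apply.
by apply: filterS => z H; apply: rV_norm_le => [|i]; [exact: ltW|rewrite !mxE].
Qed.

Lemma Ck_on_comp m n k (U : set 'rV[R]_m) (V : set 'rV[R]_n) (h : 'rV[R]_n -> R)
    (T : 'rV[R]_m -> 'rV[R]_n) :
  open U -> open V -> (forall y, U y -> V (T y)) ->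
  (forall i, Ck_on k U (fun y => T y 0 i)) -> Ck_on k V h -> Ck_on k U (h \o T).
Proof.
move=> oU oV TUV.
have Tc l y : U y -> (forall i, Ck_on l U (fun y => T y 0 i)) -> {for y, continuous T}.
  by move=> Uy HT; apply: continuous_rV => i; exact: Ck_on_continuous (HT i) Uy.
elim: k h => [|k IH] h HT Hh.
  split=> // y Uy; apply: continuous_comp; first exact: Tc HT.
  exact: (Ck_on_continuous Hh (TUV _ Uy)).
have dT y i : U y -> differentiable (fun z => T z 0 i) y.
  move=> Uy; apply: C1_differentiable Uy => //.
  by elim: (k) (HT i) => [|l IHl] // /Ck_onW.
have dh y : V y -> differentiable h y.
  move=> Vy; apply: C1_differentiable Vy => //.
  by elim: (k) Hh => [|l IHl] // /Ck_onW.
split=> [y Uy|j].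
  apply: continuous_comp; first exact: Tc HT.
  exact: (Ck_on_continuous Hh (TUV _ Uy)).
have H y : U y -> differentiable (h \o T) y /\ 'D_(delta_mx 0 j) (h \o T) y =
   \sum_i ('D_(delta_mx 0 i) h \o T) y * 'D_(delta_mx 0 j) (fun z => T z 0 i) y.
  by move=> Uy; apply: derive_comp_rV => // [|i]; [exact/dh/TUV|exact: dT].
split=> [y /H[dy _]|]; first exact: diff_derivable.
apply: (@Ck_on_ext _ k U (fun y => \sum_i ('D_(delta_mx 0 i) h \o T) y *
   'D_(delta_mx 0 j) (fun z => T z 0 i) y)) => // [y /H[_ ->]//|].
apply: Ck_on_sum => // i; apply: Ck_on_mul => //; last exact: Ck_on_derive (HT i).
by apply: IH => [i'|]; [exact: Ck_onW|exact: Ck_on_derive].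
Qed.

End Ck_closure.

Section smooth_step.
Context {R : realType}.

Fixpoint Ck1 (k : nat) (f : R -> R) : Prop :=
  continuous f /\
  match k with
  | 0 => True
  | k'.+1 => exists2 f' : R -> R, (forall t : R, is_derive t 1 f (f' t)) & Ck1 k' f'
  end.

(** Restriction to the line through [y] with direction [v] reduces this to the one-variable chain
    rule, so that derivability of [f] in the single direction [v] suffices. *)
Lemma derive_comp1 (V : normedModType R) (p : R -> R) (f : V -> R) y v (a : R) :
  is_derive (f y) 1 p a -> derivable f y v ->
  derivable (p \o f) y v /\ 'D_v (p \o f) y = a * 'D_v f y.
Proof.
move=> pd fd; pose g s := f (y + s *: v).
have g0 : y + 0 *: v = y by rewrite scale0r addr0.
have gd : is_derive (0 : R) 1 g ('D_v f y).
  by have := @is_derive_line R V f y v 0; rewrite g0; apply.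
have pd' : is_derive (g 0) 1 p a by rewrite /g g0.
have [] := @is_derive1_comp R p g 0 a ('D_v f y) pd' gd.
have E : (fun h : R => h^-1 *: (((p \o g) \o shift 0) (h *: 1) - (p \o g) 0)) =
    (fun h => h^-1 *: (((p \o f) \o shift y) (h *: v) - (p \o f) y)).
  apply/funext => h /=; rewrite /g g0; congr (_ *: (p (f _) - _)).
  by rewrite -[h *: 1]/(h * 1) mulr1 addr0 addrC.
by rewrite /derivable /derive E => H1 H2.
Qed.

Lemma Ck_on_comp1 m k (U : set 'rV[R]_m) (p : R -> R) f : open U ->
  Ck1 k p -> Ck_on k U f -> Ck_on k U (fun y => p (f y)).
Proof.
move=> oU; elim: k p f => [|k IH] p f [pc Hp] Hf.
  by split=> // y Uy; apply: (@continuous_comp _ _ _ f p); [exact: Ck_on_continuous Hf Uy|exact: pc].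
case: Hp => p' pd Hp.
have H y j : U y -> derivable (p \o f) y (delta_mx 0 j) /\
    'D_(delta_mx 0 j) (p \o f) y = p' (f y) * 'D_(delta_mx 0 j) f y.
  by move=> Uy; apply: derive_comp1; exact: Ck_on_derivable Hf Uy.
split=> [y Uy|j].
  by apply: (@continuous_comp _ _ _ f p); [exact: Ck_on_continuous Hf Uy|exact: pc].
split=> [y Uy|]; first by have [] := H y j Uy.
apply: (@Ck_on_ext _ _ _ _ (fun y => p' (f y) * 'D_(delta_mx 0 j) f y)) => //.
  by move=> y Uy; have [_ ->] := H y j Uy.
apply: Ck_on_mul => //; last exact: Ck_on_derive.
by apply: IH => //; exact: Ck_onW.
Qed.

(** The functions t^(-n) exp(-1/t), extended by 0. The family is indexed by [n] because
    differentiation leads to combinations of its members, whence smoothness by induction. *)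
Definition flat (n : nat) (t : R) : R :=
  if 0 < t then t^-1 ^+ n * expR (- t^-1) else 0.

(** One term of the exponential series, x^(n+2) / (n+2)! <= exp x at x = 1/t. The quadratic bound
    makes the derivative at 0 vanish. *)
Lemma flat_le (n : nat) t : `|flat n t| <= (n.+2`!)%:R * t ^+ 2.
Proof.
rewrite /flat; case: ifPn => [t0|_]; last by rewrite normr0 mulr_ge0// sqr_ge0.
set x := t^-1; have x0 : 0 < x by rewrite invr_gt0.
rewrite ger0_norm; last by rewrite mulr_ge0 ?expR_ge0// exprn_ge0// ltW.
have -> : t ^+ 2 = x ^- 2 by rewrite /x exprVn invrK.
rewrite expRN ler_pdivrMr ?expR_gt0// mulrAC ler_pdivlMr ?exprn_gt0// -exprD addn2.
rewrite -ler_pdivrMl ?ltr0n ?fact_gt0// mulrC.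
by apply: le_trans (expR_ge1Dxn n.+1 (ltW x0)); rewrite lerDr.
Qed.

Lemma flat_is_derive n (t : R) : is_derive t 1 (flat n) (flat n.+2 t - n%:R * flat n.+1 t).
Proof.
case: (ltrgtP t 0) => [t0|t0|->].
- have -> : flat n.+2 t - n%:R * flat n.+1 t = 0.
    by rewrite /flat !ifF ?mulr0 ?subr0//; apply/negbTE; rewrite -leNgt ltW.
  apply: (@near_eq_is_derive R R R (cst 0)).
  have : \forall s \near t, s < 0 by apply: open_nbhs_nbhs; split=> //; exact: open_lt.
  by apply: filterS => s s0; rewrite /flat ifF//; apply/negbTE; rewrite -leNgt ltW.
- have tn0 : t != 0 by rewrite gt_eqF.
  apply: (@near_eq_is_derive R R R (fun s : R => s^-1 ^+ n * expR (- s^-1))).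
    have : \forall s \near t, 0 < s by apply: open_nbhs_nbhs; split=> //; exact: open_gt.
    by apply: filterS => s s0; rewrite /flat s0.
  have d1 : is_derive t 1 (fun s : R => s^-1) (- t ^- 2).
    by apply: is_derive_eq (is_deriveV tn0 _) _; rewrite /GRing.scale/= mulr1.
  have d2 : is_derive t 1 (fun s : R => s^-1 ^+ n) (- (n%:R * t^-1 ^+ n.+1)).
    have -> : (fun s : R => s^-1 ^+ n) = (fun s : R => s^-1) ^+ n.
      by apply/funext => s; rewrite exprfctE.
    apply: is_derive_eq (is_deriveX n d1) _ => /=.
    rewrite -[_ *: _]/(_ * _) mulrN; congr (- _).
    by case: n => [|n]; rewrite ?mulr0n ?mul0r// -exprVn -mulrA -exprD addn2.
  have d3 : is_derive t 1 (fun s : R => expR (- s^-1)) (t^-1 ^+ 2 * expR (- t^-1)).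
    have := @is_derive1_comp R expR (fun s => - s^-1) t _ _ (is_derive_expR _) (is_deriveN d1).
    by move=> D; apply: (is_derive_eq D); rewrite opprK exprVn mulrC.
  apply: is_derive_eq (is_deriveM d2 d3) _.
  by rewrite /flat t0 /GRing.scale/= !exprS; ring.
- have -> : flat n.+2 0 - n%:R * flat n.+1 0 = 0.
    by rewrite /flat !ifF ?mulr0 ?subr0// ltxx.
  have f0 : flat n 0 = 0 by rewrite /flat ltxx.
  have E : (fun h : R => h^-1 *: ((flat n \o shift 0) (h *: 1) - flat n 0)) @ 0^' --> (0 : R).
    apply/cvgrPdist_le => e e0; set C : R := (n.+2`!)%:R.
    have C0 : 0 < C + 1 by rewrite ltr_wpDl.
    have h1 : \forall h \near (0 : R)^', `|h| < e / (C + 1).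
      by apply: nbhs_dnbhs; apply: (@near0_norm_lt R R); rewrite divr_gt0.
    have h2 : \forall h \near (0 : R)^', h != 0 by exact: nbhs_dnbhs_neq.
    apply: filterS2 h1 h2 => h he h0; rewrite f0 subr0 sub0r normrN /= -[h *: 1]/(h * 1) mulr1 addr0.
    rewrite normrM normfV ler_pdivrMl ?normr_gt0//.
    apply: le_trans (flat_le n h) _; rewrite -/C -(real_normK (num_real h)) expr2 mulrCA ler_wpM2l//.
    move: he; rewrite ltr_pdivlMr// mulrDr mulr1 mulrC => /ltW; apply: le_trans.
    by rewrite lerDl.
  by split; [apply/cvg_ex; exists 0|exact: cvg_lim].
Qed.

Lemma is_derive_continuous (f f' : R -> R) :
  (forall t : R, is_derive t 1 f (f' t)) -> continuous f.
Proof.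
by move=> fd t; apply: differentiable_continuous; apply/derivable1_diffP; case: (fd t).
Qed.

Lemma Ck1D k f g : Ck1 k f -> Ck1 k g -> Ck1 k (fun t => f t + g t).
Proof.
elim: k f g => [|k IH] f g [fc Hf] [gc Hg].
  by split=> // t; apply: (@cvgD R R _ _ _ _ _ _ _ (fc t) (gc t)).
split=> [t|]; first by apply: (@cvgD R R _ _ _ _ _ _ _ (fc t) (gc t)).
case: Hf Hg => f' fd Hf [g' gd Hg]; exists (fun t => f' t + g' t); last exact: IH.
by move=> t; exact: is_deriveD.
Qed.

Lemma Ck1Z k (c : R) f : Ck1 k f -> Ck1 k (fun t => c * f t).
Proof.
elim: k f => [|k IH] f [fc Hf].
  by split=> // t; apply: (@cvgM R _ _ _ (cst c) f); [exact: cvg_cst|exact: fc].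
split=> [t|]; first by apply: (@cvgM R _ _ _ (cst c) f); [exact: cvg_cst|exact: fc].
case: Hf => f' fd Hf; exists (fun t => c * f' t); last exact: IH.
by move=> t; exact: is_deriveZ.
Qed.

Lemma Ck1_flat k n : Ck1 k (flat n).
Proof.
have fc i : continuous (flat i) by apply: is_derive_continuous => t; exact: flat_is_derive.
elim: k n => [|k IH] n; split=> //.
exists (fun t => flat n.+2 t + (- n%:R) * flat n.+1 t).
  by move=> t; rewrite mulNr; exact: flat_is_derive.
by apply: Ck1D => //; exact: Ck1Z.
Qed.

(** With phi t = exp(-1/t) for t > 0 and 0 otherwise, [expR 1] times phi is 0 up to t = 0 and at
    least 1 from t = 1 on. Applying t -> 1 - e phi(t) twice makes the values constant on both sides
    without any quotient. *)
Definition smooth_step (t : R) : R :=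
  1 - expR 1 * flat 0 (1 - expR 1 * flat 0 t).

Lemma smooth_step0 t : t <= 0 -> smooth_step t = 0.
Proof.
move=> t0; rewrite /smooth_step /flat [0 < t]ltNge t0/= mulr0 subr0 ltr01 invr1 expr0 mul1r.
by rewrite -expRD addrN expR0 subrr.
Qed.

Lemma smooth_step1 t : 1 <= t -> smooth_step t = 1.
Proof.
move=> t1; have t0 : 0 < t by exact: lt_le_trans t1.
rewrite /smooth_step {1}/flat ifF ?mulr0 ?subr0//; apply/negbTE; rewrite -leNgt.
rewrite /flat t0 expr0 mul1r subr_le0 -expRD -[1 in leLHS]expR0 ler_expR subr_ge0.
by rewrite invf_le1.
Qed.

Lemma smooth_step_ge0 t : 0 <= smooth_step t.
Proof.
rewrite /smooth_step; set x := 1 - expR 1 * flat 0 t.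
rewrite subr_ge0 {1}/flat; case: ifPn => x0; last by rewrite mulr0.
rewrite expr0 mul1r -expRD -[leRHS]expR0 ler_expR subr_le0.
rewrite invf_ge1// /x lerBlDr lerDl mulr_ge0 ?expR_ge0// /flat.
by case: ifPn => // _; rewrite expr0 mul1r expR_ge0.
Qed.

Lemma smooth_step_le1 t : smooth_step t <= 1.
Proof.
rewrite /smooth_step lerBlDr lerDl mulr_ge0 ?expR_ge0// /flat.
by case: ifPn => // _; rewrite expr0 mul1r expR_ge0.
Qed.

Section on_rV.
Context {m : nat}.
Implicit Types (U : set 'rV[R]_m) (f : 'rV[R]_m -> R).

Lemma Ck_on_smooth_step k U f : open U ->
  Ck_on k U f -> Ck_on k U (fun y => smooth_step (f y)).
Proof.
move=> oU Hf.
have S1 (g : 'rV[R]_m -> R) : Ck_on k U g -> Ck_on k U (fun y => 1 - expR 1 * flat 0 (g y)).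
  move=> Hg; apply: Ck_on_add => //; first exact: Ck_on_cst.
  apply: Ck_on_opp => //; apply: Ck_on_mul => //; first exact: Ck_on_cst.
  by apply: Ck_on_comp1 => //; exact: Ck1_flat.
by rewrite /smooth_step; exact/S1/S1.
Qed.

Definition cube_bump (q : 'rV[R]_m) (r : R) (y : 'rV[R]_m) : R :=
  \prod_(j < m) (smooth_step (2 - 2 / r * (y 0 j - q 0 j)) *
                 smooth_step (2 + 2 / r * (y 0 j - q 0 j))).

Lemma Ck_on_affine k U (a b : R) j : open U -> Ck_on k U (fun y => a + b * (y 0 j)).
Proof.
move=> oU; apply: Ck_on_add => //; first exact: Ck_on_cst.
by apply: Ck_on_mul => //; [exact: Ck_on_cst|exact: Ck_on_coord].
Qed.

Lemma cube_bump_smooth q r U : open U -> smooth_on U (cube_bump q r).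
Proof.
move=> oU k; apply: Ck_on_prod => // j; apply: Ck_on_mul => //; apply: Ck_on_smooth_step => //.
  apply: Ck_on_ext (Ck_on_affine k (2 + 2 / r * q 0 j) (- (2 / r)) j oU) => // y _; ring.
apply: Ck_on_ext (Ck_on_affine k (2 - 2 / r * q 0 j) (2 / r) j oU) => // y _; ring.
Qed.

Lemma cube_bump1 q r y : 0 < r -> `|y - q| <= r / 2 -> cube_bump q r y = 1.
Proof.
move=> r0 yq; rewrite /cube_bump big1// => j _.
have := le_trans (rV_coord_le (y - q) j) yq; rewrite !mxE ler_norml => /andP[h1 h2].
have r2 : 0 < 2 / r by rewrite divr_gt0.
have E : 2 / r * (r / 2) = 1 by rewrite mulrA divfK ?gt_eqF// divff.
have := ler_wpM2l (ltW r2) h1; have := ler_wpM2l (ltW r2) h2; rewrite mulrN E => h3 h4.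
by rewrite !smooth_step1 ?mulr1//; lra.
Qed.

Lemma cube_bump0 q r y : 0 < r -> r <= `|y - q| -> cube_bump q r y = 0.
Proof.
move=> r0 yq; have r2 : 0 < 2 / r by rewrite divr_gt0.
have [j hj] : exists j, r <= `|y 0 j - q 0 j|.
  apply: contrapT => /forallNP H.
  suff : `|y - q| < r by rewrite ltNge yq.
  have [j ->] : (exists j : 'I_m, `|y - q| = `|(y - q) 0 j|).
    have [|[i j] E] := @mx_norm_neq0 _ _ _ (y - q); last by exists j; rewrite -[LHS]/(mx_norm (y - q)) E (ord1 i).
    by rewrite gt_eqF// (lt_le_trans r0).
  by have /negP := H j; rewrite -ltNge !mxE.
apply/eqP; rewrite /cube_bump (bigD1 j)//= mulf_eq0; apply/orP; left.
have E : 2 / r * r = 2 by rewrite divfK ?gt_eqF.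
rewrite mulf_eq0; move: hj; rewrite ler_normr => /orP[h|h];
  have := ler_wpM2l (ltW r2) h; rewrite E => h3; apply/orP; [left|right];
  apply/eqP/smooth_step0; lra.
Qed.

Lemma cube_bump_ge0 q r y : 0 <= cube_bump q r y.
Proof. by apply: prodr_ge0 => j _; rewrite mulr_ge0 ?smooth_step_ge0. Qed.

Lemma cube_bump_le1 q r y : cube_bump q r y <= 1.
Proof.
apply: prodr_ile1 => j _; rewrite mulr_ge0 ?smooth_step_ge0//=.
by rewrite mulr_ile1 ?smooth_step_ge0 ?smooth_step_le1.
Qed.

End on_rV.
End smooth_step.

(** * Smoothing by sums over a lattice *)

Section lattice.
Context {R : realType}.

Lemma C1_supported_bounded m (f : 'rV[R]_m -> R) (B : R) : Ck_on 1 setT f ->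
  (forall y, B <= `|y| -> f y = 0) ->
  exists2 C, 0 <= C & forall y, `|f y| <= C /\
    forall j, `|'D_(delta_mx 0 j) f y| <= C /\ (B < `|y| -> 'D_(delta_mx 0 j) f y = 0).
Proof.
move=> Hf f0.
have K : compact [set y : 'rV[R]_m | `|y| <= B + 1].
  apply: bounded_closed_compact.
    by exists (B + 1); split=> [|x Bx y /= yB]; [rewrite num_real|rewrite (le_trans yB)// ltW].
  apply: (@preimage_closed _ _ _ [set t : R | t <= B + 1]); last exact: closed_le.
  by move=> y _; exact: norm_continuous.
have bd (g : 'rV[R]_m -> R) : continuous g -> exists2 C, 0 <= C & forall y, `|y| <= B + 1 -> `|g y| <= C.
  move=> gc; have /compact_bounded : compact (g @` [set y | `|y| <= B + 1]).
    by apply: continuous_compact => //; exact: continuous_subspaceT.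
  move=> [C [_ HC]]; exists (`|C| + 1); first by rewrite addr_ge0.
  move=> y yB; apply: HC; last by exists y.
  by rewrite (le_lt_trans (ler_norm C))// ltrDl.
have D0 y j : B < `|y| -> 'D_(delta_mx 0 j) f y = 0.
  move=> By; have : {near y, cst 0 =1 f}.
    have : \forall z \near y, B < `|z|.
      by apply: (@cvgr_gt _ _ _ _ _ _ (@norm_continuous _ _ y)).
    by apply: filterS => z /ltW /f0 ->.
  by move=> /near_eq_derive <-; exact: derive_cst.
have [C0 C00 H0] := bd f (fun y => Ck_on_continuous Hf I).
have Hd j : exists C, 0 <= C /\ forall y, `|y| <= B + 1 -> `|'D_(delta_mx 0 j) f y| <= C.
  have [|C C0' H] := bd ('D_(delta_mx 0 j) f); last by exists C.
  by move=> y; exact: (Ck_on_continuous (Ck_on_derive j Hf) I).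
have [Cd HCd] := choice Hd.
exists (C0 + \sum_j Cd j); first by rewrite addr_ge0// sumr_ge0// => j _; case: (HCd j).
have Cj j : Cd j <= \sum_j Cd j.
  by rewrite (bigD1 j)//= lerDl sumr_ge0// => i _; case: (HCd i).
move=> y; split.
  have [yB|/ltW yB] := leP `|y| (B + 1).
    by rewrite (le_trans (H0 y yB))// lerDl sumr_ge0// => j _; case: (HCd j).
  rewrite f0 ?normr0; last by rewrite (le_trans _ yB)// lerDl.
  by rewrite addr_ge0// sumr_ge0// => j _; case: (HCd j).
move=> j; split; last exact: D0.
have [yB|yB] := leP `|y| (B + 1).
  by rewrite (le_trans ((HCd j).2 y yB))// (le_trans (Cj j))// lerDr.
rewrite D0 ?normr0//; last by rewrite (lt_trans _ yB)// ltrDl.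
by rewrite addr_ge0// sumr_ge0// => i _; case: (HCd i).
Qed.

(** A smooth substitute for max(0, t): the factor of t passes from 0 to 1 between -1 and 1. *)
Lemma smooth_ramp : {ramp : R -> R | [/\ forall t, t <= -1 -> ramp t = 0,
  forall t, 1 <= t -> ramp t = t &
  forall m k (U : set 'rV[R]_m) f, open U -> Ck_on k U f -> Ck_on k U (fun y => ramp (f y))]}.
Proof.
exists (fun t => t * ((1 + smooth_step t - smooth_step (- t)) / 2)); split.
- move=> t t1; rewrite smooth_step0; last by lra.
  by rewrite smooth_step1 ?addr0 ?subrr ?mul0r ?mulr0//; lra.
- move=> t t1; rewrite smooth_step1// smooth_step0; last by lra.
  by rewrite subr0 -[1 + 1]/(2) divff ?mulr1.
- move=> m k U f oU Hf; apply: Ck_on_mul => //; apply: Ck_on_mul => //; last exact: Ck_on_cst.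
  apply: Ck_on_add => //; last by apply: Ck_on_opp => //; apply: Ck_on_smooth_step => //; exact: Ck_on_opp.
  by apply: Ck_on_add => //; [exact: Ck_on_cst|exact: Ck_on_smooth_step].
Qed.

Section ramp.
Variable ramp : R -> R.
Hypothesis ramp_neg : forall t, t <= -1 -> ramp t = 0.
Hypothesis ramp_pos : forall t, 1 <= t -> ramp t = t.
Hypothesis Ck_on_ramp : forall m k (U : set 'rV[R]_m) f,
  open U -> Ck_on k U f -> Ck_on k U (fun y => ramp (f y)).

(* The integer translates of the second difference of [ramp] form a partition
   of unity and reproduce affine functions, because [ramp] is affine outside
   [-1, 1]. *)
Definition hat (t : R) : R := (ramp (t + 1) - ramp t) - (ramp t - ramp (t - 1)).

Lemma hat0 t : 2 <= `|t| -> hat t = 0.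
Proof.
rewrite /hat ler_normr => /orP[] h; first by rewrite !ramp_pos; lra.
by rewrite !ramp_neg; lra.
Qed.

Definition ramp_diff (t : R) : R := ramp t - ramp (t - 1).

Let hat_d t : hat t = ramp_diff (t + 1) - ramp_diff t. Proof. by rewrite /hat /ramp_diff addrK. Qed.

Let d1 t : 2 <= t -> ramp_diff t = 1. Proof. by move=> h; rewrite /ramp_diff !ramp_pos; lra. Qed.

Let d0 t : t <= -1 -> ramp_diff t = 0. Proof. by move=> h; rewrite /ramp_diff !ramp_neg; lra. Qed.

(** The sum telescopes in [ramp_diff], which is 1 from 2 on and 0 up to -1; the bounds on [t] place
    both ends of the sum in these ranges. *)
Lemma hat_sum K t : 1 <= t -> t <= K%:R - 2 -> \sum_(i < K) hat (t - i%:R) = 1.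
Proof.
move=> t1 tK.
have -> : \sum_(i < K) hat (t - i%:R) = ramp_diff (t + 1) - ramp_diff (t + 1 - K%:R).
  elim: (K) => [|k IH]; first by rewrite big_ord0 subr0 subrr.
  rewrite big_ord_recr/= IH hat_d -natr1.
  have -> : t + 1 - (k%:R + 1) = t - k%:R by ring.
  have -> : t - k%:R + 1 = t + 1 - k%:R by ring.
  by rewrite addrA subrK.
by rewrite d1 ?d0 ?subr0//; lra.
Qed.

(** Summation by parts. The boundary terms at the far end vanish since their arguments are at most
    -1, and [ramp t = t] at the near end. *)
Lemma hat_sum_lin K t : 1 <= t -> t <= K%:R - 2 ->
  \sum_(i < K) i%:R * hat (t - i%:R) = t.
Proof.
move=> t1 tK.
have -> : \sum_(i < K) i%:R * hat (t - i%:R) =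
    ramp t - ramp (t - K%:R) - K%:R * ramp_diff (t + 1 - K%:R).
  elim: (K) => [|k IH]; first by rewrite big_ord0 subr0 subrr mul0r subr0.
  rewrite big_ord_recr/= IH hat_d -natr1 /ramp_diff.
  have -> : t + 1 - (k%:R + 1) = t - k%:R by ring.
  have -> : t - k%:R + 1 = t + 1 - k%:R by ring.
  have -> : t - (k%:R + 1) = t - k%:R - 1 by ring.
  have -> : t + 1 - k%:R - 1 = t - k%:R by ring.
  move: (ramp (t + 1 - k%:R)) (ramp (t - k%:R)) (ramp (t - k%:R - 1)) (ramp t) => r1 r2 r3 r4; ring.
rewrite d0 ?mulr0 ?subr0; last lra.
by rewrite (ramp_pos t1) ramp_neg ?subr0//; lra.
Qed.

Lemma Ck_on_hat m k (U : set 'rV[R]_m) f : open U -> Ck_on k U f ->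
  Ck_on k U (fun y => hat (f y)).
Proof.
move=> oU Hf.
have Cr c : Ck_on k U (fun y : 'rV[R]_m => ramp (f y + c)).
  by apply: (Ck_on_ramp oU); apply: Ck_on_add => //; exact: Ck_on_cst.
have C0 := Ck_on_ramp oU Hf.
apply: (Ck_on_add oU); first exact: Ck_on_add oU (Cr 1) (Ck_on_opp oU C0).
exact/(Ck_on_opp oU)/(Ck_on_add oU C0)/(Ck_on_opp oU)/(Cr (- 1)).
Qed.

End ramp.

Section hat.
Variable hat : R -> R.
Hypothesis hat0 : forall t, 2 <= `|t| -> hat t = 0.
Hypothesis hat_sum : forall K t, 1 <= t -> t <= K%:R - 2 -> \sum_(i < K) hat (t - i%:R) = 1.
Hypothesis hat_sum_lin : forall K t, 1 <= t -> t <= K%:R - 2 ->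
  \sum_(i < K) i%:R * hat (t - i%:R) = t.
Hypothesis Ck_on_hat : forall m k (U : set 'rV[R]_m) f, open U -> Ck_on k U f ->
  Ck_on k U (fun y => hat (f y)).

(* The integer translates of [near2] have a telescoping sum. *)
Let clamp (t : R) : R := Num.max 0 (Num.min 1 t).
Let near2 (t : R) : R := clamp (t + 3) - clamp (t - 2).

Let clamp_01 t : 0 <= clamp t <= 1.
Proof. by rewrite /clamp le_max lexx/= ge_max ler01/= ge_min lexx. Qed.

Let near2_ge0 t : 0 <= near2 t.
Proof.
rewrite /near2 subr_ge0 /clamp ge_max !le_max lexx/=; apply/orP; right.
by rewrite le_min !ge_min lexx/=; apply/orP; right; lra.
Qed.

Let near2_ge1 t : `|t| <= 2 -> 1 <= near2 t.
Proof.
rewrite ler_norml => /andP[h1 h2]; rewrite /near2 /clamp.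
rewrite min_l; last lra. rewrite (max_r ler01) max_l ?subr0//.
by rewrite ge_min; apply/orP; right; lra.
Qed.

(** The two copies of [clamp] in [near2] are shifted by 5 against each other, so all but five terms
    at each end cancel. *)
Let near2_sum K t : \sum_(i < K) near2 (t - i%:R) <= 5.
Proof.
have -> : \sum_(i < K) near2 (t - i%:R) =
   \sum_(i < 5) clamp (t + 3 - i%:R) - \sum_(i < 5) clamp (t + 3 - (K + i)%:R).
  elim: (K) => [|k IH].
    by rewrite big_ord0; under [X in _ - X]eq_bigr do rewrite add0n; rewrite subrr.
  rewrite big_ord_recr/= IH /near2 !big_ord_recr !big_ord0 /=.
  rewrite !addn0 !addnS !addn0.
  have -> : clamp (t - k%:R + 3) = clamp (t + 3 - k%:R) by congr clamp; ring.
  have -> : clamp (t - k%:R - 2) = clamp (t + 3 - k.+1.+4%:R).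
    by congr clamp; rewrite -!natr1; ring.
  move: (clamp (t + 3 - k%:R)) (clamp (t + 3 - k.+1%:R)) (clamp (t + 3 - k.+2%:R))
    (clamp (t + 3 - k.+3%:R)) (clamp (t + 3 - k.+4%:R)) (clamp (t + 3 - k.+1.+4%:R)).
  move: (0 + _ + _ + _ + _ + _) => u c0 c1 c2 c3 c4 c5; ring.
rewrite lerBlDr; apply: (@le_trans _ _ (\sum_(i < 5) 1 : R)).
  by apply: ler_sum => i _; case/andP : (clamp_01 (t + 3 - i%:R)).
rewrite sumr_const card_ord lerDl; apply: sumr_ge0 => i _.
by case/andP : (clamp_01 (t + 3 - (K + i)%:R)).
Qed.

Section dimension.
Context {m : nat}.

Definition hat_rV (u : 'rV[R]_m) : R := \prod_j hat (u 0 j).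

Lemma hat_rV_smooth : smooth_on setT hat_rV.
Proof.
move=> k; apply: Ck_on_prod => [|j]; [exact: openT|exact/Ck_on_hat/Ck_on_coord/openT].
Qed.

Lemma hat_rV0 (u : 'rV[R]_m) j : 2 <= `|u 0 j| -> hat_rV u = 0.
Proof. by move=> h; rewrite /hat_rV (bigD1 j)//= hat0// mul0r. Qed.

Definition lattice (N : nat) (k : {ffun 'I_m -> 'I_(N + N).+1}) : 'rV[R]_m :=
  \row_j ((k j)%:R - N%:R).

Let rangeP (N : nat) (x : R) : `|x| <= N%:R - 2 ->
  1 <= x + N%:R /\ x + N%:R <= (N + N).+1%:R - 2.
Proof. by rewrite ler_norml -[(N + N).+1%:R]natr1 natrD => /andP[? ?]; split; lra. Qed.

Lemma hat_rV_sum N (u : 'rV[R]_m) : (forall j, `|u 0 j| <= N%:R - 2) ->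
  \sum_(k : {ffun 'I_m -> 'I_(N + N).+1}) hat_rV (u - lattice k) = 1.
Proof.
move=> uN; transitivity (\prod_(j < m) \sum_(i < (N + N).+1) hat (u 0 j + N%:R - i%:R)).
  rewrite bigA_distr_bigA/=; apply: eq_bigr => k _; apply: eq_bigr => j _.
  by rewrite !mxE; congr hat; ring.
by rewrite big1// => j _; have [h1 h2] := rangeP (uN j); exact: hat_sum.
Qed.

Lemma hat_rV_sum_lin N (u : 'rV[R]_m) l : (forall j, `|u 0 j| <= N%:R - 2) ->
  \sum_(k : {ffun 'I_m -> 'I_(N + N).+1}) lattice k 0 l * hat_rV (u - lattice k) = u 0 l.
Proof.
move=> uN; transitivity (\prod_(j < m) \sum_(i < (N + N).+1)
   (if j == l then i%:R - N%:R else 1) * hat (u 0 j + N%:R - i%:R)).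
  rewrite bigA_distr_bigA/=; apply: eq_bigr => k _; rewrite big_split/=; congr (_ * _).
    by rewrite (bigD1 l)//= eqxx big1 ?mulr1 ?mxE// => j /negbTE->.
  by apply: eq_bigr => j _; rewrite !mxE; congr hat; ring.
have [h1 h2] := rangeP (uN l).
rewrite (bigD1 l)//= eqxx [X in _ * X]big1 ?mulr1 => [|j jl]; last first.
  rewrite (negbTE jl); have [h3 h4] := rangeP (uN j); rewrite -[RHS](hat_sum h3 h4).
  by apply: eq_bigr => i _; rewrite mul1r.
under eq_bigr do rewrite mulrBl.
by rewrite sumrB -mulr_sumr hat_sum_lin// hat_sum//; ring.
Qed.

(** The number of lattice points within 2 of [u]. The indicator is dominated by a product over
    coordinates, whose sum over the lattice factors into one-dimensional sums, each at most 5. *)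
Lemma lattice_count N (u : 'rV[R]_m) :
  \sum_(k : {ffun 'I_m -> 'I_(N + N).+1}) (if `|u - lattice k| <= 2 then 1 else 0 : R) <= 5 ^+ m.
Proof.
apply: (@le_trans _ _ (\sum_(k : {ffun 'I_m -> 'I_(N + N).+1})
    \prod_(j < m) near2 (u 0 j + N%:R - (k j)%:R))).
  apply: ler_sum => k _; case: ifPn => [h|_]; last by apply: prodr_ge0 => j _.
  rewrite -[leLHS](@expr1n _ m) -[in leLHS](card_ord m) -prodr_const.
  apply: ler_prod => j _; rewrite ler01/=; apply: near2_ge1.
  by apply: le_trans h; have := rV_coord_le (u - lattice k) j; rewrite !mxE opprB addrA addrAC.
rewrite -(bigA_distr_bigA (fun j (i : 'I_(N + N).+1) => near2 (u 0 j + N%:R - i%:R))).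
rewrite -[in leRHS](card_ord m) -prodr_const; apply: ler_prod => j _.
by rewrite near2_sum sumr_ge0.
Qed.

End dimension.
End hat.
End lattice.

Section lattice_smoothing.
Context {R : realType} {m : nat}.

Lemma rV_norm_coord (u : 'rV[R]_m) r : 0 < r -> r <= `|u| -> exists j, r <= `|u 0 j|.
Proof.
move=> r0 ru; have [|[i j] E] := @mx_norm_neq0 _ _ _ u.
  by rewrite -[mx_norm u]/(`|u|) gt_eqF// (lt_le_trans r0).
by exists j; move: ru; rewrite -[`|u|]/(mx_norm u) E (ord1 i).
Qed.

Lemma smooth_lattice_kernel : exists2 Phi : 'rV[R]_m -> R,
  smooth_on setT Phi /\ (forall u, 2 <= `|u| -> Phi u = 0) &
  forall N (u : 'rV[R]_m), `|u| <= N%:R - 2 ->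
    \sum_(k : {ffun 'I_m -> 'I_(N + N).+1}) Phi (u - lattice k) = 1 /\
    forall l, \sum_(k : {ffun 'I_m -> 'I_(N + N).+1})
      lattice k 0 l * Phi (u - lattice k) = u 0 l.
Proof.
have [r [rneg rpos rC]] := @smooth_ramp R.
exists (hat_rV (hat r)); first split.
- by apply: hat_rV_smooth => *; exact: Ck_on_hat.
- move=> u /rV_norm_coord[//|j uj]; apply: (hat_rV0 _ uj) => t; exact: hat0.
- move=> N u uN.
  have {}uN j : `|u 0 j| <= N%:R - 2 by exact: le_trans (rV_coord_le u j) uN.
  split=> [|l].
    by apply: hat_rV_sum => // K t; exact: hat_sum.
  by apply: hat_rV_sum_lin => // K t; [exact: hat_sum|exact: hat_sum_lin].
Qed.

Lemma is_derive_dotrow (p y v : 'rV[R]_m) :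
  is_derive y v (dotrow p : 'rV[R]_m -> R) (dotrow p v).
Proof.
have E : (fun h : R => h^-1 *: (((dotrow p : 'rV[R]_m -> R) \o shift y) (h *: v) - dotrow p y)) @ 0^'
    --> dotrow p v.
  apply: cvg_trans (@cvg_cst _ (dotrow p v) _ (0 : R)^' _).
  apply: near_eq_cvg; near=> h; rewrite /=.
  have -> : dotrow p (h *: v + y) - dotrow p y = h * dotrow p v.
    by rewrite /dotrow -sumrB mulr_sumr; apply: eq_bigr => i _; rewrite !mxE; ring.
  rewrite -[_ *: _]/(h^-1 * (h * dotrow p v)) mulKf//.
  by near: h; exact: nbhs_dnbhs_neq.
by split; [apply/cvg_ex; exists (dotrow p v)|exact: cvg_lim].
Unshelve. all: by end_near. Qed.

Lemma derive_rescale (Phi : 'rV[R]_m -> R) (s : R) (a y : 'rV[R]_m) j :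
  differentiable Phi (s *: y - a) ->
  derivable (fun w => Phi (s *: w - a)) y (delta_mx 0 j) /\
  'D_(delta_mx 0 j) (fun w => Phi (s *: w - a)) y = s * 'D_(delta_mx 0 j) Phi (s *: y - a).
Proof.
move=> dP; pose T (w : 'rV[R]_m) := s *: w - a.
have dT i : is_derive y (delta_mx 0 j : 'rV[R]_m) (fun w => T w 0 i) (s * (delta_mx 0 j : 'rV[R]_m) 0 i).
  have -> : (fun w => T w 0 i) = s *: (fun w : 'rV[R]_m => w 0 i) - cst (a 0 i).
    by apply/funext => w; rewrite !mxE.
  have [d1 d2] := @derive_coord R m y (delta_mx 0 j) i.
  have di : is_derive y (delta_mx 0 j : 'rV[R]_m) (fun w : 'rV[R]_m => w 0 i)
    ((delta_mx 0 j : 'rV[R]_m) 0 i) by split.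
  have dc := is_derive_cst (a 0 i) y (delta_mx 0 j : 'rV[R]_m).
  by have := is_deriveB (is_deriveZ s di) dc; rewrite subr0.
have dT' i : differentiable (fun w => T w 0 i) y.
  apply: (@C1_differentiable _ _ setT) => //; first exact: openT.
  have oT : open [set: 'rV[R]_m] by exact: openT.
  apply: (@Ck_on_ext _ _ _ _ (fun w : 'rV[R]_m => - a 0 i + s * w 0 i)) => // [w _|].
    by rewrite !mxE addrC.
  exact: Ck_on_affine.
have [H1 H2] := derive_comp_rV (T := T) (delta_mx 0 j) dP dT'.
split; first exact: diff_derivable.
rewrite -[LHS]/('D_(delta_mx 0 j) (Phi \o T) y) H2 (bigD1 j)//= big1 ?addr0 => [|i ij].
  by have [_ ->] := dT j; rewrite mxE !eqxx mulr1 mulrC.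
by have [_ ->] := dT i; rewrite mxE eqxx (negbTE ij) !mulr0.
Qed.

(** Sample [f] at the points of the lattice of mesh 1/(n+1) and sum translates of the kernel. Affine
    functions are reproduced, so the error at [y] only sees how far [f] is from an affine function
    at the scale of the mesh. Comparison with a constant bounds values and derivatives; comparison
    with the tangent map gives convergence of the derivatives where [f] is differentiable. *)
Lemma lattice_smoothing (f : 'rV[R]_m -> R) (L B : R) : 0 <= B ->
  (forall x y, `|f x - f y| <= L * `|x - y|) -> (forall y, B <= `|y| -> f y = 0) ->
  exists C, exists F : nat -> 'rV[R]_m -> R,
    (forall n, [/\ smooth_on setT (F n),
      forall y, B + 2 <= `|y| -> F n y = 0,
      forall y, `|F n y - f y| <= C / n.+1%:R &
      forall y j, `|'D_(delta_mx 0 j) (F n) y| <= C]) /\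
    forall y j, differentiable f y ->
      'D_(delta_mx 0 j) (F n) y @[n --> \oo] --> 'D_(delta_mx 0 j) f y.
Proof.
move=> B0 fL f0.
have [Phi [Psm P0] Psum] := smooth_lattice_kernel.
have [C C0 HC] := C1_supported_bounded (Psm 1) P0.
have dPhi u : differentiable Phi u by exact: C1_differentiable openT (Psm 1) I.
(* After scaling by [n.+1], the ball of radius [B + 3] must stay at distance 2 from the boundary of
   the finite lattice of size [N n], where the reproduction formulas hold. *)
have [K BK] : exists K : nat, B + 5 <= K%:R.
  by exists (Num.bound (B + 5)); rewrite ltW// archi_boundP// addr_ge0.
pose s n : R := n.+1%:R; pose N n := (n.+1 * K)%N.
have s0 n : 0 < s n by rewrite ltr0n.
have s1 n : 1 <= s n by rewrite ler1n.
have sN n y : `|y| < B + 3 -> `|s n *: y : 'rV[R]_m| <= (N n)%:R - 2.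
  move=> yB; rewrite normrZ gtr0_norm// /N natrM -/(s n).
  have := ler_wpM2l (ltW (s0 n)) (ltW yB); have := ler_wpM2l (ltW (s0 n)) BK.
  by have := s1 n; lra.
pose F n y := \sum_(k : {ffun 'I_m -> 'I_(N n + N n).+1})
   f ((s n)^-1 *: lattice k) * Phi (s n *: y - lattice k).
pose D := C * 5 ^+ m.
have D0 : 0 <= D by rewrite mulr_ge0// exprn_ge0.
have F0 n y : B + 2 <= `|y| -> F n y = 0.
  move=> yB; rewrite /F big1// => k _.
  have [h|h] := leP 2 `|s n *: y - lattice k|; first by rewrite P0 ?mulr0.
  rewrite f0 ?mul0r//.
  have : `|y - (s n)^-1 *: lattice k| <= 2.
    have -> : y - (s n)^-1 *: lattice k = (s n)^-1 *: (s n *: y - lattice k).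
      by rewrite scalerBr scalerA mulVf ?gt_eqF// scale1r.
    rewrite normrZ gtr0_norm ?invr_gt0// mulrC ler_pdivrMr// (le_trans (ltW h))//.
    by rewrite ler_peMr.
  by have := ler_normD (y - (s n)^-1 *: lattice k) ((s n)^-1 *: lattice k); rewrite subrK; lra.
(* Near [y], [F n] is the affine function plus the same sum with the deviations [c k] as
   coefficients. At most [5 ^+ m] of the terms are nonzero, and a derivative costs one factor
   [s n]. *)
have G n y (al : R) p (e : R) : `|y| < B + 3 ->
    (forall z, `|z - y| <= 2 / s n -> `|f z - al - dotrow p z| <= e) ->
    `|F n y - al - dotrow p y| <= e * D /\
    forall j, `|'D_(delta_mx 0 j) (F n) y - p 0 j| <= e * s n * D.
  move=> yB Hz.
  pose c (k : {ffun 'I_m -> 'I_(N n + N n).+1}) : R :=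
    f ((s n)^-1 *: lattice k) - al - dotrow p ((s n)^-1 *: lattice k).
  have e0 : 0 <= e by apply: le_trans (Hz y _); rewrite // subrr normr0 divr_ge0// ltW.
  have cb k : `|s n *: y - lattice k| <= 2 -> `|c k| <= e.
    move=> h; apply: Hz; rewrite distrC.
    have -> : y - (s n)^-1 *: lattice k = (s n)^-1 *: (s n *: y - lattice k).
      by rewrite scalerBr scalerA mulVf ?gt_eqF// scale1r.
    by rewrite normrZ gtr0_norm ?invr_gt0// mulrC ler_wpM2r// ltW ?invr_gt0.
  pose E w := \sum_k c k * Phi (s n *: w - lattice k).
  have FE w : `|w| < B + 3 -> F n w = E w + (al + dotrow p w).
    move=> wB; have [S1 Sl] := Psum _ _ (sN n w wB).
    have -> : al + dotrow p w = \sum_(k : {ffun 'I_m -> 'I_(N n + N n).+1})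
        (al + dotrow p ((s n)^-1 *: lattice k)) * Phi (s n *: w - lattice k).
      under eq_bigr do rewrite mulrDl; rewrite big_split/= -mulr_sumr S1 mulr1; congr (_ + _).
      rewrite /dotrow; under eq_bigr do rewrite mulr_suml.
      rewrite exchange_big/=; apply: eq_bigr => l _.
      transitivity (p 0 l * (s n)^-1 * (s n *: w) 0 l).
        by rewrite mxE mulrA divfK ?gt_eqF.
      rewrite -(Sl l) mulr_sumr; apply: eq_bigr => k _.
      have -> : ((s n)^-1 *: lattice k) 0 l = (s n)^-1 * lattice k 0 l by rewrite mxE.
      by ring.
    by rewrite /F /E -big_split/=; apply: eq_bigr => k _; rewrite /c; ring.
  have sumb (a : {ffun 'I_m -> 'I_(N n + N n).+1} -> R) (b : R) : 0 <= b ->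
      (forall k, `|s n *: y - lattice k| <= 2 -> `|a k| <= b) ->
      (forall k, 2 < `|s n *: y - lattice k| -> a k = 0) -> `|\sum_k a k| <= b * 5 ^+ m.
    move=> b0 h1 h2; apply: (le_trans (ler_norm_sum _ _ _)).
    apply: (@le_trans _ _ (\sum_(k : {ffun 'I_m -> 'I_(N n + N n).+1})
        b * (if `|s n *: y - lattice k| <= 2 then 1 else 0))).
      apply: ler_sum => k _; case: ifPn => [/h1|]; first by rewrite mulr1.
      by rewrite -ltNge => /h2->; rewrite normr0 mulr0.
    by rewrite -mulr_sumr ler_wpM2l// lattice_count.
  split.
    rewrite FE// -addrA -opprD addrK /D mulrA; apply: sumb => [|k h|k h]; first exact: mulr_ge0.
      by rewrite normrM ler_pM// ?cb//; case: (HC (s n *: y - lattice k)).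
    by rewrite P0 ?mulr0// ltW.
  move=> j.
  have dk (k : {ffun 'I_m -> 'I_(N n + N n).+1}) := @derive_rescale Phi (s n) (lattice k) y j (dPhi (s n *: y - lattice k)).
  have dE : is_derive y (delta_mx 0 j : 'rV[R]_m) E
      (\sum_k c k * (s n * 'D_(delta_mx 0 j) Phi (s n *: y - lattice k))).
    rewrite (_ : E = \sum_k (c k *: (fun w => Phi (s n *: w - lattice k)))); last first.
      by apply/funext => w; rewrite fct_sumE.
    have di k : is_derive y (delta_mx 0 j : 'rV[R]_m) (c k *: (fun w => Phi (s n *: w - lattice k)))
        (c k * (s n * 'D_(delta_mx 0 j) Phi (s n *: y - lattice k))).
      have [d1 d2] := dk k; split; first exact: derivableZ.
      by rewrite deriveZ// d2.
    elim: (index_enum _) => [|k r IH]; first by rewrite !big_nil; exact: is_derive_cst.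
    by rewrite !big_cons; exact: is_deriveD.
  have dA : is_derive y (delta_mx 0 j : 'rV[R]_m) (fun w => al + dotrow p w) (p 0 j).
    have d1 := is_derive_dotrow p y (delta_mx 0 j); rewrite dotrow_delta in d1.
    by have := is_deriveD (is_derive_cst al y (delta_mx 0 j : 'rV[R]_m)) d1; rewrite add0r.
  have nE : {near y, (fun w => E w + (al + dotrow p w)) =1 F n}.
    have : \forall w \near y, `|w| < B + 3.
      by apply: (@cvgr_lt _ _ _ _ _ _ (@norm_continuous _ _ y)).
    by apply: filterS => w wB; rewrite FE.
  have [_ ->] := near_eq_is_derive nE (is_deriveD dE dA).
  rewrite addrK /D mulrA; apply: sumb => [|k h|k h].
  - by rewrite !mulr_ge0// ltW.
  - rewrite !normrM [`|s n|]gtr0_norm// -mulrA; apply: ler_pM => //; first by rewrite mulr_ge0// ltW.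
      exact: cb.
    by rewrite ler_wpM2l ?(ltW (s0 n))//; have [_ /(_ j)[]] := HC (s n *: y - lattice k).
  - by have [_ /(_ j)[_ ->]] := HC (s n *: y - lattice k); rewrite ?mulr0.
have dz (g : 'rV[R]_m -> R) y j : (forall w, B + 2 <= `|w| -> g w = 0) -> B + 3 <= `|y| ->
    'D_(delta_mx 0 j) g y = 0.
  move=> g0 yB; have : {near y, cst 0 =1 g}.
    have : \forall z \near y, B + 2 < `|z|.
      by apply: (@cvgr_gt _ _ _ _ _ _ (@norm_continuous _ _ y)); lra.
    by apply: filterS => z /ltW /g0 ->.
  by move=> /near_eq_derive <-; exact: derive_cst.
(* The deviation from the constant [f y] is of the order of [1 / s n], which compensates the factor
   [s n] lost by differentiation. *)
have cst_approx n y : forall z, `|z - y| <= 2 / s n -> `|f z - f y - dotrow 0 z| <= `|L| * (2 / s n).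
  move=> z zy; rewrite (_ : dotrow 0 z = 0) ?subr0; last first.
    by rewrite /dotrow big1// => i _; rewrite mxE mul0r.
  rewrite (le_trans (fL _ _))// (le_trans (ler_wpM2r _ (ler_norm L)))// ler_wpM2l//.
exists (`|L| * 2 * D), F; split=> [n|y j dfy].
  split=> [k|||].
  - apply: Ck_on_sum => [|kk]; first exact: openT.
    apply: Ck_on_mul; [exact: openT|exact: Ck_on_cst|].
    apply: (@Ck_on_comp _ _ _ _ setT setT Phi (fun y => s n *: y - lattice kk)) => //;
      [exact: openT|exact: openT|].
    move=> i; have oT : open [set: 'rV[R]_m] by exact: openT.
    apply: (@Ck_on_ext _ _ _ _ (fun w : 'rV[R]_m => - lattice kk 0 i + s n * w 0 i)) => // [w _|].
      by rewrite !mxE addrC.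
    exact: Ck_on_affine.
  - exact: F0.
  - move=> y; have [yB|yB] := ltP `|y| (B + 3).
      have [+ _] := G n y _ _ _ yB (cst_approx n y).
      rewrite (_ : dotrow 0 y = 0) ?subr0; last first.
        by rewrite /dotrow big1// => i _; rewrite mxE mul0r.
      by move=> /le_trans; apply; rewrite le_eqVlt; apply/orP; left; apply/eqP; rewrite /s; ring.
    rewrite F0 ?f0 ?subrr ?normr0 ?divr_ge0 ?mulr_ge0//; lra.
  - move=> y j; have [yB|yB] := ltP `|y| (B + 3); last first.
      by rewrite (dz _ _ _ (F0 n) yB) normr0 !mulr_ge0.
    have [_ /(_ j)] := G n y _ _ _ yB (cst_approx n y).
    rewrite mxE subr0 => /le_trans; apply.
    by rewrite !mulrA divfK ?gt_eqF.
have [yB|yB] := ltP `|y| (B + 3); last first.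
  rewrite (dz f)//; last by move=> w wB; apply: f0; lra.
  by under eq_fun do rewrite (dz _ _ _ (F0 _) yB); exact: cvg_cst.
apply/cvgrPdist_le => e e0.
have D1 : 0 < 2 * D + 1 by rewrite ltr_wpDl// mulr_ge0.
pose e' := e / (2 * D + 1); have e'0 : 0 < e' by rewrite divr_gt0.
have /nbhs_ballP[d /= d0 Hd] := differentiable_approx dfy e'0.
have [n0 n0d] := natS_inv_lt (divr_gt0 d0 (ltr0n R 2)).
near=> n.
have sd : 2 / s n < d.
  have : (s n)^-1 <= n0.+1%:R^-1.
    rewrite lef_pV2 ?posrE// ler_nat ltnS; near: n; exact: nbhs_infty_ge.
  by move: n0d; rewrite ltr_pdivlMr// mulrC => h1 h2; rewrite (le_lt_trans _ h1)// ler_wpM2l.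
pose p : 'rV[R]_m := \row_j 'D_(delta_mx 0 j) f y.
have [|_ /(_ j)] := G n y (f y - dotrow p y) p (e' * (2 / s n)) yB.
  move=> z zy; have := Hd (z - y); rewrite -ball_normE/= sub0r normrN subrK => /(_ (le_lt_trans zy sd)).
  rewrite diff_dotrow// -/p linearB/= opprB => /le_trans h.
  rewrite (_ : _ - _ = f z - f y - (dotrow p z - dotrow p y)); last by ring.
  by rewrite opprB in h *; apply: h; rewrite ler_wpM2l// ltW.
rewrite mxE distrC => /le_trans; apply.
rewrite -(mulrA e') divfK ?gt_eqF// /e' -!mulrA ger_pMr//.
by rewrite mulrC ler_pdivrMr// mul1r lerDl.
Unshelve. all: by end_near. Qed.

End lattice_smoothing.

(** * Differentials on the manifold *)

Section local_differentiability.
Context {R : realType}.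

Lemma near_eq_differentiable (V W : normedModType R) (u v : V -> W) a :
  {near a, u =1 v} -> differentiable u a -> differentiable v a /\ 'd v a = 'd u a :> (V -> W).
Proof.
move=> uv du; apply: differentiable_approxP; first exact: diff_continuous.
move=> e e0; have H := differentiable_approx du e0.
have ua : u a = v a by exact: nbhs_singleton uv.
have : \forall h \near 0, u (h + a) = v (h + a).
  move/nbhs_ballP : uv => [r /= r0 Hr]; apply: filterS (near0_norm_lt V r0) => h hr.
  by apply: Hr; rewrite -ball_normE /= opprD addrCA subrr addr0 normrN.
by move: H; apply: filterS2 => h + <-; rewrite -ua.
Qed.

Lemma near_eq_diff_comp (U V W : normedModType R) (T : U -> V) (F : V -> W) (G : U -> W) a b :
  T a = b -> {near a, F \o T =1 G} -> differentiable T a -> differentiable F b ->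
  differentiable G a /\ forall v, 'd G a v = 'd F b ('d T a v).
Proof.
move=> <- FG dT dF; have [dG E] := near_eq_differentiable FG (differentiable_comp dT dF).
by split=> // v; rewrite E diff_comp.
Qed.

Lemma dotrow_comp_jacobian m n (T : 'rV[R]_m -> 'rV[R]_n) a (q : 'rV[R]_n) v :
  differentiable T a -> dotrow q ('d T a v) = dotrow (q *m (jacobian T a)^T) v.
Proof.
move=> dT; have dotrowE k (p w : 'rV[R]_k) : dotrow p w = (p *m w^T) 0 0.
  by rewrite mxE; apply: eq_bigr => j _; rewrite mxE.
by rewrite !dotrowE -mulmxA -trmx_mul -deriveE// deriveEjacobian.
Qed.

Lemma dotrow_inj m (p q : 'rV[R]_m) : dotrow p =1 dotrow q -> p = q.
Proof. by move=> pq; apply/rowP => j; rewrite -!dotrow_delta pq. Qed.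

Lemma gradient_unique m (F : 'rV[R]_m -> R) y (p : 'rV[R]_m) : differentiable F y ->
  (forall v, 'd F y v = dotrow p v) -> \row_j 'D_(delta_mx 0 j) F y = p.
Proof. by move=> dF H; apply: dotrow_inj => v; rewrite -(diff_dotrow _ dF). Qed.

Section gradient_rules.
Context {m : nat}.
Local Notation nabla F y := (\row_j 'D_(delta_mx 0 j) F y : 'rV[R]_m).

Lemma gradientD (F G : 'rV[R]_m -> R) y : differentiable F y -> differentiable G y ->
  nabla (fun z => F z + G z) y = nabla F y + nabla G y.
Proof.
move=> dF dG; apply/rowP => j; rewrite !mxE.
exact: (deriveD (diff_derivable dF) (diff_derivable dG)).
Qed.

Lemma gradientM (F G : 'rV[R]_m -> R) y : differentiable F y -> differentiable G y ->
  nabla (fun z => F z * G z) y = F y *: nabla G y + G y *: nabla F y.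
Proof.
move=> dF dG; apply/rowP => j; rewrite !mxE.
exact: (deriveM (diff_derivable dF) (diff_derivable dG)).
Qed.

Lemma gradient_comp (p : R -> R) (a : R) (F : 'rV[R]_m -> R) y b : F y = b ->
  is_derive b 1 p a -> differentiable F y ->
  differentiable (p \o F) y /\ nabla (p \o F) y = a *: nabla F y.
Proof.
move=> <- pd dF; split.
  by apply: differentiable_comp => //; apply/derivable1_diffP; case: pd.
apply/rowP => j; rewrite !mxE.
by have [_ ->] := derive_comp1 pd (diff_derivable (v := delta_mx 0 j) dF).
Qed.

End gradient_rules.

Lemma diff_at_min (V : normedModType R) (F : V -> R) y v : differentiable F y ->
  (forall w, F y <= F w) -> 'd F y v = 0.
Proof.
move=> df Fmin.
suff D w : 0 <= 'd F y w.
  by apply/eqP; rewrite eq_le D andbT -oppr_ge0 -linearN.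
rewrite leNgt; apply/negP => D0.
have w0 : w != 0 by apply: contraTN D0 => /eqP->; rewrite linear0 ltxx.
have nw0 : 0 < `|w| by rewrite normr_gt0.
pose e := - 'd F y w / (2 * `|w|).
have e0 : 0 < e by rewrite divr_gt0 ?oppr_gt0// mulr_gt0.
have /nbhs_ballP[r /= r0 H] := differentiable_approx df e0.
pose t := r / (2 * `|w|).
have t0 : 0 < t by rewrite divr_gt0// mulr_gt0.
have := H (t *: w); rewrite -ball_normE/= sub0r normrN normrZ gtr0_norm//.
have tw : t * `|w| = r / 2 by rewrite /t invfM mulrA divfK// gt_eqF.
rewrite tw => /(_ _)/= h.
have /h : r / 2 < r by rewrite ltr_pdivrMr// mulr_natr mulr2n ltrDl.
have -> : 'd F y (t *: w) = t * 'd F y w by rewrite linearZ.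
rewrite ler_norml => /andP[_].
have -> : e * (r / 2) = - (t * 'd F y w) / 2.
  by rewrite -tw /e; field; rewrite gt_eqF.
have := Fmin (t *: w + y); have : t * 'd F y w < 0 by rewrite pmulr_rlt0.
by move: (t * 'd F y w) (F y) (F (t *: w + y)) => a b c; lra.
Qed.

End local_differentiability.

Section manifold_calculus.
Context {R : realType} {m : nat} {M : smooth_manifold R m} (g : riemannian_metric M).
Implicit Types (c d : chart M) (x : M) (f h : M -> R).

Definition chart_img c : set 'rV[R]_m := chart_map c @` chart_dom c.

Lemma chart_at_dom x : chart_dom (chart_at x) x.
Proof. by rewrite /chart_at; case: cid. Qed.

Lemma chart_img_map c x : chart_dom c x -> chart_img c (chart_map c x).
Proof. by move=> cx; exists x. Qed.

Lemma chart_invK c y : chart_img c y -> chart_map c (chart_inv c y) = y.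
Proof. by move=> [x cx <-]; rewrite chart_mapK. Qed.

Lemma chart_inv_dom c y : chart_img c y -> chart_dom c (chart_inv c y).
Proof. by move=> [x cx <-]; rewrite chart_mapK. Qed.

Lemma open_chart_img c : open (chart_img c).
Proof. exact: chart_img_open. Qed.

Lemma chart_inv_continuous_at c y : chart_img c y -> {for y, continuous (chart_inv c)}.
Proof. by move=> [x cx <-]; exact: chart_inv_continuous. Qed.

Lemma chart_map_imageE c (U : set M) :
  chart_map c @` (chart_dom c `&` U) = chart_img c `&` chart_inv c @^-1` U.
Proof.
apply/seteqP; split=> [_ [x [cx Ux] <-]|y [cy Uy]].
  by split; [exact: chart_img_map|rewrite /= chart_mapK].
by exists (chart_inv c y); [split => //; exact: chart_inv_dom|rewrite chart_invK].
Qed.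

Lemma open_chart_map_image c (U : set M) : open U ->
  open (chart_map c @` (chart_dom c `&` U)).
Proof.
move=> oU; rewrite chart_map_imageE openE => y [cy Uy]; apply: filterI.
  by apply: open_nbhs_nbhs; split => //; exact: open_chart_img.
by apply: (chart_inv_continuous_at cy); apply: open_nbhs_nbhs.
Qed.

Definition transition c d : 'rV[R]_m -> 'rV[R]_m := chart_map d \o chart_inv c.

Definition transition_jac c d x := jacobian (transition c d) (chart_map c x).

Lemma open_overlap c d : open (chart_map c @` (chart_dom c `&` chart_dom d)).
Proof. exact/open_chart_map_image/chart_dom_open. Qed.

Lemma overlap_map c d x : chart_dom c x -> chart_dom d x ->
  (chart_map c @` (chart_dom c `&` chart_dom d)) (chart_map c x).
Proof. by move=> cx dx; exists x. Qed.

Lemma transition_coord_differentiable c d x j : chart_dom c x -> chart_dom d x ->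
  differentiable (fun y : 'rV[R]_m => transition c d y 0 j) (chart_map c x).
Proof.
move=> cx dx.
have H : Ck_on 1 (chart_map c @` (chart_dom c `&` chart_dom d)) (fun y => transition c d y 0 j).
  exact: (chart_transition_smooth c d j 1%N).
exact: (C1_differentiable (@open_overlap c d) H (overlap_map cx dx)).
Qed.

Lemma transition_differentiable c d x : chart_dom c x -> chart_dom d x ->
  differentiable (transition c d) (chart_map c x).
Proof.
move=> cx dx; apply: differentiable_rV => i; exact: transition_coord_differentiable.
Qed.

Lemma transition_map c d x : chart_dom c x -> transition c d (chart_map c x) = chart_map d x.
Proof. by move=> cx; rewrite /transition /= chart_mapK. Qed.

Definition diff_in c f x := differentiable (f \o chart_inv c) (chart_map c x).

Definition partials c f x : 'rV[R]_m :=
  \row_j 'D_(delta_mx 0 j) (f \o chart_inv c) (chart_map c x).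

Lemma near_transition c d f x : chart_dom c x -> chart_dom d x ->
  {near chart_map c x, (f \o chart_inv d) \o transition c d =1 f \o chart_inv c}.
Proof.
move=> cx dx.
have N : nbhs (chart_map c x) (chart_map c @` (chart_dom c `&` chart_dom d)).
  by apply: open_nbhs_nbhs; split; [exact: open_overlap|exact: overlap_map].
apply: filterS N.
by move=> _ [z [cz dz] <-]; rewrite /= /transition /= chart_mapK// chart_mapK.
Qed.

Lemma diff_in_transition c d f x : chart_dom c x -> chart_dom d x ->
  diff_in d f x -> diff_in c f x /\
  forall v, 'd (f \o chart_inv c) (chart_map c x) v =
    'd (f \o chart_inv d) (chart_map d x) ('d (transition c d) (chart_map c x) v).
Proof.
move=> cx dx df.
exact: near_eq_diff_comp (transition_map d cx) (near_transition f cx dx)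
  (transition_differentiable cx dx) df.
Qed.

Lemma diff_in_chart c d f x : chart_dom c x -> chart_dom d x ->
  diff_in d f x -> diff_in c f x.
Proof. by move=> cx dx /(diff_in_transition cx dx)[]. Qed.

Lemma partials_transition c d f x : chart_dom c x -> chart_dom d x -> diff_in d f x ->
  partials c f x = partials d f x *m (transition_jac c d x)^T.
Proof.
move=> cx dx df; have [cf E] := diff_in_transition cx dx df.
apply: (gradient_unique cf) => v; rewrite E (diff_dotrow _ df).
exact: dotrow_comp_jacobian (transition_differentiable cx dx).
Qed.

Lemma gram_unit c x : chart_dom c x -> gram g c x \in unitmx.
Proof.
move=> cx; rewrite unitmxE unitfE; apply/negP => /det0P[v v0 vG].
by have := gram_posdef g cx v0; rewrite vG mul0mx mxE ltxx.
Qed.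

Lemma transition_jac_unit c d x : chart_dom c x -> chart_dom d x ->
  transition_jac c d x \in unitmx.
Proof.
move=> cx dx; have := gram_unit cx; rewrite (gram_transition g cx dx) -/(transition_jac c d x).
by rewrite !unitmx_mul => /andP[/andP[]].
Qed.

(** The dual metric g^{ij} p_i q_j on covectors. Differentials transform without inverting the
    metric, so gradients are handled through them. *)
Definition cometric c x (p q : 'rV[R]_m) : R := (p *m invmx (gram g c x) *m q^T) 0 0.

Lemma cometric_transition c d x p q : chart_dom c x -> chart_dom d x ->
  cometric c x (p *m (transition_jac c d x)^T) (q *m (transition_jac c d x)^T) =
  cometric d x p q.
Proof.
move=> cx dx; rewrite /cometric (gram_transition g cx dx) -/(transition_jac c d x).
set J := transition_jac c d x; have uJ : J \in unitmx by exact: transition_jac_unit.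
have uJT : J^T \in unitmx by rewrite unitmx_tr.
have uG := gram_unit dx.
rewrite trmx_mul trmxK.
have -> : invmx (J *m gram g d x *m J^T) = invmx J^T *m invmx (gram g d x) *m invmx J.
  have uA : J *m gram g d x *m J^T \in unitmx by rewrite !unitmx_mul uJ uG uJT.
  apply: (can_inj (mulmxK uA)); rewrite mulVmx//.
  rewrite !mulmxA mulmxKV// -(mulmxA (invmx J^T)) mulVmx// mulmx1 mulVmx//.
by rewrite !mulmxA mulmxK// -!mulmxA (mulmxA (invmx J)) mulVmx// mul1mx.
Qed.

Lemma cometric_sym c x p q : chart_dom c x -> cometric c x p q = cometric c x q p.
Proof.
move=> cx; rewrite /cometric -[in LHS](trmxK (p *m _ *m q^T)) [LHS]mxE.
by rewrite !trmx_mul trmxK trmx_inv gram_sym// mulmxA.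
Qed.

Lemma cometricDl c x p p' q : cometric c x (p + p') q = cometric c x p q + cometric c x p' q.
Proof. by rewrite /cometric !mulmxDl mxE. Qed.

Lemma cometricZl c x a p q : cometric c x (a *: p) q = a * cometric c x p q.
Proof. by rewrite /cometric -!scalemxAl mxE. Qed.

Lemma cometricDr c x p q q' : cometric c x p (q + q') = cometric c x p q + cometric c x p q'.
Proof. by rewrite /cometric linearD mulmxDr mxE. Qed.

Lemma cometricZr c x a p q : cometric c x p (a *: q) = a * cometric c x p q.
Proof. by rewrite /cometric linearZ/= -scalemxAr mxE. Qed.

Lemma gram_ge0 c x (v : 'rV[R]_m) : chart_dom c x -> 0 <= (v *m gram g c x *m v^T) 0 0.
Proof.
move=> cx; have [->|v0] := eqVneq v 0; first by rewrite !mul0mx mxE.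
by rewrite ltW// gram_posdef.
Qed.

Lemma cometric_ge0 c x p : chart_dom c x -> 0 <= cometric c x p p.
Proof.
move=> cx; have := gram_ge0 (p *m invmx (gram g c x)) cx.
by rewrite mulmxKV ?gram_unit// trmx_mul trmx_inv gram_sym// mulmxA.
Qed.

(** [inner_grad] is defined through the arbitrarily chosen chart [chart_at x]. Covectors and dual
    metric transform by the same Jacobian, so any chart around [x] computes it. *)
Lemma inner_gradE c f h x : chart_dom c x -> diff_in c f x -> diff_in c h x ->
  inner_grad g f h x = cometric c x (partials c f x) (partials c h x).
Proof.
move=> cx cf ch; have ax := chart_at_dom x.
have af := diff_in_chart ax cx cf; have ah := diff_in_chart ax cx ch.
rewrite (partials_transition cx ax af) (partials_transition cx ax ah) cometric_transition//.
rewrite /inner_grad /inner /grad.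
have -> : `[< differentiable (f \o chart_inv (chart_at x)) (chart_map (chart_at x) x) >] = true.
  exact/asboolP.
have -> : `[< differentiable (h \o chart_inv (chart_at x)) (chart_map (chart_at x) x) >] = true.
  exact/asboolP.
rewrite mulmxKV ?gram_unit// /cometric trmx_mul trmx_inv gram_sym//.
by rewrite mulmxA.
Qed.

Lemma inner_grad0l c f h x : chart_dom c x -> ~ diff_in c f x -> inner_grad g f h x = 0.
Proof.
move=> cx cf; rewrite /inner_grad /inner {1}/grad ifF ?mul0mx ?mxE//.
by apply/asboolPn => af; apply: cf; apply: diff_in_chart af => //; exact: chart_at_dom.
Qed.

Lemma inner_grad0r c f h x : chart_dom c x -> ~ diff_in c h x -> inner_grad g f h x = 0.
Proof.
move=> cx ch; rewrite /inner_grad /inner [X in _ *m X^T]/grad ifF ?trmx0 ?mulmx0 ?mxE//.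
by apply/asboolPn => ah; apply: ch; apply: diff_in_chart ah => //; exact: chart_at_dom.
Qed.

Lemma inner_grad_ge0 f x : 0 <= inner_grad g f f x.
Proof. by rewrite /inner_grad /inner; apply: gram_ge0; exact: chart_at_dom. Qed.

Lemma norm_grad_sqr f x : norm_grad g f x ^+ 2 = inner_grad g f f x.
Proof. by rewrite /norm_grad sqr_sqrtr// inner_grad_ge0. Qed.

Lemma norm_grad_ge0 f x : 0 <= norm_grad g f x.
Proof. exact: sqrtr_ge0. Qed.

Definition mdiff f x := diff_in (chart_at x) f x.
Definition covector f x := partials (chart_at x) f x.
Definition coinner x p q := cometric (chart_at x) x p q.

Lemma mdiff_in c f x : chart_dom c x -> diff_in c f x <-> mdiff f x.
Proof.
by move=> cx; have ax := chart_at_dom x; split; exact: diff_in_chart.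
Qed.

Lemma inner_grad_co f h x : mdiff f x -> mdiff h x ->
  inner_grad g f h x = coinner x (covector f x) (covector h x).
Proof. by apply: inner_gradE; exact: chart_at_dom. Qed.

Lemma coinner_sym x p q : coinner x p q = coinner x q p.
Proof. by apply: cometric_sym; exact: chart_at_dom. Qed.

Lemma coinner_ge0 x p : 0 <= coinner x p p.
Proof. by apply: cometric_ge0; exact: chart_at_dom. Qed.

Lemma mdiff_cst (a : R) x : mdiff (cst a) x /\ covector (cst a) x = 0.
Proof.
split; first exact: differentiable_cst.
by apply/rowP => j; rewrite !mxE; exact: derive_cst.
Qed.

Lemma mdiffD f h x : mdiff f x -> mdiff h x ->
  mdiff (fun z => f z + h z) x /\ covector (fun z => f z + h z) x = covector f x + covector h x.
Proof.
by move=> df dh; split; [exact: differentiableD df dh|exact: gradientD df dh].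
Qed.

Lemma mdiffM f h x : mdiff f x -> mdiff h x ->
  mdiff (fun z => f z * h z) x /\
  covector (fun z => f z * h z) x = f x *: covector h x + h x *: covector f x.
Proof.
move=> df dh; split; first exact: differentiableM df dh.
have := gradientM df dh; rewrite /= chart_mapK//; exact: chart_at_dom.
Qed.

Lemma mdiff_comp (p : R -> R) (a : R) f x : is_derive (f x) 1 p a -> mdiff f x ->
  mdiff (fun z => p (f z)) x /\ covector (fun z => p (f z)) x = a *: covector f x.
Proof.
move=> pd df.
have fE : (f \o chart_inv (chart_at x)) (chart_map (chart_at x) x) = f x.
  by rewrite /= chart_mapK//; exact: chart_at_dom.
exact: gradient_comp fE pd df.
Qed.

Lemma mdiff_near f h x : (\forall z \near x, f z = h z) -> mdiff f x ->
  mdiff h x /\ covector h x = covector f x.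
Proof.
move=> fh df; have ax := chart_at_dom x.
have E : {near chart_map (chart_at x) x, f \o chart_inv (chart_at x) =1 h \o chart_inv (chart_at x)}.
  have := chart_inv_continuous ax; rewrite /prop_for /continuous_at chart_mapK// => H.
  exact: H fh.
have [H1 H2] := near_eq_differentiable E df; split=> //.
by apply: (gradient_unique H1) => v; rewrite H2 (diff_dotrow _ df).
Qed.

(** Meant for a nonnegative function at its zeros: wherever it is differentiable there, its gradient
    vanishes. *)
Lemma covector_min f x : mdiff f x -> (forall z, f x <= f z) -> covector f x = 0.
Proof.
move=> df fmin; have ax := chart_at_dom x.
apply: (gradient_unique df) => v; rewrite /dotrow big1 => [|j _]; last by rewrite mxE mul0r.
apply: diff_at_min => // w; rewrite [in leLHS]/= chart_mapK//; exact: fmin.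
Qed.

End manifold_calculus.

(** * Continuity of matrix operations and quadratic forms *)

Section matrix_continuity.
Context {R : realType} {T : topologicalType}.
Implicit Types (x : T).

Lemma continuous_sum_at (I : Type) (r : seq I) (F : I -> T -> R) x :
  (forall i, {for x, continuous (F i)}) ->
  {for x, continuous (fun t => \sum_(i <- r) F i t)}.
Proof.
move=> H; apply: (@cvg_big R I +%R 0 xpredT _ _ _ r F (fun i => F i x)) => [z|i _]; last exact: H.
by apply: cvgD; [exact: cvg_fst|exact: cvg_snd].
Qed.

Lemma continuous_prod_at (I : Type) (r : seq I) (F : I -> T -> R) x :
  (forall i, {for x, continuous (F i)}) ->
  {for x, continuous (fun t => \prod_(i <- r) F i t)}.
Proof.
move=> H; apply: (@cvg_big R I *%R 1 xpredT _ _ _ r F (fun i => F i x)) => [z|i _]; last exact: H.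
by apply: cvgM; [exact: cvg_fst|exact: cvg_snd].
Qed.

Lemma continuous_det n (A : T -> 'M[R]_n) x :
  (forall i j, {for x, continuous (fun t => A t i j)}) ->
  {for x, continuous (fun t => \det (A t))}.
Proof.
move=> Ac; apply: continuous_sum_at => s; apply: continuousM; first exact: cst_continuous.
by apply: continuous_prod_at => i; exact: Ac.
Qed.

(** The cofactor formula describes [invmx] only where the determinant is nonzero, and this persists
    near [x]. *)
Lemma continuous_invmx n (A : T -> 'M[R]_n) x :
  (forall i j, {for x, continuous (fun t => A t i j)}) -> A x \in unitmx ->
  forall i j, {for x, continuous (fun t => invmx (A t) i j)}.
Proof.
move=> Ac uA i j; have dA := continuous_det Ac.
have d0 : \det (A x) != 0 by rewrite unitmxE unitfE in uA.
pose f t := (\det (A t))^-1 * cofactor (A t) j i.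
have E t : \det (A t) != 0 -> invmx (A t) i j = f t.
  by move=> dt; rewrite /invmx unitmxE unitfE dt !mxE.
have near_unit : \forall t \near x, \det (A t) != 0.
  have N : nbhs (\det (A x)) [set y : R | y != 0] by apply: open_nbhs_nbhs; split; [exact: open_neq|].
  exact: dA N.
rewrite /prop_for /continuous_at E//; apply: cvg_trans (_ : f t @[t --> x] --> f x).
  apply: near_eq_cvg; apply: filterS near_unit => t dt; exact/esym/E.
apply: (@continuousM R T (fun t => (\det (A t))^-1)); first exact: cvgV.
rewrite /cofactor; apply: continuousM; first exact: cst_continuous.
apply: continuous_det => k l.
by rewrite (_ : (fun t => _) = fun t => A t (lift j k) (lift i l))//; apply/funext => t; rewrite !mxE.
Qed.

Lemma compact_locally_bounded (K : set T) (f : T -> R) : compact K ->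
  (forall x, K x -> exists B, \forall z \near x, f z <= B) ->
  exists2 B, 0 < B & forall x, K x -> f x <= B.
Proof.
move=> /compact_near_coveringP cK H.
have [|B [Br HB]] := cK R (pinfty_nbhs R) (fun B x => f x <= B) _.
  move=> x Kx; have [B HB] := H x Kx.
  exists ([set z | f z <= B], [set C | B <= C]) => /=; last by move=> [z C] /= [] /le_trans; apply.
  by split=> //=; exists B; split=> [|C /ltW]; rewrite ?num_real.
exists (Num.max 1 (B + 1)); first by rewrite lt_max ltr01.
by apply: HB; rewrite lt_max ltrDl ltr01 orbT.
Qed.

End matrix_continuity.

Section quadratic_forms.
Context {R : realType} {n : nat}.
Implicit Types (A : 'M[R]_n) (v w : 'rV[R]_n).

Lemma quad_formE A v w : (v *m A *m w^T) 0 0 = \sum_j \sum_i v 0 i * A i j * w 0 j.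
Proof.
rewrite mxE; apply: eq_bigr => j _; rewrite !mxE mulr_suml.
by apply: eq_bigr => i _.
Qed.

Lemma quad_form_le A v B : (forall i j, `|A i j| <= B) ->
  (v *m A *m v^T) 0 0 <= n%:R ^+ 2 * B * `|v| ^+ 2.
Proof.
move=> AB; rewrite quad_formE.
apply: le_trans (_ : \sum_(j < n) \sum_(i < n) B * `|v| ^+ 2 <= _); last first.
  by rewrite !sumr_const !card_ord -mulrnA -[leLHS]mulr_natl natrM le_eqVlt; apply/orP; left; apply/eqP; ring.
apply: ler_sum => j _; apply: ler_sum => i _; apply: le_trans (ler_norm _) _.
rewrite !normrM mulrAC mulrC; apply: ler_pM => //.
by rewrite expr2; apply: ler_pM => //; exact: rV_coord_le.
Qed.

Lemma quad_formZ A a v : ((a *: v) *m A *m (a *: v)^T) 0 0 = a ^+ 2 * (v *m A *m v^T) 0 0.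
Proof. by rewrite linearZ/= -!scalemxAl -scalemxAr scalerA mxE expr2. Qed.

(** Cauchy-Schwarz between a covector and a vector, from the nonnegativity of the form at
    [v - t *: (p *m invmx A)] for every [t]. Taking t = p(v) / b gives the claim when b > 0. *)
Lemma quad_form_cauchy A v p : A^T = A -> A \in unitmx ->
  (forall w, 0 <= (w *m A *m w^T) 0 0) ->
  dotrow p v ^+ 2 <= (p *m invmx A *m p^T) 0 0 * (v *m A *m v^T) 0 0.
Proof.
move=> As uA pos; set b := (p *m _ *m _) 0 0; set q := (v *m A *m v^T) 0 0.
have dE : dotrow p v = (p *m v^T) 0 0 by rewrite mxE; apply: eq_bigr => j _; rewrite mxE.
have H t : 0 <= q - 2 * t * dotrow p v + t ^+ 2 * b.
  have := pos (v - t *: (p *m invmx A)); congr (0 <= _).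
  have piA : (p *m invmx A)^T = invmx A *m p^T by rewrite trmx_mul trmx_inv As.
  have pv : (v *m p^T) 0 0 = dotrow p v by rewrite mxE; apply: eq_bigr => j _; rewrite mxE mulrC.
  have -> : (v - t *: (p *m invmx A)) *m A *m (v - t *: (p *m invmx A))^T =
     v *m A *m v^T - t *: (v *m p^T) - t *: (p *m v^T) + (t ^+ 2) *: (p *m invmx A *m p^T).
    have -> : (v - t *: (p *m invmx A))^T = v^T - t *: (invmx A *m p^T).
      by rewrite -piA; apply/matrixP => i j; rewrite !mxE.
    have -> : (v - t *: (p *m invmx A)) *m A = v *m A - t *: p by rewrite mulmxBl -scalemxAl mulmxKV.
    rewrite mulmxBr -scalemxAr !mulmxBl -!scalemxAl !mulmxA mulmxK// scalerBr scalerA -expr2 opprB addrA.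
    by rewrite [LHS]addrAC; congr (_ + _); rewrite addrAC.
  have mB (X Y : 'M[R]_1) : (X - Y) 0 0 = X 0 0 - Y 0 0 by rewrite !mxE.
  have mD (X Y : 'M[R]_1) : (X + Y) 0 0 = X 0 0 + Y 0 0 by rewrite !mxE.
  have mZ c (X : 'M[R]_1) : (c *: X) 0 0 = c * X 0 0 by rewrite !mxE.
  by rewrite mD !mB !mZ pv -dE -/q -/b; ring.
have b0 : 0 <= b.
  have := pos (p *m invmx A); rewrite mulmxKV// trmx_mul trmx_inv As mulmxA.
  by rewrite -/b.
have [b_eq0|b_neq0] := eqVneq b 0.
  have [->|d0] := eqVneq (dotrow p v) 0; first by rewrite expr0n mulr_ge0// /q pos.
  (* For [b = 0] the expression is affine in [t]; this value of [t] makes it equal to -1. *)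
  have := H ((q + 1) / (2 * dotrow p v)); rewrite b_eq0 mulr0 addr0 mulrCA.
  rewrite (_ : _ - _ = - 1); last by field.
  by rewrite oppr_ge0 ler10.
have {b_neq0}b0 : 0 < b by rewrite lt_neqAle eq_sym b_neq0.
have := H (dotrow p v / b); rewrite (_ : _ + _ = q - dotrow p v ^+ 2 / b); last by field; rewrite gt_eqF.
by rewrite subr_ge0 ler_pdivrMr// mulrC.
Qed.

End quadratic_forms.

(** * The distance by chains of chart segments *)

Section chains.
Context {R : realType} {m : nat} {M : smooth_manifold R m} (g : riemannian_metric M).
Implicit Types (c d : chart M) (x : M) (f h : M -> R).

Lemma chart_gram_continuous c y i j : chart_img c y ->
  {for y, continuous (fun u => gram g c (chart_inv c u) i j)}.
Proof. exact: (gram_smooth g c i j 0%N).1. Qed.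

Lemma chart_cogram_continuous c y i j : chart_img c y ->
  {for y, continuous (fun u => invmx (gram g c (chart_inv c u)) i j)}.
Proof.
move=> cy; apply: (@continuous_invmx _ _ _ (fun u => gram g c (chart_inv c u))) => [k l|].
  exact: chart_gram_continuous.
by apply: gram_unit; exact: chart_inv_dom.
Qed.

Lemma compact_entry_bound (K : set 'rV[R]_m) (A : 'rV[R]_m -> 'M[R]_m) : compact K ->
  (forall y i j, K y -> {for y, continuous (fun u => A u i j)}) ->
  exists2 B : R, 0 < B & forall y (v : 'rV[R]_m), K y -> (v *m A y *m v^T) 0 0 <= B ^+ 2 * `|v| ^+ 2.
Proof.
move=> cK Ac.
have [|B B0 HB] := compact_locally_bounded (f := fun y => \sum_i \sum_j `|A y i j|) cK.
  move=> y Ky; exists (\sum_i \sum_j `|A y i j| + 1).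
  have H : {for y, continuous (fun u => \sum_i \sum_j `|A u i j|)}.
    apply: continuous_sum_at => i; apply: continuous_sum_at => j.
    by apply: (@continuous_comp _ _ _ (fun u => A u i j) Num.norm); [exact: Ac|exact: norm_continuous].
  have /cvgrPdist_le /(_ 1 ltr01) := H; apply: filterS => z.
  by rewrite ler_norml => /andP[]; lra.
pose D := m%:R ^+ 2 * B + 1.
have D1 : 1 <= D by rewrite lerDr mulr_ge0 ?sqr_ge0// ltW.
exists D => [|y v Ky]; first exact: lt_le_trans D1.
have := @quad_form_le R m (A y) v B; move=> /(_ _)/le_trans; apply.
  move=> i j; apply: le_trans (HB _ Ky).
  rewrite (bigD1 i)//= (bigD1 j)//= -addrA lerDl addr_ge0 ?sumr_ge0// => k _.
  by apply: sumr_ge0.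
rewrite ler_wpM2r ?sqr_ge0//; apply: (le_trans (y := D)); first by rewrite lerDl.
by rewrite expr2 ler_peMl// (le_trans ler01).
Qed.

Lemma closed_cube_compact (q : 'rV[R]_m) r : compact [set y : 'rV[R]_m | `|y - q| <= r].
Proof.
apply: bounded_closed_compact.
  exists (r + `|q|); split; first exact: num_real.
  move=> B rB y /= yr; rewrite -(subrK q y) (le_trans (ler_normD _ _))// ltW//.
  by apply: le_lt_trans rB; rewrite lerD2r.
have qc : continuous (fun y : 'rV[R]_m => `|y - q|).
  apply: (@lipschitz_fun_continuous R _ _ _ 1) => y z; rewrite mul1r.
  by rewrite (le_trans (ler_dist_dist _ _))// opprB addrA subrK.
have /continuous_closedP/(_ [set t : R | t <= r] (@closed_le _ r)) := qc.
exact.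
Qed.

Lemma chart_cube c x (U : set M) : chart_dom c x -> nbhs x U -> exists2 r, 0 < r &
  forall y, `|y - chart_map c x| <= r -> chart_img c y /\ U (chart_inv c y).
Proof.
move=> cx Ux.
have H : nbhs (chart_map c x) (chart_img c `&` chart_inv c @^-1` U).
  apply: filterI; first by apply: open_nbhs_nbhs; split; [exact: open_chart_img|exact: chart_img_map].
  have := chart_inv_continuous cx; rewrite /prop_for /continuous_at chart_mapK//; exact.
have /nbhs_ballP[e /= e0 He] := H.
exists (e / 2) => [|y ye]; first by rewrite divr_gt0.
have : ball (chart_map c x) e y.
  by rewrite -ball_normE /= distrC (le_lt_trans ye)// ltr_pdivrMr// mulr_natr mulr2n ltrDl.
by move=> /He.
Qed.

Definition seg (y z : 'rV[R]_m) (t : R) := y + t *: (z - y).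

Lemma seg0 y z : seg y z 0 = y. Proof. by rewrite /seg scale0r addr0. Qed.
Lemma seg1 y z : seg y z 1 = z. Proof. by rewrite /seg scale1r addrC subrK. Qed.
Lemma segC y z t : seg z y t = seg y z (1 - t).
Proof. by apply/rowP => j; rewrite !mxE; ring. Qed.
Lemma seg_seg y z a b t : seg (seg y z a) (seg y z b) t = seg y z (a + t * (b - a)).
Proof. by apply/rowP => j; rewrite !mxE; ring. Qed.
Lemma segB y z a b : seg y z b - seg y z a = (b - a) *: (z - y).
Proof. by apply/rowP => j; rewrite !mxE; ring. Qed.
Lemma seg_cube (q y z : 'rV[R]_m) r t : 0 <= t <= 1 -> `|y - q| <= r -> `|z - q| <= r ->
  `|seg y z t - q| <= r.
Proof.
move=> /andP[t0 t1] yr zr; rewrite (_ : _ - q = (1 - t) *: (y - q) + t *: (z - q)); last first.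
  by apply/rowP => j; rewrite !mxE; ring.
rewrite (le_trans (ler_normD _ _))// !normrZ (ger0_norm t0) ger0_norm ?subr_ge0//.
rewrite (_ : r = (1 - t) * r + t * r); last by ring.
by apply: lerD; apply: ler_wpM2l; rewrite ?subr_ge0.
Qed.

(* [l] is only an upper bound for the speed, which makes chains easy to cut. *)
Definition step c (y z : 'rV[R]_m) (l : R) := 0 < l /\ forall t, 0 <= t <= 1 ->
  chart_img c (seg y z t) /\
  ((z - y) *m gram g c (chart_inv c (seg y z t)) *m (z - y)^T) 0 0 <= l ^+ 2.

(** The last index bounds the length from above, and a constant segment is a step for every positive
    bound. The bound can thus be increased freely, and chains need neither a parametrization nor an
    integral. *)
Inductive chain : M -> M -> R -> Prop :=
| chain_step c y z l : step c y z l -> chain (chart_inv c y) (chart_inv c z) l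
| chain_cat x y z k l : chain x y k -> chain y z l -> chain x z (k + l).

Lemma step_sym c y z l : step c y z l -> step c z y l.
Proof.
move=> [l0 H]; split=> // t /andP[t0 t1]; rewrite segC.
have [|h1 h2] := H (1 - t); first by apply/andP; split; lra.
by split=> //; rewrite -(opprB z y) -scaleN1r quad_formZ expr2 mulrNN !mul1r.
Qed.

Lemma chain_sym x y l : chain x y l -> chain y x l.
Proof.
elim=> [c u v k /step_sym|a b d k l' _ ka _ lb]; first exact: chain_step.
by rewrite addrC; exact: chain_cat lb ka.
Qed.

Lemma chain_gt0 x y l : chain x y l -> 0 < l.
Proof. by elim=> [c u v k []//|a b d k l' _ k0 _ l0]; rewrite addr_gt0. Qed.

Lemma chain_refl x l : 0 < l -> chain x x l.
Proof.
move=> l0; have cx := chart_at_dom x; rewrite -{1 2}(chart_mapK cx).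
apply: chain_step; split=> // t _; rewrite /seg subrr scaler0 addr0; split.
  exact: chart_img_map.
by rewrite mul0mx mul0mx mxE sqr_ge0.
Qed.

Lemma chain_mono x y k l : chain x y k -> k <= l -> chain x y l.
Proof.
move=> xy; rewrite le_eqVlt => /orP[/eqP<-//|kl].
by rewrite -(subrKC k l); apply: chain_cat xy (chain_refl _ _); rewrite subr_gt0.
Qed.

Lemma step_sub c y z l a b : step c y z l -> 0 <= a -> a < b -> b <= 1 ->
  step c (seg y z a) (seg y z b) ((b - a) * l).
Proof.
move=> [l0 H] a0 ab b1; split=> [|t /andP[t0 t1]]; first by rewrite mulr_gt0 ?subr_gt0.
rewrite seg_seg segB quad_formZ.
have [|h1 h2] := H (a + t * (b - a)).
  have ba : 0 <= b - a by rewrite subr_ge0 ltW.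
  rewrite addr_ge0 ?mulr_ge0//= (le_trans (_ : _ <= b))//.
  by rewrite -lerBrDl ler_piMl.
by split=> //; rewrite exprMn ler_wpM2l ?sqr_ge0.
Qed.

(** The step containing the cut is divided in proportion to its bound. Cutting at any prescribed
    length is the length-space property used for compactness of balls. *)
Lemma chain_split x y l s : chain x y l -> 0 < s < l ->
  exists2 z, chain x z s & chain z y (l - s).
Proof.
move=> xy; elim: xy s => [c u v k kS|a b d k l' ak IHk lb IHl] s /andP[s0 sl].
  have k0 : 0 < k by case: kS.
  have q0 : 0 < s / k by rewrite divr_gt0.
  have q1 : s / k < 1 by rewrite ltr_pdivrMr// mul1r.
  have kE : s / k * k = s by rewrite divfK// gt_eqF.
  exists (chart_inv c (seg u v (s / k))).
    have := step_sub kS (lexx 0) q0 (ltW q1); rewrite seg0 subr0 kE; exact: chain_step.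
  have := step_sub kS (ltW q0) q1 (lexx 1); rewrite seg1 mulrBl mul1r kE; exact: chain_step.
have [sk|ks|->] := ltgtP s k.
- have [|z z1 z2] := IHk s; first by rewrite s0.
  by exists z => //; rewrite addrAC; exact: chain_cat z2 lb.
- have [|z z1 z2] := IHl (s - k); first by rewrite subr_gt0 ks ltrBlDl.
  by exists z; [rewrite -(subrKC k s); exact: chain_cat ak z1|rewrite (_ : _ - _ = l' - (s - k)) //; ring].
- by exists b => //; rewrite addrC addKr.
Qed.

(** The Gram matrix is bounded on a compact cube, so the distance is at most a multiple of the
    coordinate distance. The opposite comparison comes from bump functions. *)
Lemma local_chain c x : chart_dom c x -> exists r Lam, [/\ 0 < r, 0 < Lam,
  forall y, `|y - chart_map c x| <= r -> chart_img c y &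
  forall y z l, `|y - chart_map c x| <= r -> `|z - chart_map c x| <= r ->
    0 < l -> Lam * `|y - z| <= l -> chain (chart_inv c y) (chart_inv c z) l].
Proof.
move=> cx; have [r r0 Hr] := chart_cube cx (@filterT _ (nbhs x) _).
have [|B B0 HB] := compact_entry_bound (@closed_cube_compact (chart_map c x) r)
    (A := fun y => gram g c (chart_inv c y)).
  by move=> y i j /= yr; apply: chart_gram_continuous; have [] := Hr y yr.
exists r, B; split=> // [y /Hr[]//|y z l yr zr l0 Bl]; apply: chain_step; split=> // t t01.
have sr := seg_cube t01 yr zr; split; first by have [] := Hr _ sr.
apply: le_trans (HB _ _ sr) _; rewrite distrC -exprMn ler_sqr ?nnegrE ?mulr_ge0// ltW//.
Qed.

End chains.

Section chain_distance.
Context {R : realType} {m : nat} {M : smooth_manifold R m} (g : riemannian_metric M).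
Implicit Types (c d : chart M) (f h : M -> R).
Local Notation chain := (chain g).

Lemma chain_nbhs (x : M) e : 0 < e -> \forall z \near x, chain x z e.
Proof.
move=> e0; have cx := chart_at_dom x; set c := chart_at x in cx.
have [r [Lam [r0 L0 _ H]]] := local_chain g cx.
have s0 : 0 < Num.min r (e / Lam) by rewrite lt_min r0 divr_gt0.
have H1 : \forall z \near x, `|chart_map c x - chart_map c z| <= Num.min r (e / Lam).
  by have /cvgrPdist_le := chart_map_continuous cx; apply.
have H2 : \forall z \near x, chart_dom c z.
  by apply: open_nbhs_nbhs; split => //; exact: chart_dom_open.
move: H1 H2; apply: filterS2 => z; rewrite le_min => /andP[zr zL] cz.
rewrite -(chart_mapK cx) -(chart_mapK cz); apply: H => //.
- by rewrite subrr normr0 ltW.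
- by rewrite distrC.
- by rewrite mulrC -ler_pdivlMr.
Qed.

(** The points reachable from [x] form an open set, and so do the others; connectedness
    concludes. *)
Lemma chain_connected (x y : M) : exists l, chain x y l.
Proof.
pose B := [set y | exists l, chain x y l].
have N (z z' : M) : B z -> chain z z' 1 -> B z' by move=> [l xz] zz'; exists (l + 1); exact: chain_cat xz zz'.
have oB : open B.
  by rewrite openE => z Bz; apply: filterS (chain_nbhs z ltr01) => z'; exact: N.
have cB : closed B.
  rewrite -(setCK B); apply: open_closedC; rewrite openE => z Bz.
  by apply: filterS (chain_nbhs z ltr01) => z' zz' Bz'; apply: Bz; apply: N Bz' (chain_sym zz').
suff : B y by [].
have -> : B = setT; last by [].
apply: (@manifold_connected _ _ M B).
- by exists x, 1; exact: chain_refl.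
- by exists B => //; rewrite setTI.
- by exists B => //; rewrite setTI.
Qed.

(** The distance as a real number. Its metric properties come from operations on chains; [distE]
    identifies it with the infimum of the lengths of curves. *)
Definition dd (x y : M) : R := inf [set l | chain x y l].

Lemma dd_le x y l : chain x y l -> dd x y <= l.
Proof. by move=> xy; apply: ge_inf => //; exists 0 => k /chain_gt0/ltW. Qed.

Lemma dd_lt x y l : dd x y < l -> chain x y l.
Proof.
move=> xyl; have [|k xk kl] := inf_lt _ xyl; last exact: chain_mono xk (ltW kl).
by have [k xk] := chain_connected x y; exists k.
Qed.

Lemma dd_ge0 x y : 0 <= dd x y.
Proof.
apply: lb_le_inf; first by have [k xk] := chain_connected x y; exists k.
by move=> k /chain_gt0/ltW.
Qed.

Lemma dd_sym x y : dd x y = dd y x.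
Proof. by congr inf; apply/seteqP; split=> l /chain_sym. Qed.

Lemma dd_triangle x y z : dd x z <= dd x y + dd y z.
Proof.
apply/ler_addgt0Pr => e e0.
have e2 : 0 < e / 2 by rewrite divr_gt0.
have h1 : chain x y (dd x y + e / 2) by apply: dd_lt; rewrite ltrDl.
have h2 : chain y z (dd y z + e / 2) by apply: dd_lt; rewrite ltrDl.
by apply: le_trans (dd_le (chain_cat h1 h2)) _; rewrite addrACA -splitr.
Qed.

Lemma dd_refl x : dd x x = 0.
Proof.
apply/eqP; rewrite eq_le dd_ge0 andbT; apply/ler_addgt0Pr => e e0; rewrite add0r.
exact/dd_le/chain_refl.
Qed.

Lemma dd_lipschitz x y z : `|dd x y - dd x z| <= dd y z.
Proof.
rewrite ler_norml; apply/andP; split.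
  by rewrite lerNl opprB lerBlDl dd_triangle.
by rewrite lerBlDl (dd_sym y z) dd_triangle.
Qed.

Lemma inner_grad_partials c f x : chart_dom c x -> mdiff f x ->
  coinner g x (covector f x) (covector f x) = cometric g c x (partials c f x) (partials c f x).
Proof.
move=> cx df; rewrite -inner_grad_co// (inner_gradE g cx)//; exact/(mdiff_in f cx).
Qed.

Lemma dotrow_partials_le c f x (v : 'rV[R]_m) C l : chart_dom c x -> mdiff f x -> 0 <= C -> 0 <= l ->
  coinner g x (covector f x) (covector f x) <= C ^+ 2 ->
  (v *m gram g c x *m v^T) 0 0 <= l ^+ 2 -> `|dotrow (partials c f x) v| <= C * l.
Proof.
move=> cx df C0 l0; rewrite (inner_grad_partials cx df) => hC hl.
rewrite -ler_sqr ?nnegrE ?mulr_ge0// -normrX ger0_norm ?sqr_ge0//.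
apply: le_trans (quad_form_cauchy _ _ (gram_sym g cx) (gram_unit g cx) _) _.
  by move=> w; exact: gram_ge0.
by rewrite exprMn; apply: ler_pM => //; [exact: cometric_ge0|exact: gram_ge0].
Qed.

(** On one step, Cauchy-Schwarz for the dual metric bounds the derivative of [f] along the segment
    by [C] times the speed bound, and the mean value theorem applies. *)
Lemma chain_mvt f C x y l : 0 <= C ->
  (forall x, mdiff f x /\ coinner g x (covector f x) (covector f x) <= C ^+ 2) ->
  chain x y l -> `|f x - f y| <= C * l.
Proof.
move=> C0 H; elim=> [c u v k [k0 kS]|a b d k l' _ ak _ bl]; last first.
  by rewrite mulrDr (le_trans (ler_distD (f b) _ _))// lerD.
pose F := f \o chart_inv c.
have D (t : R) : 0 <= t <= 1 -> is_derive t 1 (fun s : R => F (u + s *: (v - u)))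
    (dotrow (partials c f (chart_inv c (seg u v t))) (v - u)).
  move=> /kS[cs _]; have dom := chart_inv_dom cs.
  have [df _] := H (chart_inv c (seg u v t)).
  have := (mdiff_in f dom).2 df; rewrite /diff_in chart_invK// => dF.
  rewrite /partials -[chart_map c _]/(chart_map c _) chart_invK// -(diff_dotrow _ dF) -deriveE//.
  by apply: is_derive_line; exact: diff_derivable.
have [||t tI E] := @MVT R (fun s : R => F (u + s *: (v - u)))
  (fun t => dotrow (partials c f (chart_inv c (seg u v t))) (v - u)) 0 1 ltr01.
- move=> t tI; by move: tI; rewrite in_itv/= => /andP[/ltW t0 /ltW t1]; apply: D; rewrite t0.
- apply: derivable_within_continuous => t; rewrite in_itv/= => /D[]//.
move: tI; rewrite in_itv/= => /andP[/ltW t0 /ltW t1].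
have t01 : 0 <= t <= 1 by rewrite t0.
have := E; rewrite scale1r scale0r addr0 subrKC subr0 mulr1 /F/= distrC => ->.
have [cs hs] := kS _ t01.
by have [df dC] := H (chart_inv c (seg u v t)); apply: dotrow_partials_le (ltW k0) dC hs => //; exact: chart_inv_dom.
Qed.

Lemma dd_mvt f C x y : 0 <= C ->
  (forall x, mdiff f x /\ coinner g x (covector f x) (covector f x) <= C ^+ 2) ->
  `|f x - f y| <= C * dd x y.
Proof.
move=> C0 H; apply/ler_addgt0Pr => e e0.
have C1 : 0 < C + 1 by rewrite ltr_wpDl.
have := @dd_lt x y (dd x y + e / (C + 1)); rewrite ltrDl divr_gt0// => /(_ isT).
move=> /(chain_mvt C0 H)/le_trans; apply; rewrite mulrDr lerD2l mulrCA ger_pMr//.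
by rewrite ler_pdivrMr// mul1r lerDl.
Qed.

End chain_distance.

(** * Functions supported in a chart cube *)

Section chart_extension.
Context {R : realType} {m : nat} {M : smooth_manifold R m} (g : riemannian_metric M).
Implicit Types (c d : chart M) (f : M -> R) (h : 'rV[R]_m -> R).

Definition chart_ext c h (x : M) : R :=
  if `[< chart_dom c x >] then h (chart_map c x) else 0.

Lemma chart_ext_dom c h x : chart_dom c x -> chart_ext c h x = h (chart_map c x).
Proof. by move=> cx; rewrite /chart_ext asboolT. Qed.

Definition chart_closed_cube c (q : 'rV[R]_m) r : set M :=
  chart_inv c @` [set y | `|y - q| <= r].

Lemma smooth_c_mdiff f x : smooth_c f -> mdiff f x.
Proof.
move=> [_ H]; have ax := chart_at_dom x.
exact: (C1_differentiable (@open_chart_img _ _ M (chart_at x)) (H _ 1%N) (chart_img_map ax)).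
Qed.

Section cube.
Variables (c : chart M) (q : 'rV[R]_m) (r : R).
Hypothesis qr : forall y, `|y - q| <= r -> chart_img c y.

Lemma chart_closed_cube_compact : compact (chart_closed_cube c q r).
Proof.
apply: continuous_compact; last exact: closed_cube_compact.
apply: continuous_in_subspaceT => y; rewrite inE /= => /qr; exact: chart_inv_continuous_at.
Qed.

Lemma chart_closed_cube_closed : closed (chart_closed_cube c q r).
Proof. exact: (compact_closed (@manifold_hausdorff _ _ M) chart_closed_cube_compact). Qed.

Lemma chart_closed_cubeP x : chart_closed_cube c q r x <->
  chart_dom c x /\ `|chart_map c x - q| <= r.
Proof.
split=> [[y yr <-]|[cx xr]]; last by exists (chart_map c x) => //; rewrite chart_mapK.
by have cy := qr yr; split; [exact: chart_inv_dom|rewrite chart_invK].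
Qed.

Lemma open_not_cube : open (~` chart_closed_cube c q r).
Proof. by apply: closed_openC; exact: chart_closed_cube_closed. Qed.

Section extension.
Variable h : 'rV[R]_m -> R.
Hypothesis h0 : forall y, r <= `|y - q| -> h y = 0.

Lemma chart_ext0 x : ~ chart_closed_cube c q r x -> chart_ext c h x = 0.
Proof.
move=> nx; rewrite /chart_ext; case: asboolP => // cx; apply: h0; rewrite leNgt; apply/negP => xr.
by apply: nx; apply/chart_closed_cubeP; split=> //; exact: ltW.
Qed.

Lemma chart_ext_supp x : chart_ext c h x != 0 -> chart_closed_cube c q r x.
Proof. by move=> /eqP hx; apply: contrapT => /chart_ext0. Qed.

Hypothesis hs : smooth_on setT h.

(** Inside the chart domain, smoothness is that of the transition maps. At the remaining points the
    function vanishes nearby, because the closed cube, compact in a Hausdorff space, is closed in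
    the whole manifold. *)
Lemma chart_ext_smooth : smooth_c (chart_ext c h).
Proof.
split.
  apply: subclosed_compact chart_closed_cube_compact _; first exact: closed_closure.
  by move/closure_id : chart_closed_cube_closed => ->; apply: closureS; exact: chart_ext_supp.
move=> d k; apply/Ck_onP => y dy; have [cy|ncy] := pselect (chart_dom c (chart_inv d y)).
  have oV := @open_overlap _ _ M d c.
  apply: (@Ck_on_sub _ _ _ (chart_map d @` (chart_dom d `&` chart_dom c))).
    by move=> _ ->; exists (chart_inv d y); [split=> //; exact: chart_inv_dom|rewrite chart_invK].
  apply: (@Ck_on_ext _ _ _ _ (h \o transition d c)) => //.
    by move=> _ [x [dx cx] <-]; rewrite /= /transition /= chart_mapK// chart_ext_dom.
  by apply: (Ck_on_comp oV openT _ _ (hs k)) => // i; exact: (chart_transition_smooth d c i k).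
apply: (@Ck_on_sub _ _ _ (chart_map d @` (chart_dom d `&` ~` chart_closed_cube c q r))).
  move=> _ ->; exists (chart_inv d y); last by rewrite chart_invK.
  by split; [exact: chart_inv_dom|move=> /chart_closed_cubeP[]].
apply: (@Ck_on_ext _ _ _ _ (cst 0)); [exact: open_chart_map_image open_not_cube| |exact: Ck_on_cst].
by move=> _ [x [dx cx] <-]; rewrite /= chart_mapK// chart_ext0.
Qed.

End extension.

(** [C] bounds the inverse Gram matrix on the cube and is independent of [h], so one gradient bound
    serves a whole sequence of functions. *)
Lemma chart_ext_grad : exists2 C, 0 < C & forall h D, 0 <= D ->
  (forall y, r <= `|y - q| -> h y = 0) -> smooth_on setT h ->
  (forall y j, `|'D_(delta_mx 0 j) h y| <= D) ->
  forall x, mdiff (chart_ext c h) x /\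
    coinner g x (covector (chart_ext c h) x) (covector (chart_ext c h) x) <= (C * D) ^+ 2.
Proof.
have [|C C0 HC] := compact_entry_bound (@closed_cube_compact R m q r)
  (A := fun y => invmx (gram g c (chart_inv c y))).
  by move=> y i j /qr; exact: chart_cogram_continuous.
exists C => // h D D0 h0 hs hD x; split; first exact/smooth_c_mdiff/chart_ext_smooth.
have dx : mdiff (chart_ext c h) x by exact/smooth_c_mdiff/chart_ext_smooth.
have [xK|xK] := pselect (chart_closed_cube c q r x); last first.
  have N : \forall z \near x, cst 0 z = chart_ext c h z.
    apply: filterS (open_nbhs_nbhs (conj open_not_cube xK)) => z zK.
    by rewrite chart_ext0.
  have [d0 v0] := mdiff_cst (M := M) 0 x; have [_ ->] := mdiff_near N d0.
  by rewrite v0 /coinner /cometric !mul0mx mxE sqr_ge0.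
have /chart_closed_cubeP[cx xr] := xK.
rewrite (inner_grad_partials g cx dx) /cometric.
have E : partials c (chart_ext c h) x = \row_j 'D_(delta_mx 0 j) h (chart_map c x).
  apply/rowP => j; rewrite !mxE; apply: near_eq_derive => /=.
  apply: filterS (open_nbhs_nbhs (conj (@open_chart_img _ _ M c) (chart_img_map cx))) => y cy.
  by rewrite /= chart_ext_dom ?chart_invK//; exact: chart_inv_dom.
have := HC _ (partials c (chart_ext c h) x) xr; rewrite chart_mapK// => /le_trans; apply.
rewrite exprMn ler_wpM2l ?sqr_ge0// ler_sqr ?nnegrE//.
by rewrite E; apply: rV_norm_le => // j; rewrite mxE.
Qed.

End cube.

Lemma manifold_bump (x : M) (U : set M) : nbhs x U -> exists f : M -> R,
  [/\ smooth_c f, forall z, 0 <= f z <= 1, \forall z \near x, f z = 1,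
      forall z, f z != 0 -> U z &
      exists2 C, 0 < C & forall y z, `|f y - f z| <= C * dd g y z].
Proof.
move=> Ux; have cx := chart_at_dom x; set c := chart_at x in cx.
have [r r0 Hr] := chart_cube cx Ux; pose q := chart_map c x.
have qr y : `|y - q| <= r -> chart_img c y by move=> /Hr[].
pose h := cube_bump q r.
have h0 y : r <= `|y - q| -> h y = 0 by exact: cube_bump0.
have hs : smooth_on setT h by apply: cube_bump_smooth; exact: openT.
exists (chart_ext c h); split.
- by apply: (chart_ext_smooth qr).
- move=> z; rewrite /chart_ext; case: asboolP => _; last by rewrite lexx ler01.
  by rewrite cube_bump_ge0 cube_bump_le1.
- have H1 : \forall z \near x, `|chart_map c x - chart_map c z| <= r / 2.
    by have /cvgrPdist_le := chart_map_continuous cx; apply; rewrite divr_gt0.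
  have H2 : \forall z \near x, chart_dom c z.
    by apply: open_nbhs_nbhs; split => //; exact: chart_dom_open.
  move: H1 H2; apply: filterS2 => z zr cz.
  by rewrite chart_ext_dom// /h cube_bump1// distrC.
- move=> z /(chart_ext_supp qr h0)/(chart_closed_cubeP qr)[cz /Hr[_]].
  by rewrite chart_mapK.
- have [C C0 HC] := chart_ext_grad qr.
  have [|D D0 HD] := C1_supported_bounded (B := `|q| + r) (hs 1).
    move=> y yB; apply: h0; have := ler_normD (y - q) q; rewrite subrK.
    by move: yB; lra.
  exists (C * (D + 1)) => [|y z]; first by rewrite mulr_gt0// ltr_wpDl.
  apply: dd_mvt; first by rewrite mulr_ge0 ?addr_ge0// ltW.
  move=> w; apply: HC => // [|u j]; first by rewrite addr_ge0.
  by have [_ /(_ j)[h1 _]] := HD u; apply: (le_trans h1); rewrite lerDl.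
Qed.

(** A bump function supported in [U] and equal to 1 at [x] has a Lipschitz constant [C] for [dd]; it
    cannot drop to 0 within distance less than [C^-1]. Together with [nbhs_dd], the distance induces
    the manifold topology. *)
Lemma dd_nbhs (x : M) (U : set M) : nbhs x U -> exists2 e, 0 < e & forall y, dd g x y < e -> U y.
Proof.
move=> /manifold_bump[f [_ _ /nbhs_singleton f1 fU [C C0 HC]]].
exists C^-1 => [|y xy]; first by rewrite invr_gt0.
apply: fU; apply/eqP => fy0; have := HC x y; rewrite f1 fy0 subr0 normr1 leNgt => /negP; apply.
by rewrite mulrC -ltr_pdivlMr// div1r.
Qed.

Lemma nbhs_dd (x : M) e : 0 < e -> \forall z \near x, dd g x z < e.
Proof.
move=> e0; have e2 : 0 < e / 2 by rewrite divr_gt0.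
apply: filterS (chain_nbhs g x e2) => z /dd_le/le_lt_trans; apply.
by rewrite ltr_pdivrMr// mulr_natr mulr2n ltrDl.
Qed.

End chart_extension.

(** * Speed and length of curves *)

Section curves.
Context {R : realType} {m : nat} {M : smooth_manifold R m} (g : riemannian_metric M).
Implicit Types (c d : chart M) (gamma delta : R -> M) (t a b : R).
Local Notation mu := (@lebesgue_measure R).

Definition speed gamma t : R := Num.sqrt (inner g (gamma t) (velocity gamma t) (velocity gamma t)).

Lemma near_chart_dom c delta t : {for t, continuous delta} -> chart_dom c (delta t) ->
  \forall s \near t, chart_dom c (delta s).
Proof.
by move=> dc cd; apply: dc; apply: open_nbhs_nbhs; split=> //; exact: chart_dom_open.
Qed.

Lemma speed_chart c delta t : {for t, continuous delta} -> chart_dom c (delta t) ->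
  derivable (chart_map c \o delta) t 1 ->
  speed delta t = Num.sqrt ((derive1 (chart_map c \o delta) t *m gram g c (delta t) *m
    (derive1 (chart_map c \o delta) t)^T) 0 0).
Proof.
move=> dc cd D; have ad := chart_at_dom (delta t).
have dT : differentiable (chart_map c \o delta) t by exact/derivable1_diffP.
have N : {near t, transition c (chart_at (delta t)) \o (chart_map c \o delta) =1
                  chart_map (chart_at (delta t)) \o delta}.
  by apply: filterS (near_chart_dom dc cd) => s cs; rewrite /= /transition /= chart_mapK.
have dF := transition_differentiable cd ad.
have [dG E] := near_eq_diff_comp (b := chart_map c (delta t)) erefl N dT dF.
have vE : velocity delta t = derive1 (chart_map c \o delta) t *m transition_jac c (chart_at (delta t)) (delta t).
  rewrite /velocity derive1E' // E -derive1E' // -deriveE// deriveEjacobian//.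
rewrite /speed /inner vE; congr Num.sqrt.
by rewrite (gram_transition g cd ad) trmx_mul !mulmxA.
Qed.

Lemma near_eq_speed gamma delta t : {near t, gamma =1 delta} -> speed gamma t = speed delta t.
Proof.
move=> N; have E := nbhs_singleton N; rewrite /speed /velocity E.
suff -> : derive1 (chart_map (chart_at (delta t)) \o gamma) t =
  derive1 (chart_map (chart_at (delta t)) \o delta) t by [].
by rewrite !derive1E; apply: near_eq_derive; apply: filterS N => s /= ->.
Qed.

Lemma gram_continuous c i j x : chart_dom c x -> {for x, continuous (fun z => gram g c z i j)}.
Proof.
move=> cx; rewrite /prop_for /continuous_at -{2}(chart_mapK cx).
apply: cvg_trans (_ : gram g c (chart_inv c (chart_map c z)) i j @[z --> x] --> _).
  apply: near_eq_cvg; apply: filterS (open_nbhs_nbhs (conj (@chart_dom_open _ _ M c) cx)) => z cz.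
  by rewrite chart_mapK.
apply: (@continuous_comp _ _ _ (chart_map c) (fun y => gram g c (chart_inv c y) i j)).
  exact: chart_map_continuous.
exact/chart_gram_continuous/chart_img_map.
Qed.

(** The velocity is expressed in [chart_at (gamma t)], which may jump with [t]. The norm does not
    depend on the chart, so near [t] it is computed in one fixed chart. *)
Lemma speed_continuous (I : set R) delta t : open I -> C1_curve_on I delta -> I t ->
  {for t, continuous (speed delta)}.
Proof.
move=> oI H It; have [dc Ht] := H t It; have ad := chart_at_dom (delta t).
set c := chart_at (delta t) in ad; have [D cD] := Ht c ad.
pose v s := derive1 (chart_map c \o delta) s.
pose F s := Num.sqrt ((v s *m gram g c (delta s) *m (v s)^T) 0 0).
have N : \forall s \near t, F s = speed delta s.
  have h1 := near_chart_dom dc ad; have h2 : \forall s \near t, I s by exact: open_nbhs_nbhs.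
  move: h1 h2; apply: filterS2 => s cs Is; have [dcs Hs] := H s Is.
  by have [Ds _] := Hs c cs; exact: (esym (speed_chart dcs cs Ds)).
rewrite /prop_for /continuous_at -(nbhs_singleton N).
apply: cvg_trans (near_eq_cvg N) _.
apply: (@continuous_comp _ _ _ (fun s => (v s *m gram g c (delta s) *m (v s)^T) 0 0) Num.sqrt); last exact: sqrt_continuous.
rewrite (_ : (fun s => _) = fun s => \sum_j \sum_i v s 0 i * gram g c (delta s) i j * v s 0 j); last first.
  by apply/funext => s; rewrite quad_formE.
have vc i : {for t, continuous (fun s => v s 0 i)}.
  by apply: (@continuous_comp _ _ _ v (fun w => w 0 i)) => //; exact: coord_continuous.
apply: continuous_sum_at => j; apply: continuous_sum_at => i.
apply: continuousM; [apply: continuousM|] => //.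
apply: (@continuous_comp _ _ _ delta (fun x => gram g c x i j)) => //.
exact: gram_continuous.
Qed.

(** The partition clause of [piecewise_C1], recursive in the partition and with an arbitrary
    starting time, so that arcs can be concatenated. *)
Fixpoint arc gamma a (s : seq R) : Prop :=
  if s is b :: s' then
    a < b /\ (exists (e : R) delta, [/\ 0 < e, C1_curve_on `]a - e, b + e[ delta &
      forall t, a <= t <= b -> gamma t = delta t]) /\ arc gamma b s'
  else True.

Lemma arc_le gamma a s : arc gamma a s -> a <= last a s.
Proof.
by elim: s a => [|b s IH] a //= [ab [_ /IH]]; apply: le_trans; exact: ltW.
Qed.

Lemma arcP gamma a (s : seq R) : path <%O a s ->
  (forall k, (k < size s)%N ->
      let t0 := nth 0 (a :: s) k in let t1 := nth 0 s k in
      exists (e : R) (delta : R -> M),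
        [/\ 0 < e, C1_curve_on `]t0 - e, t1 + e[ delta &
            forall t, t0 <= t <= t1 -> gamma t = delta t]) <-> arc gamma a s /\ path <%O a s.
Proof.
move=> ps; split.
  move=> H; split=> //; elim: s a ps H => [|b s IH] a //= /andP[ab bs] H.
  by do 2?split=> //; [exact: (H 0%N)|apply: IH => // k ks; exact: (H k.+1)].
move=> [+ _]; elim: s a ps => [|b s IH] a //= /andP[ab bs] [_ [H1 H2]] [|k] //= ks.
exact: (IH b bs H2 k ks).
Qed.

Lemma arc_path gamma a s : arc gamma a s -> path <%O a s.
Proof. by elim: s a => [|b s IH] a //= [-> [_ /IH]]. Qed.

Lemma arc_ext gamma gamma' a s : arc gamma a s ->
  (forall t, a <= t <= last a s -> gamma t = gamma' t) -> arc gamma' a s.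
Proof.
elim: s a => [|b s IH] a //= [ab [[e [delta [e0 dC gd]]] bs]] E.
have bl := arc_le bs; split=> //; split.
  exists e, delta; split=> // t /andP[h1 h2]; rewrite -E ?h1 ?(le_trans h2)//.
  by apply: gd; rewrite h1.
by apply: IH => // t /andP[h1 h2]; apply: E; rewrite h2 (le_trans (ltW ab)).
Qed.

Lemma arc_cat gamma a s1 s2 : arc gamma a s1 -> arc gamma (last a s1) s2 -> arc gamma a (s1 ++ s2).
Proof.
by elim: s1 a => [|b s IH] a //= [ab [H bs]] H2; split=> //; split=> //; exact: IH.
Qed.

Lemma piece_near gamma delta a b t : (forall t, a <= t <= b -> gamma t = delta t) -> a < t < b ->
  {near t, gamma =1 delta}.
Proof.
move=> gd /andP[h1 h2]; have : \forall s \near t, s \in `]a, b[ by apply: near_in_itvoo; rewrite in_itv/= h1.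
by apply: filterS => s; rewrite in_itv/= => /andP[? ?]; apply: gd; rewrite !ltW.
Qed.

Lemma piece_measurable e delta a b : 0 < e -> C1_curve_on `]a - e, b + e[ delta ->
  measurable_fun `]a, b[ (speed delta).
Proof.
move=> e0 dC; apply: subspace_continuous_measurable_fun; first exact: measurable_itv.
apply: continuous_in_subspaceT => t; rewrite inE/= in_itv/= => /andP[at_ tb].
by apply: (speed_continuous (interval_open _ _) dC) => //; rewrite /= in_itv/=; apply/andP; split; lra.
Qed.

Lemma piece_speed_measurable gamma e delta a b : 0 < e -> C1_curve_on `]a - e, b + e[ delta ->
  (forall t, a <= t <= b -> gamma t = delta t) -> measurable_fun `]a, b[ (speed gamma).
Proof.
move=> e0 dC gd; apply: eq_measurable_fun (piece_measurable e0 dC) => t.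
rewrite inE/= in_itv/= => tab; apply/esym/near_eq_speed; exact: piece_near gd tab.
Qed.

Lemma arc_measurable gamma a s : arc gamma a s ->
  measurable_fun `[a, last a s] (speed gamma).
Proof.
elim: s a => [|b s IH] a /=; first by move=> _; rewrite set_itv1; exact: measurable_fun_set1.
move=> [ab [[e [delta [e0 dC gd]]] bs]].
have -> : `[a, last b s]%classic = `[a, b] `|` `[b, last b s].
  have bl := arc_le bs; apply/seteqP; split=> t /=; rewrite !in_itv/=.
    by move=> /andP[-> ->]; rewrite andbT/=; case: (leP t b) => [|/ltW]; [left|right].
  by move=> [/andP[-> /le_trans->]|/andP[/(le_trans (ltW ab))-> ->]].
apply/measurable_funU; [exact: measurable_itv|exact: measurable_itv|split; last exact: IH].
by apply: measurable_fun_itv_cc; exact: piece_speed_measurable e0 dC gd.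
Qed.

Lemma arc_integral_cons gamma a b s : arc gamma a (b :: s) ->
  (\int[mu]_(t in `[a, last b s]) (speed gamma t)%:E =
   \int[mu]_(t in `[a, b]) (speed gamma t)%:E +
   \int[mu]_(t in `[b, last b s]) (speed gamma t)%:E)%E.
Proof.
move=> H; have mf := arc_measurable H; case: H => ab [_ bs]; have bl := arc_le bs.
have mfE : measurable_fun `[a, last b s] (EFin \o speed gamma) by exact/measurable_EFinP.
have E : `[a, last b s]%classic = `[a, b] `|` `]b, last b s].
  apply/seteqP; split=> t /=; rewrite !in_itv/=.
    by move=> /andP[-> ->]; rewrite andbT/=; case: (leP t b) => h; [left|right].
  by move=> [/andP[-> /le_trans->]|/andP[/ltW/(le_trans (ltW ab))-> ->]].
rewrite E ge0_integral_setU//.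
- congr (_ + _)%E; apply: integral_itv_obnd_cbnd.
  by apply: measurable_funS mfE => //; rewrite E; exact: subsetUr.
- by rewrite -E.
- by move=> t _; rewrite lee_fin sqrtr_ge0.
- apply/disj_setPS => t [] /=; rewrite !in_itv/= => /andP[_ h1] /andP[h2 _].
  by move: h2; rewrite ltNge h1.
Qed.

(** The bound on the speed is asked only off the partition points, where a broken curve has no
    two-sided derivative; these finitely many times do not count in the integral. *)
Lemma arc_length_le gamma a s (L : R) : 0 <= L -> arc gamma a s ->
  (forall t, a < t < last a s -> t \notin s -> speed gamma t <= L) ->
  (\int[mu]_(t in `[a, last a s]) (speed gamma t)%:E <= (L * (last a s - a))%:E)%E.
Proof.
move=> L0; elim: s a => [|b s IH] a.
  by move=> _ _ /=; rewrite set_itv1 integral_set1 subrr mulr0.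
move=> H SL; rewrite /= (arc_integral_cons H).
case: H => ab [[e [delta [e0 dC gd]]] bs]; have bl := arc_le bs.
have -> : L * (last b s - a) = L * (b - a) + L * (last b s - b) by ring.
rewrite EFinD; apply: leeD; last first.
  apply: IH => // t /andP[t1 t2] ts; apply: SL; first by rewrite /= t2 (lt_trans ab).
  by rewrite inE negb_or ts gt_eqF.
have mf := piece_speed_measurable e0 dC gd.
rewrite integral_itv_bndoo; last exact/measurable_EFinP.
apply: le_trans (_ : \int[mu]_(t in `]a, b[) (cst L%:E) t <= _)%E.
  apply: ge0_le_integral => //.
  - by move=> t _; rewrite lee_fin sqrtr_ge0.
  - exact/measurable_EFinP.
  - move=> t; rewrite /= in_itv/= => /andP[t1 t2]; rewrite lee_fin; apply: SL.
      by rewrite t1 (lt_le_trans t2).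
    rewrite inE negb_or lt_eqF//=; apply/negP => ts.
    have := arc_path bs; rewrite lt_path_sortedE => /andP[/allP/(_ _ ts) + _].
    by rewrite ltNge (ltW t2).
rewrite integral_cst; last exact: measurable_itv.
rewrite le_eqVlt; apply/orP; left; apply/eqP; rewrite EFinM; congr (_ * _)%E.
by apply: etrans (lebesgue_measure_itv _) _; rewrite /= lte_fin ab -EFinB.
Qed.

Lemma arc_continuous gamma a s : arc gamma a s -> {within `[a, last a s], continuous gamma}.
Proof.
elim: s a => [|b s IH] a /=; first by move=> _; rewrite set_itv1; exact: continuous_subspace1.
move=> [ab [[e [delta [e0 dC gd]]] bs]].
have -> : `[a, last b s]%classic = `[a, b] `|` `[b, last b s].
  have bl := arc_le bs; apply/seteqP; split=> t /=; rewrite !in_itv/=.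
    by move=> /andP[-> ->]; rewrite andbT/=; case: (leP t b) => [|/ltW]; [left|right].
  by move=> [/andP[-> /le_trans->]|/andP[/(le_trans (ltW ab))-> ->]].
apply: withinU_continuous; [exact: interval_closed|exact: interval_closed| |exact: IH].
apply: (@subspace_eq_continuous _ _ _ delta).
  by move=> t; rewrite inE/= in_itv/= => /gd.
apply: continuous_in_subspaceT => t; rewrite inE/= in_itv/= => /andP[h1 h2].
by have [|] := dC t _ => //; rewrite /= in_itv/=; apply/andP; split; lra.
Qed.

End curves.

(** The set of [t] with [h t <= h a] contains its supremum by the comparison to the left, and the
    comparison to the right shows that this supremum is [b]. *)
Lemma locally_nonincreasing (R : realType) (h : R -> R) (a b : R) : a <= b ->
  (forall t, a <= t <= b -> \forall s \near t,
     (s <= t -> h t <= h s) /\ (t <= s -> h s <= h t)) -> h b <= h a.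
Proof.
move=> ab H; pose A := [set t | a <= t <= b /\ h t <= h a].
have Aa : A a by rewrite /A /= lexx ab.
have supA : has_sup A by split; [exists a|exists b => t [/andP[]]].
pose T := sup A.
have aT : a <= T by apply: ub_le_sup => //; case: supA.
have Tb : T <= b by apply: ge_sup => [|t [/andP[]]//]; exists a.
have [/= d d0 Hd] := (@nbhs_ballP _ _ _ _).1 (H T (introT andP (conj aT Tb))).
have hT : h T <= h a.
  have [t At tT] : exists2 t, A t & T - d < t by exact: sup_adherent.
  have tT' : t <= T by apply: ub_le_sup => //; case: supA.
  have : ball T d t by rewrite /ball/= ger0_norm ?subr_ge0//; lra.
  by move=> /Hd[/(_ tT') h1 _]; exact: le_trans h1 At.2.
have [Tb'|Tb'] := ltP T b; last by rewrite (_ : b = T)//; apply/eqP; rewrite eq_le Tb'.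
pose s := Num.min b (T + d / 2).
have Ts : T < s by rewrite lt_min Tb' ltrDl divr_gt0.
have sT : s <= T + d / 2 by rewrite ge_min lexx orbT.
have : ball T d s by rewrite /ball/= distrC gtr0_norm ?subr_gt0//; lra.
move=> /Hd[_ /(_ (ltW Ts)) hs].
have : A s by split; [rewrite (le_trans aT (ltW Ts)) ge_min lexx|exact: le_trans hs hT].
by move=> /(ub_le_sup supA.2); rewrite leNgt Ts.
Qed.

Section distance.
Context {R : realType} {m : nat} {M : smooth_manifold R m} (g : riemannian_metric M).
Implicit Types (c d : chart M) (gamma delta : R -> M) (t a b : R).
Local Notation mu := (@lebesgue_measure R).

(** A single chart segment joins the two points. Its direction is [s - t] times a difference
    quotient close to the velocity, and the Gram matrix along it is close to the one at [delta t];
    joint continuity of the quadratic form leaves an error [e]. *)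
Lemma C1_chain (I : set R) delta t e : open I -> C1_curve_on I delta -> I t -> 0 < e ->
  \forall s \near t, s != t -> chain g (delta t) (delta s) ((speed g delta t + e) * `|s - t|).
Proof.
move=> oI H It e0; have [dc Ht] := H t It; have ad := chart_at_dom (delta t).
set c := chart_at (delta t) in ad; have [D cD] := Ht c ad.
pose phi := chart_map c \o delta; pose v := derive1 phi t; pose y0 := phi t.
have y0c : chart_img c y0 by exact: chart_img_map.
pose Q (y w : 'rV[R]_m) := (w *m gram g c (chart_inv c y) *m w^T) 0 0.
have sp : speed g delta t ^+ 2 = Q y0 v.
  rewrite (speed_chart g dc ad D) sqr_sqrtr; last exact: gram_ge0.
  by rewrite /Q /y0 /phi /= chart_mapK.
have sp0 : 0 <= speed g delta t by exact: sqrtr_ge0.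
have NQ : \forall p \near (y0, v), chart_img c p.1 /\ Q p.1 p.2 <= (speed g delta t + e) ^+ 2.
  have h1 : \forall p \near (y0, v), chart_img c p.1.
    by apply: (@cvg_fst _ _ (nbhs y0) (nbhs v)); apply: open_nbhs_nbhs; split=> //; exact: open_chart_img.
  have h2 : {for (y0, v), continuous (fun p : 'rV[R]_m * 'rV[R]_m => Q p.1 p.2)}.
    rewrite (_ : (fun p => _) = fun p : 'rV[R]_m * 'rV[R]_m =>
      \sum_j \sum_i p.2 0 i * gram g c (chart_inv c p.1) i j * p.2 0 j); last first.
      by apply/funext => p; rewrite /Q quad_formE.
    have vc i : {for (y0, v), continuous (fun p : 'rV[R]_m * 'rV[R]_m => p.2 0 i)}.
      by apply: (@continuous_comp _ _ _ snd (fun w : 'rV[R]_m => w 0 i)); [exact: cvg_snd|exact: coord_continuous].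
    apply: continuous_sum_at => j; apply: continuous_sum_at => i.
    apply: continuousM; [apply: continuousM|] => //.
    apply: (@continuous_comp _ _ _ fst (fun y => gram g c (chart_inv c y) i j)); first exact: cvg_fst.
    exact: chart_gram_continuous.
  have h3 : \forall p \near (y0, v), Q p.1 p.2 < (speed g delta t + e) ^+ 2.
    have N : nbhs (Q y0 v) [set u : R | u < (speed g delta t + e) ^+ 2].
      apply: open_nbhs_nbhs; split; first exact: open_lt.
      by rewrite /= -sp ltr_pXn2r ?nnegrE ?addr_ge0// 1?ltW// ltrDl.
    exact: h2 N.
  by apply: filterS2 h1 h3 => p ? /ltW.
have [/= [U V] [/= Uy Vv] UV] := NQ.
have /nbhs_ballP[r /= r0 rU] := Uy.
have dphi : differentiable phi t := (derivable1_diffP phi t).1 D.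
have pc : {for t, continuous phi} := differentiable_continuous dphi.
have n1 : \forall s \near t, `|phi t - phi s| < r by have /cvgrPdist_lt := pc; apply.
have /nbhs_ballP[r' /= r'0 rV] := Vv.
have r'2 : 0 < r' / 2 by rewrite divr_gt0.
have n2 : \forall s \near t, `|phi s - phi t - (s - t) *: v| <= r' / 2 * `|s - t|.
  have /nbhs_ballP[d /= d0 Hd] := differentiable_approx dphi r'2.
  apply/nbhs_ballP; exists d => //= s ts; have := Hd (s - t); rewrite subrK.
  rewrite -ball_normE/= sub0r normrN distrC => /(_ ts).
  rewrite -[in 'd phi t _](mulr1 (s - t)) -[(s - t) * 1]/((s - t) *: (1 : R^o)) linearZ/=.
  by rewrite -derive1E'.
have n3 := near_chart_dom dc ad.
near=> s => st.
have st0 : s - t != 0 by rewrite subr_eq0.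
have nst : 0 < `|s - t| by rewrite normr_gt0.
have cs : chart_dom c (delta s) by near: s; exact: n3.
have -> : delta t = chart_inv c (phi t) by rewrite /phi /= chart_mapK.
have -> : delta s = chart_inv c (phi s) by rewrite /phi /= chart_mapK.
apply: chain_step; split=> [|th /andP[th0 th1]].
  by rewrite mulr_gt0// ltr_wpDl.
pose w := (s - t)^-1 *: (phi s - phi t).
have wE : phi s - phi t = (s - t) *: w by rewrite scalerA divff// scale1r.
have Vw : V w.
  apply: rV; rewrite -ball_normE /= distrC.
  have -> : w - v = (s - t)^-1 *: (phi s - phi t - (s - t) *: v).
    by rewrite scalerBr scalerA mulVf// scale1r.
  rewrite normrZ normfV; apply: (@le_lt_trans _ _ (r' / 2)).
    by rewrite mulrC ler_pdivrMr//; near: s; exact: n2.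
  by rewrite ltr_pdivrMr// mulr_natr mulr2n ltrDl.
have Uy' : U (seg (phi t) (phi s) th).
  apply: rU; rewrite -ball_normE /= /seg opprD addNKr normrN normrZ ger0_norm//.
  apply: (@le_lt_trans _ _ `|phi s - phi t|); first by rewrite ler_piMl.
  by rewrite distrC; near: s; exact: n1.
have [h1 h2] := UV (seg (phi t) (phi s) th, w) (conj Uy' Vw).
split=> //; rewrite wE quad_formZ exprMn mulrC real_normK ?num_real//.
by rewrite ler_wpM2r ?sqr_ge0.
Unshelve. all: by end_near. Qed.

(** With [F] a primitive of the speed, the function [dd (delta a) (delta s) - F s - 2 * k' * s] is
    locally nonincreasing: one [k'] pays for the short chain, the other for the derivative of [F].
    The slope [k'] is chosen so that the total loss over [[a, b]] is [k]. *)
Lemma piece_dd_le e delta a b : 0 < e -> a < b -> C1_curve_on `]a - e, b + e[ delta ->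
  ((dd g (delta a) (delta b))%:E <= \int[mu]_(t in `[a, b]) (speed g delta t)%:E)%E.
Proof.
(* The primitive starts slightly before [a] and extends beyond [b], so that it has two-sided
   derivatives at both ends. *)
move=> e0 ab dC; pose a' := a - e / 2; pose b' := b + e / 2.
have e2 : 0 < e / 2 by rewrite divr_gt0.
have a'a : a' < a by rewrite /a'; lra.
have bb' : b < b' by rewrite /b'; lra.
pose I : set R := `]a - e, b + e[%classic.
have oI : open I by exact: interval_open.
have abI t : a' <= t <= b' -> I t.
  by move=> /andP[h1 h2]; rewrite /I /= in_itv/=; apply/andP; rewrite /a' in h1; rewrite /b' in h2; split; lra.
have spc t : a' <= t <= b' -> {for t, continuous (speed g delta)}.
  by move=> tab; apply: speed_continuous oI dC (abI t tab).
have int : mu.-integrable `[a', b'] (EFin \o speed g delta).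
  apply: continuous_compact_integrable; first exact: segment_compact.
  by apply: continuous_in_subspaceT => t; rewrite inE/= in_itv/=; exact: spc.
pose F (x : R) := (\int[mu]_(t in `[a', x]) speed g delta t)%R.
have DF x : a <= x <= b -> is_derive x 1 F (speed g delta x).
  move=> /andP[ax xb].
  have [|||h1 h2] := @continuous_FTC1 _ (speed g delta) (BLeft a') x b' _ int.
  - exact: le_lt_trans bb'.
  - by rewrite lte_fin; apply: lt_le_trans ax.
  - by apply: spc; rewrite (le_trans (ltW a'a))//= (le_trans xb)// ltW.
  by split; [exact: h1|rewrite -derive1E].
have FE : (\int[mu]_(t in `[a, b]) (speed g delta t)%:E = (F b - F a)%:E)%E.
  have inta : mu.-integrable `[a', b] (EFin \o speed g delta).
    apply: (integrableS _ _ _ int) => //.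
    by apply: subset_itvl; rewrite bnd_simp ltW.
  rewrite /F Rintegral_itvB//; rewrite ?bnd_simp ?ltW//.
  have mS : measurable_fun `]a, b] (speed g delta).
    apply: measurable_fun_itv_oc; exact: piece_measurable e0 dC.
  rewrite -integral_itv_obnd_cbnd; last exact/measurable_EFinP.
  rewrite /Rintegral fineK//; apply: integrable_fin_num => //.
  apply: (integrableS _ _ _ inta) => //.
  by move=> t /=; rewrite !in_itv/= => /andP[h1 ->]; rewrite andbT ltW// (lt_trans a'a).
rewrite FE lee_fin; apply/ler_addgt0Pr => k k0.
pose k' := k / (2 * (b - a)); have ba : 0 < b - a by rewrite subr_gt0.
have k'0 : 0 < k' by rewrite divr_gt0// mulr_gt0.
pose h s := dd g (delta a) (delta s) - F s - 2 * k' * s.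
suff : h b <= h a.
  rewrite /h dd_refl; have -> : k = 2 * k' * (b - a) by rewrite /k'; field; rewrite subr_eq0 gt_eqF.
  lra.
apply: locally_nonincreasing (ltW ab) _ => t /andP[ta tb].
have tI : I t by apply: abI; rewrite (le_trans (ltW a'a) ta) (le_trans tb (ltW bb')).
have n1 := C1_chain oI dC tI k'0.
have DFt := DF t (introT andP (conj ta tb)).
have dF : differentiable F t by apply/derivable1_diffP; case: DFt.
have n2 : \forall s \near t, `|F s - F t - (s - t) * speed g delta t| <= k' * `|s - t|.
  have /nbhs_ballP[d /= d0 Hd] := differentiable_approx dF k'0.
  apply/nbhs_ballP; exists d => //= s ts; have := Hd (s - t); rewrite subrK.
  rewrite -ball_normE/= sub0r normrN distrC => /(_ ts).
  rewrite -[in 'd F t _](mulr1 (s - t)) -[(s - t) * 1]/((s - t) *: (1 : R^o)) linearZ/=.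
  by rewrite -deriveE//; case: DFt => _ ->.
near=> s.
have [->|st] := eqVneq s t; first by rewrite lexx.
have h1 : dd g (delta t) (delta s) <= (speed g delta t + k') * `|s - t|.
  by apply: dd_le; move: st; near: s.
have h2 : `|F s - F t - (s - t) * speed g delta t| <= k' * `|s - t| by near: s.
have h3 := dd_lipschitz g (delta a) (delta t) (delta s).
move: h2 (le_trans h3 h1); rewrite !ler_norml /h => /andP[h21 h22] /andP[h31 h32].
by split=> [le|le]; move: h21 h22 h31 h32; [rewrite ler0_norm ?subr_le0//|rewrite ger0_norm ?subr_ge0//];
  rewrite ?mulrDl => *; nra.
Unshelve. all: by end_near. Qed.

Lemma arc_dd_le gamma a s : arc gamma a s ->
  ((dd g (gamma a) (gamma (last a s)))%:E <= \int[mu]_(t in `[a, last a s]) (speed g gamma t)%:E)%E.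
Proof.
elim: s a => [|b s IH] a.
  by move=> _ /=; rewrite set_itv1 integral_set1 dd_refl.
move=> H; rewrite (arc_integral_cons g H); case: H => ab [[e [delta [e0 dC gd]]] bs].
apply: (@le_trans _ _ ((dd g (gamma a) (gamma b))%:E + (dd g (gamma b) (gamma (last b s)))%:E)%E).
  by rewrite -EFinD lee_fin dd_triangle.
apply: leeD; last exact: IH.
have -> : gamma a = delta a by apply: gd; rewrite lexx ltW.
have -> : gamma b = delta b by apply: gd; rewrite lexx ltW.
apply: le_trans (piece_dd_le e0 ab dC) _.
rewrite le_eqVlt; apply/orP; left; apply/eqP; apply: eq_integral_itv_bounded.
- exact: piece_measurable e0 dC.
- exact: piece_speed_measurable e0 dC gd.
- by move=> t; rewrite in_itv/= => tab; apply/esym/near_eq_speed; exact: piece_near gd tab.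
Qed.

Lemma dd_le_dist (x y : M) : ((dd g x y)%:E <= dist g x y)%E.
Proof.
apply: le_ereal_inf_tmp => _ [gamma [[gc [s [[ps /eqP ls] H]]] g0 g1] <-].
have [H1 _] := (arcP gamma ps).1 H.
have := arc_dd_le H1; rewrite ls g0 g1 => /le_trans; apply.
by rewrite /curve_length /speed.
Qed.

End distance.

Section chains_to_curves.
Context {R : realType} {m : nat} {M : smooth_manifold R m} (g : riemannian_metric M).
Implicit Types (c d : chart M) (gamma delta : R -> M) (t a b : R) (p q u v : 'rV[R]_m).
Local Notation mu := (@lebesgue_measure R).

Lemma is_derive_affine p q t : is_derive t 1 (fun s : R => p + s *: q) q.
Proof.
have E : (fun h : R => h^-1 *: (((fun s : R => p + s *: q) \o shift t) (h *: 1) - (p + t *: q))) @ 0^'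
    --> q.
  apply: cvg_trans (@cvg_cst _ q _ (0 : R)^' _).
  apply: near_eq_cvg; near=> h; rewrite /= -[h *: 1]/(h * 1) mulr1 scalerDl.
  rewrite opprD addrACA subrr add0r addrK scalerA mulVf ?scale1r//.
  by near: h; exact: nbhs_dnbhs_neq.
by split; [apply/cvg_ex; exists q|exact: cvg_lim].
Unshelve. all: by end_near. Qed.

Lemma affine_continuous p q : continuous (fun s : R => p + s *: q).
Proof.
move=> t; have [D _] := is_derive_affine p q t.
exact: (differentiable_continuous ((derivable1_diffP _ t).1 D)).
Qed.

Definition chart_line c p q t : M := chart_inv c (p + t *: q).

Lemma open_chart_line c p q : open [set t | chart_img c (p + t *: q)].
Proof.
have /continuousP/(_ _ (@open_chart_img _ _ M c)) := @affine_continuous p q.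
exact.
Qed.

Lemma chart_line_C1 c p q : C1_curve_on [set t | chart_img c (p + t *: q)] (chart_line c p q).
Proof.
move=> t /= ct; pose w (s : R) := p + s *: q.
have wc : {for t, continuous w} by exact: affine_continuous.
split.
  by apply: (@continuous_comp _ _ _ w (chart_inv c)) => //; exact: chart_inv_continuous_at.
move=> d dt.
have ov : (chart_map c @` (chart_dom c `&` chart_dom d)) (w t).
  by exists (chart_inv c (w t)); [split=> //; exact: chart_inv_dom|rewrite chart_invK].
have near_ov : \forall s \near t, (chart_map c @` (chart_dom c `&` chart_dom d)) (w s).
  by apply: wc; apply: open_nbhs_nbhs; split=> //; exact: open_overlap.
have T1 i : Ck_on 1 (chart_map c @` (chart_dom c `&` chart_dom d)) (fun y => transition c d y 0 i).
  exact: (chart_transition_smooth c d i 1%N).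
pose V s : 'rV[R]_m := \row_i dotrow (\row_j 'D_(delta_mx 0 j) (fun y => transition c d y 0 i) (w s)) q.
have H s : (chart_map c @` (chart_dom c `&` chart_dom d)) (w s) ->
    derivable (chart_map d \o chart_line c p q) s 1 /\
    derive1 (chart_map d \o chart_line c p q) s = V s.
  move=> ovs; have dTi i := C1_differentiable (@open_overlap _ _ M c d) (T1 i) ovs.
  have dT : differentiable (transition c d) (w s) by exact: differentiable_rV.
  have [Dw wE] := is_derive_affine p q s.
  have dw : differentiable w s := (derivable1_diffP w s).1 Dw.
  have N : {near s, transition c d \o w =1 chart_map d \o chart_line c p q} by apply: filterE => s'.
  have [dG E] := near_eq_diff_comp (b := w s) erefl N dw dT.
  split; first exact/derivable1_diffP.
  rewrite derive1E' // E -derive1E' // derive1E wE -deriveE// derive_mx; last exact: diff_derivable.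
  by apply/rowP => i; rewrite !mxE deriveE// diff_dotrow.
have [D DE] := H t ov; split; first exact: D.
have N : \forall s \near t, V s = derive1 (chart_map d \o chart_line c p q) s.
  by apply: filterS near_ov => s ovs; have [_ E] := H s ovs; exact: (esym E).
rewrite /prop_for /continuous_at DE; apply: cvg_trans (near_eq_cvg N) _.
apply: continuous_rV => i.
rewrite (_ : (fun s => V s 0 i) = fun s => \sum_j
   'D_(delta_mx 0 j) (fun y => transition c d y 0 i) (w s) * q 0 j); last first.
  by apply/funext => s; rewrite mxE; apply: eq_bigr => j _; rewrite mxE.
apply: continuous_sum_at => j; apply: continuousM; last exact: cst_continuous.
apply: (@continuous_comp _ _ _ w ('D_(delta_mx 0 j) (fun y => transition c d y 0 i))) => //.
exact: (Ck_on_continuous (Ck_on_derive j (T1 i)) ov).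
Qed.

Lemma chart_line_speed c p q t : chart_img c (p + t *: q) ->
  speed g (chart_line c p q) t = Num.sqrt ((q *m gram g c (chart_line c p q t) *m q^T) 0 0).
Proof.
move=> ct; have [dc Hc] := chart_line_C1 ct.
have cd : chart_dom c (chart_line c p q t) by exact: chart_inv_dom.
have [D _] := Hc c cd.
rewrite (speed_chart g dc cd D); suff -> : derive1 (chart_map c \o chart_line c p q) t = q by [].
have [_ E] := is_derive_affine p q t; apply: etrans E; rewrite derive1E; apply: near_eq_derive.
have : \forall s \near t, chart_img c (p + s *: q).
  by apply: open_nbhs_nbhs; split => //; exact: open_chart_line.
by apply: filterS => s cs; rewrite /= /chart_line chart_invK.
Qed.

(** The segment is run through in time [k / L], which makes its speed at most [L]. The curve extends
    a little beyond both ends because the chart image is open. *)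
Lemma step_arc c u v k (L a : R) : step g c u v k -> 0 < L -> exists gamma,
  [/\ arc gamma a [:: a + k / L], gamma a = chart_inv c u, gamma (a + k / L) = chart_inv c v &
    forall t, a < t < a + k / L -> speed g gamma t <= L].
Proof.
move=> [k0 H] L0; pose q := (L / k) *: (v - u); pose p := u - a *: q.
have Lk : 0 < L / k by rewrite divr_gt0.
have kL : 0 < k / L by rewrite divr_gt0.
have wE t : p + t *: q = seg u v ((t - a) * (L / k)).
  by rewrite /p /q /seg; apply/rowP => j; rewrite !mxE; ring.
have in01 t : a <= t <= a + k / L -> 0 <= (t - a) * (L / k) <= 1.
  move=> /andP[h1 h2]; apply/andP; split; first by rewrite mulr_ge0 ?subr_ge0// ltW.
  rewrite -[L / k]invrK invf_div ler_pdivrMr// mul1r; lra.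
have img t : a <= t <= a + k / L -> chart_img c (p + t *: q).
  by move=> /in01/H[]; rewrite wE.
have ab : a < a + k / L by rewrite ltrDl.
exists (chart_line c p q); split.
- split=> //; split=> //.
  have /nbhs_ballP[e1 /= e10 He1] : nbhs a [set t | chart_img c (p + t *: q)].
    by apply: open_nbhs_nbhs; split; [exact: open_chart_line|apply: img; rewrite lexx ltW].
  have /nbhs_ballP[e2 /= e20 He2] : nbhs (a + k / L) [set t | chart_img c (p + t *: q)].
    by apply: open_nbhs_nbhs; split; [exact: open_chart_line|apply: img; rewrite lexx ltW].
  exists (Num.min e1 e2), (chart_line c p q); split=> // [|t]; first by rewrite lt_min e10.
  rewrite /= in_itv/= => /andP[h1 h2]; apply: chart_line_C1 => /=.
  have m1 : Num.min e1 e2 <= e1 by rewrite ge_min lexx.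
  have m2 : Num.min e1 e2 <= e2 by rewrite ge_min lexx orbT.
  have [ta|at_] := ltP t a.
    by apply: He1; rewrite /ball/= gtr0_norm ?subr_gt0//; lra.
  have [tb|bt] := leP t (a + k / L); first by apply: img; rewrite at_.
  by apply: He2; rewrite /ball/= distrC gtr0_norm ?subr_gt0//; lra.
- by rewrite /chart_line wE subrr mul0r seg0.
- rewrite /chart_line wE (_ : _ * _ = 1) ?seg1// addrC addKr; field.
  by rewrite !gt_eqF.
- move=> t /andP[h1 h2]; have t01 : a <= t <= a + k / L by rewrite !ltW.
  rewrite (chart_line_speed (img t t01)).
  suff h : (q *m gram g c (chart_line c p q t) *m q^T) 0 0 <= L ^+ 2.
    by apply: le_trans (ler_wsqrtr h) _; rewrite sqrtr_sqr ger0_norm// ltW.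
  rewrite /chart_line wE /q quad_formZ; have [_ h] := H _ (in01 t t01).
  rewrite (_ : L ^+ 2 = (L / k) ^+ 2 * k ^+ 2); last by field; rewrite gt_eqF.
  by rewrite ler_wpM2l ?sqr_ge0.
Qed.

(** All steps use the same speed bound [L], so a chain of bound [l] takes time [l / L]; for [L = l]
    this is the unit interval required by [dist]. *)
Lemma chain_arc x y l (L : R) : chain g x y l -> 0 < L -> forall a, exists gamma s,
  [/\ arc gamma a s, last a s = a + l / L, gamma a = x & gamma (a + l / L) = y] /\
    forall t, a < t < a + l / L -> t \notin s -> speed g gamma t <= L.
Proof.
move=> xy L0; elim: xy => [c u v k kS|{}x z {}y k l' xz IHk zy IHl] a.
  have [gamma [h1 h2 h3 h4]] := step_arc a kS L0.
  by exists gamma, [:: a + k / L]; split => // t /h4.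
have [g1 [s1 [[A1 l1 g1a g1b] S1]]] := IHk a; set b := a + k / L in l1 g1b S1.
have [g2 [s2 [[A2 l2 g2a g2b] S2]]] := IHl b.
have bE : b + l' / L = a + (k + l') / L by rewrite /b; ring.
rewrite bE in l2 g2b S2.
have ab : a < b by rewrite ltrDl divr_gt0// (chain_gt0 xz).
have bl : b < a + (k + l') / L by rewrite -bE ltrDl divr_gt0// (chain_gt0 zy).
pose gm t := if t <= b then g1 t else g2 t.
have gm2 t : b <= t -> gm t = g2 t.
  rewrite le_eqVlt => /orP[/eqP<-|bt]; first by rewrite /gm lexx g1b g2a.
  by rewrite /gm leNgt bt.
exists gm, (s1 ++ s2); split; first split.
- apply: arc_cat.
    by apply: arc_ext A1 _ => t /andP[_]; rewrite l1 /gm => ->.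
  by rewrite l1; apply: arc_ext A2 _ => t /andP[/gm2->].
- by rewrite last_cat l1 l2.
- by rewrite /gm ltW// g1a.
- by rewrite gm2 ?ltW.
- move=> t /andP[h1 h2]; rewrite mem_cat negb_or => /andP[t1 t2].
  have [tb|bt|tb] := ltgtP t b.
  + rewrite (_ : speed g gm t = speed g g1 t); first by apply: S1 => //; rewrite h1.
    apply: near_eq_speed; have : \forall s \near t, s < b by exact: (open_nbhs_nbhs (conj (@open_lt R b) tb)).
    by apply: filterS => s sb; rewrite /gm ltW.
  + rewrite (_ : speed g gm t = speed g g2 t); first by apply: S2 => //; rewrite bt.
    apply: near_eq_speed; have : \forall s \near t, b < s by exact: (open_nbhs_nbhs (conj (@open_gt R b) bt)).
    by apply: filterS => s /ltW/gm2.
  (* The junction time belongs to the partition [s1], which cannot be empty since the first arc has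
     positive duration. *)
  + move: t1; rewrite tb -l1; case: (s1) l1 => [/= E|b' s' _]; last by rewrite /= mem_last.
    by move: ab; rewrite -E ltxx.
Qed.

Lemma chain_dist_le x y l : chain g x y l -> (dist g x y <= l%:E)%E.
Proof.
move=> xy; have l0 := chain_gt0 xy.
have [gm [s [[A ls g0 g1] S]]] := chain_arc xy l0 0.
have l1 : 0 + l / l = 1 by rewrite add0r divff// gt_eqF.
rewrite l1 in ls g1 S.
apply: (@le_trans _ _ (curve_length g gm)).
  apply: ereal_inf_lbound; exists gm => //; split=> //; split.
    by have := arc_continuous A; rewrite ls.
  by exists s; have ps := arc_path A; split; [split=> //; rewrite ls|apply/(arcP gm ps)].
have := @arc_length_le _ _ _ g gm 0 s l (ltW l0) A; rewrite ls => /(_ S).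
by rewrite subr0 mulr1.
Qed.

Lemma distE x y : dist g x y = (dd g x y)%:E.
Proof.
apply/eqP; rewrite eq_le dd_le_dist andbT; apply/lee_addgt0Pr => e e0.
by rewrite -EFinD; apply/chain_dist_le/dd_lt; rewrite ltrDl.
Qed.

End chains_to_curves.

(** * Completeness and compact balls *)

Section completeness.
Context {R : realType} {m : nat} {M : smooth_manifold R m} (g : riemannian_metric M).
Implicit Types (x y z : M).

Definition rel_compact_ball x (r : R) := exists2 K : set M, compact K & forall y, dd g x y < r -> K y.

Lemma rel_compact_ballS x y r s : rel_compact_ball x r -> dd g x y + s <= r -> rel_compact_ball y s.
Proof.
move=> [K cK HK] sr; exists K => // z yz; apply: HK; apply: le_lt_trans (dd_triangle g x y z) _.
by apply: lt_le_trans sr; rewrite ltrD2l.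
Qed.

Lemma rel_compact_ball_small x : exists2 e, 0 < e & rel_compact_ball x e.
Proof.
have cx := chart_at_dom x; set c := chart_at x in cx.
have [r r0 Hr] := chart_cube cx (@filterT _ (nbhs x) _).
have qr (y : 'rV[R]_m) : `|y - chart_map c x| <= r -> chart_img c y by move=> /Hr[].
have [|e e0 He] := @dd_nbhs _ _ _ g x (chart_closed_cube c (chart_map c x) r).
  have H1 : \forall z \near x, `|chart_map c x - chart_map c z| <= r.
    by have /cvgrPdist_le := chart_map_continuous cx; apply.
  have H2 : \forall z \near x, chart_dom c z.
    by apply: open_nbhs_nbhs; split => //; exact: chart_dom_open.
  by move: H1 H2; apply: filterS2 => z zr cz; apply/(chart_closed_cubeP qr); rewrite distrC.
exists e => //; exists (chart_closed_cube c (chart_map c x) r) => //.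
exact: chart_closed_cube_compact.
Qed.

Lemma dd_continuous x : continuous (dd g x).
Proof.
move=> y; apply/cvgrPdist_lt => e e0; apply: filterS (nbhs_dd g y e0) => z.
exact: le_lt_trans (dd_lipschitz g x y z).
Qed.

(** The closed ball of radius [s] is compact and hence covered by finitely many small balls whose
    concentric balls of radius [r / 2] are relatively compact. The union of the latter contains
    everything within [r / 4] of the closed ball, in particular the ball of radius [s + r / 8]. *)
Lemma rel_compact_ball_step x r s : 0 < r -> (forall y, dd g x y < r -> rel_compact_ball y (r / 2)) ->
  r / 2 <= s < r -> rel_compact_ball x s -> rel_compact_ball x (s + r / 8).
Proof.
move=> r0 H /andP[rs sr] [K cK HK].
pose K' := K `&` [set y | dd g x y <= s].
have cK' : compact K'.
  apply: compact_closedI => //.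
  have /continuous_closedP/(_ _ (@closed_le R s)) := @dd_continuous x; exact.
pose F : set_system (set M) := [set P | exists2 K0, compact K0 & forall K1, K0 `<=` K1 -> P K1].
have FF : Filter F.
  split.
  - by exists set0 => //; exact: compact0.
  - move=> P Q [K0 c0 H0] [K1 c1 H1]; exists (K0 `|` K1); first exact: compactU.
    by move=> K2 h; split; [apply: H0|apply: H1] => z hz; apply: h; [left|right].
  - by move=> P Q PQ [K0 c0 H0]; exists K0 => // K1 /H0/PQ.
have [|K0 c0 H0] := (compact_near_coveringP _).1 cK' (set M) F
    (fun K1 z => forall z', dd g z z' < r / 4 -> K1 z') FF _.
  move=> y [_ /= ys]; have [|Ky cKy HKy] := H y _; first exact: le_lt_trans sr.
  have r8 : 0 < r / 8 by rewrite divr_gt0.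
  exists ([set z | dd g y z < r / 8], [set K1 | Ky `<=` K1]) => /=.
    by split; [exact: nbhs_dd|exists Ky].
  move=> [z K1] /= [yz KyK1] z' zz'; apply: KyK1; apply: HKy.
  by apply: le_lt_trans (dd_triangle g y z z') _; lra.
(* Cutting the chain at [s - r / 16] leaves a remainder of length [3 * r / 16], below the margin
   [r / 4], and the cut point is strictly inside the ball of radius [s]. *)
exists K0 => // z' xz'; have [|z xz zz'] := chain_split (s := s - r / 16) (dd_lt xz').
  by apply/andP; split; lra.
have sz : dd g x z <= s - r / 16 := dd_le xz.
apply: (H0 K0 _ z); first exact: subset_refl.
- split; last by rewrite /=; lra.
  by apply: HK; lra.
- apply: le_lt_trans (dd_le zz') _; lra.
Qed.

(** If all centres had relatively compact balls of radius [r / 2], four increments of [r / 8] would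
    lead from [r / 2] to [r]. *)
Lemma rel_compact_ball_halve x r : 0 < r -> ~ rel_compact_ball x r ->
  exists y, dd g x y < r /\ ~ rel_compact_ball y (r / 2).
Proof.
move=> r0 nx; apply: contrapT => /forallNP H; apply: nx.
have H' y : dd g x y < r -> rel_compact_ball y (r / 2).
  by move=> xy; apply: contrapT => ny; apply: (H y).
have h0 : rel_compact_ball x (r / 2) by apply: H'; rewrite dd_refl.
have h1 : rel_compact_ball x (r / 2 + r / 8).
  by apply: rel_compact_ball_step => //; apply/andP; split; lra.
have h2 : rel_compact_ball x (r / 2 + r / 8 + r / 8).
  by apply: rel_compact_ball_step => //; apply/andP; split; lra.
have h3 : rel_compact_ball x (r / 2 + r / 8 + r / 8 + r / 8).
  by apply: rel_compact_ball_step => //; apply/andP; split; lra.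
have h4 : rel_compact_ball x (r / 2 + r / 8 + r / 8 + r / 8 + r / 8).
  by apply: rel_compact_ball_step => //; apply/andP; split; lra.
by apply: (rel_compact_ballS h4); rewrite dd_refl; lra.
Qed.

(** Hopf-Rinow without geodesics. A ball that is not relatively compact produces centres [u n], each
    within [r / 2 ^+ n] of the next, whose balls of radius [r / 2 ^+ n] are not relatively compact
    either. They form a Cauchy sequence, and a small compact neighbourhood of the limit contains
    such a ball. *)
Lemma complete_rel_compact_ball : complete_metric g -> forall x r, rel_compact_ball x r.
Proof.
move=> hc x r.
have [r0|r0] := ltP 0 r; last first.
  exists set0; first exact: compact0.
  by move=> y /lt_le_trans/(_ r0); rewrite ltNge dd_ge0.
apply: contrapT => nx.
pose P (p : M * R) y := 0 < p.2 -> ~ rel_compact_ball p.1 p.2 ->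
    dd g p.1 y < p.2 /\ ~ rel_compact_ball y (p.2 / 2).
have H p : exists y, P p y.
  case: p => y s; rewrite /P /=.
  have [s0|s0] := ltP 0 s; last by exists y.
  have [ny|ny] := pselect (rel_compact_ball y s); first by exists y.
  by have [z Hz] := rel_compact_ball_halve s0 ny; exists z.
have [f Hf] := choice H.
pose rr n : R := r / 2 ^+ n.
have rr0 n : 0 < rr n by rewrite divr_gt0// exprn_gt0.
have rrS n : rr n.+1 = rr n / 2 by rewrite /rr exprSr invfM mulrA.
pose u := fix u n := if n is k.+1 then f (u k, rr k) else x.
have nu n : ~ rel_compact_ball (u n) (rr n).
  elim: n => [|n IH]; first by rewrite /rr expr0 divr1.
  by rewrite rrS; have [] := Hf (u n, rr n) (rr0 n) IH.
have du n : dd g (u n) (u n.+1) < rr n by have [] := Hf (u n, rr n) (rr0 n) (nu n).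
have duk n k : dd g (u n) (u (n + k)%N) <= 2 * rr n - 2 * rr (n + k)%N.
  elim: k => [|k IH]; first by rewrite addn0 subrr dd_refl.
  rewrite addnS rrS (le_trans (dd_triangle g _ (u (n + k)%N) _))//.
  by have := du (n + k)%N; lra.
have rrlim e : 0 < e -> exists N, forall n, (N <= n)%N -> rr n < e.
  move=> e0; have := @cvg_geometric R r (2^-1).
  rewrite ger0_norm ?invr_ge0// invf_lt1// ltr1n => /(_ isT) /cvgrPdist_lt /(_ e e0)[N _ HN].
  exists N => n Nn; have := HN n Nn; rewrite /geometric /= sub0r normrN exprVn.
  exact: le_lt_trans (ler_norm _).
have dnl n k : (n <= k)%N -> dd g (u n) (u k) < 2 * rr n.
  by move=> nk; rewrite -(subnKC nk); have := duk n (k - n)%N; have := rr0 (n + (k - n))%N; lra.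
have [|z Hz] := hc u.
  move=> e e0; have [|N HN] := rrlim (e / 4); first by rewrite divr_gt0.
  exists N => i j Ni Nj; rewrite distE lte_fin.
  rewrite (le_lt_trans (dd_triangle g _ (u N) _))// (dd_sym _ (u i)).
  by have := dnl _ _ Ni; have := dnl _ _ Nj; have := HN N (leqnn N); lra.
have [e e0 He] := rel_compact_ball_small z.
have e2 : 0 < e / 2 by rewrite divr_gt0.
have [N HN] := rrlim _ e2; have [N' HN'] := Hz _ e2.
have := HN' (maxn N N') (leq_maxr _ _); rewrite distE lte_fin => h1.
have h2 := HN (maxn N N') (leq_maxl _ _).
apply: (nu (maxn N N')); apply: (rel_compact_ballS He); rewrite dd_sym; lra.
Qed.

Lemma supported_in_ball (f : M -> R) x r : complete_metric g ->
  (forall y, f y != 0 -> dd g x y < r) -> compactly_supported f.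
Proof.
move=> hc H; have [K cK HK] := complete_rel_compact_ball hc x r.
have clK : closed K := compact_closed (@manifold_hausdorff _ _ M) cK.
apply: subclosed_compact cK _; first exact: closed_closure.
by move/closure_id : clK => ->; apply: closureS => y /H; exact: HK.
Qed.

Lemma lip_cP (f : M -> R) : lip_c g f <->
  compactly_supported f /\ exists2 L, 0 <= L & forall y z, `|f y - f z| <= L * dd g y z.
Proof.
split=> [[cf [L HL]]|[cf [L _ HL]]]; split=> //.
  exists `|L| => // y z; have := HL y z; rewrite distE -EFinM lee_fin => /le_trans; apply.
  by rewrite ler_wpM2r ?dd_ge0// ler_norm.
by exists L => y z; rewrite distE -EFinM lee_fin.
Qed.

End completeness.

(** Induction over compact sets, applied to finiteness of volume and to smooth approximability. *)
Lemma compact_local_property (T : topologicalType) (K : set T) (Q : set T -> Prop) : compact K ->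
  Q set0 -> (forall A B, Q A -> Q B -> Q (A `|` B)) ->
  (forall x, K x -> exists2 A, Q A & nbhs x A) -> exists2 A, Q A & K `<=` A.
Proof.
move=> /compact_near_coveringP cK Q0 QU H.
pose F : set_system (set T) := [set P | exists2 A, Q A & forall B, A `<=` B -> P B].
have FF : Filter F.
  split.
  - by exists set0.
  - move=> P P' [A qA HA] [B qB HB]; exists (A `|` B); first exact: QU.
    by move=> C h; split; [apply: HA|apply: HB] => z hz; apply: h; [left|right].
  - by move=> P P' PP' [A qA HA]; exists A => // B /HA/PP'.
have [|A qA HA] := cK (set T) F (fun B z => B z) FF _.
  move=> x /H[A qA Ax]; exists (A, [set B | A `<=` B]) => /=; first by split=> //; exists A.
  by move=> [z B] /= [Az]; exact.
by exists A => //; exact: HA.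
Qed.

(** * The Riemannian volume *)

Section borel_measurability.
Context {R : realType}.

Lemma borel_open (T : ptopologicalType) (U : set T) : open U -> measurable (U : set (borel T)).
Proof. by move=> oU; exact: sub_sigma_algebra. Qed.

Lemma borel_closed (T : ptopologicalType) (U : set T) : closed U -> measurable (U : set (borel T)).
Proof.
by move=> cU; rewrite -(setCK U); apply: measurableC; apply: borel_open; exact: closed_openC.
Qed.

Lemma open_preimage_at (S T : topologicalType) (D : set S) (f : S -> T) (U : set T) : open D ->
  (forall y, D y -> {for y, continuous f}) -> open U -> open (D `&` f @^-1` U).
Proof.
move=> oD fc oU; rewrite openE => y [Dy Uy]; apply: filterI; first exact: open_nbhs_nbhs.
by apply: (fc y Dy); exact: open_nbhs_nbhs.
Qed.

Lemma measurable_continuous_on (T : ptopologicalType) (D : set T) (f : T -> R) : open D ->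
  (forall y, D y -> {for y, continuous f}) ->
  measurable_fun (D : set (borel T)) (f : borel T -> R).
Proof.
move=> oD fc; apply: (measurability _ (RGenOpens.measurableE R)).
move=> _ [_ [a [b ->]] <-]; apply: borel_open; by apply: open_preimage_at => //; exact: interval_open.
Qed.

Lemma borel_measurable_on (S T : ptopologicalType) (D : set S) (f : S -> T) : open D ->
  (forall y, D y -> {for y, continuous f}) ->
  measurable_fun (D : set (borel S)) (f : borel S -> borel T).
Proof.
move=> oD fc; apply: (@measurability _ _ (borel S) (borel T) _ _ (@open T)) => //.
by move=> _ [U oU <-]; apply: borel_open; exact: open_preimage_at.
Qed.

End borel_measurability.

(* The determinant does not vanish along the segment from the identity. *)
Lemma posdef_det_gt0 (R : realType) n (A : 'M[R]_n) :
  (forall v : 'rV[R]_n, v != 0 -> 0 < (v *m A *m v^T) 0 0) -> 0 < \det A.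
Proof.
move=> Apos; pose F t := \det (t *: A + (1 - t) *: 1%:M).
have pos t : 0 <= t <= 1 -> F t != 0.
  move=> /andP[t0 t1]; apply/negP => /det0P[v v0 /(congr1 (fun w => (w *m v^T) 0 0))].
  have -> : (v *m (t *: A + (1 - t) *: 1%:M) *m v^T) 0 0 =
      t * (v *m A *m v^T) 0 0 + (1 - t) * (v *m v^T) 0 0.
    rewrite mulmxDr -!scalemxAr mulmx1 mulmxDl -!scalemxAl.
    have mD (X Y : 'M[R]_1) : (X + Y) 0 0 = X 0 0 + Y 0 0 by rewrite !mxE.
    have mZ c (X : 'M[R]_1) : (c *: X) 0 0 = c * X 0 0 by rewrite !mxE.
    by rewrite mD !mZ.
  rewrite mul0mx [RHS]mxE; apply/eqP; have h1 := Apos v v0.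
  have h2 : 0 < (v *m v^T) 0 0.
    rewrite mxE lt_neqAle eq_sym; apply/andP; split; last first.
      by apply: sumr_ge0 => j _; rewrite mxE -expr2 sqr_ge0.
    rewrite psumr_eq0; last by move=> j _; rewrite mxE -expr2 sqr_ge0.
    apply: contra v0 => /allP H; apply/eqP/rowP => j.
    by have := H j (mem_index_enum j); rewrite !mxE -expr2 sqrf_eq0 => /eqP.
  rewrite gt_eqF//; have [->|tn0] := eqVneq t 0; first by rewrite mul0r add0r subr0 mul1r.
  by rewrite ltr_pwDl ?mulr_gt0 ?mulr_ge0 ?subr_ge0// 1?ltW// lt_neqAle eq_sym tn0.
have cF : continuous F.
  move=> t; apply: (@continuous_det _ _ n (fun t : R => t *: A + (1 - t) *: 1%:M)) => i j.
  rewrite (_ : (fun t => _) = fun t : R => t * A i j + (1 - t) * (1%:M : 'M[R]_n) i j); last first.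
    by apply/funext => s; rewrite !mxE.
  apply: continuousD; apply: continuousM; do ?exact: cst_continuous; first exact: id.
  by apply: continuousB; [exact: cst_continuous|exact: id].
rewrite ltNge; apply/negP => F1.
have F0 : 0 < F 0 by rewrite /F scale0r add0r subr0 scale1r det1.
have F1' : F 1 <= 0 by rewrite /F scale1r subrr scale0r addr0.
have [|t] := @IVT R F 0 1 0 ler01 (continuous_subspaceT cF).
  by rewrite ge_min le_max F1' (ltW F0) !orbT.
by rewrite in_itv/= => /pos/negP tp /eqP.
Qed.

Section manifold_measure.
Context {R : realType} {m : nat} {M : smooth_manifold R m} (g : riemannian_metric M).
Implicit Types (c d : chart M) (f h : M -> R).

(** For each set of a countable base that lies in some [W x], one such [x] is kept. *)
Lemma lindelof (W : M -> set M) : (forall x, nbhs x (W x)) ->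
  exists s : nat -> M, forall y, exists n, W (s n) y.
Proof.
move=> Wx; have [B cB [_ Bx]] := @manifold_second_countable _ _ M.
have /pcard_surjP[e he] := cB.
have H n : exists x, (exists x, e n `<=` W x) -> e n `<=` W x.
  by have [[x Hx]|] := pselect (exists x, e n `<=` W x); [exists x|exists point].
have [s Hs] := choice H; exists s => y.
have [U [BU Uy] UW] := Bx y _ (Wx y).
have [n _ enU] := he U BU; exists n; apply: (Hs n); last by rewrite enU.
by exists y; rewrite enU.
Qed.

Lemma measurable_local (d : measure_display) (T : measurableType d) (f : M -> T) :
  (forall x, exists U, [/\ open U, U x & measurable_fun (U : set (borel M)) f]) ->
  measurable_fun setT (f : borel M -> T).
Proof.
move=> /choice[U HU]; have [|s Hs] := @lindelof U.
  by move=> x; have [oU Ux _] := HU x; exact: open_nbhs_nbhs.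
have -> : [set: borel M] = \bigcup_n U (s n).
  by apply/seteqP; split=> // y _; have [n ?] := Hs y; exists n.
apply/measurable_fun_bigcup => n; last by have [] := HU (s n).
by have [oU _ _] := HU (s n); exact: borel_open.
Qed.

Lemma measurable_chart_map c : measurable_fun (chart_dom c : set (borel M))
  (chart_map c : borel M -> borel 'rV[R]_m).
Proof.
apply: borel_measurable_on; first exact: chart_dom_open.
by move=> x; exact: chart_map_continuous.
Qed.

Lemma measurable_chart_image c (A : set M) : measurable (A : set (borel M)) -> A `<=` chart_dom c ->
  measurable (chart_map c @` A : set (borel 'rV[R]_m)).
Proof.
move=> mA Ac.
have -> : chart_map c @` A = chart_img c `&` chart_inv c @^-1` A.
  apply/seteqP; split=> [_ [x Ax <-]|y [cy Ay]].
    by have cx := Ac _ Ax; split; [exact: chart_img_map|rewrite /= chart_mapK].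
  by exists (chart_inv c y); rewrite ?chart_invK.
apply: (borel_measurable_on (@open_chart_img _ _ M c) (@chart_inv_continuous_at _ _ M c)) => //.
by apply: borel_open; exact: open_chart_img.
Qed.

Definition chart_density c (y : 'rV[R]_m) : R := Num.sqrt (\det (gram g c (chart_inv c y))).

Lemma chart_density_continuous c y : chart_img c y -> {for y, continuous (chart_density c)}.
Proof.
move=> cy; apply: (@continuous_comp _ _ _ (fun y => \det (gram g c (chart_inv c y))) Num.sqrt).
  by apply: continuous_det => i j; exact: chart_gram_continuous.
exact: sqrt_continuous.
Qed.

Variables (vol : {measure set (borel M) -> \bar R}) (hvol : riemannian_volume g vol).

Lemma measurable_chart_weight c (A : set M) : measurable (A : set (borel M)) -> A `<=` chart_dom c ->
  measurable_fun setT ((fun y => (\1_(chart_map c @` A) y * chart_density c y)%:E) :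
    borel 'rV[R]_m -> \bar R).
Proof.
move=> mA Ac; have mcA := measurable_chart_image mA Ac; apply/measurable_EFinP.
rewrite (_ : (fun y => _) = chart_density c \_ (chart_map c @` A)); last first.
  apply/funext => y; rewrite patchE indicE; case: ifPn => _; first by rewrite mul1r.
  by rewrite mul0r.
apply/(measurable_restrictT _ mcA).
apply: (@measurable_funS _ _ (borel 'rV[R]_m) _ (chart_img c)).
- by apply: borel_open; exact: open_chart_img.
- by move=> _ [x /Ac cx <-]; exact: chart_img_map.
- apply: measurable_continuous_on; first exact: open_chart_img.
  by move=> y; exact: chart_density_continuous.
Qed.

Lemma chart_weight_ge0 c (A : set M) y : (0 <= (\1_(chart_map c @` A) y * chart_density c y)%:E)%E.
Proof. by rewrite lee_fin mulr_ge0// sqrtr_ge0. Qed.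

Lemma vol_cube_finite c q r : 0 < r -> (forall y, `|y - q| <= r -> chart_img c y) ->
  (vol (chart_closed_cube c q r) < +oo)%E.
Proof.
move=> r0 qr; have mA := borel_closed (chart_closed_cube_closed qr).
have Ac : chart_closed_cube c q r `<=` chart_dom c by move=> x /(chart_closed_cubeP qr)[].
have [|B B0 HB] := compact_locally_bounded (f := chart_density c) (@closed_cube_compact R m q r).
  move=> y /qr/chart_density_continuous/cvgrPdist_le/(_ 1 ltr01) H.
  exists (chart_density c y + 1); apply: filterS H => z.
  by rewrite ler_norml => /andP[]; lra.
rewrite (hvol mA Ac); apply: le_lt_trans (ltry (B * (2 * r) ^+ m)).
have cubeE y : (chart_map c @` chart_closed_cube c q r) y <-> (forall j, `|y 0 j - q 0 j| <= r).
  split=> [[x /(chart_closed_cubeP qr)[_ h] <-] j|h].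
    by have := le_trans (rV_coord_le (chart_map c x - q) j) h; rewrite !mxE.
  have yr : `|y - q| <= r by apply: rV_norm_le => [|j]; [exact: ltW|rewrite !mxE].
  exists (chart_inv c y); last by rewrite chart_invK//; exact: qr.
  by exists y.
apply: (lebesgue_integral_rV_cube_le (q := q) (ltW r0) (ltW B0)).
- exact: measurable_chart_weight.
- by move=> y; exact: chart_weight_ge0.
- move=> y h; rewrite lee_fin indicE mem_set ?mul1r; last exact/cubeE.
  by apply: HB; rewrite /=; apply: rV_norm_le => [|j]; [exact: ltW|rewrite !mxE].
- by move=> y h; rewrite indicE memNset ?mul0r// => /cubeE.
Qed.

Lemma vol_compact_finite (K : set M) : compact K -> (vol K < +oo)%E.
Proof.
move=> cK; have mK : measurable (K : set (borel M)).
  by apply: borel_closed; exact: (compact_closed (@manifold_hausdorff _ _ M) cK).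
have [||x _|A [mA vA] KA] := compact_local_property
    (Q := fun A : set M => measurable (A : set (borel M)) /\ (vol A < +oo)%E) cK.
- by split; [exact: measurable0|rewrite measure0].
- move=> A B [mA vA] [mB vB]; split; first exact: measurableU.
  by apply: le_lt_trans (measureU2 _ mA mB) _; rewrite lte_add_pinfty.
- have cx := chart_at_dom x; set c := chart_at x in cx.
  have [r r0 Hr] := chart_cube cx (@filterT _ (nbhs x) _).
  have qr (y : 'rV[R]_m) : `|y - chart_map c x| <= r -> chart_img c y by move=> /Hr[].
  exists (chart_closed_cube c (chart_map c x) r).
    by split; [apply: borel_closed; exact: chart_closed_cube_closed|exact: vol_cube_finite].
  have H1 : \forall z \near x, `|chart_map c x - chart_map c z| <= r.
    by have /cvgrPdist_le := chart_map_continuous cx; apply.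
  have H2 : \forall z \near x, chart_dom c z.
    by apply: open_nbhs_nbhs; split => //; exact: chart_dom_open.
  by move: H1 H2; apply: filterS2 => z zr cz; apply/(chart_closed_cubeP qr); rewrite distrC.
- by apply: le_lt_trans vA; apply: le_measure => //; rewrite inE.
Qed.

(** A positive definite Gram matrix has positive determinant, so by continuity the density is
    bounded below on a small cube inside [U]. *)
Lemma vol_nbhs_gt0 (x : M) (U : set M) : nbhs x U -> measurable (U : set (borel M)) -> (0 < vol U)%E.
Proof.
move=> Ux mU; have cx := chart_at_dom x; set c := chart_at x in cx; set q := chart_map c x.
have dq0 : 0 < chart_density c q.
  rewrite /chart_density /q chart_mapK// sqrtr_gt0.
  by apply: posdef_det_gt0 => v; exact: gram_posdef.
have [r1 r10 Hr] := chart_cube cx Ux.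
have /cvgrPdist_le/(_ (chart_density c q / 2)) := chart_density_continuous (chart_img_map cx).
rewrite divr_gt0// => /(_ isT)/nbhs_ballP[r2 /= r20 Hr2].
pose r := Num.min r1 (r2 / 2).
have r0 : 0 < r by rewrite lt_min r10 divr_gt0.
have rr1 : r <= r1 by rewrite ge_min lexx.
have rr2 : r < r2.
  by rewrite (@le_lt_trans _ _ (r2 / 2)) ?ge_min ?lexx ?orbT// ltr_pdivrMr// mulr_natr mulr2n ltrDl.
have qr (y : 'rV[R]_m) : `|y - q| <= r -> chart_img c y by move=> yr; have [] := Hr y (le_trans yr rr1).
have mA := borel_closed (chart_closed_cube_closed qr).
have Ac : chart_closed_cube c q r `<=` chart_dom c by move=> z /(chart_closed_cubeP qr)[].
apply: (@lt_le_trans _ _ (vol (chart_closed_cube c q r))); last first.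
  apply: le_measure; rewrite ?inE// => z /(chart_closed_cubeP qr)[cz zr].
  by have [_] := Hr _ (le_trans zr rr1); rewrite chart_mapK.
rewrite (hvol mA Ac).
apply: (@lt_le_trans _ _ ((chart_density c q / 2) * (2 * r) ^+ m)%:E).
  by rewrite lte_fin mulr_gt0 ?divr_gt0 ?exprn_gt0 ?mulr_gt0.
apply: (lebesgue_integral_rV_cube_ge (q := q) r0).
- by rewrite ltW// divr_gt0.
- exact: measurable_chart_weight.
- by move=> y; exact: chart_weight_ge0.
- move=> y h; have yr : `|y - q| <= r by apply: rV_norm_le => [|j]; [exact: ltW|rewrite !mxE].
  rewrite indicE mem_set; last first.
    by exists (chart_inv c y); [exists y|rewrite chart_invK//; exact: qr].
  rewrite mul1r lee_fin; have := Hr2 y; rewrite -ball_normE /= distrC => /(_ (le_lt_trans yr rr2)).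
  by rewrite ler_norml => /andP[]; rewrite -/q -/(chart_density c y); lra.
Qed.

End manifold_measure.

(** * Lipschitz functions on the manifold *)

Section clamp.
Context {R : realType} {m : nat}.
Implicit Types (q y z : 'rV[R]_m) (r : R).

(** The projection onto a closed cube, 1-Lipschitz for the sup norm. Composition with it extends a
    Lipschitz function from a chart cube to all of R^m, where Rademacher's theorem is available. *)
Definition clamp_cube q r y : 'rV[R]_m :=
  \row_j Num.max (q 0 j - r) (Num.min (q 0 j + r) (y 0 j)).

Lemma clamp_cube_in q r y : 0 <= r -> `|clamp_cube q r y - q| <= r.
Proof.
move=> r0; apply: rV_norm_le => // j; rewrite !mxE ler_norml.
rewrite lerBrDl le_max [q 0 j - r]addrC addrC lexx/=.
by rewrite lerBlDr ge_max [r + _]addrC ge_min lexx/= andbT; lra.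
Qed.

Lemma clamp_cube_id q r y : `|y - q| <= r -> clamp_cube q r y = y.
Proof.
move=> yr; apply/rowP => j; rewrite mxE; have := le_trans (rV_coord_le (y - q) j) yr.
rewrite !mxE ler_norml => /andP[h1 h2].
by rewrite min_r ?max_r//; lra.
Qed.

Lemma clamp_cube_lipschitz q r y z : `|clamp_cube q r y - clamp_cube q r z| <= `|y - z|.
Proof.
apply: rV_norm_le => // j; apply: le_trans (rV_coord_le (y - z) j); rewrite !mxE.
move: (y 0 j) (z 0 j) (q 0 j - r) (q 0 j + r) => {y z q r} y z a b.
have mx (u v : R) : `|Num.max a u - Num.max a v| <= `|u - v|.
  by rewrite !ler_norml !maxEle; case: (leP a u); case: (leP a v); case: (ger0P (u - v)) => *; apply/andP; split; lra.
have mn (u v : R) : `|Num.min b u - Num.min b v| <= `|u - v|.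
  by rewrite !ler_norml !minEle; case: (leP b u); case: (leP b v); case: (ger0P (u - v)) => *; apply/andP; split; lra.
exact: le_trans (mx _ _) (mn _ _).
Qed.

End clamp.

Lemma dotrowE (R : realType) n (p w : 'rV[R]_n) : dotrow p w = (p *m w^T) 0 0.
Proof. by rewrite mxE; apply: eq_bigr => j _; rewrite mxE. Qed.

Section locally_lipschitz.
Context {R : realType} {m : nat} {M : smooth_manifold R m} (g : riemannian_metric M).
Implicit Types (c d : chart M) (f h : M -> R) (x : M).

Definition dd_lip_near f x (L : R) :=
  \forall z \near (x, x), `|f z.1 - f z.2| <= L * dd g z.1 z.2.

Definition dd_lip_loc f := forall x, exists2 L, 0 <= L & dd_lip_near f x L.

Lemma lip_locP f : lip_loc g f -> dd_lip_loc f.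
Proof.
move=> H x; have [L [U [Ux HU]]] := H x; exists `|L| => //.
exists (U, U) => //= -[y z] /= [Uy Uz].
have := HU y z Uy Uz; rewrite distE -EFinM lee_fin => /le_trans; apply.
by rewrite ler_wpM2r ?dd_ge0// ler_norm.
Qed.

Lemma dd_lip_near_nbhs f x L : dd_lip_near f x L -> exists2 U : set M, nbhs x U &
  forall y z, U y -> U z -> `|f y - f z| <= L * dd g y z.
Proof.
move=> [[U V] /= [Ux Vx] UV]; exists (U `&` V); first exact: filterI.
by move=> y z [Uy _] [_ Vz]; exact: (UV (y, z)).
Qed.

Lemma dd_lip_loc_global f L : 0 <= L -> (forall y z, `|f y - f z| <= L * dd g y z) -> dd_lip_loc f.
Proof. by move=> L0 H x; exists L => //; apply: filterE => z; exact: H. Qed.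

Lemma dd_lip_loc_continuous f : dd_lip_loc f -> continuous f.
Proof.
move=> H x; have [L L0 /dd_lip_near_nbhs[U Ux HU]] := H x; apply/cvgrPdist_lt => e e0.
have e1 : 0 < e / (L + 1) by rewrite divr_gt0// ltr_wpDl.
have U0 := nbhs_singleton Ux.
apply: filterS2 Ux (nbhs_dd g x e1) => z Uz xz.
apply: le_lt_trans (HU _ _ U0 Uz) _.
have := dd_ge0 g x z; move: xz; rewrite ltr_pdivlMr ?ltr_wpDl// mulrC mulrDl mul1r.
lra.
Qed.

Lemma local_extension f x c : dd_lip_loc f -> chart_dom c x -> exists r K F,
  [/\ 0 < r, forall y, `|y - chart_map c x| <= r -> chart_img c y,
      forall y z : 'rV[R]_m, `|F y - F z| <= K * `|y - z| &
      forall y, `|y - chart_map c x| <= r -> F y = f (chart_inv c y)].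
Proof.
move=> H cx; have [L L0 /dd_lip_near_nbhs[U Ux HU]] := H x.
have [r1 r10 Hr1] := chart_cube cx Ux.
have [r2 [Lam [r20 La0 _ Hr2]]] := local_chain g cx.
pose r := Num.min r1 r2; set q := chart_map c x in Hr1 Hr2 *.
have r0 : 0 < r by rewrite lt_min r10.
have rr1 : r <= r1 by rewrite ge_min lexx.
have rr2 : r <= r2 by rewrite ge_min lexx orbT.
exists r, (L * Lam), (fun y => f (chart_inv c (clamp_cube q r y))); split=> //.
- by move=> y yr; have [] := Hr1 y (le_trans yr rr1).
- move=> y z; set u := clamp_cube q r y; set v := clamp_cube q r z.
  have uq : `|u - q| <= r by apply: clamp_cube_in; exact: ltW.
  have vq : `|v - q| <= r by apply: clamp_cube_in; exact: ltW.
  have [->|uv] := eqVneq u v; first by rewrite subrr normr0 !mulr_ge0// ltW.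
  have nuv : 0 < `|u - v| by rewrite normr_gt0 subr_eq0.
  have [_ Uu] := Hr1 u (le_trans uq rr1); have [_ Uv] := Hr1 v (le_trans vq rr1).
  rewrite (le_trans (HU _ _ Uu Uv))// -mulrA ler_wpM2l//.
  apply: (@le_trans _ _ (Lam * `|u - v|)); last by rewrite ler_wpM2l ?clamp_cube_lipschitz// ltW.
  apply: dd_le; apply: Hr2 => //; [exact: le_trans uq _|exact: le_trans vq _|exact: mulr_gt0].
- by move=> y yr; rewrite clamp_cube_id.
Qed.

Definition open_chart_cube c (q : 'rV[R]_m) r : set M :=
  chart_dom c `&` chart_map c @^-1` [set y | `|y - q| < r].

Lemma open_open_chart_cube c q r : open (open_chart_cube c q r).
Proof.
apply: open_preimage_at; first exact: chart_dom_open.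
  by move=> x; exact: chart_map_continuous.
rewrite (_ : [set y | _] = ball q r); first exact: ball_open.
by apply/seteqP; split=> y; rewrite -ball_normE /= distrC.
Qed.

Lemma nbhs_open_chart_cube c x r : chart_dom c x -> 0 < r ->
  nbhs x (open_chart_cube c (chart_map c x) r).
Proof.
move=> cx r0; apply: open_nbhs_nbhs; split; first exact: open_open_chart_cube.
by split=> //=; rewrite subrr normr0.
Qed.

Section extension.
Variables (c : chart M) (q : 'rV[R]_m) (r : R) (f : M -> R) (F : 'rV[R]_m -> R).
Hypothesis qr : forall y, `|y - q| <= r -> chart_img c y.
Hypothesis FE : forall y, `|y - q| <= r -> F y = f (chart_inv c y).

Lemma near_extension x : open_chart_cube c q r x ->
  {near chart_map c x, f \o chart_inv c =1 F}.
Proof.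
move=> [cx /= xr].
have : nbhs (chart_map c x) (ball q r).
  by apply: open_nbhs_nbhs; split; [exact: ball_open|rewrite -ball_normE /= distrC].
apply: filterS => y; rewrite -ball_normE /= distrC => yr.
by rewrite /= FE// ltW.
Qed.

Lemma diff_in_extension x : open_chart_cube c q r x ->
  mdiff f x <-> differentiable F (chart_map c x).
Proof.
move=> xU; have cx := xU.1; rewrite -(mdiff_in f cx); have N := near_extension xU.
split=> D; first by have [] := near_eq_differentiable N D.
have N' : {near chart_map c x, F =1 f \o chart_inv c} by apply: filterS N.
by have [] := near_eq_differentiable N' D.
Qed.

Lemma partials_extension x : open_chart_cube c q r x ->
  partials c f x = \row_j 'D_(delta_mx 0 j) F (chart_map c x).
Proof.
move=> xU; apply/rowP => j; rewrite !mxE; apply: near_eq_derive; exact: near_extension.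
Qed.

End extension.

(** Move from [x] along the chart line in the direction of the gradient. Over a time [s] the
    function grows by [s * b + o(s)], with [b] the squared norm of the gradient, while the distance
    covered is at most [(Num.sqrt b + e) * s]. Hence b <= L sqrt b in the limit. *)
Lemma inner_grad_lip f x L : 0 <= L -> dd_lip_near f x L -> inner_grad g f f x <= L ^+ 2.
Proof.
move=> L0 /dd_lip_near_nbhs[U Ux HU].
have cx := chart_at_dom x; set c := chart_at x in cx.
have [df|ndf] := pselect (mdiff f x); last first.
  by rewrite (@inner_grad0l _ _ _ g c)// ?sqr_ge0// => /(mdiff_in f cx).
rewrite inner_grad_co// (inner_grad_partials g cx df).
set p := partials c f x; set b := cometric g c x p p.
have b0 : 0 <= b by exact: cometric_ge0.
pose y0 := chart_map c x; pose v := p *m invmx (gram g c x).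
have y0c : chart_img c (y0 + 0 *: v) by rewrite scale0r addr0; exact: chart_img_map.
have l0 : chart_line c y0 v 0 = x by rewrite /chart_line scale0r addr0 chart_mapK.
have vT : v^T = invmx (gram g c x) *m p^T by rewrite /v trmx_mul trmx_inv gram_sym.
have spE : speed g (chart_line c y0 v) 0 = Num.sqrt b.
  rewrite chart_line_speed// l0; congr Num.sqrt.
  by rewrite /v mulmxKV ?gram_unit// -/v vT mulmxA.
have pv : dotrow p v = b.
  by rewrite dotrowE vT mulmxA.
have dF := (mdiff_in f cx).2 df; rewrite /diff_in in dF.
suff H e : 0 < e -> b <= L * (Num.sqrt b + e) + e * `|v|.
  have bb : b = Num.sqrt b ^+ 2 by rewrite sqr_sqrtr.
  rewrite bb ler_sqr ?nnegrE ?sqrtr_ge0//; set s := Num.sqrt b in bb H *.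
  have s0 : 0 <= s by exact: sqrtr_ge0.
  rewrite leNgt; apply/negP => Ls.
  (* If the norm [s] of the gradient exceeded [L], this [e] would make the error at most half of the
     excess [(s - L) * s]. *)
  pose e := (s - L) * s / (2 * (L + `|v| + 1)).
  have den : 0 < L + `|v| + 1 by rewrite ltr_wpDl// addr_ge0.
  have num : 0 < (s - L) * s by rewrite mulr_gt0 ?subr_gt0// (le_lt_trans L0 Ls).
  have e0 : 0 < e by rewrite divr_gt0// mulr_gt0.
  have := H e e0; have E : e * (L + `|v| + 1) = (s - L) * s / 2.
    by rewrite /e; field; rewrite gt_eqF.
  by rewrite bb expr2; nra.
move=> e0.
have n1 := C1_chain g (@open_chart_line _ _ M c y0 v) (@chart_line_C1 _ _ M c y0 v) y0c e0.
rewrite spE l0 in n1.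
have /nbhs_ballP[d /= d0 Hd] := differentiable_approx dF e0.
have n2 : \forall s \near (0 : R), s * `|v| < d.
  have dv : 0 < d / (`|v| + 1) by rewrite divr_gt0// ltr_wpDl.
  apply: filterS (near0_norm_lt R dv) => s; rewrite ltr_pdivlMr ?ltr_wpDl// => sd.
  apply: le_lt_trans sd; apply: (@le_trans _ _ (`|s| * `|v|)).
    by rewrite ler_wpM2r// ler_norm.
  by rewrite ler_wpM2l// lerDl.
have n3 : \forall s \near (0 : R), U (chart_line c y0 v s).
  have [lc _] := chart_line_C1 y0c; apply: lc.
  by rewrite l0.
have : \forall s \near (0 : R), [/\ s != 0 -> chain g x (chart_line c y0 v s) ((Num.sqrt b + e) * `|s - 0|),
    s * `|v| < d & U (chart_line c y0 v s)].
  by near=> s; split; near: s.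
move=> /nbhs_ballP[rho /= rho0 Hrho].
have s0 : 0 < rho / 2 by rewrite divr_gt0.
have := Hrho (rho / 2); rewrite /ball /= sub0r normrN gtr0_norm//.
rewrite ltr_pdivrMr// mulr_natr mulr2n ltrDl => /(_ rho0)[h1 h2 h3].
set s := rho / 2 in s0 h1 h2 h3; rewrite gt_eqF// subr0 gtr0_norm// in h1.
have h4 := HU _ _ (nbhs_singleton Ux) h3.
have h5 := le_trans h4 (ler_wpM2l L0 (dd_le (h1 isT))).
have := Hd (s *: v); rewrite -ball_normE /= sub0r normrN normrZ gtr0_norm// => /(_ h2).
have -> : 'd (f \o chart_inv c) (chart_map c x) (s *: v) = s * b.
  by rewrite linearZ/= (diff_dotrow _ dF) -/(partials c f x) -/p pv.
rewrite [s *: v + chart_map c x]addrC chart_mapK// -/(chart_line c y0 v s) => h6.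
have h7 : s * b <= s * (L * (Num.sqrt b + e) + e * `|v|).
  move: h5 h6; rewrite !ler_norml => /andP[h51 h52] /andP[h61 h62].
  rewrite mulrDr; have -> : s * (L * (Num.sqrt b + e)) = L * ((Num.sqrt b + e) * s) by ring.
  have -> : s * (e * `|v|) = e * (s * `|v|) by ring.
  by lra.
by rewrite ler_pM2l// in h7.
Unshelve. all: by end_near. Qed.

End locally_lipschitz.

(** * Differentiability almost everywhere and measurability of gradients *)

Section ae_differentiability.
Context {R : realType} {m : nat} {M : smooth_manifold R m} (g : riemannian_metric M).
Variables (vol : {measure set (borel M) -> \bar R}) (hvol : riemannian_volume g vol).
Implicit Types (c d : chart M) (f h : M -> R) (x : M).

Lemma negligible_local (N : set M) :
  (forall x, exists2 U : set M, nbhs x U & vol.-negligible (N `&` U)) -> vol.-negligible N.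
Proof.
move=> H; have [|U HU] := @choice _ _ (fun x U => nbhs x U /\ vol.-negligible (N `&` U)).
  by move=> x; have [U] := H x; exists U.
have [|s Hs] := @lindelof _ _ M U; first by move=> x; have [] := HU x.
apply: (@negligibleS _ (borel M) R vol (\bigcup_n (N `&` U (s n)))).
  by move=> y Ny; have [n ?] := Hs y; exists n.
by apply: negligible_bigcup => n; have [] := HU (s n).
Qed.

Lemma rV_null_negligible c (Z : set 'rV[R]_m) : rV_null Z ->
  vol.-negligible (chart_dom c `&` chart_map c @^-1` Z).
Proof.
move=> [F F0 ZF].
apply: (@negligibleS _ (borel M) R vol (\bigcup_k (chart_dom c `&` chart_map c @^-1` F k))).
  by move=> x [cx /ZF[k _ Fk]]; exists k.
apply: negligible_bigcup => k; have [mF H] := F0 k.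
have mA : measurable (chart_dom c `&` chart_map c @^-1` F k : set (borel M)).
  by apply: measurable_chart_map => //; apply: borel_open; exact: chart_dom_open.
have Ac : chart_dom c `&` chart_map c @^-1` F k `<=` chart_dom c by move=> x [].
apply/(negligibleP vol mA); apply: etrans (hvol mA Ac) _; apply: H.
- exact: measurable_chart_weight.
- by move=> y; exact: chart_weight_ge0.
- move=> y nFy; rewrite indicE memNset ?mul0r// => -[x [cx Fx] xy].
  by apply: nFy; rewrite -xy.
Qed.

Lemma ae_mdiff f : dd_lip_loc g f -> vol.-negligible [set x | ~ mdiff f x].
Proof.
move=> Hf; apply: negligible_local => x; have cx := chart_at_dom x.
have [r [K [F [r0 qr FK FE]]]] := local_extension Hf cx.
exists (open_chart_cube (chart_at x) (chart_map (chart_at x) x) r).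
  exact: nbhs_open_chart_cube.
apply: negligibleS (rV_null_negligible (chart_at x) (lipschitz_differentiable FK)).
move=> z [nz zU]; split; first by case: zU.
by move=> /(diff_in_extension FE zU).
Qed.

Lemma measurable_partial (F : 'rV[R]_m -> R) (j : 'I_m) : continuous F ->
  measurable_fun ([set y | differentiable F y] : set (borel 'rV[R]_m))
    ('D_(delta_mx 0 j) F : borel 'rV[R]_m -> R).
Proof.
move=> cF; pose e : 'rV[R]_m := delta_mx 0 j.
pose h n (y : borel 'rV[R]_m) : R := n.+1%:R * (F ((y : 'rV[R]_m) + n.+1%:R^-1 *: e) - F y).
apply: (@measurable_fun_cvg _ _ _ _ h) => [n|y /= dF].
  apply: measurable_funTS; apply: measurable_continuous_rV => y.
  apply: (@continuousM R 'rV[R]_m (fun=> n.+1%:R) (fun y => F (y + n.+1%:R^-1 *: e) - F y)); first exact: cst_continuous.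
  apply: continuousB; last exact: cF.
  have tc : continuous (fun y : 'rV[R]_m => y + n.+1%:R^-1 *: e) := @continuous_translation _ _ _.
  exact: (continuous_comp (tc y) (cF _)).
apply/cvgrPdist_le => k k0.
have /nbhs_ballP[d /= d0 Hd] := differentiable_approx dF k0.
have [N HN] := natS_inv_lt d0.
exists N => // n /= Nn; have n0 : 0 < n.+1%:R :> R by rewrite ltr0n.
have ne : `|n.+1%:R^-1 *: e| <= n.+1%:R^-1.
  by rewrite normrZ ger0_norm ?invr_ge0// ler_piMr ?invr_ge0// norm_delta_mx_le.
have := Hd (n.+1%:R^-1 *: e); rewrite -ball_normE /= sub0r normrN.
have nd : `|n.+1%:R^-1 *: e| < d.
  apply: le_lt_trans ne (le_lt_trans _ HN).
  by rewrite lef_pV2 ?posrE// ler_nat.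
move=> /(_ nd); rewrite linearZ/= -deriveE// => hh; rewrite distrC.
have -> : h n y - 'D_e F y = n.+1%:R * (F (n.+1%:R^-1 *: e + y) - F y - n.+1%:R^-1 * 'D_e F y).
  by rewrite /h [n.+1%:R^-1 *: e + _]addrC [RHS]mulrBr mulrA divff ?gt_eqF// mul1r.
rewrite normrM gtr0_norm// -ler_pdivlMl//; apply: le_trans hh _.
by rewrite mulrC ler_wpM2r// ltW.
Qed.

(** Locally both functions extend to Lipschitz functions of the coordinates. Their differentiability
    sets are Borel by the description through [approximable]; on them the dual metric gives a
    formula in the partial derivatives, and elsewhere the value is 0 by convention. *)
Lemma measurable_inner_grad f h : dd_lip_loc g f -> dd_lip_loc g h ->
  measurable_fun setT (inner_grad g f h : borel M -> R).
Proof.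
move=> Hf Hh; apply: measurable_local => x; have cx := chart_at_dom x.
set c := chart_at x in cx; pose q := chart_map c x.
have [r1 [K1 [F [r10 qr1 FK FE]]]] := local_extension Hf cx.
have [r2 [K2 [H [r20 qr2 HK HE]]]] := local_extension Hh cx.
pose r := Num.min r1 r2; have r0 : 0 < r by rewrite lt_min r10.
have rr1 : r <= r1 by rewrite ge_min lexx.
have rr2 : r <= r2 by rewrite ge_min lexx orbT.
have qr (y : 'rV[R]_m) : `|y - q| <= r -> chart_img c y by move=> yr; apply: qr1; exact: le_trans yr rr1.
have FE' (y : 'rV[R]_m) : `|y - q| <= r -> F y = f (chart_inv c y) by move=> yr; apply: FE; exact: le_trans yr rr1.
have HE' (y : 'rV[R]_m) : `|y - q| <= r -> H y = h (chart_inv c y) by move=> yr; apply: HE; exact: le_trans yr rr2.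
have cF : continuous F := lipschitz_fun_continuous FK.
have cH : continuous H := lipschitz_fun_continuous HK.
set U := open_chart_cube c q r.
have oU : open U by exact: open_open_chart_cube.
have mU : measurable (U : set (borel M)) by exact: borel_open.
exists U; split=> //; first exact: nbhs_singleton (nbhs_open_chart_cube cx r0).
have Uc : U `<=` chart_dom c by move=> z [].
have mc : measurable_fun (U : set (borel M)) (chart_map c : borel M -> borel 'rV[R]_m).
  apply: measurable_funS (@measurable_chart_map _ _ M c) => //.
  by apply: borel_open; exact: chart_dom_open.
have dE G : [set y | differentiable G y] = approximable predT G.
  by apply/seteqP; split=> y; [exact: differentiable_approximable|exact: approximable_differentiable].
have mdF : measurable ([set y | differentiable F y] : set (borel 'rV[R]_m)).
  by rewrite dE; exact: measurable_approximable.
have mdH : measurable ([set y | differentiable H y] : set (borel 'rV[R]_m)).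
  by rewrite dE; exact: measurable_approximable.
pose D := U `&` chart_map c @^-1` ([set y | differentiable F y] `&` [set y | differentiable H y]).
have mD : measurable (D : set (borel M)) by apply: mc => //; exact: measurableI.
have DU : D `<=` U by move=> z [].
have -> : U = D `|` (U `\` D).
  by apply/seteqP; split=> z; [have [|] := pselect (D z); [left|right]|case=> [/DU|[]]].
apply/measurable_funU => //; first exact: measurableD.
split; last first.
  apply: (eq_measurable_fun (cst 0 : borel M -> R)); last exact: measurable_cst.
  move=> z; rewrite inE => -[zU nD]; have cz := Uc z zU.
  have [df|ndf] := pselect (mdiff f z); last first.
    by rewrite (@inner_grad0l _ _ _ g c)// => /(mdiff_in f cz).
  have [dh|ndh] := pselect (mdiff h z); last first.
    by rewrite (@inner_grad0r _ _ _ g c)// => /(mdiff_in h cz).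
  exfalso; apply: nD; split=> //; split; [exact: ((diff_in_extension FE' zU).1 df)|exact: ((diff_in_extension HE' zU).1 dh)].
apply: (eq_measurable_fun (fun z : borel M => \sum_j \sum_i
   'D_(delta_mx 0 i) F (chart_map c z) * invmx (gram g c z) i j * 'D_(delta_mx 0 j) H (chart_map c z))).
  move=> z; rewrite inE => -[zU [/= dF dH]]; have cz := Uc z zU.
  have df := (diff_in_extension FE' zU).2 dF; have dh := (diff_in_extension HE' zU).2 dH.
  rewrite (inner_gradE g cz); [|exact/mdiff_in|exact/mdiff_in].
  rewrite (partials_extension FE' zU) (partials_extension HE' zU) /cometric quad_formE.
  by apply: eq_bigr => j _; apply: eq_bigr => i _; rewrite !mxE.
have mDc : measurable_fun (D : set (borel M)) (chart_map c : borel M -> borel 'rV[R]_m).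
  exact: measurable_funS mc.
apply: measurable_sum => j; apply: measurable_sum => i.
apply: measurable_funM; first apply: measurable_funM.
- apply: (measurable_comp mdF _ (measurable_partial i cF) mDc).
  by move=> _ [z [_ [dF _]] <-].
- apply: (@measurable_funS _ _ (borel M) _ U) => //.
  apply: measurable_continuous_on => // z zU.
  apply: continuous_invmx; last exact: gram_unit (Uc z zU).
  by move=> k l; apply: gram_continuous; exact: Uc.
- apply: (measurable_comp mdH _ (measurable_partial j cH) mDc).
  by move=> _ [z [_ [_ dH]] <-].
Qed.

End ae_differentiability.

Section cube_smoothing.
Context {R : realType} {m : nat}.
Implicit Types (q y z a : 'rV[R]_m) (w : 'rV[R]_m -> R).

Lemma rescale_smooth k (s : R) a i : Ck_on k setT (fun y : 'rV[R]_m => (s *: y - a) 0 i).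
Proof.
have oT : open [set: 'rV[R]_m] by exact: openT.
apply: (@Ck_on_ext _ _ _ _ (fun y : 'rV[R]_m => - a 0 i + s * y 0 i)) => // [y _|].
  by rewrite !mxE addrC.
exact: Ck_on_affine.
Qed.

Lemma rescale_differentiable (s : R) a y : differentiable (fun z : 'rV[R]_m => s *: z - a) y.
Proof.
apply: differentiable_rV => i; exact: (C1_differentiable openT (rescale_smooth 1 s a i)).
Qed.

(** [lattice_smoothing] widens the support by 2. The homothety of ratio [2 / r] sends the radius [r]
    to 2 and [2 * r] to 4, so the widened support is the cube of twice the radius. *)
Lemma cube_smoothing w q r K : 0 < r ->
  (forall y z, `|w y - w z| <= K * `|y - z|) -> (forall y, r <= `|y - q| -> w y = 0) ->
  exists C, exists G : nat -> 'rV[R]_m -> R, [/\ 0 <= C,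
    forall n, [/\ smooth_on setT (G n), forall y, 2 * r <= `|y - q| -> G n y = 0,
      forall y, `|G n y - w y| <= C / n.+1%:R & forall y j, `|'D_(delta_mx 0 j) (G n) y| <= C] &
    forall y j, differentiable w y ->
      'D_(delta_mx 0 j) (G n) y @[n --> \oo] --> 'D_(delta_mx 0 j) w y].
Proof.
move=> r0 wK w0; pose dl := r / 2; pose s := 2 / r.
have dl0 : 0 < dl by rewrite divr_gt0.
have s0 : 0 < s by rewrite divr_gt0.
have sdl : s * dl = 1 by rewrite /s /dl; field; rewrite gt_eqF.
pose h y := w (dl *: y - - q).
have hw y : h (s *: y - s *: q) = w y.
  by rewrite /h -scalerBr scalerA [dl * s]mulrC sdl scale1r opprK subrK.
have wh y : w y = h (s *: y - s *: q) by rewrite hw.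
have [|||C [F [HF HD]]] := @lattice_smoothing R m h (K * dl) 2.
- by [].
- move=> y z; rewrite /h (le_trans (wK _ _))//.
  rewrite (_ : _ - - q - _ = dl *: (y - z)); last by apply/rowP => j; rewrite !mxE; ring.
  by rewrite normrZ (gtr0_norm dl0) mulrA.
- move=> y y2; apply: w0; rewrite opprK addrK normrZ gtr0_norm//.
  by rewrite /dl mulrAC ler_pdivlMr// ler_wpM2l// ltW.
pose G n y := F n (s *: y - s *: q).
have C0 : 0 <= C.
  have [_ _ /(_ 0) + _] := HF 0%N; rewrite divr1; exact: le_trans.
have dF n y : differentiable (F n) y.
  by have [Fs _ _ _] := HF n; exact: (C1_differentiable openT (Fs 1%N)).
exists (C + s * C), G; split; first by rewrite addr_ge0// mulr_ge0// ltW.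
- move=> n; have [Fs F0 Fh FD] := HF n; split.
  + move=> k; apply: (@Ck_on_comp _ _ _ k setT setT (F n) (fun y => s *: y - s *: q)) => //.
    * exact: openT.
    * exact: openT.
    * by move=> i; exact: rescale_smooth.
  + move=> y yr; apply: F0; rewrite -scalerBr normrZ gtr0_norm//.
    apply: le_trans (_ : s * (2 * r) <= _); last by rewrite ler_wpM2l// ltW.
    by rewrite /s mulrCA divfK ?gt_eqF//; lra.
  + move=> y; rewrite wh; apply: le_trans (Fh _) _; apply: ler_wpM2r; rewrite ?invr_ge0//.
    by rewrite lerDl; apply: mulr_ge0 => //; exact: ltW.
  + move=> y j; have [_ ->] := derive_rescale j (dF n (s *: y - s *: q)).
    rewrite normrM gtr0_norm//; apply: ler_wpDl => //.
    by apply: ler_wpM2l; [exact: ltW|exact: FD].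
- move=> y j dw; have dh : differentiable h (s *: y - s *: q).
    apply: (@differentiable_comp _ _ _ _ (fun y => dl *: y - - q) w).
      exact: rescale_differentiable.
    by rewrite -scalerBr scalerA [dl * s]mulrC sdl scale1r opprK subrK.
  have E : 'D_(delta_mx 0 j) w y = s * 'D_(delta_mx 0 j) h (s *: y - s *: q).
    have [_] := derive_rescale j dh.
    by have -> : (fun z => h (s *: z - s *: q)) = w by apply/funext => z; exact: hw.
  rewrite E (_ : (fun n => _) = fun n => s * 'D_(delta_mx 0 j) (F n) (s *: y - s *: q)).
    by apply: cvgMr; exact: HD.
  by apply/funext => n; have [_ ->] := derive_rescale j (dF n (s *: y - s *: q)).
Qed.

End cube_smoothing.

Section cutoff.
Context {R : realType} {m : nat} {M : smooth_manifold R m} (g : riemannian_metric M).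

Definition cutoff (x : M) (e : R) (y : M) : R := Num.max 0 (Num.min 1 (2 - 2 / e * dd g x y)).

Lemma cutoff_bounds x e y : 0 <= cutoff x e y <= 1.
Proof. by rewrite le_max lexx/= ge_max ler01 ge_min lexx. Qed.

Lemma cutoff_lipschitz x e y z : 0 < e -> `|cutoff x e y - cutoff x e z| <= 2 / e * dd g y z.
Proof.
move=> e0; have e2 : 0 < 2 / e by rewrite divr_gt0.
have mx (u v : R) : `|Num.max 0 u - Num.max 0 v| <= `|u - v|.
  by rewrite !ler_norml !maxEle; case: (leP 0 u); case: (leP 0 v); case: (ger0P (u - v)) => *; apply/andP; split; lra.
have mn (u v : R) : `|Num.min 1 u - Num.min 1 v| <= `|u - v|.
  by rewrite !ler_norml !minEle; case: (leP 1 u); case: (leP 1 v); case: (ger0P (u - v)) => *; apply/andP; split; lra.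
apply: le_trans (mx _ _) (le_trans (mn _ _) _).
rewrite (_ : _ - _ = 2 / e * (dd g x z - dd g x y)); last by ring.
rewrite normrM gtr0_norm//; apply: ler_wpM2l; first exact: ltW.
by rewrite distrC; exact: dd_lipschitz.
Qed.

Lemma cutoff1 x e y : 0 < e -> dd g x y <= e / 2 -> cutoff x e y = 1.
Proof.
move=> e0 ye; have h : 2 / e * dd g x y <= 1.
  by rewrite mulrC mulrA ler_pdivrMr// mul1r; lra.
by rewrite /cutoff min_l ?max_r//; lra.
Qed.

Lemma cutoff_supp x e y : 0 < e -> cutoff x e y != 0 -> dd g x y < e.
Proof.
move=> e0 hby; rewrite ltNge; apply: contraNN hby => ey.
have h2 : 2 <= 2 / e * dd g x y by rewrite mulrC mulrA ler_pdivlMr//; lra.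
by rewrite /cutoff max_l// ge_min; apply/orP; right; lra.
Qed.

End cutoff.

(** * Smooth approximation of Lipschitz functions of compact support *)

Section smooth_approximation.
Context {R : realType} {m : nat} {M : smooth_manifold R m} (g : riemannian_metric M).
Variables (vol : {measure set (borel M) -> \bar R}) (hvol : riemannian_volume g vol).
Implicit Types (c d : chart M) (f h : M -> R) (x : M).

(** The data required by dominated convergence: a common compact support, uniform convergence with a
    rate, a uniform gradient bound, and convergence of the differentials off a null set. *)
Definition smooth_approx f := exists C (K : set M) (F : nat -> M -> R) (N : set M),
  [/\ 0 <= C, compact K, vol.-negligible N,
    forall n, [/\ smooth_c (F n), forall x, ~ K x -> F n x = 0,
      forall x, `|F n x - f x| <= C / n.+1%:R &
      forall x, coinner g x (covector (F n) x) (covector (F n) x) <= C] &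
    forall x j, ~ N x -> mdiff f x /\
      covector (F n) x 0 j @[n --> \oo] --> covector f x 0 j].

Lemma coinnerDle x (p q : 'rV[R]_m) :
  coinner g x (p + q) (p + q) <= 2 * coinner g x p p + 2 * coinner g x q q.
Proof.
have := coinner_ge0 g x (p - q); rewrite -scaleN1r /coinner.
rewrite !(cometricDl, cometricDr, cometricZl, cometricZr).
by rewrite (cometric_sym g q p (chart_at_dom x)); lra.
Qed.

Lemma smooth_cD f h : smooth_c f -> smooth_c h -> smooth_c (fun x => f x + h x).
Proof.
move=> [cf sf] [ch sh]; split.
  apply: (@subclosed_compact _ _ (closure [set x | f x != 0] `|` closure [set x | h x != 0])).
  - exact: closed_closure.
  - exact: compactU.
  - rewrite -closureU; apply: closureS => x /=; have [->|] := eqVneq (f x) 0; last by left.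
    by rewrite add0r; right.
by move=> c k; apply: Ck_on_add; [exact: open_chart_img|exact: sf|exact: sh].
Qed.

Lemma smooth_approxD f h : smooth_approx f -> smooth_approx h ->
  smooth_approx (fun x => f x + h x).
Proof.
move=> [C [K [F [N [C0 cK N0 HF HN]]]]] [C' [K' [F' [N' [C'0 cK' N'0 HF' HN']]]]].
exists (2 * C + 2 * C'), (K `|` K'), (fun n x => F n x + F' n x), (N `|` N'); split.
- by rewrite addr_ge0// mulr_ge0.
- exact: compactU.
- exact: negligibleU.
- move=> n; have [s1 z1 b1 g1] := HF n; have [s2 z2 b2 g2] := HF' n; split.
  + exact: smooth_cD.
  + by move=> x /not_orP[/z1-> /z2->]; rewrite addr0.
  + move=> x; rewrite opprD addrACA (le_trans (ler_normD _ _))//.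
    rewrite (le_trans (lerD (b1 x) (b2 x)))// -mulrDl ler_wpM2r ?invr_ge0//; lra.
  + move=> x; have [_ ->] := mdiffD (smooth_c_mdiff x s1) (smooth_c_mdiff x s2).
    by apply: le_trans (coinnerDle _ _ _) _; have := g1 x; have := g2 x; lra.
- move=> x j /not_orP[nN nN']; have [d1 c1] := HN x j nN; have [d2 c2] := HN' x j nN'.
  have [d12 E] := mdiffD d1 d2; split=> //; rewrite E mxE.
  rewrite (_ : (fun n => _) = fun n => covector (F n) x 0 j + covector (F' n) x 0 j).
    exact: cvgD.
  apply/funext => n; have [s1 _ _ _] := HF n; have [s2 _ _ _] := HF' n.
  by have [_ ->] := mdiffD (smooth_c_mdiff x s1) (smooth_c_mdiff x s2); rewrite mxE.
Qed.

Lemma covector_transition c x f : chart_dom c x -> mdiff f x ->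
  covector f x = partials c f x *m (transition_jac (chart_at x) c x)^T.
Proof.
move=> cx df; apply: partials_transition => //; first exact: chart_at_dom.
exact/(mdiff_in f cx).
Qed.

Lemma near0_mdiff f x : (\forall z \near x, f z = 0) -> mdiff f x /\ covector f x = 0.
Proof.
move=> N; have [d0 v0] := mdiff_cst (M := M) 0 x.
have N' : \forall z \near x, cst 0 z = f z by apply: filterS N => z ->.
by have [d E] := mdiff_near N' d0; split=> //; rewrite E.
Qed.

Lemma local_smooth_approx x : exists2 U : set M, nbhs x U & forall f L,
  (forall y z, `|f y - f z| <= L * dd g y z) -> 0 <= L -> (forall y, f y != 0 -> U y) ->
  smooth_approx f.
Proof.
have cx := chart_at_dom x; set c := chart_at x in cx.
have [r0 [Lam [r00 La0 qr Hch]]] := local_chain g cx; set q := chart_map c x in qr Hch.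
(* Smoothing doubles the support, and [2 * r] must still be smaller than the radius [r0] of the cube
   controlled by the chart. *)
pose r := r0 / 4; have rp : 0 < r by rewrite divr_gt0.
have r2 : 2 * r < r0 by rewrite /r; lra.
exists (open_chart_cube c q r); first exact: nbhs_open_chart_cube.
move=> f L fL L0 fU; pose w y := f (chart_inv c (clamp_cube q r0 y)).
have wK y z : `|w y - w z| <= (L * Lam) * `|y - z|.
  rewrite /w; set u := clamp_cube q r0 y; set v := clamp_cube q r0 z.
  have [->|uv] := eqVneq u v; first by rewrite subrr normr0 !mulr_ge0// ltW.
  have nuv : 0 < `|u - v| by rewrite normr_gt0 subr_eq0.
  rewrite (le_trans (fL _ _))// -mulrA ler_wpM2l//.
  apply: (@le_trans _ _ (Lam * `|u - v|)); last by rewrite ler_wpM2l ?clamp_cube_lipschitz// ltW.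
  by apply: dd_le; apply: Hch => //; try exact: mulr_gt0; apply: clamp_cube_in; exact: ltW.
have w0 y : r <= `|y - q| -> w y = 0.
  move=> yr; pose u := clamp_cube q r0 y.
  have ur : r <= `|u - q|.
    have [j yj] := rV_norm_coord rp yr; apply: le_trans (rV_coord_le (u - q) j).
    move: yj; rewrite !mxE !ler_normr => /orP[h|h]; apply/orP; [left|right].
      rewrite lerBrDr le_max le_min; apply/orP; right; apply/andP; rewrite /r in h *; split; lra.
    rewrite lerNr lerBlDr ge_max ge_min; apply/andP; rewrite /r in h *; split; first by lra.
    by apply/orP; right; lra.
  apply/eqP; apply: contraT => /fU[_ /=].
  by rewrite chart_invK ?ltNge ?ur//; apply: qr; apply: clamp_cube_in; exact: ltW.
have wE y : `|y - q| <= r0 -> w y = f (chart_inv c y) by move=> yr; rewrite /w clamp_cube_id.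
have [C [G [C0 HG DG]]] := cube_smoothing rp wK w0.
have [C1 C10 HC1] := chart_ext_grad g qr.
have G0 n y : r0 <= `|y - q| -> G n y = 0.
  by move=> yr; have [_ z _ _] := HG n; apply: z; exact: le_trans (ltW r2) yr.
have qr2 y : `|y - q| <= 2 * r -> chart_img c y by move=> yr; apply: qr; exact: le_trans yr (ltW r2).
have Gs n : smooth_c (chart_ext c (G n)).
  by have [Gs _ _ _] := HG n; apply: (chart_ext_smooth qr) => //; exact: G0.
exists (C + (C1 * C) ^+ 2), (chart_closed_cube c q r0), (fun n => chart_ext c (G n)),
  [set z | ~ mdiff f z]; split.
- by rewrite addr_ge0// sqr_ge0.
- exact: chart_closed_cube_compact.
- by apply: (ae_mdiff hvol); exact: dd_lip_loc_global L0 fL.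
- move=> n; have [sG zG bG dG] := HG n; split=> //.
  + by move=> z nz; apply: (chart_ext0 qr) => //; exact: G0.
  + move=> z; apply: le_trans (_ : C / n.+1%:R <= _); last first.
      by rewrite ler_wpM2r ?invr_ge0// lerDl sqr_ge0.
    have [cz|ncz] := pselect (chart_dom c z); last first.
      rewrite /chart_ext asboolF// (_ : f z = 0) ?subrr ?normr0 ?divr_ge0//.
      by apply/eqP; apply: contraT => /fU[].
    rewrite chart_ext_dom// (_ : f z = w (chart_map c z))//.
    have [zr|zr] := leP `|chart_map c z - q| r0; first by rewrite wE// chart_mapK.
    have rz : r <= `|chart_map c z - q| by rewrite (le_trans _ (ltW zr))// /r; lra.
    rewrite w0//; apply/eqP; apply: contraT => /fU[_ /=].
    by rewrite ltNge rz.
  + move=> z; have [_ h] := HC1 (G n) C C0 (G0 n) sG dG z.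
    by rewrite (le_trans h)// lerDr.
- move=> z j /contrapT dz; split=> //.
  have [zU|nzU] := pselect (open_chart_cube c q r0 z); last first.
    have nzK : ~ chart_closed_cube c q (2 * r) z.
      by move=> /(chart_closed_cubeP qr2)[cz zr]; apply: nzU; split=> //=; exact: le_lt_trans r2.
    have oK := open_not_cube qr2.
    have nf : \forall y \near z, f y = 0.
      apply: filterS (open_nbhs_nbhs (conj oK nzK)) => y nyK; apply/eqP; apply: contraT => /fU[cy /= yr].
      by exfalso; apply: nyK; apply/(chart_closed_cubeP qr2); split=> //; lra.
    have nF n : \forall y \near z, chart_ext c (G n) y = 0.
      apply: filterS (open_nbhs_nbhs (conj oK nzK)) => y nyK; apply: (chart_ext0 qr2) => //.
      by have [_ z0 _ _] := HG n.
    have [_ ->] := near0_mdiff nf.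
    rewrite (_ : (fun n => _) = fun=> (0 : 'rV[R]_m) 0 j); first exact: cvg_cst.
    by apply/funext => n; have [_ ->] := near0_mdiff (nF n).
  have cz : chart_dom c z by case: zU.
  have dw := (diff_in_extension wE zU).1 dz.
  rewrite (covector_transition cz dz) (partials_extension wE zU) mxE.
  rewrite (_ : (fun n => _) = fun n => \sum_i 'D_(delta_mx 0 i) (G n) (chart_map c z) *
      (transition_jac (chart_at z) c z)^T i j); last first.
    apply/funext => n; rewrite (covector_transition cz (smooth_c_mdiff z (Gs n))) mxE.
    apply: eq_bigr => i _; congr (_ * _); rewrite mxE; apply: near_eq_derive => /=.
    apply: filterS (open_nbhs_nbhs (conj (@open_chart_img _ _ M c) (chart_img_map cz))) => y cy.
    by rewrite /= chart_ext_dom ?chart_invK//; exact: chart_inv_dom.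
  apply: (@cvg_big R 'I_m +%R 0 xpredT _ nat \oo (index_enum _)
     (fun i n => 'D_(delta_mx 0 i) (G n) (chart_map c z) * (transition_jac (chart_at z) c z)^T i j)).
    by move=> t; apply: cvgD; [exact: cvg_fst|exact: cvg_snd].
  move=> i _.
  have Ew : (\row_j0 'D_(delta_mx 0 j0) w (chart_map c z) : 'rV[R]_m) 0 i =
    'D_(delta_mx 0 i) w (chart_map c z) by rewrite mxE.
  by rewrite Ew; apply: cvgM; [exact: DG|exact: cvg_cst].
Qed.

Lemma lip_mul_bounded f h L B L' B' : (forall y z, `|f y - f z| <= L * dd g y z) ->
  (forall y, `|f y| <= B) -> (forall y z, `|h y - h z| <= L' * dd g y z) -> (forall y, `|h y| <= B') ->
  forall y z, `|f y * h y - f z * h z| <= (L * B' + B * L') * dd g y z.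
Proof.
move=> fL fB hL hB y z.
have -> : f y * h y - f z * h z = (f y - f z) * h y + f z * (h y - h z) by ring.
rewrite (le_trans (ler_normD _ _))// !normrM mulrDl.
rewrite [L * B' * _]mulrAC -[B * L' * _]mulrA.
by apply: lerD; apply: ler_pM.
Qed.

Lemma lip_c_bounded f : lip_c g f -> exists2 B, 0 < B & forall y, `|f y| <= B.
Proof.
move=> /lip_cP[cf [L L0 fL]].
have fc : continuous f := dd_lip_loc_continuous (dd_lip_loc_global L0 fL).
have [|B B0 HB] := compact_locally_bounded (f := fun y => `|f y|) cf.
  move=> y _; exists (`|f y| + 1); have /cvgrPdist_le/(_ 1 ltr01) := fc y; apply: filterS => z yz.
  rewrite -(subrK (f y) (f z)) addrC (le_trans (ler_normD _ _))// lerD2l.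
  by rewrite distrC.
exists B => // y; have [->|fy] := eqVneq (f y) 0; first by rewrite normr0 ltW.
by apply: HB; apply: subset_closure.
Qed.

(** A partition of unity built by compactness. A set is good when some Lipschitz [b] with values in
    [0, 1], equal to 1 on it, makes every product h b approximable. For a union [a + (1 - a) b]
    works: h (a + (1 - a) b) = h a + (h (1 - a)) b, and h (1 - a) is again Lipschitz with compact
    support. *)
Lemma lip_c_smooth_approx f : lip_c g f -> smooth_approx f.
Proof.
move=> lf; have /lip_cP[cf _] := lf.
pose Q (A : set M) := exists b : M -> R, [/\ exists2 L, 0 <= L & forall y z, `|b y - b z| <= L * dd g y z,
  forall y, 0 <= b y <= 1, forall y, A y -> b y = 1 &
  forall h, lip_c g h -> smooth_approx (fun y => h y * b y)].
have [||x _|A [b [_ _ b1 Hb]] KA] := compact_local_property (Q := Q) cf.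
- exists (cst 0); split=> //.
  + by exists 0 => // y z; rewrite subrr normr0 mul0r.
  + by move=> y; rewrite lexx ler01.
  + move=> h _; have [U xU HU] := local_smooth_approx point.
    apply: (HU _ 0) => // [y z|y]; first by rewrite !mulr0 subrr normr0 mul0r.
    by rewrite mulr0 eqxx.
- move=> A B [a [[La La0 aL] a01 aA Ha]] [b [[Lb Lb0 bL] b01 bB Hb]].
  have a1 y : `|a y| <= 1 by rewrite ler_norml; have := a01 y; lra.
  have b1 y : `|b y| <= 1 by rewrite ler_norml; have := b01 y; lra.
  have a'L y z : `|(1 - a y) - (1 - a z)| <= La * dd g y z.
    by rewrite opprB addrCA addrAC subrr add0r distrC.
  have a'1 y : `|1 - a y| <= 1 by rewrite ler_norml; have := a01 y; lra.
  exists (fun y => a y + (1 - a y) * b y); split.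
  + exists (La + (La * 1 + 1 * Lb)); first by rewrite !addr_ge0// mulr_ge0.
    move=> y z; rewrite opprD addrACA; apply: le_trans (ler_normD _ _) _.
    by rewrite [X in _ <= X]mulrDl; exact: (lerD (aL y z) (lip_mul_bounded a'L a'1 bL b1 y z)).
  + move=> y; have := a01 y; have := b01 y; nra.
  + by move=> y [/aA ->|/bB ->]; lra.
  + move=> h lh; have lh' : lip_c g (fun y => h y * (1 - a y)).
      have [Bh Bh0 hB] := lip_c_bounded lh; have /lip_cP[ch [Lh Lh0 hL]] := lh.
      apply/lip_cP; split.
        apply: subclosed_compact ch _; first exact: closed_closure.
        by apply: closureS => y /=; apply: contraNneq => ->; rewrite mul0r.
      exists (Lh * 1 + Bh * La); first by rewrite addr_ge0// mulr_ge0// ltW.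
      exact: lip_mul_bounded.
    rewrite (_ : (fun y => _) = fun y => h y * a y + h y * (1 - a y) * b y).
      by apply: smooth_approxD; [exact: Ha|exact: Hb].
    by apply/funext => y; ring.
- have [U xU HU] := local_smooth_approx x.
  have [e e0 eU] := dd_nbhs g xU.
  exists [set y | dd g x y < e / 2]; last by apply: nbhs_dd; rewrite divr_gt0.
  exists (cutoff g x e); split=> //.
  + exists (2 / e) => [|y z]; first by rewrite divr_ge0// ltW.
    exact: cutoff_lipschitz.
  + by move=> y; exact: cutoff_bounds.
  + by move=> y /= /ltW; exact: cutoff1.
  + move=> h lh; have [Bh Bh0 hB] := lip_c_bounded lh; have /lip_cP[ch [Lh Lh0 hL]] := lh.
    apply: (HU _ (Lh * 1 + Bh * (2 / e))).
    * apply: lip_mul_bounded => // [y z|y]; first exact: cutoff_lipschitz.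
      by rewrite ler_norml; have := cutoff_bounds g x e y; lra.
    * by rewrite addr_ge0// mulr_ge0// ?divr_ge0// ltW.
    * move=> y hby; apply: eU; apply: (@cutoff_supp _ _ _ g) => //.
      by apply: contraNneq hby => ->; rewrite mulr0.
- rewrite (_ : f = fun y => f y * b y); first exact: Hb.
  apply/funext => y; have [->|fy] := eqVneq (f y) 0; first by rewrite mul0r.
  by rewrite b1 ?mulr1//; apply: KA; exact: subset_closure.
Qed.

End smooth_approximation.

(** * Integration *)

Section integration.
Context {d : measure_display} {T : measurableType d} {R : realType}.
Variable mu : {measure set T -> \bar R}.
Implicit Types (f h : T -> R).

Definition integ f := mu.-integrable setT (EFin \o f).
Local Notation RI f := (Rintegral mu setT f).

Lemma integ_measurable f : integ f -> measurable_fun setT f.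
Proof. by move=> /measurable_int/measurable_EFinP. Qed.

Lemma integ_le f h : measurable_fun setT f -> (forall x, `|f x| <= h x) -> integ h -> integ f.
Proof.
move=> mf fh ih; apply: (@le_integrable _ _ _ mu setT measurableT _ (EFin \o h)) => //; first exact/measurable_EFinP.
by move=> x _ /=; rewrite lee_fin (le_trans (fh x))// ler_norm.
Qed.

Lemma integE f : integ f -> (\int[mu]_x (f x)%:E)%E = (RI f)%:E.
Proof. by move=> i; rewrite /Rintegral fineK//; exact: integrable_fin_num. Qed.

Lemma integ_ge0 f : measurable_fun setT f -> (forall x, 0 <= f x) ->
  (\int[mu]_x (f x)%:E < +oo)%E -> integ f.
Proof.
move=> mf f0 fi; apply/integrableP; split; first exact/measurable_EFinP.
by under eq_integral do rewrite /= ger0_norm//.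
Qed.

Lemma integD f h : integ f -> integ h -> integ (fun x => f x + h x).
Proof. by move=> i j; exact: (integrableD measurableT i j). Qed.

Lemma integB f h : integ f -> integ h -> integ (fun x => f x - h x).
Proof. by move=> i j; exact: (integrableB measurableT i j). Qed.

Lemma integZ c f : integ f -> integ (fun x => c * f x).
Proof. by move=> i; exact: (integrableZl measurableT c i). Qed.

Lemma RI_D f h : integ f -> integ h -> RI (fun x => f x + h x) = RI f + RI h.
Proof. by move=> i j; exact: RintegralD. Qed.

Lemma RI_B f h : integ f -> integ h -> RI (fun x => f x - h x) = RI f - RI h.
Proof. by move=> i j; exact: RintegralB. Qed.

Lemma RI_Z c f : integ f -> RI (fun x => c * f x) = c * RI f.
Proof. by move=> i; exact: RintegralZl. Qed.

Lemma RI_ge0 f : (forall x, 0 <= f x) -> 0 <= RI f.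
Proof. by move=> f0; exact: Rintegral_ge0. Qed.

Lemma RI_le f h : integ f -> integ h -> (forall x, f x <= h x) -> RI f <= RI h.
Proof. by move=> i j fh; apply: le_Rintegral. Qed.

Lemma negligible_ae (N : set T) (P : T -> Prop) : mu.-negligible N ->
  (forall x, ~ N x -> P x) -> \forall x \ae mu, P x.
Proof.
move=> N0 H; apply: negligibleS N0 => x /= nP; apply: contrapT => nN; exact: nP (H x nN).
Qed.

Lemma RI_ae f h (N : set T) : measurable_fun setT f -> measurable_fun setT h -> mu.-negligible N ->
  (forall x, ~ N x -> f x = h x) -> RI f = RI h.
Proof.
move=> mf mh N0 E; rewrite /Rintegral; congr fine; apply: ae_eq_integral => //.
- exact/measurable_EFinP.
- exact/measurable_EFinP.
- by apply: (negligible_ae N0) => x nN _; rewrite E.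
Qed.

Lemma RI_le_ae f h (N : set T) : integ f -> integ h -> mu.-negligible N ->
  (forall x, ~ N x -> f x <= h x) -> RI f <= RI h.
Proof.
move=> i j N0 E; have k : integ (fun x => Num.max (f x) (h x)).
  have e x : Num.max (f x) (h x) = f x + Num.max 0 (h x - f x).
    by rewrite !maxEle; case: ifP; case: ifP => //; rewrite ?subr_ge0; try lra;
      move=> /negbT + /negbT; rewrite -!ltNge; lra.
  apply: (integ_le _ _ (integD (integrable_norm i) (integrable_norm j))).
    by apply: measurable_maxr; exact: integ_measurable.
  move=> x /=; rewrite maxEle; case: ifP => _; first by rewrite lerDr.
  by rewrite lerDl.
rewrite -(@RI_ae (fun x => Num.max (f x) (h x)) h N)//.
- by apply: RI_le => // x; rewrite le_max lexx.
- exact: integ_measurable.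
- exact: integ_measurable.
- by move=> x /E; rewrite maxEle => ->.
Qed.

Lemma RI_dct (f_ : nat -> T -> R) f h (N : set T) : (forall n, measurable_fun setT (f_ n)) ->
  measurable_fun setT f -> integ h -> (forall n x, `|f_ n x| <= h x) -> mu.-negligible N ->
  (forall x, ~ N x -> f_ n x @[n --> \oo] --> f x) ->
  integ f /\ RI (f_ n) @[n --> \oo] --> RI f.
Proof.
move=> mf_ mf ih fh N0 fc.
have [||||i _ c] := @dominated_convergence _ _ _ mu setT measurableT
   (fun n x => (f_ n x)%:E) (EFin \o f) (EFin \o h) _ _ _ ih.
- by move=> n; exact/measurable_EFinP.
- exact/measurable_EFinP.
- apply: (negligible_ae N0) => x nN _; apply: cvg_EFin; last exact: fc.
  by apply: nearW => n.
- by apply: (negligible_ae (negligible_set0 _)) => x _ n _; rewrite /= lee_fin.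
split=> //; apply: fine_cvg.
by have -> : (fine (\int[mu]_x (EFin \o f) x))%:E = (\int[mu]_x (EFin \o f) x)%E
  by rewrite fineK//; exact: integrable_fin_num.
Qed.

Lemma fatou_bound (f_ : nat -> T -> R) f (B : \bar R) : (forall n, measurable_fun setT (f_ n)) ->
  (forall n x, 0 <= f_ n x) -> (forall x, f_ n x @[n --> \oo] --> f x) ->
  (forall n, (\int[mu]_x (f_ n x)%:E <= B)%E) -> (\int[mu]_x (f x)%:E <= B)%E.
Proof.
move=> mf f0 fc fB.
have mfE n : measurable_fun setT (fun x => (f_ n x)%:E) by exact/measurable_EFinP.
have := @fatou _ _ _ mu setT measurableT (fun n x => (f_ n x)%:E) mfE.
rewrite (_ : (fun x => limn_einf _) = EFin \o f); last first.
  apply/funext => x; have E : (f_ n x)%:E @[n --> \oo] --> (f x)%:E.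
    by apply: cvg_EFin; [apply: nearW => n|exact: fc].
  by rewrite (cvg_limn_einf_sup E).1.
move=> /(_ _)/le_trans; apply; first by move=> n x _; rewrite lee_fin.
rewrite limn_einf_lim; apply: lime_le; first exact: is_cvg_einfs.
apply: nearW => n; apply: le_trans (fB n).
by apply: ereal_inf_lbound; exists n => //=.
Qed.

Lemma hoelder_RI f h p q : measurable_fun setT f -> measurable_fun setT h ->
  (forall x, 0 <= f x) -> (forall x, 0 <= h x) -> 0 < p -> 0 < q -> p^-1 + q^-1 = 1 ->
  integ (fun x => f x `^ p) -> integ (fun x => h x `^ q) ->
  integ (fun x => f x * h x) /\
  RI (fun x => f x * h x) <= RI (fun x => f x `^ p) `^ p^-1 * RI (fun x => h x `^ q) `^ q^-1.
Proof.
move=> mf mh f0 h0 p0 q0 pq i j.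
have NE k r : (forall x, 0 <= k x) -> 0 < r -> integ (fun x => k x `^ r) ->
    ('N[mu]_r%:E [EFin \o k] = (RI (fun x => k x `^ r) `^ r^-1)%:E)%E.
  move=> k0 r0 ik; rewrite unlock /= -poweR_EFin -(integE ik); congr (_ `^ _)%E.
  by apply: eq_integral => x _; rewrite /= ger0_norm.
have := hoelder mu mf mh p0 q0 pq; rewrite (NE f p)// (NE h q)// -EFinM Lnorm1.
have -> : (\int[mu]_x `|(EFin \o (f \* h)%R) x| = \int[mu]_x (f x * h x)%:E)%E.
  by apply: eq_integral => x _ /=; rewrite ger0_norm ?mulr_ge0.
move=> H; have k : integ (fun x => f x * h x).
  apply: integ_ge0 => [|x|]; [exact: measurable_funM|exact: mulr_ge0|].
  exact: le_lt_trans H (ltry _).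
by split=> //; move: H; rewrite integE// lee_fin.
Qed.

End integration.

Section lipschitz_algebra.
Context {R : realType} {m : nat} {M : smooth_manifold R m} (g : riemannian_metric M).
Implicit Types (f h : M -> R) (x : M).

Lemma dd_lip_locE f : dd_lip_loc g f <-> forall x, exists L (U : set M), [/\ 0 <= L, nbhs x U &
  forall y z, U y -> U z -> `|f y - f z| <= L * dd g y z].
Proof.
split=> H x.
  by have [L L0 /dd_lip_near_nbhs[U Ux HU]] := H x; exists L, U.
have [L [U [L0 Ux HU]]] := H x; exists L => //.
by exists (U, U) => //= -[y z] /= [Uy Uz]; exact: HU.
Qed.

Lemma dd_lip_loc_cst (c : R) : dd_lip_loc g (cst c).
Proof. by apply: (@dd_lip_loc_global _ _ _ _ _ 0) => // y z; rewrite subrr normr0 mul0r. Qed.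

Lemma dd_lip_locD f h : dd_lip_loc g f -> dd_lip_loc g h -> dd_lip_loc g (fun x => f x + h x).
Proof.
move=> /dd_lip_locE Hf /dd_lip_locE Hh; apply/dd_lip_locE => x.
have [L [U [L0 Ux HU]]] := Hf x; have [L' [U' [L'0 U'x HU']]] := Hh x.
exists (L + L'), (U `&` U'); split; [exact: addr_ge0|exact: filterI|].
move=> y z [Uy U'y] [Uz U'z]; rewrite opprD addrACA (le_trans (ler_normD _ _))// mulrDl.
by apply: lerD; [exact: HU|exact: HU'].
Qed.

Lemma near_bounded f x : {for x, continuous f} -> \forall z \near x, `|f z| <= `|f x| + 1.
Proof.
move=> /cvgrPdist_le/(_ 1 ltr01); apply: filterS => z h.
have -> : f z = f x + (f z - f x) by ring.
by rewrite (le_trans (ler_normD _ _))// lerD2l distrC.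
Qed.

Lemma dd_lip_locM f h : dd_lip_loc g f -> dd_lip_loc g h -> dd_lip_loc g (fun x => f x * h x).
Proof.
move=> lf lh; have cf := dd_lip_loc_continuous lf; have ch := dd_lip_loc_continuous lh.
move: lf lh => /dd_lip_locE Hf /dd_lip_locE Hh; apply/dd_lip_locE => x.
have [L [U [L0 Ux HU]]] := Hf x; have [L' [U' [L'0 U'x HU']]] := Hh x.
have nf := near_bounded (cf x); have nh := near_bounded (ch x).
exists (L * (`|h x| + 1) + (`|f x| + 1) * L'),
  ((U `&` U') `&` ([set z | `|f z| <= `|f x| + 1] `&` [set z | `|h z| <= `|h x| + 1])); split.
- by rewrite addr_ge0// mulr_ge0// addr_ge0.
- by apply: filterI; apply: filterI.
- move=> y z [[Uy U'y] [/= fy hy]] [[Uz U'z] [/= fz hz]].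
  have -> : f y * h y - f z * h z = (f y - f z) * h y + f z * (h y - h z) by ring.
  rewrite (le_trans (ler_normD _ _))// !normrM mulrDl.
  rewrite [L * _ * dd _ _ _]mulrAC -[_ * L' * _]mulrA.
  by apply: lerD; apply: ler_pM => //; [exact: HU|exact: HU'].
Qed.

(** The derivative is to be bounded on half-lines, which suits the truncated powers: they vanish on
    the negative axis and may be unbounded at infinity. *)
Lemma dd_lip_loc_comp (p p' : R -> R) f : (forall t : R, is_derive t 1 p (p' t)) ->
  (forall T : R, exists B, forall t, t <= T -> `|p' t| <= B) ->
  dd_lip_loc g f -> dd_lip_loc g (fun x => p (f x)).
Proof.
move=> dp bp lf; have cf := dd_lip_loc_continuous lf.
move: lf => /dd_lip_locE Hf; apply/dd_lip_locE => x.
have [L [U [L0 Ux HU]]] := Hf x; have nf := near_bounded (cf x).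
have [B HB] := bp (`|f x| + 1).
have B0 : 0 <= B by apply: le_trans (HB 0 _); rewrite // addr_ge0.
exists (B * L), (U `&` [set z | `|f z| <= `|f x| + 1]); split; [exact: mulr_ge0|exact: filterI|].
move=> y z [Uy /= fy] [Uz /= fz]; rewrite -mulrA.
suff H (s t : R) : s <= t -> t <= `|f x| + 1 -> `|p t - p s| <= B * `|t - s|.
  apply: (@le_trans _ _ (B * `|f y - f z|)); last by rewrite ler_wpM2l// HU.
  have [yz|/ltW yz] := leP (f y) (f z).
    by rewrite distrC [`|f y - _|]distrC; apply: H => //; exact: le_trans (ler_norm _) fz.
  by apply: H => //; exact: le_trans (ler_norm _) fy.
move=> st tT; have [|c] := @MVT_segment _ p p' s t st (fun u _ => dp u).
  by apply: derivable_within_continuous => u _; case: (dp u).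
rewrite in_itv/= => /andP[_ ct] ->; rewrite normrM ler_wpM2r//.
by apply: HB; exact: le_trans tT.
Qed.

Definition comp_supp f := exists2 K : set M, compact K & forall x, ~ K x -> f x = 0.

Lemma comp_suppM f h : comp_supp f -> comp_supp (fun x => f x * h x).
Proof. by move=> [K cK HK]; exists K => // x /HK ->; rewrite mul0r. Qed.

Lemma comp_suppMr f h : comp_supp f -> comp_supp (fun x => h x * f x).
Proof. by move=> [K cK HK]; exists K => // x /HK ->; rewrite mulr0. Qed.

Lemma comp_suppD f h : comp_supp f -> comp_supp h -> comp_supp (fun x => f x + h x).
Proof.
move=> [K cK HK] [K' cK' HK']; exists (K `|` K'); first exact: compactU.
by move=> x /not_orP[/HK-> /HK'->]; rewrite addr0.
Qed.

Lemma comp_suppN f : comp_supp f -> comp_supp (fun x => - f x).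
Proof. by move=> [K cK HK]; exists K => // x /HK->; rewrite oppr0. Qed.

Lemma comp_supp_near0 (K : set M) f x : compact K -> (forall x, ~ K x -> f x = 0) -> ~ K x ->
  \forall z \near x, f z = 0.
Proof.
move=> cK HK nK; have clK := compact_closed (@manifold_hausdorff _ _ M) cK.
by apply: filterS (open_nbhs_nbhs (conj (closed_openC clK) nK)) => z /HK.
Qed.

Lemma coinner0l x p : coinner g x 0 p = 0.
Proof. by rewrite /coinner /cometric !mul0mx mxE. Qed.

Lemma inner_grad_near0 f h x : (\forall z \near x, f z = 0) -> inner_grad g f h x = 0.
Proof.
move=> N; have [df E] := near0_mdiff N; have ax := chart_at_dom x.
have [dh|dh] := pselect (mdiff h x); last by rewrite (inner_grad0r g _ ax dh).
by rewrite inner_grad_co// E coinner0l.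
Qed.

Lemma comp_supp_inner_grad f h : comp_supp f -> comp_supp (inner_grad g f h).
Proof.
move=> [K cK HK]; exists K => // x nK; apply: inner_grad_near0.
exact: comp_supp_near0 cK HK nK.
Qed.

Lemma comp_supp_compactly f : comp_supp f <-> compactly_supported f.
Proof.
split=> [[K cK HK]|cf].
  have clK := compact_closed (@manifold_hausdorff _ _ M) cK.
  apply: subclosed_compact cK _; first exact: closed_closure.
  move/closure_id : clK => ->; apply: closureS => x /= /eqP fx.
  by apply: contrapT => /HK.
exists (closure [set x | f x != 0]) => // x nx; apply/eqP; apply: contrapT => /negP fx.
by apply: nx; exact: subset_closure.
Qed.

Lemma lip_c_dd f : lip_c g f -> dd_lip_loc g f /\ comp_supp f.
Proof.
move=> /lip_cP[cf [L L0 fL]]; split; last exact/comp_supp_compactly.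
exact: dd_lip_loc_global L0 fL.
Qed.

(** By compactness a single [N] serves as Lipschitz constant for pairs with one point in [K] and
    distance less than [N^-1]. For more distant points the bound [2 * B] on the difference is at
    most [2 * B * N] times the distance. *)
Lemma dd_lip_loc_lip_c f : dd_lip_loc g f -> comp_supp f -> lip_c g f.
Proof.
move=> lf cf; have fc := dd_lip_loc_continuous lf.
apply/lip_cP; split; first exact/comp_supp_compactly.
case: cf => K cK HK.
have [|B B0 HB] := compact_locally_bounded (f := fun x => `|f x|) cK.
  by move=> x _; exists (`|f x| + 1); exact: near_bounded (fc x).
have {}HB x : `|f x| <= B.
  by have [/HB//|/HK->] := pselect (K x); rewrite normr0 ltW.
have [|n [nr Hn]] := (compact_near_coveringP K).1 cK R (pinfty_nbhs R)
    (fun n x => forall y, dd g x y < n^-1 -> `|f x - f y| <= n * dd g x y) _.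
  move=> x Kx; have [L [U [L0 Ux HU]]] := (dd_lip_locE f).1 lf x.
  have [e e0 eU] := dd_nbhs g Ux; have e2 : 0 < e / 2 by rewrite divr_gt0.
  exists ([set z | dd g x z < e / 2], [set n | Num.max L (2 / e) < n]) => /=.
    split; first exact: nbhs_dd.
    by exists (Num.max L (2 / e)); split=> //; rewrite num_real.
  move=> [z n] /= [xz]; rewrite gt_max => /andP[Ln en] y zy.
  have n0 : 0 < n by apply: le_lt_trans en; rewrite divr_ge0// ltW.
  have ne : n^-1 < e / 2 by rewrite -[e / 2]invrK invf_div ltf_pV2 ?posrE// divr_gt0.
  apply: le_trans (HU z y _ _) _.
  - by apply: eU; lra.
  - by apply: eU; apply: le_lt_trans (dd_triangle g x z y) _; lra.
  - by rewrite ler_wpM2r ?dd_ge0// ltW.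
pose N := Num.max 1 (n + 1); have N0 : 0 < N by rewrite lt_max ltr01.
have nN : n < N by rewrite lt_max ltrDl ltr01 orbT.
have {}Hn := Hn N nN.
have BN : 0 <= 2 * B * N by rewrite mulr_ge0 ?mulr_ge0// ltW.
exists (N + 2 * B * N); first by rewrite addr_ge0// ltW.
have H y z : K y -> `|f y - f z| <= (N + 2 * B * N) * dd g y z.
  move=> Ky; rewrite mulrDl; have [yz|yz] := ltP (dd g y z) N^-1.
    by rewrite (le_trans (Hn y Ky z yz))// lerDl mulr_ge0 ?dd_ge0.
  apply: (@le_trans _ _ (2 * B)).
    by rewrite (le_trans (ler_normB _ _))//; have := HB y; have := HB z; lra.
  apply: (@le_trans _ _ (2 * B * N * dd g y z)); last by rewrite lerDr mulr_ge0 ?dd_ge0// ltW.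
  rewrite -(mulrA (2 * B)) ler_peMr ?mulr_ge0 ?(ltW B0)//.
  by move: yz; rewrite -div1r ler_pdivrMr// mulrC.
move=> y z; have [Ky|/HK fy] := pselect (K y); first exact: H.
have [Kz|/HK fz] := pselect (K z); first by rewrite distrC dd_sym; exact: H.
by rewrite fy fz subrr normr0 mulr_ge0 ?dd_ge0// addr_ge0// ltW.
Qed.

End lipschitz_algebra.

Section manifold_integration.
Context {R : realType} {m : nat} {M : smooth_manifold R m} (g : riemannian_metric M).
Variables (vol : {measure set (borel M) -> \bar R}) (hvol : riemannian_volume g vol).
Implicit Types (f h : M -> R) (x : M).
Local Notation RI f := (@Rintegral _ (borel M) R vol setT f).
Local Notation integ := (@integ _ (borel M) R vol).

(** A class of integrands stable under sums and products, and integrable as soon as the support is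
    compact. *)
Definition loc_bdd f := measurable_fun setT (f : borel M -> R) /\
  forall x, exists B, \forall z \near x, `|f z| <= B.

Lemma loc_bdd_continuous f : continuous f -> loc_bdd f.
Proof.
move=> cf; split=> [|x]; last by exists (`|f x| + 1); exact: near_bounded (cf x).
have oT : open [set: M] by exact: openT.
exact: (measurable_continuous_on oT (fun y _ => cf y)).
Qed.

Lemma loc_bddM f h : loc_bdd f -> loc_bdd h -> loc_bdd (fun x => f x * h x).
Proof.
move=> [mf bf] [mh bh]; split=> [|x]; first exact: measurable_funM.
have [B HB] := bf x; have [B' HB'] := bh x; exists (B * B').
by move: HB HB'; apply: filterS2 => z h1 h2; rewrite normrM; apply: ler_pM.
Qed.

Lemma loc_bddD f h : loc_bdd f -> loc_bdd h -> loc_bdd (fun x => f x + h x).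
Proof.
move=> [mf bf] [mh bh]; split=> [|x]; first exact: measurable_funD.
have [B HB] := bf x; have [B' HB'] := bh x; exists (B + B').
by move: HB HB'; apply: filterS2 => z h1 h2; rewrite (le_trans (ler_normD _ _))// lerD.
Qed.

Lemma loc_bdd_cst (c : R) : loc_bdd (cst c).
Proof. by apply: loc_bdd_continuous => x; exact: cst_continuous. Qed.

Lemma loc_bddN f : loc_bdd f -> loc_bdd (fun x => - f x).
Proof.
move=> [mf bf]; split=> [|x]; first exact: measurableT_comp.
by have [B HB] := bf x; exists B; apply: filterS HB => z; rewrite normrN.
Qed.

Lemma loc_bdd_inner_grad f h : dd_lip_loc g f -> dd_lip_loc g h -> loc_bdd (inner_grad g f h).
Proof.
move=> lf lh; split=> [|x]; first exact: measurable_inner_grad.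
have [L [U [L0 Ux HU]]] := (dd_lip_locE g f).1 lf x.
have [L' [U' [L'0 U'x HU']]] := (dd_lip_locE g h).1 lh x.
exists (L ^+ 2 + L' ^+ 2).
have nU : \forall z \near x, nbhs z U by exact: (@nbhs_interior _ x U Ux).
have nU' : \forall z \near x, nbhs z U' by exact: (@nbhs_interior _ x U' U'x).
move: nU nU'; apply: filterS2 => z Uz U'z.
have h1 : inner_grad g f f z <= L ^+ 2.
  by apply: inner_grad_lip => //; exists (U, U) => //= -[y w] /= [? ?]; exact: HU.
have h2 : inner_grad g h h z <= L' ^+ 2.
  by apply: inner_grad_lip => //; exists (U', U') => //= -[y w] /= [? ?]; exact: HU'.
have az := chart_at_dom z.
have b0 : 0 <= L ^+ 2 + L' ^+ 2 by rewrite addr_ge0// sqr_ge0.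
have [df|df] := pselect (mdiff f z); last by rewrite (inner_grad0l g _ az df) normr0.
have [dh|dh] := pselect (mdiff h z); last by rewrite (inner_grad0r g _ az dh) normr0.
move: h1 h2; rewrite !inner_grad_co// => h1 h2.
have p1 := coinner_ge0 g z (covector f z + covector h z).
have p2 := coinner_ge0 g z (covector f z - covector h z).
have p3 := coinner_ge0 g z (covector f z); have p4 := coinner_ge0 g z (covector h z).
move: p1 p2; rewrite -scaleN1r /coinner !(cometricDl, cometricDr, cometricZl, cometricZr).
rewrite -!/(coinner _ _ _ _) (coinner_sym g z (covector h z) (covector f z)) ler_norml => p1 p2.
move: h1 h2 p1 p2 p3 p4; move: (coinner g z (covector f z) (covector f z))
  (coinner g z (covector h z) (covector h z)) (coinner g z (covector f z) (covector h z)) (L ^+ 2) (L' ^+ 2).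
by move=> P Q X l l' h1 h2 p1 p2 p3 p4; apply/andP; split; lra.
Qed.

Lemma integ_indic (K : set M) : compact K -> integ (\1_K).
Proof.
move=> cK; have mK : measurable (K : set (borel M)).
  by apply: borel_closed; exact: (compact_closed (@manifold_hausdorff _ _ M) cK).
apply: integ_ge0 => [|x|]; [exact: measurable_indic|by rewrite indicE|].
by rewrite integral_indic// setIT; exact: vol_compact_finite hvol _ cK.
Qed.

Lemma loc_bdd_integ f : loc_bdd f -> comp_supp f -> integ f.
Proof.
move=> [mf bf] [K cK HK].
have [B B0 HB] := compact_locally_bounded (f := fun x => `|f x|) cK (fun x _ => bf x).
apply: integ_le mf _ (integZ B (integ_indic cK)) => x.
rewrite indicE; have [Kx|nKx] := pselect (K x); first by rewrite mem_set// mulr1 HB.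
by rewrite HK// normr0 mulr_ge0// ltW.
Qed.

Lemma RI_dct_supp (f_ : nat -> M -> R) f (K N : set M) (C : R) :
  (forall n, measurable_fun setT (f_ n : borel M -> R)) -> measurable_fun setT (f : borel M -> R) ->
  compact K -> (forall n x, `|f_ n x| <= C) -> (forall n x, ~ K x -> f_ n x = 0) ->
  vol.-negligible N -> (forall x, ~ N x -> f_ n x @[n --> \oo] --> f x) ->
  integ f /\ RI (f_ n) @[n --> \oo] --> RI f.
Proof.
move=> mf_ mf cK fC fK N0 fc.
apply: (RI_dct mf_ mf (integZ C (integ_indic cK)) _ N0 fc) => n x.
rewrite indicE; have [Kx|nKx] := pselect (K x); first by rewrite mem_set// mulr1.
by rewrite fK// normr0 mulr_ge0// (le_trans _ (fC n x)).
Qed.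

End manifold_integration.

Lemma powR_seq_cvg (R : realType) (r u : R) (u_ : nat -> R) : 0 < r -> (forall n, 0 <= u_ n) ->
  u_ n @[n --> \oo] --> u -> u_ n `^ r @[n --> \oo] --> u `^ r.
Proof.
move=> r0 u_0 cu; have u0 : 0 <= u.
  have -> : u = lim (u_ n @[n --> \oo]) by apply/esym/cvg_lim.
  by apply: limr_ge; [apply/cvg_ex; exists u|apply: nearW].
have [u_eq0|u_neq0] := eqVneq u 0.
  rewrite u_eq0 powR0 ?gt_eqF//; rewrite u_eq0 in cu; apply/cvgrPdist_le => e e0.
  have er : 0 < e `^ r^-1 by exact: powR_gt0.
  have /cvgrPdist_le/(_ _ er) := cu; apply: filterS => n; rewrite !sub0r !normrN.
  rewrite !ger0_norm ?powR_ge0// => ue.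
  have := ge0_ler_powR (ltW r0) (u_0 n) (powR_ge0 _ _) ue.
  by rewrite -powRrM mulVf ?gt_eqF// powRr1// ltW.
have {u_neq0 u0}u0 : 0 < u by rewrite lt_neqAle eq_sym u_neq0.
have [D _] := is_derive1_powR r u0.
have c : {for u, continuous (fun t : R => t `^ r)} := differentiable_continuous ((derivable1_diffP _ _).1 D).
exact: (cvg_comp _ (fun t : R => t `^ r) cu c).
Qed.

Lemma cvg_quad_form (R : realType) n (A : 'M[R]_n) (v_ : nat -> 'rV[R]_n) (v : 'rV[R]_n) :
  (forall j, v_ k 0 j @[k --> \oo] --> v 0 j) ->
  (v_ k *m A *m (v_ k)^T) 0 0 @[k --> \oo] --> (v *m A *m v^T) 0 0.
Proof.
move=> vc; rewrite quad_formE.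
rewrite (_ : (fun k => _) = fun k => \sum_j \sum_i v_ k 0 i * A i j * v_ k 0 j); last first.
  by apply/funext => k; rewrite quad_formE.
have addc : continuous (fun z : R * R => z.1 + z.2).
  by move=> z; apply: cvgD; [exact: cvg_fst|exact: cvg_snd].
apply: (@cvg_big R 'I_n +%R 0 xpredT addc nat \oo (index_enum _) (fun j k => \sum_i v_ k 0 i * A i j * v_ k 0 j)) => j _.
apply: (@cvg_big R 'I_n +%R 0 xpredT addc nat \oo (index_enum _) (fun i k => v_ k 0 i * A i j * v_ k 0 j)) => i _.
by apply: cvgM => //; apply: cvgM => //; exact: cvg_cst.
Qed.

(** * The Sobolev and spectral inequalities for Lipschitz functions *)

Section lip_c_inequalities.
Context {R : realType} {m : nat} {M : smooth_manifold R m} (g : riemannian_metric M).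
Variables (vol : {measure set (borel M) -> \bar R}) (hvol : riemannian_volume g vol).
Implicit Types (f h : M -> R) (x : M).
Local Notation RI f := (@Rintegral _ (borel M) R vol setT f).
Local Notation integ := (@integ _ (borel M) R vol).

Lemma Lnorm_integ (k : M -> R) (r : R) : 0 < r -> integ (fun x => `|k x| `^ r) ->
  ('N[vol]_r%:E [(EFin \o k : borel M -> \bar R)] = (RI (fun x => `|k x| `^ r) `^ r^-1)%:E)%E.
Proof. by move=> r0 ik; rewrite unlock /= -poweR_EFin -integE. Qed.

(** One sequence of smooth functions along which all integrals occurring in the two inequalities
    converge. *)
Lemma lip_c_approx_cvg f : (0 < m)%N -> lip_c g f -> exists F : nat -> M -> R, [/\
  forall n, smooth_c (F n) /\ integ (inner_grad g (F n) (F n)),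
  integ (inner_grad g f f) /\ RI (inner_grad g (F n) (F n)) @[n --> \oo] --> RI (inner_grad g f f),
  forall r : R, 0 < r -> [/\ forall n, integ (fun x => `|F n x| `^ r), integ (fun x => `|f x| `^ r) &
    RI (fun x => `|F n x| `^ r) @[n --> \oo] --> RI (fun x => `|f x| `^ r)] &
  forall b : M -> R, continuous b -> [/\ forall n, integ (fun x => b x * F n x ^+ 2),
      integ (fun x => b x * f x ^+ 2) &
      RI (fun x => b x * F n x ^+ 2) @[n --> \oo] --> RI (fun x => b x * f x ^+ 2)]].
Proof.
move=> m0 lf; have [C [K [F [N [C0 cK N0 HF HN]]]]] := lip_c_smooth_approx hvol lf.
have [ddf _] := lip_c_dd lf; have cf := dd_lip_loc_continuous ddf.
have [B B0 fB] := lip_c_bounded lf.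
have ddF n : dd_lip_loc g (F n).
  have [sF _ _ gF] := HF n.
  apply: (@dd_lip_loc_global _ _ _ _ _ (Num.sqrt C)) => [|y z]; first exact: sqrtr_ge0.
  apply: dd_mvt => [|x]; first exact: sqrtr_ge0.
  by rewrite sqr_sqrtr//; split; [exact: smooth_c_mdiff|exact: gF].
have cF n := dd_lip_loc_continuous (ddF n).
have FK n x : ~ K x -> F n x = 0 by have [_ + _ _] := HF n; apply.
have Ff x : F n x @[n --> \oo] --> f x.
  apply/cvgrPdist_le => e e0; have eC : 0 < e / (C + 1) by rewrite divr_gt0// ltr_wpDl.
  have [n0 Hn0] := natS_inv_lt eC; exists n0 => // n /= nn.
  have [_ _ bF _] := HF n; rewrite distrC (le_trans (bF x))//.
  have n1 : n.+1%:R^-1 <= n0.+1%:R^-1 :> R by rewrite lef_pV2 ?posrE ?ltr0n// ler_nat.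
  have h : n.+1%:R^-1 * (C + 1) <= e.
    by rewrite -ler_pdivlMr ?ltr_wpDl// (le_trans n1)// ltW.
  apply: le_trans h; rewrite mulrC ler_wpM2l ?invr_ge0//; lra.
have fK x : ~ K x -> f x = 0.
  move=> nK; have c0 : F n x @[n --> \oo] --> (0 : R).
    by apply: cvg_near_cst; apply: nearW => n; exact: FK.
  by rewrite -(cvg_lim (@Rhausdorff R) (Ff x)) (cvg_lim (@Rhausdorff R) c0).
have FB n x : `|F n x| <= B + C.
  have [_ _ bF _] := HF n; have -> : F n x = f x + (F n x - f x) by ring.
  rewrite (le_trans (ler_normD _ _))// lerD// (le_trans (bF x))// ler_pdivrMr// ler_peMr//.
  by rewrite ler1n.
have BC : 0 <= B + C by rewrite addr_ge0// ltW.
have csF n : comp_supp (F n) by exists K => // x; exact: FK.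
have csf : comp_supp f by exists K.
have lbF n : loc_bdd (F n) by exact: loc_bdd_continuous.
have lbf : loc_bdd f by exact: loc_bdd_continuous.
have mF n := (lbF n).1; have mf := lbf.1.
have lbG n : loc_bdd (inner_grad g (F n) (F n)) by exact: loc_bdd_inner_grad.
have lbg : loc_bdd (inner_grad g f f) by exact: loc_bdd_inner_grad.
have iG n : integ (inner_grad g (F n) (F n)).
  exact: loc_bdd_integ hvol _ (lbG n) (comp_supp_inner_grad _ _ (csF n)).
have [ig cg] : integ (inner_grad g f f) /\
    RI (inner_grad g (F n) (F n)) @[n --> \oo] --> RI (inner_grad g f f).
  apply: (RI_dct_supp hvol (K := K) (C := C) (N := N)) => //.
  - by move=> n; exact: (lbG n).1.
  - exact: lbg.1.
  - move=> n x; have [sF _ _ gF] := HF n; rewrite ger0_norm ?inner_grad_ge0//.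
    by rewrite inner_grad_co ?gF//; exact: smooth_c_mdiff.
  - move=> n x nK; apply: inner_grad_near0; apply: (comp_supp_near0 cK _ nK); exact: FK.
  - move=> x nN; have dF n : mdiff (F n) x by have [sF _ _ _] := HF n; exact: smooth_c_mdiff.
    have H := @cvg_quad_form R m (invmx (gram g (chart_at x) x)) (fun n => covector (F n) x) (covector f x) (fun j => (HN x j nN).2).
    have df : mdiff f x := (HN x (Ordinal m0) nN).1.
    rewrite inner_grad_co//; apply: cvg_trans H; apply: near_eq_cvg; apply: nearW => n.
    by rewrite inner_grad_co.
exists F; split; [|by split| |].
- by move=> n; split; [have [] := HF n|exact: iG].
- move=> r r0; have mp k : measurable_fun setT (k : borel M -> R) ->
      measurable_fun setT ((fun x => `|k x| `^ r) : borel M -> R).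
    move=> mk; apply: (measurableT_comp (measurable_powR r)).
    exact: (measurableT_comp (@normr_measurable R setT)).
  have iF n : integ (fun x => `|F n x| `^ r).
    apply: (integ_le (mp _ (mF n)) _ (integZ ((B + C) `^ r) (integ_indic hvol cK))) => x.
    rewrite ger0_norm ?powR_ge0// indicE; have [Kx|nKx] := pselect (K x).
      by rewrite mem_set// mulr1; apply: ge0_ler_powR; rewrite ?nnegrE ?(ltW r0).
    by rewrite FK// normr0 powR0 ?gt_eqF// mulr_ge0 ?powR_ge0.
  have [i c] : integ (fun x => `|f x| `^ r) /\
      RI (fun x => `|F n x| `^ r) @[n --> \oo] --> RI (fun x => `|f x| `^ r).
    apply: (RI_dct_supp hvol (K := K) (C := (B + C) `^ r) (N := set0)) => //.
    + by move=> n; exact: mp.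
    + exact: mp.
    + move=> n x; rewrite ger0_norm ?powR_ge0//; apply: ge0_ler_powR; rewrite ?nnegrE ?(ltW r0)//.
    + by move=> n x nK; rewrite FK// normr0 powR0 ?gt_eqF.
    + exact: negligible_set0.
    + move=> x _; apply: powR_seq_cvg => //; exact: (cvg_norm (Ff x)).
  by split.
- move=> b cb; have lb h : loc_bdd h -> loc_bdd (fun x => b x * h x ^+ 2).
    by move=> lh; apply: loc_bddM; [exact: loc_bdd_continuous|exact: loc_bddM].
  have iF n : integ (fun x => b x * F n x ^+ 2).
    apply: (loc_bdd_integ hvol); first exact: lb.
    exact/comp_suppMr/comp_suppM.
  have [D D0 HD] := compact_locally_bounded (f := fun x => `|b x|) cK
     (fun x _ => ex_intro _ (`|b x| + 1) (near_bounded (cb x))).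
  have [i c] : integ (fun x => b x * f x ^+ 2) /\
      RI (fun x => b x * F n x ^+ 2) @[n --> \oo] --> RI (fun x => b x * f x ^+ 2).
    apply: (RI_dct_supp hvol (K := K) (C := D * (B + C) ^+ 2) (N := set0)) => //.
    + by move=> n; exact: (lb _ (lbF n)).1.
    + exact: (lb _ lbf).1.
    + move=> n x; have [Kx|nKx] := pselect (K x); last first.
        by rewrite FK// expr0n mulr0 normr0 mulr_ge0 ?sqr_ge0// ltW.
      rewrite normrM normrX; apply: ler_pM => //; first exact: HD.
      by apply: lerXn2r; rewrite ?nnegrE.
    + by move=> n x nK; rewrite FK// expr0n mulr0.
    + exact: negligible_set0.
    + move=> x _; apply: cvgM; first exact: cvg_cst.
      by rewrite expr2; apply: (cvgM (Ff x) (Ff x)).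
  by split.
Qed.

Lemma sobolev_lip_c (S : R) f : (3 <= m)%N -> 0 < S -> sobolev_inequality g vol S -> lip_c g f ->
  let q : R := 2 * m%:R / (m%:R - 2) in
  integ (fun x => `|f x| `^ q) /\
  RI (fun x => `|f x| `^ q) `^ (2 / q) <= S ^+ 2 * RI (inner_grad g f f).
Proof.
move=> m3 S0 hS lf q.
have m2 : 0 < m%:R - 2 :> R by rewrite subr_gt0 ltr_nat.
have m0 : 0 < m%:R :> R by rewrite ltr0n (leq_trans _ m3).
have q0 : 0 < q by rewrite divr_gt0// mulr_gt0.
have [F [HF [ig cg] Hr _]] := lip_c_approx_cvg (ltn_trans (isT : (0 < 2)%N) m3) lf; have [iFq ifq cq] := Hr q q0.
split=> //.
have H n : RI (fun x => `|F n x| `^ q) `^ (2 / q) <= S ^+ 2 * RI (inner_grad g (F n) (F n)).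
  have [sF iG] := HF n; have := hS (F n) sF; rewrite (Lnorm_integ q0 (iFq n)).
  have E x : `|norm_grad g (F n) x| `^ 2 = inner_grad g (F n) (F n) x.
    by rewrite ger0_norm ?norm_grad_ge0// powR_mulrn ?norm_grad_ge0// norm_grad_sqr.
  have iN : integ (fun x => `|norm_grad g (F n) x| `^ 2).
    by under eq_fun do rewrite E.
  rewrite (@Lnorm_integ _ 2)// -EFinM lee_fin.
  rewrite (_ : (fun x => `|norm_grad g (F n) x| `^ 2) = inner_grad g (F n) (F n)); last exact/funext.
  set X := RI _; set Y := RI _ => XY.
  have Y0 : 0 <= Y by apply: RI_ge0 => x; exact: inner_grad_ge0.
  have : (X `^ q^-1) ^+ 2 <= (S * Y `^ 2^-1) ^+ 2.
    by apply: lerXn2r; rewrite ?nnegrE ?powR_ge0// mulr_ge0 ?powR_ge0// ltW.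
  rewrite -powR_mulrn ?powR_ge0// -powRrM mulrC exprMn => /le_trans; apply.
  by rewrite -(powR_mulrn 2 (powR_ge0 Y _)) -powRrM mulVf// powRr1.
have c1 : S ^+ 2 * RI (inner_grad g (F n) (F n)) @[n --> \oo] --> S ^+ 2 * RI (inner_grad g f f).
  by apply: cvgMr.
have c2 : RI (fun x => `|F n x| `^ q) `^ (2 / q) @[n --> \oo] --> RI (fun x => `|f x| `^ q) `^ (2 / q).
  apply: powR_seq_cvg => // [|n]; first exact: divr_gt0.
  by apply: RI_ge0 => x; exact: powR_ge0.
by apply: (ler_cvg_to c2 c1); apply: nearW.
Qed.

Lemma lambda1_lip_c a H f : (0 < m)%N -> continuous a -> lambda1_ge0 g vol a H -> lip_c g f ->
  integ (fun x => a x * f x ^+ 2) /\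
  H * RI (fun x => a x * f x ^+ 2) <= RI (inner_grad g f f).
Proof.
move=> m0 ca hH lf; have [F [HF [ig cg] _ Hb]] := lip_c_approx_cvg m0 lf.
have [iF ifa c] := Hb a ca; split=> //.
have K n : H * RI (fun x => a x * F n x ^+ 2) <= RI (inner_grad g (F n) (F n)).
  have [sF iG] := HF n; have := hH (F n) sF.
  rewrite (_ : (fun x => (H * a x * F n x ^+ 2)%:E) = fun x => (H * (a x * F n x ^+ 2))%:E); last first.
    by apply/funext => x; rewrite mulrA.
  rewrite (_ : (fun x => (norm_grad g (F n) x ^+ 2)%:E) = fun x => (inner_grad g (F n) (F n) x)%:E); last first.
    by apply/funext => x; rewrite norm_grad_sqr.
  by rewrite (integE (integZ H (iF n))) (integE iG) lee_fin RI_Z.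
have c1 : H * RI (fun x => a x * F n x ^+ 2) @[n --> \oo] --> H * RI (fun x => a x * f x ^+ 2).
  by apply: cvgMr.
by apply: (ler_cvg_to c1 cg); apply: nearW.
Qed.

End lip_c_inequalities.

(** * The weak inequality and its test functions *)

Section weak_formulation.
Context {R : realType} {m : nat} {M : smooth_manifold R m} (g : riemannian_metric M).
Variables (vol : {measure set (borel M) -> \bar R}) (hvol : riemannian_volume g vol).
Implicit Types (f h eta psi a : M -> R) (x : M) (A : R).
Local Notation RI f := (@Rintegral _ (borel M) R vol setT f).
Local Notation integ := (@integ _ (borel M) R vol).

(** The integrand of the weak form after expanding <grad(eta psi), grad psi> by the product rule,
    which is valid where both functions are differentiable. *)
Definition weak_density a A psi eta x := a x * eta x * psi x ^+ 2 +
  (A - 1) * (eta x * inner_grad g psi psi x) - psi x * inner_grad g eta psi x.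

Lemma loc_bdd_weak_density a A psi eta : continuous a -> dd_lip_loc g psi -> dd_lip_loc g eta ->
  loc_bdd (weak_density a A psi eta).
Proof.
move=> ca lpsi leta; have cpsi := dd_lip_loc_continuous lpsi; have ceta := dd_lip_loc_continuous leta.
have [ba bpsi beta] := And3 (loc_bdd_continuous ca) (loc_bdd_continuous cpsi) (loc_bdd_continuous ceta).
have bp := loc_bdd_inner_grad lpsi lpsi; have be := loc_bdd_inner_grad leta lpsi.
apply: loc_bddD; last exact/loc_bddN/loc_bddM.
apply: loc_bddD; first by apply: loc_bddM; exact: loc_bddM.
apply: (loc_bddM (loc_bdd_cst (A - 1))); exact: loc_bddM.
Qed.

Lemma comp_supp_weak_density a A psi eta : comp_supp eta -> comp_supp (weak_density a A psi eta).
Proof.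
move=> ceta; apply: comp_suppD; last exact/comp_suppN/comp_suppMr/comp_supp_inner_grad.
apply: comp_suppD; first exact/comp_suppM/comp_suppMr.
exact/comp_suppMr/comp_suppM.
Qed.

Lemma integ_weak_density a A psi eta : continuous a -> dd_lip_loc g psi -> lip_c g eta ->
  integ (weak_density a A psi eta).
Proof.
move=> ca lpsi /lip_c_dd[leta ceta].
by apply: (loc_bdd_integ hvol); [exact: loc_bdd_weak_density|exact: comp_supp_weak_density].
Qed.

Lemma weak_formE a A psi eta : continuous a -> dd_lip_loc g psi -> lip_c g eta ->
  weak_form g vol a A psi eta = (RI (weak_density a A psi eta))%:E.
Proof.
move=> ca lpsi leta0; have [leta csupp] := lip_c_dd leta0.
have cpsi := dd_lip_loc_continuous lpsi; have ceta := dd_lip_loc_continuous leta.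
have [ba bpsi beta] := And3 (loc_bdd_continuous ca) (loc_bdd_continuous cpsi) (loc_bdd_continuous ceta).
have lep : dd_lip_loc g (fun z => eta z * psi z) := dd_lip_locM leta lpsi.
have i1 : integ (fun x => a x * eta x * psi x ^+ 2).
  apply: (loc_bdd_integ hvol); last exact/comp_suppM/comp_suppMr.
  by apply: loc_bddM; exact: loc_bddM.
have i2 : integ (fun x => A * (eta x * inner_grad g psi psi x)).
  apply: (loc_bdd_integ hvol); last exact/comp_suppMr/comp_suppM.
  apply: (loc_bddM (loc_bdd_cst A)); apply: loc_bddM => //; exact: loc_bdd_inner_grad.
have i3 : integ (inner_grad g (fun z => eta z * psi z) psi).
  apply: (loc_bdd_integ hvol); first exact: loc_bdd_inner_grad.
  exact/comp_supp_inner_grad/comp_suppM.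
rewrite /weak_form (_ : (fun x => (A * eta x * norm_grad g psi x ^+ 2)%:E) =
  fun x => (A * (eta x * inner_grad g psi psi x))%:E); last first.
  by apply/funext => x; rewrite norm_grad_sqr mulrA.
rewrite (integE i1) (integE i2) (integE i3).
have EE (X Y Z : R) : (X%:E + Y%:E - Z%:E)%E = (X + Y - Z)%:E by [].
rewrite EE -(RI_D i1 i2) -(RI_B (integD i1 i2) i3).
congr (_%:E); apply: (RI_ae _ _ (negligibleU (ae_mdiff hvol lpsi) (ae_mdiff hvol leta))).
- exact: (integ_measurable (integB (integD i1 i2) i3)).
- exact: (integ_measurable (integ_weak_density A ca lpsi leta0)).
- move=> x /not_orP[/contrapT dpsi /contrapT deta].
  have [dep E] := mdiffM deta dpsi.
  rewrite /weak_density !inner_grad_co// E /coinner cometricDl !cometricZl; ring.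
Qed.

(** Linearity in the test function holds only almost everywhere, since [grad] is set to 0 at points
    of nondifferentiability. It allows two test functions to be compared through their
    difference. *)
Lemma RI_weak_density_comb a A psi eta eta' (c : R) : continuous a -> dd_lip_loc g psi ->
  lip_c g eta -> lip_c g eta' ->
  RI (weak_density a A psi (fun x => c * eta x - eta' x)) =
  c * RI (weak_density a A psi eta) - RI (weak_density a A psi eta').
Proof.
move=> ca lpsi leta leta'.
have i1 := integ_weak_density A ca lpsi leta; have i2 := integ_weak_density A ca lpsi leta'.
have [le ce] := lip_c_dd leta; have [le' ce'] := lip_c_dd leta'.
have lc : dd_lip_loc g (fun x => c * eta x - eta' x).
  have := dd_lip_locD (dd_lip_locM (dd_lip_loc_cst g c) le) (dd_lip_locM (dd_lip_loc_cst g (-1)) le').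
  by congr dd_lip_loc; apply/funext => x /=; rewrite mulN1r.
rewrite -(RI_Z c i1) -(RI_B (integZ c i1) i2).
apply: (RI_ae _ _ (negligibleU (ae_mdiff hvol lpsi) (negligibleU (ae_mdiff hvol le) (ae_mdiff hvol le')))).
- exact: (loc_bdd_weak_density A ca lpsi lc).1.
- exact: (integ_measurable (integB (integZ c i1) i2)).
- move=> x /not_orP[/contrapT dpsi /not_orP[/contrapT d /contrapT d']].
  have [dc Ec] := mdiffM (mdiff_cst c x).1 d; have [dn En] := mdiffM (mdiff_cst (-1) x).1 d'.
  have [dD ED] := mdiffD dc dn.
  have [dT ET] : mdiff (fun x => c * eta x - eta' x) x /\
      covector (fun x => c * eta x - eta' x) x = c *: covector eta x - covector eta' x.
    rewrite (_ : (fun x => c * eta x - eta' x) = fun z => cst c z * eta z + cst (-1) z * eta' z); last first.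
      by apply/funext => z /=; rewrite mulN1r.
    split=> //; rewrite ED Ec En (mdiff_cst c x).2 (mdiff_cst (-1) x).2 !scaler0 !addr0 scaleN1r.
    by [].
  rewrite -scaleN1r in ET; rewrite /weak_density !inner_grad_co// ET /coinner cometricDl !cometricZl; ring.
Qed.

End weak_formulation.

(** * Truncated powers and the functions F and G *)

Section truncated_powers.
Context {R : realType} (s e : R).
Hypotheses (s0 : 0 < s) (e0 : 0 < e).
Implicit Types (t al : R) (k : nat).

Definition pow_frac t := t `^ s / (t `^ s + e).

(* For t > 0 this is t^al u^k with u = t^s / (t^s + e): for k large it is smooth at 0, and u tends to 1 as e -> 0. *)
Definition trunc_pow al k t := if 0 < t then t `^ al * pow_frac t ^+ k else 0.

(** Since t u' = s u (1 - u), the derivative of t^al u^k is t^(al - 1) u^k (al + k s (1 - u)). It is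
    written through [trunc_pow] so that its bounds follow from theirs. *)
Definition dtrunc_pow al k t :=
  (al + k%:R * s) * trunc_pow (al - 1) k t - k%:R * s * trunc_pow (al - 1) k.+1 t.

Lemma pow_frac_den t : 0 < t `^ s + e.
Proof. by rewrite ltr_wpDl ?powR_ge0. Qed.

Lemma pow_frac_ge0 t : 0 <= pow_frac t.
Proof. by rewrite divr_ge0 ?powR_ge0// ltW// pow_frac_den. Qed.

Lemma pow_frac_le1 t : pow_frac t <= 1.
Proof. by rewrite ler_pdivrMr ?pow_frac_den// mul1r lerDl ltW. Qed.

Lemma pow_frac_le t : pow_frac t <= t `^ s / e.
Proof. by rewrite ler_wpM2l ?powR_ge0// lef_pV2 ?posrE ?pow_frac_den// lerDr powR_ge0. Qed.

Lemma trunc_pow_ge0 al k t : 0 <= trunc_pow al k t.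
Proof. by rewrite /trunc_pow; case: ifP => // _; rewrite mulr_ge0 ?powR_ge0// exprn_ge0// pow_frac_ge0. Qed.

Lemma trunc_pow_le al k t : 0 <= t -> trunc_pow al k t <= t `^ al.
Proof.
move=> t0; rewrite /trunc_pow; case: ifP => _; last exact: powR_ge0.
by rewrite ler_piMr ?powR_ge0// exprn_ile1 ?pow_frac_ge0 ?pow_frac_le1.
Qed.

Lemma trunc_pow_small al k t : 0 < t -> trunc_pow al k t <= t `^ (al + k%:R * s) / e ^+ k.
Proof.
move=> t0; rewrite /trunc_pow t0 powRD ?(gt_eqF t0) ?implybT// -mulrA ler_wpM2l ?powR_ge0//.
rewrite [k%:R * s]mulrC powRrM powR_mulrn ?powR_ge0// -expr_div_n.
by apply: lerXn2r; rewrite ?nnegrE ?pow_frac_ge0 ?divr_ge0 ?powR_ge0 ?pow_frac_le// ltW.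
Qed.

Lemma trunc_pow_bounded al k : 0 <= al + k%:R * s -> forall T, exists2 B, 0 <= B &
  forall t, t <= T -> `|trunc_pow al k t| <= B.
Proof.
move=> ak T; exists (T `^ (al + k%:R * s) / e ^+ k).
  by rewrite divr_ge0 ?powR_ge0// exprn_ge0// ltW.
move=> t tT; rewrite ger0_norm ?trunc_pow_ge0//; have [t0|t0] := ltP 0 t; last first.
  by rewrite /trunc_pow ltNge t0/= divr_ge0 ?powR_ge0// exprn_ge0// ltW.
rewrite (le_trans (trunc_pow_small _ _ t0))// ler_wpM2r ?invr_ge0 ?exprn_ge0 ?(ltW e0)//.
exact: ge0_ler_powR (ltW t0) (le_trans (ltW t0) tT) tT.
Qed.

Lemma dtrunc_pow_bounded al k : 1 <= al + k%:R * s -> forall T, exists B,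
  forall t, t <= T -> `|dtrunc_pow al k t| <= B.
Proof.
move=> ak T; have [|B B0 HB] := @trunc_pow_bounded (al - 1) k _ T; first lra.
have [|B' B'0 HB'] := @trunc_pow_bounded (al - 1) k.+1 _ T; first by rewrite -natr1 mulrDl mul1r; have := ltW s0; lra.
exists (`|al + k%:R * s| * B + `|k%:R * s| * B') => t tT.
rewrite /dtrunc_pow (le_trans (ler_normB _ _))// [X in X + _]normrM [X in _ + X]normrM.
by apply: lerD; apply: ler_wpM2l => //; [exact: HB|exact: HB'].
Qed.

Lemma is_derive_pow_frac t : 0 < t ->
  is_derive t 1 pow_frac (s * pow_frac t * (1 - pow_frac t) / t).
Proof.
move=> t0; have tn0 : t != 0 by rewrite gt_eqF.
have D1 := is_derive1_powR s t0.
have den : t `^ s + e != 0 by rewrite gt_eqF// pow_frac_den.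
have D2 : is_derive t 1 (fun x => x `^ s + e) (s * t `^ (s - 1)).
  by apply: is_derive_eq (is_deriveD D1 (is_derive_cst e t 1)) _; rewrite addr0.
have D3 := @is_deriveV R (fun x => x `^ s + e) t _ 1 den D2.
have D : is_derive t 1 pow_frac _ := is_deriveM D1 D3.
apply: is_derive_eq D _.
rewrite /GRing.scale/= powRB// ?(gt_eqF t0) ?implybT// powRr1 ?(ltW t0)// /pow_frac.
by field; rewrite tn0 den.
Qed.

Lemma is_derive_trunc_pow_gt0 al k t : 0 < t ->
  is_derive t 1 (trunc_pow al k) (dtrunc_pow al k t).
Proof.
move=> t0; have tn0 : t != 0 by rewrite gt_eqF.
have N : \near t, t `^ al * pow_frac t ^+ k = trunc_pow al k t.
  near=> z; rewrite /trunc_pow ifT//; near: z; exact: lt_nbhsr.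
apply: near_eq_is_derive N _.
have D1 := is_derive1_powR al t0; have D2 := is_derive_pow_frac t0.
have D3 : is_derive t 1 (fun x => pow_frac x ^+ k) (k%:R * pow_frac t ^+ k.-1 * (s * pow_frac t * (1 - pow_frac t) / t)).
  have -> : (fun x => pow_frac x ^+ k) = pow_frac ^+ k by rewrite exprfctE.
  exact: is_deriveX.
apply: is_derive_eq (is_deriveM D1 D3) _.
rewrite /GRing.scale/= /dtrunc_pow /trunc_pow t0 powRB// ?(gt_eqF t0) ?implybT// powRr1 ?(ltW t0)//.
by case: k {D3} => [|k]; rewrite ?mul0r ?expr0 ?exprS -?natr1/=; field.
Unshelve. all: end_near. Qed.

(** Near 0 the function behaves at most like t to the power al + k s; an exponent of at least 2
    makes the difference quotient at 0 tend to 0. *)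
Lemma is_derive_trunc_pow al k t : 2 <= al + k%:R * s ->
  is_derive t 1 (trunc_pow al k) (dtrunc_pow al k t).
Proof.
move=> ak; have [t0|t0|t0] := ltgtP t 0; last 2 first.
- exact: is_derive_trunc_pow_gt0.
- have -> : dtrunc_pow al k t = 0 by rewrite /dtrunc_pow /trunc_pow t0 ltxx !mulr0 subrr.
  suff L : h^-1 *: ((trunc_pow al k \o shift t) (h *: (1 : R)) - trunc_pow al k t) @[h --> 0^'] --> (0 : R).
    by split; [apply/cvg_ex; exists 0|exact: (cvg_lim (@Rhausdorff R) L)].
  have f0 : trunc_pow al k t = 0 by rewrite /trunc_pow t0 ltxx.
  have C0 : 0 < (e ^+ k)^-1 by rewrite invr_gt0 exprn_gt0.
  apply/cvgrPdist_le => d d0; near=> h.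
  have hn0 : h != 0 by near: h; exact: nbhs_dnbhs_neq.
  have h1 : `|h| <= 1 by near: h; apply: dnbhs0_le.
  have h2 : `|h| <= d * e ^+ k by near: h; apply: dnbhs0_le; rewrite mulr_gt0// exprn_gt0.
  rewrite sub0r normrN f0 subr0 /= t0 addr0 /GRing.scale/= mulr1 normrM normfV.
  have [hp|hp] := ltP 0 h; last by rewrite /trunc_pow ltNge hp/= normr0 mulr0 ltW.
  rewrite (ger0_norm (trunc_pow_ge0 _ _ _)) mulrC ler_pdivrMr ?normr_gt0//.
  rewrite (le_trans (trunc_pow_small _ _ hp))// ler_pdivrMr ?exprn_gt0//.
  have hh : h `^ (al + k%:R * s) <= h ^+ 2.
    rewrite -powR_mulrn ?(ltW hp)//; apply: ger_powR => //.
    by rewrite hp -(ger0_norm (ltW hp)).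
  rewrite (le_trans hh)// expr2; move: h2; rewrite (ger0_norm (ltW hp)) => h2.
  by rewrite mulrAC ler_wpM2r// ltW.
- have N : \near t, cst 0 t = trunc_pow al k t.
    near=> z; rewrite /trunc_pow ltNge ltW//; near: z.
    exact: lt_nbhsl.
  have -> : dtrunc_pow al k t = 0 by rewrite /dtrunc_pow /trunc_pow ltNge ltW//= !mulr0 subrr.
  by apply: near_eq_is_derive N _; exact: is_derive_cst.
Unshelve. all: end_near. Qed.

End truncated_powers.

(* The test functions are eta = chi^2 G(psi), against v = chi F(psi): F grows like t^tau and
   sigma F^2 = t^2 G, t G = F F', while G' is just large enough to dominate F'^2. *)
Section test_powers.
Context {R : realType} (s e tau : R) (N : nat).
Hypotheses (s0 : 0 < s) (e0 : 0 < e).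
Implicit Types (t : R).

Definition pow_F t := trunc_pow s e tau N t.
Definition pow_F' t := dtrunc_pow s e tau N t.
(** The logarithmic derivative t F' / F. It lies between tau and tau + N s, and tends to tau as e ->
    0 for fixed t > 0. *)
Definition pow_sigma t := tau + N%:R * s * (1 - pow_frac s e t).
Definition pow_G t := (tau + N%:R * s) * trunc_pow s e (2 * tau - 2) (N + N) t -
  N%:R * s * trunc_pow s e (2 * tau - 2) (N + N).+1 t.
Definition pow_G' t := (tau + N%:R * s) * dtrunc_pow s e (2 * tau - 2) (N + N) t -
  N%:R * s * dtrunc_pow s e (2 * tau - 2) (N + N).+1 t.

(** The common factor b, in terms of which F = t b, F' = sigma b and G = sigma b^2. *)
Definition pow_base t := trunc_pow s e (tau - 1) N t.

Lemma pow_sigma_ge t : tau <= pow_sigma t.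
Proof. by rewrite lerDl mulr_ge0 ?mulr_ge0 ?(ltW s0)// subr_ge0 pow_frac_le1. Qed.

Lemma pow_sigma_le t : pow_sigma t <= tau + N%:R * s.
Proof. by rewrite lerD2l ler_piMr ?mulr_ge0 ?(ltW s0)// lerBlDr lerDl pow_frac_ge0. Qed.

Lemma trunc_powS al k t : trunc_pow s e al k.+1 t = pow_frac s e t * trunc_pow s e al k t.
Proof. by rewrite /trunc_pow; case: ifP => _; rewrite ?mulr0// exprS mulrCA. Qed.

Lemma trunc_powD al be k l t :
  trunc_pow s e (al + be) (k + l) t = trunc_pow s e al k t * trunc_pow s e be l t.
Proof.
rewrite /trunc_pow; case: ifP => t0; rewrite ?mulr0// powRD ?(gt_eqF t0) ?implybT//.
by rewrite exprD; ring.
Qed.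

Lemma trunc_powM al k t : t * trunc_pow s e al k t = trunc_pow s e (al + 1) k t.
Proof.
rewrite /trunc_pow; case: ifP => t0; rewrite ?mulr0// powRD ?(gt_eqF t0) ?implybT//.
by rewrite powRr1 ?ltW//; ring.
Qed.

Lemma pow_FE t : pow_F t = t * pow_base t.
Proof. by rewrite trunc_powM subrK. Qed.

Lemma pow_F'E t : pow_F' t = pow_sigma t * pow_base t.
Proof. by rewrite /pow_F' /dtrunc_pow trunc_powS /pow_sigma /pow_base; ring. Qed.

Lemma trunc_pow_base2 t : trunc_pow s e (2 * tau - 2) (N + N) t = pow_base t ^+ 2.
Proof. by rewrite expr2 -trunc_powD; congr trunc_pow; ring. Qed.

Lemma pow_GE t : pow_G t = pow_sigma t * pow_base t ^+ 2.
Proof. by rewrite /pow_G trunc_powS trunc_pow_base2 /pow_sigma; ring. Qed.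

Lemma pow_G'E t : t * pow_G' t = pow_base t ^+ 2 * (pow_sigma t * (2 * pow_sigma t - 2) -
  N%:R * s ^+ 2 * pow_frac s e t * (1 - pow_frac s e t)).
Proof.
have H : t * trunc_pow s e (2 * tau - 2 - 1) (N + N) t = pow_base t ^+ 2.
  by rewrite trunc_powM subrK trunc_pow_base2.
rewrite -H /pow_G' /dtrunc_pow !trunc_powS /pow_sigma -!natr1 !natrD; ring.
Qed.

Lemma pow_F_ge0 t : 0 <= pow_F t. Proof. exact: trunc_pow_ge0. Qed.

Lemma pow_G_ge0 t : 0 <= tau -> 0 <= pow_G t.
Proof. by move=> tau0; rewrite pow_GE mulr_ge0 ?sqr_ge0// (le_trans tau0)// pow_sigma_ge. Qed.

Lemma pow_GF t : t * pow_G t = pow_F t * pow_F' t.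
Proof. by rewrite pow_GE pow_FE pow_F'E; ring. Qed.

Lemma pow_GF2 t : t ^+ 2 * pow_G t = pow_sigma t * pow_F t ^+ 2.
Proof. by rewrite pow_GE pow_FE; ring. Qed.

(** Up to the factor b^2, the right side is 2 sigma^2 - s sigma minus a correction of at most s
    (sigma - tau), due to the derivative of u. What remains over the left side is at least the
    square (s / tau) (sigma - tau)^2. *)
Lemma pow_G'_ge t : 0 < tau ->
  (2 - s / tau) * pow_F' t ^+ 2 <= t * pow_G' t + (2 - s) * pow_G t.
Proof.
move=> tau0; rewrite pow_G'E pow_GE pow_F'E exprMn.
set B := pow_base t; set u := pow_frac s e t; set y := pow_sigma t.
have u1 : u <= 1 := pow_frac_le1 s e0 t; have u0 : 0 <= u := pow_frac_ge0 s e0 t.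
have h : N%:R * s ^+ 2 * u * (1 - u) <= s * (y - tau).
  have -> : s * (y - tau) = N%:R * s ^+ 2 * (1 - u) by rewrite /y /pow_sigma -/u; ring.
  by rewrite mulrAC ler_piMr// mulr_ge0 ?subr_ge0// mulr_ge0// sqr_ge0.
have h2 : 0 <= s / tau * (y - tau) ^+ 2 by rewrite mulr_ge0 ?sqr_ge0// divr_ge0// ltW.
have E : s / tau * (y - tau) ^+ 2 = s / tau * y ^+ 2 - 2 * (s * y) + s * tau.
  by field; rewrite gt_eqF.
set Z := N%:R * s ^+ 2 * u * (1 - u) in h *; set q := s / tau in h2 E *.
have -> : (2 - q) * (y ^+ 2 * B ^+ 2) = B ^+ 2 * ((2 - q) * y ^+ 2) by ring.
have -> : B ^+ 2 * (y * (2 * y - 2) - Z) + (2 - s) * (y * B ^+ 2) =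
  B ^+ 2 * (2 * y ^+ 2 - s * y - Z) by ring.
by apply: ler_wpM2l; [exact: sqr_ge0|nra].
Qed.

(** For t >= 1 the bound t^tau and [tau <= p] suffice. For t < 1 the factor u^N raises the exponent
    to tau + N s >= p, at the cost of e^(-N). *)
Lemma pow_F_le_pow (p t : R) : 0 <= t -> tau <= p -> p <= tau + N%:R * s ->
  pow_F t <= (1 + (e ^+ N)^-1) * t `^ p.
Proof.
move=> t0 tp ps; have [{}t0|{}t0] := ltP 0 t; last first.
  by rewrite /pow_F /trunc_pow ltNge t0/= mulr_ge0 ?powR_ge0// addr_ge0// invr_ge0 exprn_ge0// ltW.
have en0 : 0 <= (e ^+ N)^-1 by rewrite invr_ge0 exprn_ge0// ltW.
have tp0 : 0 <= t `^ p := powR_ge0 _ _.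
have [t1|t1] := leP 1 t.
  rewrite (le_trans (trunc_pow_le s e0 _ _ (ltW t0)))//.
  by rewrite (le_trans (ler_powR t1 tp))// ler_peMl// lerDl.
rewrite (le_trans (trunc_pow_small s e0 _ _ t0))// mulrDl mul1r mulrC.
rewrite (@le_trans _ _ ((e ^+ N)^-1 * t `^ p))//; last by rewrite lerDr.
by rewrite ler_wpM2l//; apply: ger_powR => //; rewrite t0 ltW.
Qed.

Lemma is_derive_pow_F t : 2 <= tau + N%:R * s -> is_derive t 1 pow_F (pow_F' t).
Proof. by move=> h; exact: is_derive_trunc_pow. Qed.

Lemma is_derive_pow_G t : 2 <= 2 * tau - 2 + (N + N)%:R * s -> is_derive t 1 pow_G (pow_G' t).
Proof.
move=> h.
have D1 := is_derive_trunc_pow e0 t h.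
have D2 : is_derive t 1 (trunc_pow s e (2 * tau - 2) (N + N).+1) (dtrunc_pow s e (2 * tau - 2) (N + N).+1 t).
  by apply: (is_derive_trunc_pow e0 t); rewrite -natr1 mulrDl mul1r; have := ltW s0; lra.
have D : is_derive t 1 pow_G _ :=
  is_deriveB (is_deriveZ (tau + N%:R * s) D1) (is_deriveZ (N%:R * s) D2).
exact: is_derive_eq D _.
Qed.

Lemma pow_F'_bounded : 1 <= tau + N%:R * s -> forall T, exists B, forall t, t <= T -> `|pow_F' t| <= B.
Proof. exact: dtrunc_pow_bounded. Qed.

Lemma pow_G'_bounded : 1 <= 2 * tau - 2 + (N + N)%:R * s ->
  forall T, exists B, forall t, t <= T -> `|pow_G' t| <= B.
Proof.
move=> h T; have [B HB] := dtrunc_pow_bounded s0 e0 h T.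
have [|B' HB'] := @dtrunc_pow_bounded R s e s0 e0 (2 * tau - 2) (N + N).+1 _ T.
  by rewrite -natr1 mulrDl mul1r; have := ltW s0; lra.
exists (`|tau + N%:R * s| * B + `|N%:R * s| * B') => t tT.
rewrite (le_trans (ler_normB _ _))// [X in X + _]normrM [X in _ + X]normrM.
by apply: lerD; apply: ler_wpM2l => //; [exact: HB|exact: HB'].
Qed.

End test_powers.

Lemma pow_frac_cvg1 (R : realType) (s t : R) : 0 < t -> pow_frac s n.+1%:R^-1 t @[n --> \oo] --> (1 : R).
Proof.
move=> t0; have ts : t `^ s != 0 by rewrite gt_eqF ?powR_gt0.
rewrite [X in _ --> X](_ : _ = t `^ s / (t `^ s + 0)); last by rewrite addr0 divff.
apply: cvgM; first exact: cvg_cst.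
apply: cvgV; first by rewrite addr0.
by apply: cvgD; [exact: cvg_cst|exact: cvg_harmonic].
Qed.

(** * The pointwise inequality for the test functions *)

Section test_pair.
Context {R : realType} {m : nat} {M : smooth_manifold R m} (g : riemannian_metric M).
Variables (vol : {measure set (borel M) -> \bar R}) (hvol : riemannian_volume g vol).
Implicit Types (x : M).
Local Notation RI f := (@Rintegral _ (borel M) R vol setT f).
Local Notation integ := (@integ _ (borel M) R vol).

(** The trace pairing of two positive semidefinite 2 x 2 matrices, with entries k, l, r and P, Q,
    Z. *)
Lemma quad_form_ge0 (k l r P Q Z : R) : 0 <= Z -> (forall u v : R, 0 <= u ^+ 2 * P + 2 * (u * v) * Q + v ^+ 2 * Z) ->
  0 <= k -> 0 <= r -> l ^+ 2 <= k * r -> 0 <= k * P + 2 * l * Q + r * Z.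
Proof.
move=> Z0 H k0 r0 lkr; have [kE|kn0] := eqVneq k 0.
  have l0 : l ^+ 2 = 0 by apply/eqP; rewrite eq_le sqr_ge0 andbT (le_trans lkr)// kE mul0r.
  by move/eqP: l0; rewrite sqrf_eq0 => /eqP ->; rewrite kE !(mul0r, mulr0) !add0r mulr_ge0.
have {}k0 : 0 < k by rewrite lt_neqAle eq_sym kn0.
rewrite -(pmulr_rge0 _ k0); have := H k l.
have : 0 <= (k * r - l ^+ 2) * Z by rewrite mulr_ge0// subr_ge0.
by move=> h1 h2; have := addr_ge0 h1 h2; congr (0 <= _); ring.
Qed.

Variables (a psi chi : M -> R) (A s e tau : R) (N : nat).
Hypotheses (sA : s = 1 + A) (s0 : 0 < s) (e0 : 0 < e) (tau0 : 0 < tau) (sN : 2 <= tau + N%:R * s).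
Hypotheses (ca : continuous a) (lpsi : dd_lip_loc g psi) (lchi : dd_lip_loc g chi) (schi : comp_supp chi).

Local Notation F := (pow_F s e tau N).
Local Notation G := (pow_G s e tau N).
Local Notation sg := (pow_sigma s e tau N).

Definition test_v x := chi x * F (psi x).
Definition test_eta x := chi x * chi x * G (psi x).

Let sN' : 2 <= 2 * tau - 2 + (N + N)%:R * s.
Proof. by move: sN; rewrite (natrD _ N N) (mulrDl N%:R N%:R s); move: (N%:R * s) => X h; lra. Qed.

Lemma lip_test_v : lip_c g test_v.
Proof.
apply: dd_lip_loc_lip_c; last exact: comp_suppM.
apply: dd_lip_locM => //.
apply: (@dd_lip_loc_comp _ _ _ _ F (pow_F' s e tau N)) lpsi => [t|]; first exact: is_derive_pow_F.
by apply: (@pow_F'_bounded R s e tau N s0 e0); apply: le_trans sN; rewrite ler1n.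
Qed.

Lemma lip_test_eta : lip_c g test_eta.
Proof.
apply: dd_lip_loc_lip_c; last exact/comp_suppM/comp_suppM.
apply: dd_lip_locM; first exact: dd_lip_locM.
apply: (@dd_lip_loc_comp _ _ _ _ G (pow_G' s e tau N)) lpsi => [t|].
  exact: (is_derive_pow_G s0 e0 t sN').
by apply: (@pow_G'_bounded R s e tau N s0 e0); apply: le_trans sN'; rewrite ler1n.
Qed.

(** By t G = F F' and [pow_G'_ge], the difference of the two sides is at least a quadratic form in
    chi F' grad psi and F grad chi, with coefficients [c - c1], [1 - c1] and [c2 - c1], where c = 2
    - s / tau. The last hypothesis is the discriminant condition for this form. *)
Lemma test_pointwise c1 c2 x : mdiff psi x -> mdiff chi x ->
  0 <= c1 -> c1 <= 2 - s / tau -> c1 <= c2 -> (1 - c1) ^+ 2 <= (2 - s / tau - c1) * (c2 - c1) ->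
  weak_density g a A psi test_eta x <= a x * sg (psi x) * test_v x ^+ 2 -
    c1 * inner_grad g test_v test_v x + c2 * (F (psi x) ^+ 2 * inner_grad g chi chi x).
Proof.
move=> dpsi dchi c10 c1c c12 cc.
set t := psi x.
have [dF EF] := mdiff_comp (is_derive_pow_F e0 t sN) dpsi.
have [dG EG] := mdiff_comp (is_derive_pow_G s0 e0 t sN') dpsi.
have [dv Ev] := mdiffM dchi dF.
have [dcc Ecc] := mdiffM dchi dchi; have [de Ee] := mdiffM dcc dG.
rewrite /weak_density !inner_grad_co// /test_v /test_eta Ev Ee EF EG Ecc -/t.
set P := coinner g x (covector psi x) (covector psi x).
set Q := coinner g x (covector chi x) (covector psi x).
set Z := coinner g x (covector chi x) (covector chi x).
have Qs : coinner g x (covector psi x) (covector chi x) = Q by rewrite coinner_sym.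
rewrite /coinner !(cometricDl, cometricDr, cometricZl, cometricZr) -!/(coinner _ _ _ _) -/P -/Q -/Z Qs.
set f := F t; set f' := pow_F' s e tau N t; set G0 := G t; set G1 := pow_G' s e tau N t.
have E1 : t * G0 = f * f' := pow_GF s e tau N t.
have E2 : t ^+ 2 * G0 = sg t * f ^+ 2 := pow_GF2 s e tau N t.
have E3 := pow_G'_ge N s0 e0 t tau0; rewrite -/G1 -/f' -/G0 in E3.
have P0 : 0 <= P := coinner_ge0 g x _.
have Z0 : 0 <= Z := coinner_ge0 g x _.
set c := 2 - s / tau in c1c cc E3.
have := @quad_form_ge0 (c - c1) (1 - c1) (c2 - c1) ((chi x * f') ^+ 2 * P) (chi x * f' * f * Q) (f ^+ 2 * Z).
have H1 : 0 <= f ^+ 2 * Z by rewrite mulr_ge0// sqr_ge0.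
have H2 (u v : R) : 0 <= u ^+ 2 * ((chi x * f') ^+ 2 * P) + 2 * (u * v) * (chi x * f' * f * Q) +
    v ^+ 2 * (f ^+ 2 * Z).
  have := coinner_ge0 g x ((u * (chi x * f')) *: covector psi x + (v * f) *: covector chi x).
  rewrite /coinner !(cometricDl, cometricDr, cometricZl, cometricZr) -!/(coinner _ _ _ _) -/P -/Q -/Z Qs.
  by congr (0 <= _); ring.
rewrite subr_ge0 subr_ge0 => /(_ H1 H2 c1c c12 cc) q0.
have q1 : 0 <= chi x ^+ 2 * P * (t * G1 + (2 - s) * G0 - c * f' ^+ 2).
  by rewrite mulr_ge0 ?subr_ge0// mulr_ge0// sqr_ge0.
rewrite -subr_ge0; apply: le_trans (addr_ge0 q0 q1) _; rewrite le_eqVlt; apply/orP; left; apply/eqP.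
have -> : A - 1 = s - 2 by rewrite sA; ring.
have E1' := congr1 (fun z => 2 * chi x * Q * z) E1.
have E2' := congr1 (fun z => a x * chi x ^+ 2 * z) E2.
rewrite /= in E1' E2'.
apply/eqP; rewrite -subr_eq0; apply/eqP.
have -> : 0 = (2 * chi x * Q * (f * f') - 2 * chi x * Q * (t * G0)) +
   (a x * chi x ^+ 2 * (t ^+ 2 * G0) - a x * chi x ^+ 2 * (sg t * f ^+ 2)) * (-1) *(-1).
  by rewrite E1' E2' !subrr mul0r mul0r addr0.
ring.
Qed.

End test_pair.

Lemma pow_F_cvg (R : realType) (s tau t : R) N : 0 < tau -> 0 <= t ->
  pow_F s n.+1%:R^-1 tau N t @[n --> \oo] --> t `^ tau.
Proof.
move=> tau0; rewrite le_eqVlt => /orP[/eqP<-|t0].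
  rewrite powR0 ?gt_eqF//; apply: cvg_near_cst; apply: nearW => n.
  by rewrite /pow_F /trunc_pow ltxx.
rewrite [X in _ --> X](_ : _ = t `^ tau * 1 ^+ N); last by rewrite expr1n mulr1.
rewrite /pow_F /trunc_pow t0; apply: cvgM; first exact: cvg_cst.
by apply: (cvg_comp _ (fun x : R => x ^+ N) (pow_frac_cvg1 s t0)); exact: exprn_continuous.
Qed.

Lemma pow_sigma_cvg (R : realType) (s tau t : R) N : 0 < t ->
  pow_sigma s n.+1%:R^-1 tau N t @[n --> \oo] --> tau.
Proof.
move=> t0; rewrite [X in _ --> X](_ : _ = tau + N%:R * s * (1 - 1)); last by rewrite subrr mulr0 addr0.
apply: cvgD; first exact: cvg_cst.
apply: cvgM; first exact: cvg_cst.
by apply: cvgB; [exact: cvg_cst|exact: pow_frac_cvg1].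
Qed.

Lemma measurable_pow_sigma (R : realType) (s e tau : R) N : 0 < e ->
  measurable_fun setT (pow_sigma s e tau N).
Proof.
move=> e0; rewrite (_ : pow_sigma s e tau N = fun t => tau + N%:R * s * (1 - t `^ s * (t `^ s + e) `^ (-1))).
  apply: measurable_funD; first exact: measurable_cst.
  apply: measurable_funM; first exact: measurable_cst.
  apply: measurable_funB; first exact: measurable_cst.
  apply: measurable_funM; first exact: measurable_powR.
  apply: (measurableT_comp (measurable_powR _)).
  by apply: measurable_funD; [exact: measurable_powR|exact: measurable_cst].
by apply/funext => t; rewrite powR_inv1// addr_ge0 ?powR_ge0// ltW.
Qed.

(* Both sides behave like powers of t near 0, the left one with the larger exponent. *)
Lemma trunc_pow_le_pow_G (R : realType) (s d T : R) N : 0 < s -> 0 < d -> 0 <= T ->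
  exists2 C, 0 <= C & forall e t, 0 < e -> e <= 1 -> 0 <= t -> t <= T ->
    trunc_pow s d 0 (N + N).+2 t <= C * pow_G s e s N t.
Proof.
move=> s0 d0 T0; pose k := (N + N)%N.
have dk : 0 < d ^+ k.+2 by exact: exprn_gt0.
have D0 : 0 < T `^ s + 1 by rewrite ltr_wpDl ?powR_ge0.
have C0 : 0 <= T ^+ 2 * (T `^ s + 1) ^+ k / (s * d ^+ k.+2).
  apply: divr_ge0; last by rewrite mulr_ge0// ltW.
  by rewrite mulr_ge0// exprn_ge0// ltW.
exists (T ^+ 2 * (T `^ s + 1) ^+ k / (s * d ^+ k.+2)) => // e t e0 e1 t0 tT.
have [{}t0|{}t0] := ltP 0 t; last first.
  by rewrite {1}/trunc_pow ltNge t0/= mulr_ge0// pow_G_ge0// ltW.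
have tn0 : t != 0 by rewrite gt_eqF.
have TtS : t `^ s <= T `^ s by apply: ge0_ler_powR => //; rewrite ?nnegrE ltW.
have ts0 : 0 < t `^ s := powR_gt0 _ t0.
have h1 : trunc_pow s d 0 k.+2 t <= t `^ s ^+ k.+2 / d ^+ k.+2.
  have := trunc_pow_small s d0 0 k.+2 t0; rewrite add0r [_%:R * s]mulrC powRrM powR_mulrn//.
  exact: ltW.
have h2 : s * (t `^ s ^+ 2 / t ^+ 2 * (t `^ s / (T `^ s + 1)) ^+ k) <= pow_G s e s N t.
  rewrite pow_GE// -trunc_pow_base2 /trunc_pow t0.
  apply: ler_pM.
  - exact: ltW.
  - by rewrite mulr_ge0 ?exprn_ge0 ?divr_ge0 ?exprn_ge0 ?(ltW ts0) ?(ltW t0) ?(ltW D0).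
  - exact: pow_sigma_ge.
  - have -> : t `^ (2 * s - 2) = t `^ s ^+ 2 / t ^+ 2.
      rewrite powRB ?(gt_eqF t0) ?implybT// (powR_mulrn 2 (ltW t0)) [2 * s]mulrC powRrM.
      by rewrite powR_mulrn// ltW.
    rewrite ler_wpM2l ?divr_ge0 ?exprn_ge0 ?(ltW ts0) ?(ltW t0)//.
    apply: lerXn2r; rewrite ?nnegrE ?divr_ge0 ?pow_frac_ge0 ?(ltW ts0) ?(ltW D0) ?(ltW (pow_frac_den _ _ _))//.
    rewrite /pow_frac ler_wpM2l ?(ltW ts0)// lef_pV2 ?posrE ?pow_frac_den//.
    by rewrite lerD.
apply: le_trans h1 _; apply: le_trans (ler_wpM2l C0 h2).
have -> : T ^+ 2 * (T `^ s + 1) ^+ k / (s * d ^+ k.+2) *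
   (s * (t `^ s ^+ 2 / t ^+ 2 * (t `^ s / (T `^ s + 1)) ^+ k)) =
   t `^ s ^+ k.+2 / d ^+ k.+2 * (T ^+ 2 / t ^+ 2).
  rewrite expr_div_n -(addn2 k) !exprD; field.
  by rewrite !expf_neq0 ?gt_eqF// -exprD expf_neq0 ?gt_eqF.
rewrite ler_peMr//; first by rewrite divr_ge0 ?exprn_ge0// ltW.
rewrite ler_pdivlMr ?exprn_gt0// mul1r.
by apply: lerXn2r => //; rewrite nnegrE ltW.
Qed.

Lemma compact_continuous_bounded (R : realType) (m : nat) (M : smooth_manifold R m) (K : set M) (f : M -> R) :
  compact K -> continuous f -> exists2 B, 0 < B & forall x, K x -> f x <= B.
Proof.
move=> cK cf; apply: compact_locally_bounded => // x _; exists (`|f x| + 1).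
by apply: filterS (near_bounded (cf x)) => z; exact: le_trans (ler_norm _).
Qed.

(** * The sequence of test functions *)

Section test_sequence.
Context {R : realType} {m : nat} {M : smooth_manifold R m} (g : riemannian_metric M).
Variables (vol : {measure set (borel M) -> \bar R}) (hvol : riemannian_volume g vol).
Implicit Types (x : M).
Local Notation RI f := (@Rintegral _ (borel M) R vol setT f).
Local Notation integ := (@integ _ (borel M) R vol).
Hypothesis hcomplete : complete_metric g.
Variables (a psi : M -> R) (A s p : R).
Hypotheses (sA : s = 1 + A) (s0 : 0 < s).
Hypotheses (ca : continuous a) (lpsi : dd_lip_loc g psi) (psi0 : forall x, 0 <= psi x).

Lemma cutoff_props (o : M) (r : R) : 0 < r ->
  [/\ dd_lip_loc g (cutoff g o r), comp_supp (cutoff g o r) &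
    forall x, inner_grad g (cutoff g o r) (cutoff g o r) x <= (2 / r) ^+ 2].
Proof.
move=> r0; have r2 : 0 <= 2 / r by rewrite divr_ge0// ltW.
split.
- by apply: (dd_lip_loc_global r2) => y z; exact: cutoff_lipschitz.
- by apply/comp_supp_compactly/(supported_in_ball hcomplete) => y; exact: (cutoff_supp r0).
- move=> x; apply: inner_grad_lip => //; exists (setT, setT); first by split; exact: filterT.
  by move=> [y z] _ /=; exact: cutoff_lipschitz.
Qed.

Lemma cutoff_eq1_compact (o : M) (r : nat -> R) (K : set M) : compact K ->
  (forall n, n.+1%:R <= r n) -> \forall n \near \oo, forall x, K x -> cutoff g o (r n) x = 1.
Proof.
move=> cK rn; have [B B0 HB] := compact_continuous_bounded cK (@dd_continuous _ _ _ g o).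
near=> n => x Kx; have r0 : 0 < r n by apply: lt_le_trans (rn n); rewrite ltr0n.
apply: cutoff1 => //; apply: le_trans (HB x Kx) _; rewrite ler_pdivlMr//.
apply: le_trans (rn n); rewrite (@le_trans _ _ n%:R) ?ler_nat//.
near: n; exact: nbhs_infty_ger.
Unshelve. all: end_near. Qed.

(** The regularization is e = 1/(n+1), and the cutoff radius is tied to it. Only these properties of
    the sequence are used afterwards, with tau <= s to raise the integrability and with tau = s to
    conclude. *)
Lemma test_sequence tau N c1 c2 : 0 < tau -> tau <= p -> p <= tau + N%:R * s -> 2 <= tau + N%:R * s ->
  0 <= c1 -> c1 <= 2 - s / tau -> c1 <= c2 -> (1 - c1) ^+ 2 <= (2 - s / tau - c1) * (c2 - c1) ->
  integ (fun x => psi x `^ (2 * p)) ->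
  exists (v sg eta : nat -> M -> R),
  [/\ forall n, lip_c g (v n) /\ lip_c g (eta n),
      forall n x, [/\ 0 <= v n x <= psi x `^ tau, 0 <= eta n x & tau <= sg n x <= tau + N%:R * s],
      (forall x, v n x @[n --> \oo] --> psi x `^ tau) /\
        (forall x, 0 < psi x -> sg n x @[n --> \oo] --> tau),
      (forall n, loc_bdd (sg n)) /\
      forall n, RI (weak_density g a A psi (eta n)) <= RI (fun x => a x * sg n x * v n x ^+ 2) -
        c1 * RI (inner_grad g (v n) (v n)) + n.+1%:R^-1 &
      tau = s -> forall (K : set M) d, compact K -> 0 < d -> exists2 C, 0 <= C &
        \forall n \near \oo, forall x, K x -> trunc_pow s d 0 (N + N).+2 (psi x) <= C * eta n x].
Proof.
move=> tau0 tp pN sN c10 c1c c12 cc ip.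
have c20 : 0 <= c2 := le_trans c10 c12.
pose e n : R := n.+1%:R^-1; have e0 n : 0 < e n by rewrite invr_gt0 ltr0n.
pose C n := (1 + (e n ^+ N)^-1); have C0 n : 0 <= C n by rewrite addr_ge0// invr_ge0 exprn_ge0// ltW.
pose I := RI (fun x => psi x `^ (2 * p)); have I0 : 0 <= I by apply: RI_ge0 => x; exact: powR_ge0.
pose D n := c2 * 4 * C n ^+ 2 * I.
have D0 n : 0 <= D n by rewrite !mulr_ge0// exprn_ge0.
(* The error c2 int F^2 |grad chi|^2 is at most [D n / r n ^+ 2], as F is bounded by [C n] times
   psi^p and the slope of the cutoff by [2 / r n]. [D n] may blow up with n; this radius keeps the
   error below 1/(n+1). *)
pose r n := n.+1%:R * (1 + D n).
have rn n : n.+1%:R <= r n by rewrite ler_peMr// lerDl.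
have r0 n : 0 < r n by apply: lt_le_trans (rn n); rewrite ltr0n.
pose o : M := point; pose chi n := cutoff g o (r n).
have lchi n : dd_lip_loc g (chi n) by have [] := cutoff_props o (r0 n).
have schi n : comp_supp (chi n) by have [] := cutoff_props o (r0 n).
have gchi n x : inner_grad g (chi n) (chi n) x <= (2 / r n) ^+ 2 by have [_ _] := cutoff_props o (r0 n).
have chi0 n x : 0 <= chi n x by have /andP[] := cutoff_bounds g o (r n) x.
have chi1 n x : chi n x <= 1 by have /andP[] := cutoff_bounds g o (r n) x.
pose v n := test_v psi (chi n) s (e n) tau N; pose eta n := test_eta psi (chi n) s (e n) tau N.
pose sg n x := pow_sigma s (e n) tau N (psi x).
have lv n : lip_c g (v n) by exact: lip_test_v.
have leta n : lip_c g (eta n) by exact: lip_test_eta.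
have mpsi : measurable_fun setT (psi : borel M -> R) := (loc_bdd_continuous (dd_lip_loc_continuous lpsi)).1.
have lsg n : loc_bdd (sg n).
  split; first exact: (measurableT_comp (measurable_pow_sigma _ _ _ (e0 n)) mpsi).
  move=> x; exists (tau + N%:R * s); apply: nearW => z; rewrite ger0_norm ?pow_sigma_le//.
  by rewrite (le_trans (ltW tau0))// pow_sigma_ge.
exists v, sg, eta; split.
- by [].
- move=> n x; split; last by rewrite pow_sigma_ge// pow_sigma_le.
    rewrite mulr_ge0 ?pow_F_ge0//= /v /test_v.
    have Fp : 0 <= pow_F s (e n) tau N (psi x) by exact: pow_F_ge0.
    rewrite (le_trans (ler_piMl Fp (chi1 n x)))//.
    exact: trunc_pow_le.
  by rewrite mulr_ge0 ?mulr_ge0// pow_G_ge0// ltW.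
- split=> x; last exact: pow_sigma_cvg.
  rewrite -[psi x `^ tau]mul1r; apply: cvgM; last exact: pow_F_cvg.
  apply: cvg_near_cst.
  have := cutoff_eq1_compact o (@compact_set1 _ x) rn; apply: filterS => n; exact.
- split=> // n.
  have [lvd lvs] := lip_c_dd (lv n).
  have bv : loc_bdd (v n) := loc_bdd_continuous (dd_lip_loc_continuous lvd).
  pose f1 x := a x * sg n x * v n x ^+ 2; pose f2 := inner_grad g (v n) (v n).
  pose f3 x := pow_F s (e n) tau N (psi x) ^+ 2 * inner_grad g (chi n) (chi n) x.
  have i1 : integ f1.
    apply: (loc_bdd_integ hvol); last exact/comp_suppMr/comp_suppM.
    by apply: loc_bddM; [apply: loc_bddM => //; exact: loc_bdd_continuous|exact: loc_bddM].
  have i2 : integ f2.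
    by apply: (loc_bdd_integ hvol); [exact: loc_bdd_inner_grad|exact: comp_supp_inner_grad].
  have lF : dd_lip_loc g (fun x => pow_F s (e n) tau N (psi x)).
    apply: (@dd_lip_loc_comp _ _ _ _ _ (pow_F' s (e n) tau N)) lpsi => [t|].
      exact: is_derive_pow_F.
    by apply: (@pow_F'_bounded R s (e n) tau N s0 (e0 n)); apply: le_trans sN; rewrite ler1n.
  have bF := loc_bdd_continuous (dd_lip_loc_continuous lF).
  have i3 : integ f3.
    apply: (loc_bdd_integ hvol); last exact/comp_suppMr/comp_supp_inner_grad.
    by apply: loc_bddM; [exact: loc_bddM|exact: loc_bdd_inner_grad].
  have f3le : RI f3 <= (C n ^+ 2 * (2 / r n) ^+ 2) * I.
    rewrite -RI_Z//; apply: RI_le => //; first exact: integZ.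
    move=> x; rewrite mulrAC; apply: ler_pM => //; rewrite ?exprn_ge0 ?pow_F_ge0 ?inner_grad_ge0//.
    rewrite mulrC powRrM powRAC powR_mulrn ?powR_ge0// -exprMn.
    apply: lerXn2r; rewrite ?nnegrE ?mulr_ge0 ?powR_ge0 ?pow_F_ge0//.
    by rewrite mulrC; exact: pow_F_le_pow.
  have key : RI (weak_density g a A psi (eta n)) <= RI (fun x => f1 x - c1 * f2 x + c2 * f3 x).
    apply: (RI_le_ae _ _ (negligibleU (ae_mdiff hvol lpsi) (ae_mdiff hvol (lchi n)))).
    + exact: integ_weak_density.
    + exact: integD (integB i1 (integZ c1 i2)) (integZ c2 i3).
    + move=> x /not_orP[/contrapT dpsi /contrapT dchi].
      exact: test_pointwise.
  apply: le_trans key _.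
  rewrite (RI_D (integB i1 (integZ c1 i2)) (integZ c2 i3)) (RI_B i1 (integZ c1 i2)) (RI_Z c1 i2) (RI_Z c2 i3).
  rewrite lerD2l (le_trans (ler_wpM2l c20 f3le))//.
  have -> : c2 * (C n ^+ 2 * (2 / r n) ^+ 2 * I) = D n / r n ^+ 2.
    by rewrite /D; field; rewrite gt_eqF.
  rewrite ler_pdivrMr ?exprn_gt0// mulrC ler_pdivlMr ?ltr0n//.
  rewrite expr2; apply: ler_pM => //.
  + rewrite /r mulrDr mulr1 (@le_trans _ _ (n.+1%:R * D n))//; last by rewrite lerDr.
    by rewrite ler_peMl// ler1n.
- move=> taus K d cK d0.
  have [T T0 HT] := compact_continuous_bounded cK (dd_lip_loc_continuous lpsi).
  have [B B0 HB] := trunc_pow_le_pow_G N s0 d0 (ltW T0).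
  exists B => //; have := cutoff_eq1_compact o cK rn; apply: filterS => n Hn x Kx.
  rewrite /eta /test_eta /chi Hn// !mul1r taus; apply: HB => //; last exact: HT.
  by rewrite /e invf_le1 ?ltr0n// ler1n.
Qed.

End test_sequence.

Lemma finite_norm_integ d (T : measurableType d) (R : realType) (mu : {measure set T -> \bar R})
  (f : T -> R) (r : R) : 0 < r -> measurable_fun setT f -> (forall x, 0 <= f x) ->
  finite_norm mu r%:E f -> integ mu (fun x => f x `^ r).
Proof.
move=> r0 mf f0; rewrite /finite_norm => H.
apply: integ_ge0 => [|x|]; [|exact: powR_ge0|].
  exact: (measurableT_comp (measurable_powR r)).
have := poweR_lty r H; rewrite (powR_Lnorm _ _ (lt0r_neq0 r0)) => {}H.
apply: le_lt_trans H; rewrite le_eqVlt; apply/orP; left; apply/eqP.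
by apply: eq_integral => x _; rewrite poweR_EFin /= ger0_norm.
Qed.

(** * Higher integrability and conclusion *)

Section higher_integrability.
Context {R : realType} {m : nat} {M : smooth_manifold R m} (g : riemannian_metric M).
Variables (vol : {measure set (borel M) -> \bar R}) (hvol : riemannian_volume g vol).
Implicit Types (x : M).
Local Notation RI f := (@Rintegral _ (borel M) R vol setT f).
Local Notation integ := (@integ _ (borel M) R vol).
Hypotheses (hcomplete : complete_metric g) (m3 : (3 <= m)%N).
Variables (S : R).
Hypotheses (S0 : 0 < S) (hS : sobolev_inequality g vol S).

Let q : R := 2 * m%:R / (m%:R - 2).
Let q' : R := m%:R / (m%:R - 2).

Let m0 : 0 < m%:R :> R.
Proof. by rewrite ltr0n (leq_trans _ m3). Qed.

Let m2 : 0 < m%:R - 2 :> R.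
Proof. by rewrite subr_gt0 ltr_nat. Qed.

Lemma sobolev_exponent_gt0 : 0 < q.
Proof. by rewrite divr_gt0// mulr_gt0. Qed.

(* Hoelder with the exponents m/2 and m/(m-2), then Sobolev. *)
Lemma hoelder_sobolev (b v : M -> R) : measurable_fun setT (b : borel M -> R) -> (forall x, 0 <= b x) ->
  integ (fun x => b x `^ (m%:R / 2)) -> lip_c g v ->
  integ (fun x => b x * v x ^+ 2) /\
  RI (fun x => b x * v x ^+ 2) <= RI (fun x => b x `^ (m%:R / 2)) `^ (2 / m%:R) * (S ^+ 2 * RI (inner_grad g v v)).
Proof.
move=> mb b0 ib lv; have [iv Hv] := sobolev_lip_c hvol m3 S0 hS lv; rewrite -/q in iv Hv.
have [lvd _] := lip_c_dd lv; have mv := (loc_bdd_continuous (dd_lip_loc_continuous lvd)).1.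
have E x : (v x ^+ 2) `^ q' = `|v x| `^ q.
  by rewrite -[v x ^+ 2]real_normK ?num_real// -powR_mulrn// -powRrM; congr (_ `^ _); rewrite /q /q' mulrA.
have [||||||||i H] := @hoelder_RI _ _ _ vol b (fun x => v x ^+ 2) (m%:R / 2) q' mb.
- exact: measurable_funX.
- exact: b0.
- by move=> x; exact: sqr_ge0.
- by rewrite divr_gt0.
- by rewrite divr_gt0.
- by rewrite /q' !invf_div; field; rewrite gt_eqF.
- exact: ib.
- by under eq_fun do rewrite E.
have Em : (m%:R / 2)^-1 = 2 / m%:R :> R by rewrite invf_div.
have Eq : q'^-1 = 2 / q by rewrite /q' /q; field; rewrite !gt_eqF.
have Ef : (fun x => (v x ^+ 2) `^ q') = fun x => `|v x| `^ q by apply/funext => x; exact: E.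
rewrite Em Eq Ef in H; split; first exact: i.
apply: le_trans H _; apply: ler_wpM2l; [exact: powR_ge0|exact: Hv].
Qed.

Variables (a : M -> R).
Hypotheses (ca : continuous a) (a0 : forall x, 0 <= a x) (ia : integ (fun x => a x `^ (m%:R / 2))).

(** The closed balls of integer radius exhaust the manifold and are compact by completeness;
    dominated convergence makes the tails of a^(m/2) small. *)
Lemma small_tail (d : R) : 0 < d -> exists2 K : set M, compact K &
  let b x := a x * \1_(~` K) x in [/\ measurable_fun setT (b : borel M -> R),
    integ (fun x => b x `^ (m%:R / 2)) & RI (fun x => b x `^ (m%:R / 2)) `^ (2 / m%:R) <= d].
Proof.
move=> d0; pose o : M := point; pose K (n : nat) := [set x | dd g o x <= n%:R].
have cloK n : closed (K n).
  have /continuous_closedP/(_ _ (@closed_le R n%:R)) := @dd_continuous _ _ _ g o; exact.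
have cK n : compact (K n).
  have [K' cK' HK'] := complete_rel_compact_ball hcomplete o (n%:R + 1).
  by apply: subclosed_compact (cloK n) cK' _ => x /= Kx; apply: HK'; rewrite (le_lt_trans Kx)// ltrDl.
pose b n x := a x * \1_(~` K n) x.
have ma : measurable_fun setT (a : borel M -> R) := (loc_bdd_continuous ca).1.
have mb n : measurable_fun setT (b n : borel M -> R).
  apply: measurable_funM => //; apply: measurable_indic.
  by apply: (@measurableC _ (borel M)); exact: borel_closed (cloK n).
have b0 n x : 0 <= b n x by rewrite mulr_ge0// indicE.
have mh : 0 < m%:R / 2 :> R by rewrite divr_gt0.
have [i c] : integ (cst 0) /\ RI (fun x => b n x `^ (m%:R / 2)) @[n --> \oo] --> RI (cst 0).
  apply: (@RI_dct _ _ _ vol _ _ (fun x => a x `^ (m%:R / 2)) set0) => //.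
  - by move=> n; exact: (measurableT_comp (measurable_powR _)).
  - move=> n x; rewrite ger0_norm ?powR_ge0//; apply: ge0_ler_powR; rewrite ?nnegrE ?(ltW mh)//.
    by rewrite ler_piMr// indicE; case: (_ \in _).
  - exact: negligible_set0.
  - move=> x _; apply: cvg_near_cst; near=> n.
    rewrite /b indicE memNset ?mulr0 ?powR0 ?gt_eqF//= => nK; apply: nK.
    by rewrite /K /=; near: n; exact: nbhs_infty_ger.
rewrite (_ : RI (cst 0) = 0) in c; last first.
  rewrite -[RHS](mul0r (RI (cst 0))) -(RI_Z 0 i); congr (Rintegral _ _ _).
  by apply/funext => x; rewrite mul0r.
have /cvgrPdist_le/(_ d d0) : RI (fun x => b n x `^ (m%:R / 2)) `^ (2 / m%:R) @[n --> \oo] --> (0 : R).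
  rewrite -[X in _ --> X](@powR0 R (2 / m%:R)) ?gt_eqF ?divr_gt0//.
  apply: powR_seq_cvg => //; first by rewrite divr_gt0.
  by move=> n; apply: RI_ge0 => x; exact: powR_ge0.
case=> n _ /(_ n (leqnn n)); rewrite sub0r normrN ger0_norm ?powR_ge0// => H.
exists (K n) => //; split; [exact: (mb n)| |exact: H].
apply: (integ_le _ _ ia) => [|x].
  exact: (measurableT_comp (measurable_powR _) (mb n)).
rewrite ger0_norm ?powR_ge0//; apply: (ge0_ler_powR (ltW mh) (b0 n x) (a0 x)).
by rewrite ler_piMr// indicE; case: (_ \in _).
Unshelve. all: end_near. Qed.

Variables (psi : M -> R) (A s : R).
Hypotheses (sA : s = 1 + A) (s0 : 0 < s).
Hypotheses (lpsi : dd_lip_loc g psi) (psi0 : forall x, 0 <= psi x) (hpsi : weak_ineq g vol a A psi).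

Lemma weak_ineq_RI eta : (forall x, 0 <= eta x) -> lip_c g eta -> 0 <= RI (weak_density g a A psi eta).
Proof. by move=> e0 le; have := hpsi e0 le; rewrite (weak_formE hvol A ca lpsi le) lee_fin. Qed.

Lemma large_exponent (p tau : R) : exists N : nat, p <= tau + N%:R * s /\ 2 <= tau + N%:R * s.
Proof.
pose N := (Num.truncn (`|p - tau| / s + `|2 - tau| / s)).+1.
have HN : `|p - tau| / s + `|2 - tau| / s <= N%:R by rewrite ltW// truncnS_gt.
have : `|p - tau| + `|2 - tau| <= N%:R * s by rewrite -ler_pdivrMr// mulrDl.
by exists N; have := ler_norm (p - tau); have := ler_norm (2 - tau); have := normr_ge0 (2 - tau);
  have := normr_ge0 (p - tau); lra.
Qed.

(** The gradients of the [v n] are bounded in L^2 uniformly in n: of the available coefficient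
    [c / 4], one half absorbs the tail of a and the other half remains. Sobolev and Fatou then carry
    the bound to the limit. *)
Lemma power_Lq tau p : s / 2 < tau -> tau <= s -> tau <= p -> integ (fun x => psi x `^ (2 * p)) ->
  integ (fun x => (psi x `^ tau) `^ q).
Proof.
move=> stau taus taup ip; have tau0 : 0 < tau by apply: lt_trans stau; rewrite divr_gt0.
have q0 := sobolev_exponent_gt0.
have [N [pN N2]] := large_exponent p tau.
pose c := 2 - s / tau.
have c0 : 0 < c by rewrite subr_gt0 ltr_pdivrMr//; move: stau; rewrite ltr_pdivrMr//; lra.
have c1 : c <= 1.
  by have : 1 <= s / tau; [rewrite ler_pdivlMr// mul1r|rewrite /c; lra].
have cV : 0 < c^-1 by rewrite invr_gt0.
have [v [sg [eta [lve bnd [vc _] [lsg HW] _]]]] :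
  exists (v sg eta : nat -> M -> R),
  [/\ forall n, lip_c g (v n) /\ lip_c g (eta n),
      forall n x, [/\ 0 <= v n x <= psi x `^ tau, 0 <= eta n x & tau <= sg n x <= tau + N%:R * s],
      (forall x, v n x @[n --> \oo] --> psi x `^ tau) /\
        (forall x, 0 < psi x -> sg n x @[n --> \oo] --> tau),
      (forall n, loc_bdd (sg n)) /\
      forall n, RI (weak_density g a A psi (eta n)) <= RI (fun x => a x * sg n x * v n x ^+ 2) -
        (c / 4) * RI (inner_grad g (v n) (v n)) + n.+1%:R^-1 &
      tau = s -> forall (K : set M) d, compact K -> 0 < d -> exists2 C, 0 <= C &
        \forall n \near \oo, forall x, K x -> trunc_pow s d 0 (N + N).+2 (psi x) <= C * eta n x].
  (* With [c1 = c / 4] and this [c2], the product in the discriminant condition is at least 3/2,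
     whereas the square of [1 - c1] is at most 1. *)
  apply: (test_sequence hvol hcomplete sA s0 ca lpsi psi0 (p := p) (c2 := 2 / c + c / 2)) => //.
  - by rewrite divr_ge0// ltW.
  - rewrite -/c; lra.
  - lra.
  - rewrite -/c; have -> : (c - c / 4) * (2 / c + c / 2 - c / 4) = 3 / 2 + 3 / 16 * c ^+ 2.
      by field; rewrite gt_eqF.
    nra.
pose s1 := tau + N%:R * s; have s10 : 0 < s1 by rewrite (lt_le_trans _ N2).
(* At this size of the tail, Hoelder and Sobolev bound [s1] times its contribution by [c / 8] times
   the gradient integral. *)
have d0 : 0 < c / 8 / (s1 * S ^+ 2) by rewrite !divr_gt0// mulr_gt0// exprn_gt0.
have [K cK /= [mb ib Hb]] := small_tail d0.
set b := (fun x => a x * \1_(~` K) x) in mb ib Hb.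
have b0 x : 0 <= b x by rewrite mulr_ge0// indicE.
have [Ba Ba0 HBa] := compact_continuous_bounded cK ca.
have [T T0 HT] := compact_continuous_bounded cK (dd_lip_loc_continuous lpsi).
pose B1 := Ba * (T `^ tau) ^+ 2 * RI (\1_K : M -> R).
have iK : integ (\1_K : M -> R) := integ_indic hvol cK.
(* On [K] both a and psi are bounded, which gives the constant [B1] independent of n; outside [K]
   the weight is the small [b]. *)
have grad_bound n : RI (inner_grad g (v n) (v n)) <= 8 / c * (s1 * B1 + 1).
  have [lv le] := lve n; have [lvd lvs] := lip_c_dd lv.
  have bv : loc_bdd (v n) := loc_bdd_continuous (dd_lip_loc_continuous lvd).
  have [ibv Hbv] := hoelder_sobolev mb b0 ib lv.
  set Y := RI (inner_grad g (v n) (v n)) in Hbv *.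
  have Y0 : 0 <= Y by apply: RI_ge0 => x; exact: inner_grad_ge0.
  have i1 : integ (fun x => Ba * (T `^ tau) ^+ 2 * \1_K x) := integZ _ iK.
  have h1 : RI (fun x => a x * sg n x * v n x ^+ 2) <=
      RI (fun x => s1 * (Ba * (T `^ tau) ^+ 2 * \1_K x + b x * v n x ^+ 2)).
    apply: RI_le.
    - apply: (loc_bdd_integ hvol); last exact/comp_suppMr/comp_suppM.
      by apply: loc_bddM; [apply: loc_bddM => //; exact: loc_bdd_continuous|exact: loc_bddM].
    - exact: integZ (integD i1 ibv).
    - move=> x; have [/andP[v0 vle] _ /andP[sg1 sg2]] := bnd n x.
      rewrite mulrAC mulrC; apply: ler_pM => //.
      + by rewrite (le_trans (ltW tau0)).
      + by rewrite mulr_ge0// sqr_ge0.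
      + rewrite /b !indicE; have [Kx|nKx] := pselect (K x).
          rewrite mem_set// memNset ?mulr0 ?mul0r ?addr0 ?mulr1; last exact.
          apply: ler_pM; rewrite ?sqr_ge0 ?HBa//.
          apply: lerXn2r; rewrite ?nnegrE ?powR_ge0// (le_trans vle)//.
          apply: ge0_ler_powR; rewrite ?nnegrE ?(ltW tau0) ?HT// ltW//.
        by rewrite (memNset nKx) (mem_set (nKx : (~` K) x)) mulr0 add0r mulr1.
  rewrite (RI_Z s1 (integD i1 ibv)) (RI_D i1 ibv) (RI_Z _ iK) -/B1 in h1.
  have h2 := weak_ineq_RI (fun x => let: And3 _ h _ := bnd n x in h) le.
  have h3 := HW n; rewrite -/Y in h3.
  have n1 : n.+1%:R^-1 <= 1 :> R by rewrite invf_le1 ?ltr0n// ler1n.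
  have h4 : s1 * RI (fun x => b x * v n x ^+ 2) <= c / 8 * Y.
    apply: (@le_trans _ _ (s1 * (c / 8 / (s1 * S ^+ 2) * (S ^+ 2 * Y)))).
      by rewrite ler_wpM2l ?(ltW s10)// (le_trans Hbv)// ler_wpM2r// mulr_ge0// exprn_ge0// ltW.
    rewrite le_eqVlt; apply/orP; left; apply/eqP; field; rewrite !gt_eqF//.
  have -> : 8 / c * (s1 * B1 + 1) = (s1 * B1 + 1) / (c / 8) by field; rewrite gt_eqF.
  rewrite ler_pdivlMr ?divr_gt0// mulrC; move: h1 h2 h3 h4; rewrite mulrDr.
  move: (RI (weak_density _ _ _ _ _)) (RI (fun x => a x * sg n x * _)) (s1 * RI _) => W X1 X2.
  move: (s1 * B1) => X3 h1 h2 h3 h4; move: h3 h4; have -> : c / 4 * Y = c / 8 * Y + c / 8 * Y by field.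
  by move: (c / 8 * Y) (n.+1%:R^-1) n1 => y z n1 h3 h4; lra.
have Z0 : 0 <= s1 * B1 + 1.
  rewrite addr_ge0// mulr_ge0 ?(ltW s10)// mulr_ge0 ?RI_ge0// mulr_ge0 ?exprn_ge0 ?powR_ge0// ltW//.
pose B := (S ^+ 2 * (8 / c * (s1 * B1 + 1))) `^ (q / 2).
have Lq n : RI (fun x => `|v n x| `^ q) <= B.
  have [iv Hv] := sobolev_lip_c hvol m3 S0 hS (lve n).1; rewrite -/q in iv Hv.
  have : (RI (fun x => `|v n x| `^ q) `^ (2 / q)) `^ (q / 2) <= B.
    have q20 : 0 <= q / 2 by apply: mulr_ge0; [exact: ltW|rewrite invr_ge0].
    have B0 : 0 <= S ^+ 2 * (8 / c * (s1 * B1 + 1)).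
      by rewrite mulr_ge0 ?exprn_ge0 ?(ltW S0)// mulr_ge0// divr_ge0// ltW.
    apply: (ge0_ler_powR q20 (powR_ge0 _ _) B0).
    by rewrite (le_trans Hv)// ler_wpM2l ?exprn_ge0 ?(ltW S0).
  rewrite -powRrM (_ : 2 / q * (q / 2) = 1) ?powRr1//; last by field; rewrite gt_eqF.
  by apply: RI_ge0 => x; exact: powR_ge0.
have mpsi : measurable_fun setT (psi : borel M -> R) := (loc_bdd_continuous (dd_lip_loc_continuous lpsi)).1.
apply: integ_ge0 => [|x|].
- by apply: (measurableT_comp (measurable_powR _)); exact: (measurableT_comp (measurable_powR _)).
- exact: powR_ge0.
- apply: le_lt_trans (ltry B).
  apply: (@fatou_bound _ _ _ vol (fun n x => `|v n x| `^ q)).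
  + by move=> n; have [iv _] := sobolev_lip_c hvol m3 S0 hS (lve n).1; exact: (integ_measurable iv).
  + by move=> n x; exact: powR_ge0.
  + move=> x; apply: powR_seq_cvg => //.
    by rewrite -[psi x `^ tau]ger0_norm ?powR_ge0//; exact: cvg_norm.
  + move=> n; have [iv _] := sobolev_lip_c hvol m3 S0 hS (lve n).1.
    by rewrite (integE iv) lee_fin.
Qed.

End higher_integrability.

(** * Reaching the exponent s, and vanishing for H > s *)

Section vanishing.
Context {R : realType} {m : nat} {M : smooth_manifold R m} (g : riemannian_metric M).
Variables (vol : {measure set (borel M) -> \bar R}) (hvol : riemannian_volume g vol).
Implicit Types (x : M).
Local Notation RI f := (@Rintegral _ (borel M) R vol setT f).
Local Notation integ := (@integ _ (borel M) R vol).
Hypotheses (hcomplete : complete_metric g) (m3 : (3 <= m)%N).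
Variables (S : R).
Hypotheses (S0 : 0 < S) (hS : sobolev_inequality g vol S).
Variables (a : M -> R).
Hypotheses (ca : continuous a) (a0 : forall x, 0 <= a x) (ia : integ (fun x => a x `^ (m%:R / 2))).
Variables (psi : M -> R) (A s : R).
Hypotheses (sA : s = 1 + A) (s0 : 0 < s).
Hypotheses (lpsi : dd_lip_loc g psi) (psi0 : forall x, 0 <= psi x) (hpsi : weak_ineq g vol a A psi).

Let q : R := 2 * m%:R / (m%:R - 2).

Let m0 : 0 < m%:R :> R.
Proof. by rewrite ltr0n (leq_trans _ m3). Qed.

Let m2 : 0 < m%:R - 2 :> R.
Proof. by rewrite subr_gt0 ltr_nat. Qed.

Let q0 : 0 < q. Proof. exact: sobolev_exponent_gt0. Qed.

(** Applied with tau equal to the current exponent, [power_Lq] replaces [p] by [p * k] with k = m /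
    (m - 2). As [p > s / 2], each round gains at least the fixed amount [d], so finitely many rounds
    reach [s]. *)
Lemma integrable_high_power p : s / 2 < p -> integ (fun x => psi x `^ (2 * p)) ->
  exists2 p', s <= p' & integ (fun x => psi x `^ (2 * p')).
Proof.
pose k : R := m%:R / (m%:R - 2).
have k1 : 0 < k - 1 by rewrite subr_gt0 /k ltr_pdivlMr// mul1r; lra.
pose d := s / 2 * (k - 1); have d0 : 0 < d by rewrite mulr_gt0// divr_gt0.
have H n : forall p, s / 2 < p -> s <= p + n%:R * d -> integ (fun x => psi x `^ (2 * p)) ->
    exists2 p', s <= p' & integ (fun x => psi x `^ (2 * p')).
  elim: n => [|n IH] p1 sp; first by rewrite mul0r addr0 => sp1 ip; exists p1.
  move=> sn ip; have [sp1|/ltW p1s] := leP s p1; first by exists p1.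
  have i := power_Lq hvol hcomplete m3 S0 hS ca a0 ia sA s0 lpsi psi0 hpsi sp p1s (lexx p1) ip.
  have pk : p1 + d <= p1 * k.
    have -> : p1 * k = p1 + p1 * (k - 1) by ring.
    by rewrite lerD2l ler_wpM2r// ltW.
  apply: (IH (p1 * k)).
  - by apply: lt_le_trans pk; rewrite ltr_wpDr// ltW.
  - by rewrite (le_trans sn)// -natr1 mulrDl mul1r addrA addrAC lerD2r.
  - rewrite (_ : (fun x => _) = fun x => (psi x `^ p1) `^ q); first exact: i.
    by apply/funext => x; rewrite -powRrM; congr (_ `^ _); rewrite /q /k; field; rewrite gt_eqF.
move=> sp ip; apply: (H (Num.truncn (`|s - p| / d)).+1 p) => //.
have : `|s - p| / d <= (Num.truncn (`|s - p| / d)).+1%:R by rewrite ltW// truncnS_gt.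
by rewrite ler_pdivrMr//; have := ler_norm (s - p); move: (_.+1%:R * d) => z h1 h2; lra.
Qed.

Lemma weighted_square_integ : integ (fun x => (psi x `^ s) `^ q) ->
  integ (fun x => a x * (psi x `^ s) ^+ 2).
Proof.
move=> iw; pose q' : R := m%:R / (m%:R - 2).
have mpsi := (loc_bdd_continuous (dd_lip_loc_continuous lpsi)).1.
have [||||||||i _] := @hoelder_RI _ _ _ vol a (fun x => (psi x `^ s) ^+ 2) (m%:R / 2) q' (loc_bdd_continuous ca).1.
- by apply: measurable_funX; exact: (measurableT_comp (measurable_powR _) mpsi).
- exact: a0.
- by move=> x; exact: sqr_ge0.
- by rewrite divr_gt0.
- by rewrite divr_gt0.
- by rewrite /q' !invf_div; field; rewrite gt_eqF.
- exact: ia.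
- rewrite (_ : (fun x => _) = fun x => (psi x `^ s) `^ q) //.
  apply/funext => x.
  have -> : (psi x `^ s) ^+ 2 = (psi x `^ s) `^ 2 by rewrite powR_mulrn ?powR_ge0.
  by rewrite -(powRrM (psi x `^ s) 2 q') /q' /q mulrA.
- exact: i.
Qed.

Lemma RI_eq0_lower_bound (f : M -> R) x (U : set M) (c : R) : (forall x, 0 <= f x) -> integ f -> RI f = 0 ->
  open U -> U x -> 0 < c -> (forall z, U z -> c <= f z) -> False.
Proof.
move=> f0 i_f If oU Ux c0 fU.
have mU : measurable (U : set (borel M)) by exact: borel_open.
have vU := vol_nbhs_gt0 hvol (open_nbhs_nbhs (conj oU Ux)) mU.
have h : (c%:E * vol U <= \int[vol]_z (f z)%:E)%E.
  rewrite -(setIT U) -(@integral_indic _ (borel M) R vol setT measurableT U mU).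
  rewrite -(@ge0_integralZl_EFin _ (borel M) R vol setT measurableT) ?(ltW c0)//; last first.
    by apply/measurable_EFinP; exact: measurable_indic.
  apply: ge0_le_integral => //.
  - by move=> z _; rewrite lee_fin mulr_ge0 ?(ltW c0)// indicE.
  - by apply/measurable_EFinP; apply: measurable_funM => //; exact: measurable_indic.
  - by apply/measurable_EFinP; exact: (integ_measurable i_f).
  - move=> z _; rewrite -EFinM lee_fin indicE; case: (pselect (U z)) => Uz.
      by rewrite mem_set// mulr1 fU.
    by rewrite memNset// mulr0.
move: h; rewrite (integE i_f) If; apply/negP; rewrite -ltNge.
by rewrite mule_gt0// lte_fin.
Qed.

Variables (p : R).
Hypotheses (sp : s / 2 < p) (ip : integ (fun x => psi x `^ (2 * p))).

(** At tau = s the coefficient [2 - s / tau] is 1 and [c1 = c2 = 1] is admissible, as the mixed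
    coefficient [1 - c1] is 0: no part of the gradient is given up. Here [E n] is the weighted
    integral plus the cutoff error, and its limit carries exactly the factor s. *)
Lemma limit_sequence : let w x := psi x `^ s in
  exists N (v eta : nat -> M -> R) (E : nat -> R),
  [/\ 2 <= s + N%:R * s /\ integ (fun x => w x `^ q),
      forall n, lip_c g (v n) /\ lip_c g (eta n),
      forall n x, 0 <= v n x <= w x /\ 0 <= eta n x,
      (forall x, v n x @[n --> \oo] --> w x) /\ forall (K : set M) d, compact K -> 0 < d -> exists2 C, 0 <= C &
        \forall n \near \oo, forall x, K x -> trunc_pow s d 0 (N + N).+2 (psi x) <= C * eta n x &
      [/\ RI (fun x => a x * v n x ^+ 2) @[n --> \oo] --> RI (fun x => a x * w x ^+ 2),
        E n @[n --> \oo] --> s * RI (fun x => a x * w x ^+ 2) &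
        forall n, 0 <= RI (weak_density g a A psi (eta n)) <= E n - RI (inner_grad g (v n) (v n))]].
Proof.
move=> w; have [p' sp' ip'] := integrable_high_power sp ip.
have s2 : s / 2 < s by rewrite ltr_pdivrMr// ltr_pMr// ltr1n.
have iw : integ (fun x => w x `^ q) :=
  power_Lq hvol hcomplete m3 S0 hS ca a0 ia sA s0 lpsi psi0 hpsi s2 (lexx s) sp' ip'.
have iaw := weighted_square_integ iw.
have [N [pN N2]] := large_exponent s0 p' s.
have ss : 2 - s / s = 1 by rewrite divff ?gt_eqF//; ring.
have [||v [sg [eta [lve bnd [vc sgc] [lsg HW] HC]]]] :=
  @test_sequence _ _ _ g vol hvol hcomplete a psi A s p' sA s0 ca lpsi psi0 s N 1 1 s0 sp' pN N2 ler01 _ (lexx 1) _ ip'.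
- by rewrite ss.
- by rewrite ss subrr expr0n mul0r.
have mpsi := (loc_bdd_continuous (dd_lip_loc_continuous lpsi)).1.
have mw : measurable_fun setT (w : borel M -> R) := measurableT_comp (measurable_powR _) mpsi.
have bv n : loc_bdd (v n).
  by have [lvd _] := lip_c_dd (lve n).1; exact: loc_bdd_continuous (dd_lip_loc_continuous lvd).
have ba := loc_bdd_continuous ca.
have vw n x : v n x ^+ 2 <= w x ^+ 2.
  have [/andP[v0 vw] _ _] := bnd n x.
  by apply: lerXn2r; rewrite ?nnegrE ?powR_ge0.
pose E n := RI (fun x => a x * sg n x * v n x ^+ 2) + n.+1%:R^-1.
exists N, v, eta, E; split=> //.
- by move=> n x; have [] := bnd n x.
- by split=> // K d; exact: HC.
split.
- apply: (RI_dct _ _ iaw _ (negligible_set0 _) _).2.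
  + by move=> n; exact: (loc_bddM ba (loc_bddM (bv n) (bv n))).1.
  + exact: (integ_measurable iaw).
  + move=> n x; rewrite ger0_norm; last by rewrite mulr_ge0// sqr_ge0.
    exact: (ler_wpM2l (a0 x) (vw n x)).
  + by move=> x _; apply: cvgM; [exact: cvg_cst|exact: (cvgM (vc x) (vc x))].
- rewrite -[X in _ --> X]addr0; apply: cvgD; last exact: cvg_harmonic.
  rewrite -(RI_Z s iaw).
  apply: (RI_dct _ _ (integZ (s + N%:R * s) iaw) _ (negligible_set0 _) _).2.
  + by move=> n; exact: (loc_bddM (loc_bddM ba (lsg n)) (loc_bddM (bv n) (bv n))).1.
  + exact: (integ_measurable (integZ s iaw)).
  + move=> n x; have [/andP[v0 _] _ /andP[sg1 sg2]] := bnd n x.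
    have sg0 := le_trans (ltW s0) sg1.
    rewrite mulrAC mulrC ger0_norm; last by rewrite mulr_ge0// mulr_ge0// sqr_ge0.
    apply: (ler_pM sg0 _ sg2 (ler_wpM2l (a0 x) (vw n x))).
    by rewrite mulr_ge0// sqr_ge0.
  + move=> x _; have [px|px] := ltP 0 (psi x).
      rewrite [X in _ --> X](_ : _ = a x * s * (psi x `^ s) ^+ 2); last by ring.
      apply: cvgM; last exact: (cvgM (vc x) (vc x)).
      by apply: cvgM; [exact: cvg_cst|exact: sgc].
    (* Where psi vanishes, [sg n] need not tend to s, but [v n] is 0 there. *)
    have w0 : psi x `^ s = 0 by rewrite (le_anti (x := psi x) (y := 0)) ?px ?psi0// powR0// gt_eqF.
    rewrite w0 expr0n !mulr0; apply: cvg_near_cst; apply: nearW => n.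
    have [/andP[v0 vle] _ _] := bnd n x.
    have -> : v n x = 0 by apply/eqP; rewrite eq_le v0 andbT (le_trans vle)// w0.
    by rewrite expr0n mulr0.
- move=> n.
  apply/andP; split; first exact: (weak_ineq_RI hvol ca lpsi hpsi (fun x => let: And3 _ h _ := bnd n x in h) (lve n).2).
  by rewrite (le_trans (HW n))// mul1r /E addrAC.
Qed.

Lemma strict_vanishing H : s < H -> lambda1_ge0 g vol a H -> forall x, psi x = 0.
Proof.
move=> sH hH; have [N [v [eta [E [[_ iw] lve bnd [vc _] [cJ cE HE]]]]]] := limit_sequence.
set w := fun x => psi x `^ s in iw bnd vc cJ cE.
set J := RI (fun x => a x * w x ^+ 2) in cJ cE.
have mn : (0 < m)%N by rewrite (leq_trans _ m3).
have J0 : 0 <= J by apply: RI_ge0 => x; rewrite mulr_ge0// sqr_ge0.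
have c1 : E n - H * RI (fun x => a x * v n x ^+ 2) @[n --> \oo] --> s * J - H * J.
  by apply: cvgB => //; apply: cvgM => //; exact: cvg_cst.
have : 0 <= s * J - H * J.
  apply: (ler_cvg_to (cvg_cst (0 : R)) c1); apply: nearW => n.
  have [_ h] := lambda1_lip_c hvol mn ca hH (lve n).1.
  by have /andP[h1 h2] := HE n; rewrite subr_ge0 (le_trans h)// -subr_ge0 (le_trans h1).
have -> : s * J - H * J = - ((H - s) * J) by ring.
rewrite oppr_ge0 pmulr_rle0 ?subr_gt0// => J0'.
have {J0 J0'}JE : J = 0 by apply/eqP; rewrite eq_le J0 J0'.
rewrite JE mulr0 in cE.
have mpsi := (loc_bdd_continuous (dd_lip_loc_continuous lpsi)).1.
have c2 : RI (fun x => `|v n x| `^ q) @[n --> \oo] --> RI (fun x => w x `^ q).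
  apply: (RI_dct _ _ iw _ (negligible_set0 _) _).2.
  - by move=> n; have [i _] := sobolev_lip_c hvol m3 S0 hS (lve n).1; exact: (integ_measurable i).
  - exact: (integ_measurable iw).
  - move=> n x; have [/andP[v0 vw] _] := bnd n x; rewrite ger0_norm ?powR_ge0//.
    by apply: (ge0_ler_powR (ltW q0)); rewrite ?nnegrE ?powR_ge0// ger0_norm.
  - move=> x _; apply: powR_seq_cvg => //.
    by rewrite -[w x]ger0_norm ?powR_ge0//; exact: cvg_norm.
have wq0 x : 0 <= w x `^ q by exact: powR_ge0.
have c3 : RI (fun x => `|v n x| `^ q) `^ (2 / q) @[n --> \oo] --> RI (fun x => w x `^ q) `^ (2 / q).
  apply: powR_seq_cvg c2; first exact: divr_gt0.
  by move=> n; apply: RI_ge0 => x; exact: powR_ge0.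
have c4 : S ^+ 2 * E n @[n --> \oo] --> (0 : R).
  by rewrite -[X in _ --> X](mulr0 (S ^+ 2)); apply: cvgM => //; exact: cvg_cst.
have : RI (fun x => w x `^ q) `^ (2 / q) <= 0.
  apply: (ler_cvg_to c3 c4); apply: nearW => n.
  have [_ h] := sobolev_lip_c hvol m3 S0 hS (lve n).1; rewrite (le_trans h)//.
  rewrite ler_wpM2l ?sqr_ge0//; have /andP[h1 h2] := HE n.
  by rewrite -subr_ge0 (le_trans h1).
have I0 : 0 <= RI (fun x => w x `^ q) by apply: RI_ge0.
move=> I1; have {I1}IE : RI (fun x => w x `^ q) = 0.
  apply/eqP; rewrite eq_le I0 andbT leNgt; apply/negP => Ipos.
  by have := powR_gt0 (2 / q) Ipos; rewrite ltNge I1.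
move=> x; apply: contrapT => /eqP px; have {}px : 0 < psi x by rewrite lt_neqAle eq_sym px psi0.
have p2 : 0 < psi x / 2 by rewrite divr_gt0.
have oU : open [set z | psi x / 2 < psi z].
  by have /continuousP/(_ _ (@open_gt R (psi x / 2))) := dd_lip_loc_continuous lpsi; exact.
apply: (@RI_eq0_lower_bound (fun x => w x `^ q) x _ (((psi x / 2) `^ s) `^ q) wq0 iw IE oU).
- by rewrite /= ltr_pdivrMr// ltr_pMr// ltr1n.
- by rewrite !powR_gt0.
- move=> z /= /ltW pz; apply: (ge0_ler_powR (ltW q0) (powR_ge0 _ _) (powR_ge0 _ _)).
  exact: (ge0_ler_powR (ltW s0) (ltW p2) (psi0 z)).
Qed.

End vanishing.

(** * Equality in the weak inequality for H = s *)

Section weak_equality.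
Context {R : realType} {m : nat} {M : smooth_manifold R m} (g : riemannian_metric M).
Variables (vol : {measure set (borel M) -> \bar R}) (hvol : riemannian_volume g vol).
Implicit Types (x : M).
Local Notation RI f := (@Rintegral _ (borel M) R vol setT f).
Local Notation integ := (@integ _ (borel M) R vol).
Variables (a : M -> R).
Hypotheses (ca : continuous a) (a0 : forall x, 0 <= a x).
Variables (psi : M -> R) (A s : R).
Hypotheses (s0 : 0 < s).
Hypotheses (lpsi : dd_lip_loc g psi) (psi0 : forall x, 0 <= psi x).

Lemma loc_bdd_norm (f : M -> R) : loc_bdd f -> loc_bdd (fun x => `|f x|).
Proof.
move=> [mf bf]; split=> [|x]; first exact: (measurableT_comp (@normr_measurable R setT)).
by have [B HB] := bf x; exists B; apply: filterS HB => z; rewrite normr_id.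
Qed.

Lemma lip_c_truncate (eta : M -> R) d k : 0 < d -> 2 <= k%:R * s -> lip_c g eta ->
  lip_c g (fun x => eta x * trunc_pow s d 0 k (psi x)).
Proof.
move=> d0 ks /lip_c_dd[le se]; apply: dd_lip_loc_lip_c; last exact: comp_suppM.
apply: dd_lip_locM => //.
apply: (@dd_lip_loc_comp _ _ _ _ (trunc_pow s d 0 k) (dtrunc_pow s d 0 k)) lpsi => [t|].
  by apply: is_derive_trunc_pow => //; rewrite add0r.
by apply: dtrunc_pow_bounded => //; rewrite add0r (le_trans _ ks)// ler1n.
Qed.

(* Cutting off the zero set of psi, where its gradient vanishes almost everywhere. *)
Lemma weak_density_truncate_cvg (eta : M -> R) k : lip_c g eta -> (forall x, 0 <= eta x) -> 2 <= k%:R * s ->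
  RI (weak_density g a A psi (fun x => eta x * trunc_pow s n.+1%:R^-1 0 k (psi x))) @[n --> \oo] -->
  RI (weak_density g a A psi eta).
Proof.
move=> lc eta0 ks; have [le se] := lip_c_dd lc.
have d0 n : 0 < n.+1%:R^-1 :> R by rewrite invr_gt0 ltr0n.
pose T n j x := trunc_pow s n.+1%:R^-1 0 j (psi x).
have ks1 : 2 <= k.+1%:R * s by rewrite -[k.+1%:R]natr1 mulrDl mul1r (le_trans ks)// lerDl ltW.
have lT n j : 2 <= j%:R * s -> dd_lip_loc g (T n j).
  move=> js; apply: (@dd_lip_loc_comp _ _ _ _ (trunc_pow s _ 0 j) (dtrunc_pow s n.+1%:R^-1 0 j)) lpsi => [t|].
    by apply: is_derive_trunc_pow => //; rewrite add0r.
  by apply: dtrunc_pow_bounded => //; rewrite add0r (le_trans _ js)// ler1n.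
have bT n j : 2 <= j%:R * s -> loc_bdd (T n j).
  by move=> /(lT n) l; exact: loc_bdd_continuous (dd_lip_loc_continuous l).
have T0 n j x : 0 <= T n j x by exact: trunc_pow_ge0.
have T1 n j x : T n j x <= 1.
  by rewrite (le_trans (trunc_pow_le s (d0 n) _ _ (psi0 x)))// powRr0.
pose P := inner_grad g psi psi; pose Q := inner_grad g eta psi.
have P0 x : 0 <= P x by exact: inner_grad_ge0.
pose f1 x := a x * eta x * psi x ^+ 2; pose f2 x := (A - 1) * (eta x * P x).
pose f3 x := psi x * Q x; pose f4 x := k%:R * s * (eta x * P x).
have ba := loc_bdd_continuous ca; have bpsi := loc_bdd_continuous (dd_lip_loc_continuous lpsi).
have beta := loc_bdd_continuous (dd_lip_loc_continuous le).
have bP : loc_bdd P by exact: loc_bdd_inner_grad.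
have bQ : loc_bdd Q by exact: loc_bdd_inner_grad.
have b1 : loc_bdd f1 by apply: loc_bddM; exact: loc_bddM.
have b2 : loc_bdd f2 := loc_bddM (loc_bdd_cst _) (loc_bddM beta bP).
have b3 : loc_bdd f3 := loc_bddM bpsi bQ.
have b4 : loc_bdd f4 := loc_bddM (loc_bdd_cst _) (loc_bddM beta bP).
(* The density of the truncated test function. Its second term comes from t T'(t) = k s (T_k -
   T_{k+1}) for T_k = u^k; where psi > 0 both truncations tend to 1, so this term tends to 0. *)
pose f_ n x := T n k x * (f1 x + f2 x - f3 x) - (T n k x - T n k.+1 x) * f4 x.
have bf n : loc_bdd (f_ n).
  apply: loc_bddD; first by apply: loc_bddM; [exact: bT|apply: loc_bddD (loc_bddN b3); exact: loc_bddD].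
  by apply/loc_bddN/loc_bddM => //; apply: loc_bddD (loc_bddN (bT _ _ ks1)); exact: bT.
have fE n : RI (weak_density g a A psi (fun x => eta x * trunc_pow s n.+1%:R^-1 0 k (psi x))) = RI (f_ n).
  apply: (RI_ae _ _ (negligibleU (ae_mdiff hvol lpsi) (ae_mdiff hvol le))).
  - have [lt _] := lip_c_dd (lip_c_truncate (d0 n) ks lc).
    exact: (loc_bdd_weak_density A ca lpsi lt).1.
  - exact: (bf n).1.
  - move=> x /not_orP[/contrapT dpsi /contrapT deta].
    have h2 : 2 <= 0 + k%:R * s by rewrite add0r.
    have [dT ET] := mdiff_comp (is_derive_trunc_pow (d0 n) (psi x) h2) dpsi.
    have [de Ee] := mdiffM deta dT.
    rewrite /weak_density /f_ /f1 /f2 /f3 /f4 /P /Q !inner_grad_co// Ee ET.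
    rewrite /coinner !(cometricDl, cometricZl).
    have E : psi x * dtrunc_pow s n.+1%:R^-1 0 k (psi x) = k%:R * s * (T n k x - T n k.+1 x).
      rewrite /dtrunc_pow mulrBr [psi x * (_ * trunc_pow _ _ _ k _)]mulrCA.
      rewrite [psi x * (_ * trunc_pow _ _ _ k.+1 _)]mulrCA !trunc_powM subrK add0r -/(T n k x) -/(T n k.+1 x).
      by ring.
    have E' := congr1 (fun z => eta x * cometric g (chart_at x) x (covector psi x) (covector psi x) * z) E.
    rewrite /= in E'; apply/eqP; rewrite -subr_eq0; apply/eqP.
    rewrite -[RHS](subrr (eta x * cometric g (chart_at x) x (covector psi x) (covector psi x) *
      (psi x * dtrunc_pow s n.+1%:R^-1 0 k (psi x)))) {1}E' /T; ring.
under eq_fun do rewrite fE.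
have bh : loc_bdd (fun x => `|f1 x| + `|f2 x| + `|f3 x| + `|f4 x|).
  by do 3 (apply: loc_bddD; last exact: loc_bdd_norm); exact: loc_bdd_norm.
have ih : integ (fun x => `|f1 x| + `|f2 x| + `|f3 x| + `|f4 x|).
  apply: (loc_bdd_integ hvol bh); case: (se) => K cK HK; exists K => // x nK.
  have QK : Q x = 0 by exact: (inner_grad_near0 g _ (comp_supp_near0 cK HK nK)).
  by rewrite /f1 /f2 /f3 /f4 QK HK// !(mulr0, mul0r) normr0 !addr0.
apply: (RI_dct _ _ ih _ (negligibleU (ae_mdiff hvol lpsi) (ae_mdiff hvol le)) _).2.
- by move=> n; exact: (bf n).1.
- exact: (loc_bdd_weak_density A ca lpsi le).1.
- move=> n x; rewrite /f_ (le_trans (ler_normB _ _))//.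
  have h (t z : R) : 0 <= t -> t <= 1 -> `|t * z| <= `|z|.
    by move=> t0 t1; rewrite normrM ger0_norm// ler_piMl.
  apply: lerD.
    rewrite (le_trans (h _ _ (T0 _ _ _) (T1 _ _ _)))// (le_trans (ler_normB _ _))// lerD2r.
    exact: ler_normD.
  have T2 : T n k.+1 x <= T n k x.
    by rewrite /T trunc_powS ler_piMl ?pow_frac_le1//; exact: T0.
  by apply: h; [rewrite subr_ge0|rewrite lerBlDr (le_trans (T1 _ _ _))// lerDl].
- move=> x /not_orP[/contrapT dpsi /contrapT deta].
  have [px|px] := ltP 0 (psi x).
    have cT j : T n j x @[n --> \oo] --> (1 : R).
      rewrite /T /trunc_pow px powRr0.
      rewrite [X in _ --> X](_ : _ = 1 * 1 ^+ j); last by rewrite expr1n mulr1.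
      apply: cvgM; first exact: cvg_cst.
      by apply: (cvg_comp _ (fun x : R => x ^+ j) (pow_frac_cvg1 s px)); exact: exprn_continuous.
    rewrite [X in _ --> X](_ : _ = 1 * (f1 x + f2 x - f3 x) - (1 - 1) * f4 x); last first.
      by rewrite subrr mul0r subr0 mul1r.
    apply: cvgB; apply: cvgM; try exact: cvg_cst; first exact: cT.
    by apply: cvgB; exact: cT.
  have p0 : psi x = 0 by apply/eqP; rewrite eq_le px psi0.
  have E0 : covector psi x = 0 by apply: covector_min => // z; rewrite p0.
  have -> : weak_density g a A psi eta x = 0.
    by rewrite /weak_density inner_grad_co// E0 coinner0l p0 expr0n !(mulr0, mul0r) subr0 addr0.
  apply: cvg_near_cst; apply: nearW => n.
  by rewrite /f_ /T /trunc_pow p0 ltxx subrr !mul0r subr0.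
Qed.

Hypothesis hpsi : weak_ineq g vol a A psi.

(** For fixed [d], the integral for the truncation of [z] is nonnegative and at most a multiple of
    the one for [eta n], hence 0. Letting [d] tend to 0 afterwards restores [z]. *)
Lemma weak_equality (eta : nat -> M -> R) k : 2 <= k%:R * s ->
  (forall n, lip_c g (eta n)) -> (forall n x, 0 <= eta n x) ->
  (forall (K : set M) d, compact K -> 0 < d -> exists2 C, 0 <= C &
        \forall n \near \oo, forall x, K x -> trunc_pow s d 0 k (psi x) <= C * eta n x) ->
  RI (weak_density g a A psi (eta n)) @[n --> \oo] --> (0 : R) ->
  forall z, (forall x, 0 <= z x) -> lip_c g z -> RI (weak_density g a A psi z) = 0.
Proof.
move=> ks le e0 HC cW z z0 lz.
have zero d : 0 < d -> RI (weak_density g a A psi (fun x => z x * trunc_pow s d 0 k (psi x))) = 0.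
  move=> d0; have lt := lip_c_truncate d0 ks lz.
  have t0 x : 0 <= z x * trunc_pow s d 0 k (psi x) by rewrite mulr_ge0// trunc_pow_ge0.
  apply/eqP; rewrite eq_le (weak_ineq_RI hvol ca lpsi hpsi t0 lt) andbT.
  have [lzd [K cK HK]] := lip_c_dd lz.
  have [B B0 HB] := compact_continuous_bounded cK (dd_lip_loc_continuous lzd).
  have [C C0 Hn] := HC K d cK d0.
  have c0 : B * C * RI (weak_density g a A psi (eta n)) @[n --> \oo] --> (0 : R).
    by rewrite -[X in _ --> X](mulr0 (B * C)); apply: cvgM => //; exact: cvg_cst.
  apply: (ler_cvg_to (cvg_cst (RI (weak_density g a A psi (fun x => z x * trunc_pow s d 0 k (psi x))))) c0).
  apply: filterS Hn => n Hn.
  (* The multiple of [eta n] minus the truncation of [z] is itself an admissible test function: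
     nonnegative on [K] by domination, and outside [K] because [z] vanishes there. *)
  rewrite -subr_ge0 -(RI_weak_density_comb hvol A (B * C) ca lpsi (le n) lt).
  have [led ces] := lip_c_dd (le n); have [ltd cts] := lip_c_dd lt.
  apply: (weak_ineq_RI hvol ca lpsi hpsi).
  - move=> x; rewrite subr_ge0; have [Kx|/HK->] := pselect (K x); last first.
      by rewrite mul0r !mulr_ge0// ltW.
    by rewrite -mulrA ler_pM ?trunc_pow_ge0 ?HB ?Hn.
  - apply: dd_lip_loc_lip_c.
      have := dd_lip_locD (dd_lip_locM (dd_lip_loc_cst g (B * C)) led) (dd_lip_locM (dd_lip_loc_cst g (-1)) ltd).
      by congr dd_lip_loc; apply/funext => x /=; rewrite mulN1r.
    by apply: comp_suppD; [exact: comp_suppMr|exact: comp_suppN].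
have c := weak_density_truncate_cvg lz z0 ks.
rewrite (_ : (fun n : nat => _) = fun _ => 0) in c; last first.
  by apply/funext => n; apply: zero; rewrite invr_gt0 ltr0n.
by rewrite -(cvg_lim (@Rhausdorff R) c) lim_cst//; exact: Rhausdorff.
Qed.

End weak_equality.

Theorem theorem5 (R : realType) (m : nat) (hm : (3 <= m)%N)
  (M : smooth_manifold R m) (g : riemannian_metric M)
  (vol : {measure set (borel M) -> \bar R}) (hvol : riemannian_volume g vol)
  (hcomplete : complete_metric g)
  (o : M)
  (S : R) (hS : 0 < S) (hSobolev : sobolev_inequality g vol S)
  (hgrowth : exists C : R, \forall r \near +oo,
     (vol (geodesic_ball g o r) <= (C * r ^+ m)%:E)%E)
  (a : M -> R) (ha_cont : continuous a) (ha_ge0 : forall x, 0 <= a x)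
  (ha_int : @finite_norm _ (borel M) R vol (m%:R / 2)%:E a)
  (ha_decay : exists C : R, \forall r \near +oo,
     (ereal_sup [set (a x)%:E | x in ~` geodesic_ball g o r]
      <= (C / r ^+ 2)%:E)%E)
  (A : R)
  (psi : M -> R) (hpsi_ge0 : forall x, 0 <= psi x) (hpsi_lip : lip_loc g psi)
  (hpsi : weak_ineq g vol a A psi)
  (p : R) (hp : (1 + A) / 2 < p)
  (hpsi_int : @finite_norm _ (borel M) R vol (2 * p)%:E psi) :
  (forall H : R, 1 + A < H -> 0 < 1 + A -> lambda1_ge0 g vol a H ->
     (forall x, a x = 0) \/ (forall x, psi x = 0)) /\
  (forall H : R, H = 1 + A -> 0 < 1 + A -> lambda1_ge0 g vol a H ->
     weak_eq g vol a A psi).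
Proof.
have lpsi := lip_locP hpsi_lip; have mn : (0 < m)%N := leq_trans (isT : (0 < 3)%N) hm.
have mh : 0 < m%:R / 2 :> R by rewrite divr_gt0// ltr0n.
have ia := finite_norm_integ mh (loc_bdd_continuous ha_cont).1 ha_ge0 ha_int.
have ip (s0 : 0 < 1 + A) : @integ _ (borel M) R vol (fun x => psi x `^ (2 * p)).
  apply: (finite_norm_integ _ (loc_bdd_continuous (dd_lip_loc_continuous lpsi)).1 hpsi_ge0 hpsi_int).
  by rewrite mulr_gt0// (lt_trans _ hp)// divr_gt0.
split=> H sH s0 hH.
  right; exact: (strict_vanishing hvol hcomplete hm hS hSobolev ha_cont ha_ge0 ia (erefl _) s0 lpsi hpsi_ge0
    hpsi hp (ip s0) sH hH).
have [N [v [eta [E [[N2 _] lve bnd [_ HC] [cJ cE HE]]]]]] :=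
  limit_sequence hvol hcomplete hm hS hSobolev ha_cont ha_ge0 ia (erefl _) s0 lpsi hpsi_ge0 hpsi hp (ip s0).
move=> z z0 lz; rewrite (weak_formE hvol A ha_cont lpsi lz); congr (_%:E).
(* The exponent [(N + N).+2] is the one for which [eta] dominates the truncations. It satisfies
   [2 <= k * s] because [(2 * N + 2) * s] is twice [s + N * s], which is at least 2. *)
apply: (weak_equality hvol ha_cont s0 lpsi hpsi_ge0 hpsi (eta := eta) (k := (N + N).+2)) => //.
- have -> : (N + N).+2%:R = N%:R + N%:R + 2 :> R by rewrite -(addn2 (N + N)) (natrD _ (N + N)) (natrD _ N).
  have y0 := mulr_ge0 (ler0n R N) (ltW s0).
  have -> : (N%:R + N%:R + 2) * (1 + A) = 2 * (N%:R * (1 + A)) + 2 * (1 + A) by ring.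
  by move: (N%:R * (1 + A)) y0 N2 => y y0 h; lra.
- by move=> n; have [] := lve n.
- by move=> n x; have [] := bnd n x.
(* The weak form along [eta] lies between 0 and [E n] minus the gradient integral, hence below this
   difference by the spectral inequality; for H = 1 + A its two limits cancel. *)
- have c0 : E n - H * Rintegral vol setT (fun x => a x * v n x ^+ 2) @[n --> \oo] --> (0 : R).
    rewrite -[X in _ --> X](subrr ((1 + A) * Rintegral vol setT (fun x => a x * (psi x `^ (1 + A)) ^+ 2))).
    by rewrite sH; apply: cvgB => //; apply: cvgM => //; exact: cvg_cst.
  apply: (squeeze_cvgr _ (cvg_cst 0) c0); apply: nearW => n; have /andP[-> h] := HE n; rewrite /=.
  have [_ hl] := lambda1_lip_c hvol mn ha_cont hH (lve n).1.
  by rewrite (le_trans h)// lerD2l lerN2.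
Qed.
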